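(* There exists a simple closed curve $\Gamma$ in $S^2_\infty(\mathbf{H}^3)$ such that $\Gamma$ bounds more than one least area plane in $\mathbf{H}^3$, i.e. there exist at least two distinct least area planes $P_i$ in $\mathbf{H}^3$ with $\partial_\infty P_i=\Gamma$.
   Context: $\mathbf{H}^3$ is hyperbolic 3-space and $S^2_\infty(\mathbf{H}^3)$ is its sphere at infinity. For $P\subset\mathbf{H}^3$, the asymptotic boundary $\partial_\infty P\subset S^2_\infty(\mathbf{H}^3)$ is the set of limit points of $P$ in the sphere at infinity. A least area disk is a disk which has the smallest area among the disks with the same boundary. A least area plane in $\mathbf{H}^3$ is a complete plane such that any compact subdisk in the plane is a least area disk. *)

(* Defs.v *)
From HB Require Import structures.
From mathcomp Require Import all_boot all_order all_algebra.
From mathcomp Require Import all_classical all_reals all_analysis.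

Set Implicit Arguments.
Unset Strict Implicit.
Unset Printing Implicit Defensive.

Import Order.TTheory GRing.Theory Num.Theory.
Import numFieldNormedType.Exports.

Local Open Scope classical_set_scope.
Local Open Scope ring_scope.

(* Hyperbolic 3-space is the Poincare ball model: the open unit ball of R^3
   with the metric 4 |dx|^2 / (1 - |x|^2)^2.  The library norm on 'rV[R]_3 is
   the sup norm, so the Euclidean inner product is written out; the topology
   on 'rV[R]_3 is nevertheless the usual one. *)
Definition dot (R : realType) (u v : 'rV[R]_3) : R :=
  \sum_(i < 3) u ord0 i * v ord0 i.

Definition hyp3 (R : realType) : set 'rV[R]_3 := [set x | dot x x < 1].

Definition sphere_infty (R : realType) : set 'rV[R]_3 := [set x | dot x x = 1].

Definition hyp_metric (R : realType) (x u v : 'rV[R]_3) : R :=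
  4 * dot u v / (1 - dot x x) ^+ 2.

Definition open_disk (R : realType) : set (R * R) :=
  [set p | p.1 ^+ 2 + p.2 ^+ 2 < 1].

Definition closed_disk (R : realType) : set (R * R) :=
  [set p | p.1 ^+ 2 + p.2 ^+ 2 <= 1].

Definition unit_circle (R : realType) : set (R * R) :=
  [set p | p.1 ^+ 2 + p.2 ^+ 2 = 1].

Arguments hyp3 : clear implicits.
Arguments sphere_infty : clear implicits.
Arguments open_disk : clear implicits.
Arguments closed_disk : clear implicits.
Arguments unit_circle : clear implicits.

Definition asymptotic_boundary (R : realType) (P : set 'rV[R]_3) :
  set 'rV[R]_3 := closure P `&` sphere_infty R.

Definition simple_closed_curve (R : realType) (G : set 'rV[R]_3) : Prop :=
  exists g : R * R -> 'rV[R]_3,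
    [/\ {within unit_circle R, continuous g},
        set_inj (unit_circle R) g
      & g @` unit_circle R = G].

Definition partial1 (R : realType) (f : R * R -> 'rV[R]_3) :
  R * R -> 'rV[R]_3 := 'D_((1, 0) : R * R) f.

Definition partial2 (R : realType) (f : R * R -> 'rV[R]_3) :
  R * R -> 'rV[R]_3 := 'D_((0, 1) : R * R) f.

(* Meant for open U: f is C^k on U iff its iterated partial derivatives up to
   order k exist and those of order k are continuous on U. *)
Fixpoint Ck (R : realType) (k : nat) (U : set (R * R))
    (f : R * R -> 'rV[R]_3) : Prop :=
  match k with
  | 0 => forall p, U p -> {for p, continuous f}
  | k'.+1 =>
      [/\ forall p, U p -> derivable f p (1, 0) /\ derivable f p (0, 1),
          Ck k' U (partial1 f)
        & Ck k' U (partial2 f)]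
  end.

Definition smooth_on (R : realType) (U : set (R * R))
    (f : R * R -> 'rV[R]_3) : Prop :=
  forall k, Ck k U f.

(* Density of the area form induced by the hyperbolic metric:
   sqrt (E G - F^2). *)
Definition area_density (R : realType) (f : R * R -> 'rV[R]_3) (p : R * R) : R :=
  let g := hyp_metric (f p) in
  let fu := partial1 f p in
  let fv := partial2 f p in
  Num.sqrt (g fu fu * g fv fv - g fu fv ^+ 2).

Definition area (R : realType) (f : R * R -> 'rV[R]_3) : \bar R :=
  (\int[lebesgue_measure \x lebesgue_measure]_(p in open_disk R)
     (area_density f p)%:E)%E.

(* Disks are mapped disks, as in the Plateau problem: the interior may have
   self-intersections or branch points, but the boundary is a simple closed
   curve. *)
Definition disk (R : realType) (f : R * R -> 'rV[R]_3) : Prop :=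
  [/\ {within closed_disk R, continuous f},
      smooth_on (open_disk R) f,
      f @` closed_disk R `<=` hyp3 R
    & set_inj (unit_circle R) f].

(* Since both maps are injective on the circle, having the same boundary as
   sets means having the same boundary up to a homeomorphism of the circle. *)
Definition least_area_disk (R : realType) (f : R * R -> 'rV[R]_3) : Prop :=
  disk f /\
  forall h : R * R -> 'rV[R]_3, disk h ->
    h @` unit_circle R = f @` unit_circle R -> (area f <= area h)%E.

(* Subdisks are smooth up to the boundary, as is usual for submanifolds with
   boundary. *)
Definition compact_subdisk (R : realType) (P : set 'rV[R]_3)
    (f : R * R -> 'rV[R]_3) : Prop :=
  [/\ exists2 U, open U /\ closed_disk R `<=` U & smooth_on U f,
      forall p, closed_disk R p -> injective ('d f p),
      set_inj (closed_disk R) f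
    & f @` closed_disk R `<=` P].

Definition plane (R : realType) (P : set 'rV[R]_3) : Prop :=
  exists (f : R * R -> 'rV[R]_3) (finv : 'rV[R]_3 -> R * R),
    [/\ smooth_on setT f,
        forall p, injective ('d f p),
        range f = P,
        cancel f finv
      & {within P, continuous finv}]
    /\ P `<=` hyp3 R.

Definition C1_curve (R : realType) (c : R -> 'rV[R]_3) : Prop :=
  (forall t, derivable c t 1) /\ continuous (derive1 c).

Definition curve_length (R : realType) (c : R -> 'rV[R]_3) : \bar R :=
  (\int[lebesgue_measure]_(t in `[0%R, 1%R])
     (Num.sqrt (hyp_metric (c t) (derive1 c t) (derive1 c t)))%:E)%E.

(* Distance of the Riemannian metric induced on P: infimum of the lengths of
   the curves contained in P. *)
Definition intrinsic_dist (R : realType) (P : set 'rV[R]_3)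
    (x y : 'rV[R]_3) : \bar R :=
  ereal_inf [set curve_length c | c in
    [set c : R -> 'rV[R]_3 |
      [/\ C1_curve c, c @` `[0, 1] `<=` P, c 0 = x & c 1 = y]]].

Definition complete_surface (R : realType) (P : set 'rV[R]_3) : Prop :=
  forall x : nat -> 'rV[R]_3, (forall n, P (x n)) ->
    (forall e : R, 0 < e -> exists N, forall m n, (N <= m)%N -> (N <= n)%N ->
       (intrinsic_dist P (x m) (x n) < e%:E)%E) ->
    exists2 y, P y &
      forall e : R, 0 < e -> exists N, forall n, (N <= n)%N ->
        (intrinsic_dist P (x n) y < e%:E)%E.

Definition least_area_plane (R : realType) (P : set 'rV[R]_3) : Prop :=
  [/\ plane P, complete_surface P
    & forall f, compact_subdisk P f -> least_area_disk f].

(* Main.v *)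
Require Import Defs.
From HB Require Import structures.
From mathcomp Require Import all_boot all_order all_algebra.
From mathcomp Require Import all_classical all_reals all_analysis.
From mathcomp Require Import measurable_realfun ring lra.
Set Implicit Arguments.
Unset Strict Implicit.
Unset Printing Implicit Defensive.
Import Order.TTheory GRing.Theory Num.Theory.
Import numFieldNormedType.Exports.
Local Open Scope classical_set_scope.
Local Open Scope ring_scope.

(** Let a screw motion of hyperbolic space, with translation along an axis and with pitch lam, act on
    the ball.  A surface invariant under the one-parameter group of these screw motions is a curve in
    the two-dimensional orbit space, and its area is the length of that curve for the orbit metric
    weighted by the length of the orbits; it is minimal when the curve is a geodesic.  Such a geodesic
    with turning point at x = sinh^2 r = 12 turns around the axis by a total angle which depends
    continuously on the pitch.  For a suitable pitch, found by the intermediate value theorem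
    (profile_exists), the geodesic sweeps exactly half a turn.  Its two ends are then antipodal, the
    invariant surface Pl over it is a plane whose ideal boundary is a pair of antipodal spirals closed
    up by the two ends of the axis (boundary_Pl), and the half turn around the axis sends this plane
    to a different one (eps = -1 in place of eps = 1) with the same ideal boundary.

    That the plane is least area is proved by calibration.  A map Phi from hyperbolic space to R^2
    maps Pl to R^2 injectively and preserves the area of pieces of Pl (plane_density), while it does
    not increase the area of any disk (Phi_area_le).  In polar coordinates x and angle of the orbit
    space, the first coordinate of Phi is a function of xi = N(angle) Q(x), where N is determined by
    the geodesic and Q^2 is x (1 + x) away from the axis; the second is the height, corrected so that
    the gradients of both coordinates are orthogonal to the direction in which the area form
    calibrating Pl degenerates.  That Phi does not increase area then reduces to one inequality for
    the squared slopes of N and Q (key_inequality), which holds because the squared slope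
    k = (1 + 2 x)^2 / (1 + mu x), as a function of S = x (1 + x), is concave for x >= 1 and Q can be
    bent near the axis.

    If f parametrises a compact subdisk of Pl and h is a disk with the same boundary, a winding number
    argument shows that Phi o h covers Phi o f (calibrated_image), since Phi o f is an embedding and the
    two loops Phi o f and Phi o h on the circle agree up to reparametrisation.  Hence
    area f = |Phi f D| <= |Phi h D| <= area h (subdisk_area_le).  The two comparisons of area with
    Lebesgue measure need only local covers of images of small squares and a bisection argument
    (bisection_le), because Phi is merely continuous on the surface v = 0, whose image is a line.
    Completeness of Pl holds because a curve that is short for the hyperbolic metric moves little in
    the ball and changes the conformal factor little, so that an intrinsically Cauchy sequence stays in
    a region where the parametrisation of Pl is a homeomorphism with controlled lengths. *)

(** * Loops in the punctured plane *)

Section continuity_helpers.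
Context {T U V : topologicalType}.

Lemma cont_fst (c : T -> U * V) t : {for t, continuous c} ->
  {for t, continuous (fun t => (c t).1)}.
Proof. by move=> cc; apply: (cvg_comp _ _ cc); exact: cvg_fst. Qed.

Lemma cont_snd (c : T -> U * V) t : {for t, continuous c} ->
  {for t, continuous (fun t => (c t).2)}.
Proof. by move=> cc; apply: (cvg_comp _ _ cc); exact: cvg_snd. Qed.

Lemma cont_comp (f : T -> U) (g : U -> V) t : {for t, continuous f} ->
  {for f t, continuous g} -> {for t, continuous (fun t => g (f t))}.
Proof. by move=> cf cg; apply: (cvg_comp _ _ cf); exact: cg. Qed.

Lemma cont_pair (f : T -> U) (g : T -> V) t : {for t, continuous f} ->
  {for t, continuous g} -> {for t, continuous (fun t => (f t, g t))}.
Proof. by move=> cf cg; exact: (cvg_pair cf cg). Qed.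

End continuity_helpers.

Section haslog.
Context {R : realType}.
Implicit Types c : R -> R * R.

Definition dot2 (a b : R * R) : R := a.1 * b.1 + a.2 * b.2.

(** The curve c, of period 2 pi, has a continuous argument al of period 2 pi: it avoids the origin
    and has winding number 0 around it. *)
Definition haslog c := exists al : R -> R,
  [/\ continuous al, (forall t, al (t + pi *+ 2) = al t) &
      forall t, 0 < (c t).1 * cos (al t) + (c t).2 * sin (al t) /\
                (c t).1 * sin (al t) = (c t).2 * cos (al t)].

Definition perio c := forall t, c (t + pi *+ 2) = c t.

Lemma sub_pair_fst (T : topologicalType) (c : T -> R * R) : continuous c ->
  continuous (fun t => (c t).1) /\ continuous (fun t => (c t).2).
Proof. by move=> cc; split => t; [apply: cont_fst|apply: cont_snd]; exact: cc. Qed.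

(** Adding to al the angle between c and c', which stays within a quarter turn, gives an argument of
    c'. *)
Lemma haslog_near c c' : haslog c -> continuous c' -> perio c' ->
  (forall t, 0 < dot2 (c t) (c' t)) -> haslog c'.
Proof.
move=> [al [cal pal Hal]] cc' pc' dd.
pose d t := (c' t).1 * cos (al t) + (c' t).2 * sin (al t).
pose e t := (c' t).2 * cos (al t) - (c' t).1 * sin (al t).
have d0 t : 0 < d t.
  have [r0 rE] := Hal t.
  have := dd t; rewrite /dot2 => ddt.
  have cs := cos2Dsin2 (al t).
  rewrite -(pmulr_rgt0 _ r0); rewrite /d.
  suff -> : ((c t).1 * cos (al t) + (c t).2 * sin (al t)) *
     ((c' t).1 * cos (al t) + (c' t).2 * sin (al t)) =
     (c t).1 * (c' t).1 + (c t).2 * (c' t).2 by [].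
  transitivity (((c t).1 * (c' t).1 + (c t).2 * (c' t).2)
     * (cos (al t) ^+ 2 + sin (al t) ^+ 2)); last by rewrite cs mulr1.
  have H1 : (c t).1 * sin (al t) - (c t).2 * cos (al t) = 0 by rewrite rE subrr.
  apply/eqP; rewrite -subr_eq0; apply/eqP.
  transitivity (((c t).1 * sin (al t) - (c t).2 * cos (al t)) *
     ((c' t).2 * cos (al t) - (c' t).1 * sin (al t))); first by ring.
  by rewrite H1 mul0r.
have [c1 c2] := sub_pair_fst cc'.
have csal : continuous (fun t => cos (al t)).
  by move=> t; apply: (@cont_comp _ _ _ al); [exact: cal|exact: continuous_cos].
have snal : continuous (fun t => sin (al t)).
  by move=> t; apply: (@cont_comp _ _ _ al); [exact: cal|exact: continuous_sin].
exists (fun t => al t + atan (e t / d t)); split.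
- move=> t; apply: cvgD; first exact: cal.
  apply: (@cont_comp _ _ _ (fun t => e t / d t) atan); last exact: continuous_atan.
  apply: cvgM.
    by apply: cvgB; apply: cvgM; [exact: c2|exact: csal|exact: c1|exact: snal].
  apply: cvgV; first by rewrite gt_eqF.
  by apply: cvgD; apply: cvgM; [exact: c1|exact: csal|exact: c2|exact: snal].
- by move=> t; rewrite /e /d !pal !pc'.
move=> t; set b := atan _.
have cb : 0 < cos b by apply: cos_gt0_pihalf; rewrite atan_gtNpi2 atan_ltpi2.
have sb : sin b * d t = cos b * e t.
  have tb : tan b = e t / d t by rewrite atanK.
  have -> : sin b = e t / d t * cos b by rewrite -tb /tan divfK ?gt_eqF.
  by rewrite mulrAC divfK ?gt_eqF// mulrC.
rewrite cosD sinD; split.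
  suff : 0 < d t * ((c' t).1 * (cos (al t) * cos b - sin (al t) * sin b) +
      (c' t).2 * (sin (al t) * cos b + cos (al t) * sin b)).
    by rewrite pmulr_rgt0.
  suff -> : d t * ((c' t).1 * (cos (al t) * cos b - sin (al t) * sin b) +
      (c' t).2 * (sin (al t) * cos b + cos (al t) * sin b)) =
      cos b * (d t ^+ 2 + e t ^+ 2).
    rewrite mulr_gt0// ltr_wpDr ?sqr_ge0//; exact/exprn_gt0.
  transitivity (d t * cos b * d t + (sin b * d t) * e t); first by rewrite /d /e; ring.
  by rewrite sb; ring.
apply/eqP; rewrite -subr_eq0; apply/eqP.
transitivity (sin b * d t - cos b * e t); first by rewrite /d /e; ring.
by rewrite sb subrr.
Qed.

(** The set where P holds is open and closed in the line, which is connected. *)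
Lemma locally_constant_pred (P : R -> Prop) :
  (forall s, \forall s' \near s, P s <-> P s') -> P 0 -> P 1.
Proof.
move=> lc P0.
have cR : connected [set: R] by apply/connected_intervalP.
suff -> : P = setT by [].
have oP (Q : R -> Prop) : (forall s, \forall s' \near s, Q s <-> Q s') -> open Q.
  move=> lQ; rewrite openE => s Qs; apply: filterS (lQ s) => s' [+ _]; exact.
apply: cR; first by exists 0.
- by exists P; [exact: oP|rewrite setTI].
- exists P; last by rewrite setTI.
  rewrite -[P]setCK; apply: open_closedC; apply: oP => s.
  by apply: filterS (lc s) => s' ss'; split => nP /ss' => /nP.
Qed.

(** Winding number 0 is a locally constant property of the parameter of the homotopy, by uniform
    continuity on one period. *)
Lemma haslog_homotopy (H : R -> R -> R * R) :
  continuous (fun z : R * R => H z.1 z.2) ->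
  (forall s, perio (H s)) -> (forall s t, H s t != 0) ->
  haslog (H 0) -> haslog (H 1).
Proof.
move=> cH pH H0.
have cHs s : continuous (H s).
  move=> t; apply: (@cont_comp _ _ _ (fun t => (s, t)) (fun z => H z.1 z.2)); last exact: cH.
  by apply: cont_pair; [exact: cvg_cst|exact: cvg_id].
suff key s : \forall s' \near s, forall t, 0 < dot2 (H s t) (H s' t).
  apply: (@locally_constant_pred (fun s => haslog (H s))) => s.
  apply: filterS (key s) => s' ss'; split => hl.
    exact: (haslog_near hl).
  apply: (haslog_near hl) => // t; have := ss' t.
  by rewrite /dot2 (mulrC (H s t).1) (mulrC (H s t).2).
have := @segment_compact R 0 (pi *+ 2).
move=> /compact_near_coveringP/(_ R (nbhs s) (fun s' t => 0 < dot2 (H s t) (H s' t))).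
have loc (x : R) : \forall x' \near x & i \near s, 0 < dot2 (H s x') (H i x').
  have pos : 0 < dot2 (H s x) (H s x).
    rewrite /dot2 -!expr2 lt_neqAle addr_ge0 ?sqr_ge0// andbT eq_sym paddr_eq0 ?sqr_ge0//.
    rewrite !sqrf_eq0; apply: contra (H0 s x) => /andP[/eqP e1 /eqP e2].
    by rewrite (surjective_pairing (H s x)) e1 e2.
  have cc : {for (x, s), continuous (fun z : R * R => dot2 (H s z.1) (H z.2 z.1))}.
    have [c1 c2] := sub_pair_fst (cHs s).
    have [d1 d2] := sub_pair_fst cH.
    have sw : {for (x, s), continuous (fun z : R * R => (z.2, z.1))}.
      by apply: cont_pair; [exact: cvg_snd|exact: cvg_fst].
    apply: cvgD; apply: cvgM.
    - by apply: (@cont_comp _ _ _ fst (fun t => (H s t).1)); [exact: cvg_fst|exact: c1].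
    - by apply: (@cont_comp _ _ _ (fun z : R * R => (z.2, z.1)) (fun z => (H z.1 z.2).1)); [exact: sw|exact: d1].
    - by apply: (@cont_comp _ _ _ fst (fun t => (H s t).2)); [exact: cvg_fst|exact: c2].
    - by apply: (@cont_comp _ _ _ (fun z : R * R => (z.2, z.1)) (fun z => (H z.1 z.2).2)); [exact: sw|exact: d2].
  have := cc (fun r => 0 < r) => /(_ _) H1.
  have : nbhs (dot2 (H s x) (H s x)) (fun r : R => 0 < r) by exact: lt_nbhsr.
  by move/cc.
move=> /(_ _ (fun x _ => loc x)) K.
apply: filterS K => s' Ks' t.
(* reduce t modulo 2 pi *)
have p0 : 0 < (pi : R) *+ 2 by rewrite pmulrn_lgt0// pi_gt0.
have perZ (c : R -> R * R) (n : int) u : perio c -> c (u + (pi *+ 2) * n%:~R) = c u.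
  move=> pc; case: n => n.
    rewrite -pmulrn; elim: n => [|n ih]; first by rewrite mulr0n mulr0 addr0.
    by rewrite -natr1 mulrDr mulr1 addrA pc.
  rewrite NegzE mulrNz mulrN -pmulrn; elim: n => [|n ih].
    by rewrite mulr1 -[LHS]pc subrK.
  by rewrite -ih -[LHS]pc -(natr1 n.+1) mulrDr mulr1; congr c; ring.
pose n := Num.floor (t / (pi *+ 2)).
have -> : t = (t - pi *+ 2 * n%:~R) + pi *+ 2 * n%:~R by rewrite subrK.
rewrite !perZ//; apply: Ks' => /=; rewrite in_itv/=.
have := floor_itv (t / (pi *+ 2)); rewrite -/n intrD.
rewrite ler_pdivlMr// ltr_pdivrMr// mulrC => /andP[h1 h2].
rewrite subr_ge0 h1/= lerBlDr; apply: ltW; rewrite (lt_le_trans h2)//.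
by rewrite mulrDl mul1r addrC (mulrC (n%:~R)).
Qed.

Lemma haslog_cst (v : R * R) : v != 0 -> haslog (cst v).
Proof.
have main (th : R) : 0 < dot2 (cos th, sin th) v -> haslog (cst v).
  move=> h; apply: (@haslog_near (cst (cos th, sin th))).
  - exists (cst th); split => //=; first exact: cst_continuous.
    move=> _; split; last by rewrite mulrC.
    by rewrite -!expr2 cos2Dsin2.
  - exact: cst_continuous.
  - by [].
  - by [].
move=> v0.
have [v1|v1|v1] := ltgtP v.1 0.
- by apply: (main pi); rewrite /dot2/= cospi sinpi mul0r addr0 mulN1r oppr_gt0.
- by apply: (main 0); rewrite /dot2/= cos0 sin0 mul0r addr0 mul1r.
have [v2|v2|v2] := ltgtP v.2 0.
- by apply: (main (- (pi / 2))); rewrite /dot2/= cosN sinN cos_pihalf sin_pihalf mul0r add0r mulN1r oppr_gt0.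
- by apply: (main (pi / 2)); rewrite /dot2/= cos_pihalf sin_pihalf mul0r add0r mul1r.
by move: v0; rewrite (surjective_pairing v) v1 v2 eqxx.
Qed.

Definition circ (t : R) : R * R := (cos t, sin t).

Lemma circ_continuous : continuous circ.
Proof. by move=> t; apply: cont_pair; [exact: continuous_cos|exact: continuous_sin]. Qed.

Lemma circ_perio : perio circ.
Proof. by move=> t; rewrite /circ cosD2pi sinD2pi. Qed.

Lemma circ_unit t : unit_circle R (circ t).
Proof. by rewrite /unit_circle/= cos2Dsin2. Qed.

(** An argument of the unit circle differs from t by a multiple of 2 pi at each t, hence by a constant,
    which is not periodic. *)
Lemma circ_nolog : ~ haslog circ.
Proof.
move=> [al [cal pal Hal]].
pose b t := al t - t.
have cb : continuous b by move=> t; apply: cvgB; [exact: cal|exact: cvg_id].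
have sb t : sin (b t) = 0.
  rewrite /b sinB; have [_ /= E] := Hal t.
  by rewrite mulrC E mulrC subrr.
have b2 : b (pi *+ 2) = b 0 - pi *+ 2.
  by rewrite /b -[X in al X]add0r pal subr0.
have p0 := pi_gt0 R.
have : exists2 c, c \in `[0, pi *+ 2] & b c = b 0 - pi / 2.
  apply: IVT.
  - by rewrite mulrn_wge0// ltW.
  - by apply: continuous_subspaceT => ?; exact: cb.
  - rewrite b2 -mulr_natl; move: (pi : R) p0 (b 0) => p p0 x.
    by rewrite ge_min le_max; apply/andP; split; apply/orP; [right|left]; lra.
move=> [c _ /(congr1 sin)]; rewrite sb sinB sb cos_pihalf sin_pihalf mulr0 mulr1 sub0r.
have := cos2Dsin2 (b 0); rewrite sb expr0n addr0 => /eqP + /esym/eqP.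
by rewrite oppr_eq0 => /[swap] /eqP ->; rewrite expr0n eq_sym oner_eq0.
Qed.

End haslog.

Lemma within_continuous_comp (T U V : topologicalType) (A : set U)
    (k : T -> U) (g : U -> V) :
  {within A, continuous g} -> continuous k -> (forall t, A (k t)) ->
  continuous (g \o k).
Proof.
move=> cg ck Ak t B /= nB.
have h : nbhs_subspace (k t : subspace A) (g @^-1` B) by exact: (cg (k t) B nB).
rewrite -(nbhs_subspace_in (Ak t)) in h.
suff : \forall s \near t, B (g (k s)) by [].
have h2 : \forall s \near t, A (k s) -> B (g (k s)) by exact: (ck t _ h).
by apply: filterS h2 => s; apply; exact: Ak.
Qed.

(** * Degree argument on the disk *)

Section hitting.
Context {R : realType}.
Implicit Types (f g : R * R -> R * R) (k : R -> R * R).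

Definition clamp (a b s : R) := Num.max a (Num.min b s).

Lemma clamp_continuous a b : continuous (clamp a b).
Proof.
move=> s; apply: (@cont_comp _ _ _ (fun s => (a, Num.min b s)) (fun z => Num.max z.1 z.2)).
  apply: cont_pair; first exact: cvg_cst.
  apply: (@cont_comp _ _ _ (fun s => (b, s)) (fun z => Num.min z.1 z.2)).
    by apply: cont_pair; [exact: cvg_cst|exact: cvg_id].
  exact: min_continuous.
exact: max_continuous.
Qed.

Lemma clamp_itv a b s : a <= b -> a <= clamp a b s <= b.
Proof. by move=> ab; rewrite /clamp le_max lexx/= ge_max ab ge_min lexx. Qed.

Lemma clampl a b : a <= b -> clamp a b a = a.
Proof. by move=> ab; rewrite /clamp (min_r ab) maxxx. Qed.

Lemma clampr a b : a <= b -> clamp a b b = b.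
Proof. by move=> ab; rewrite /clamp minxx max_r. Qed.

Lemma segment_map_continuous (sg : R -> R) (c0 : R * R) k : continuous sg -> continuous k ->
  continuous (fun z : R * R => c0 + sg z.1 *: (k z.2 - c0)).
Proof.
move=> csg ck z; apply: (cvgD (cvg_cst _)); apply: cvgZ.
  by apply: (@cont_comp _ _ _ fst sg); [exact: cvg_fst|exact: csg].
apply: cvgB; last exact: cvg_cst.
by apply: (@cont_comp _ _ _ snd k); [exact: cvg_snd|exact: ck].
Qed.

Lemma haslog_eq k k' : k =1 k' -> haslog k -> haslog k'.
Proof. by move=> /funext ->. Qed.

(** Shrinking the loop k to c0 along segments inside A is a homotopy of g o k to a constant. *)
Lemma haslog_fill (A : set (R * R)) (c0 : R * R) g k :
  {within A, continuous g} -> (forall z, A z -> g z != 0) ->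
  continuous k -> perio k ->
  (forall t s, 0 <= s <= 1 -> A (c0 + s *: (k t - c0))) ->
  haslog (fun t => g (k t)).
Proof.
move=> cg g0 ck pk Ak.
pose H s t := g (c0 + clamp 0 1 s *: (k t - c0)).
have H01 s t : A (c0 + clamp 0 1 s *: (k t - c0)) by apply: Ak; exact: clamp_itv.
apply: (@haslog_eq (H 1)).
  by move=> t; rewrite /H clampr// scale1r addrC subrK.
apply: haslog_homotopy.
- apply: (within_continuous_comp cg) => [|z]; last exact: H01.
  by apply: segment_map_continuous ck; exact: clamp_continuous.
- by move=> s t; rewrite /H pk.
- by move=> s t; apply: g0; exact: H01.
have c0A : A c0 by have := Ak 0 0; rewrite lexx ler01 scale0r addr0; apply.
apply: (@haslog_eq (cst (g c0))); last by apply: haslog_cst; exact: g0.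
by move=> t; rewrite /H clampl// scale0r addr0.
Qed.

Lemma closed_disk_segment (a b : R * R) s : 0 <= s <= 1 ->
  closed_disk R a -> closed_disk R b -> closed_disk R (a + s *: (b - a)).
Proof.
move: a b => [a1 a2] [b1 b2]; rewrite /closed_disk/= => /andP[s0 s1] Ha Hb.
have -> : (a1 + s * (b1 - a1)) ^+ 2 + (a2 + s * (b2 - a2)) ^+ 2 =
  (1 - s) * (a1 ^+ 2 + a2 ^+ 2) + s * (b1 ^+ 2 + b2 ^+ 2)
   - s * (1 - s) * ((a1 - b1) ^+ 2 + (a2 - b2) ^+ 2) by ring.
have h1 : (1 - s) * (a1 ^+ 2 + a2 ^+ 2) <= (1 - s) * 1 by apply: ler_wpM2l => //; rewrite subr_ge0.
have h2 : s * (b1 ^+ 2 + b2 ^+ 2) <= s * 1 by apply: ler_wpM2l.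
have h3 : 0 <= s * (1 - s) * ((a1 - b1) ^+ 2 + (a2 - b2) ^+ 2).
  by rewrite !mulr_ge0 ?subr_ge0// addr_ge0// sqr_ge0.
lra.
Qed.

Lemma circ_closed_disk t : closed_disk R (circ t).
Proof. by rewrite /closed_disk/= cos2Dsin2. Qed.

(** Near its only zero q0, f points outward, so that on a small circle around q0 it has the argument of
    that circle; the boundary circle is homotopic to the small one away from q0. *)
Lemma nolog_isolated f (q0 : R * R) r :
  {within closed_disk R, continuous f} -> open_disk R q0 ->
  (forall z, closed_disk R z -> z <> q0 -> f z != 0) ->
  0 < r -> (forall z, closed_disk R z -> `|z - q0| < r -> z <> q0 ->
     0 < dot2 (f z) (z - q0)) ->
  ~ haslog (fun t => f (circ t)).
Proof.
move=> cf Dq0 f0 r0 fpos hl.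
have cq0 : closed_disk R q0 by exact: ltW Dq0.
have neq s t : 0 < s -> q0 + s *: (circ t - q0) <> q0.
  move=> s0 /eqP; rewrite -subr_eq0 addrAC subrr add0r scaler_eq0 gt_eqF//= subr_eq0.
  move=> /eqP E; have := circ_unit t; rewrite E /unit_circle/= => E1.
  by move: Dq0; rewrite /open_disk/= E1 ltxx.
pose s0 := r / (4 + r).
have s0gt0 : 0 < s0 by rewrite divr_gt0// addr_gt0.
have s0le1 : s0 <= 1 by rewrite ler_pdivrMr ?addr_gt0// mul1r lerDr.
have near_q0 t : `|q0 + s0 *: (circ t - q0) - q0| < r.
  rewrite addrAC subrr add0r normrZ gtr0_norm//.
  have h : `|circ t - q0| <= 2.
    rewrite (le_trans (ler_normB _ _))// (_ : 2 = 1 + 1)//.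
    have bnd (z : R * R) : closed_disk R z -> `|z| <= 1.
      move=> Dz; rewrite prod_normE ge_max.
      have aux (x y : R) : x ^+ 2 + y ^+ 2 <= 1 -> `|x| <= 1.
        move=> xy; rewrite -(@ler_pXn2r _ 2) ?nnegrE// expr1n real_normK ?num_real//.
        by apply: le_trans xy; rewrite lerDl sqr_ge0.
      move: Dz; rewrite /closed_disk/= => Dz.
      by rewrite (aux _ _ Dz) (aux _ z.1)// addrC.
    by apply: lerD; apply: bnd => //; exact: circ_closed_disk.
  rewrite (le_lt_trans (ler_wpM2l (ltW s0gt0) h))// /s0 mulrAC ltr_pdivrMr ?addr_gt0//.
  rewrite mulrDr mulrC.
  suff : 0 < r * 2 + r * r by lra.
  by rewrite addr_gt0// mulr_gt0.
have step : haslog (fun t => f (q0 + s0 *: (circ t - q0))).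
  pose H s t := f (q0 + clamp s0 1 (1 - s) *: (circ t - q0)).
  have cl s : s0 <= clamp s0 1 (1 - s) <= 1 by exact: clamp_itv.
  have clA s t : closed_disk R (q0 + clamp s0 1 (1 - s) *: (circ t - q0)).
    apply: closed_disk_segment => //; last exact: circ_closed_disk.
    by have /andP[h ->] := cl s; rewrite (le_trans _ h)// ltW.
  apply: (@haslog_eq (H 1)).
    by move=> t; rewrite /H subrr /clamp min_r// max_l// ltW.
  apply: haslog_homotopy.
  - apply: (within_continuous_comp cf) => [|z]; last exact: clA.
    apply: (@segment_map_continuous (fun s => clamp s0 1 (1 - s)) q0 circ) => [s|]; last exact: circ_continuous.
    apply: (@cont_comp R R R (fun s : R => 1 - s) (clamp s0 1)); last exact: clamp_continuous.
    by apply: cvgB; [exact: cvg_cst|exact: cvg_id].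
  - by move=> s t; rewrite /H circ_perio.
  - move=> s t; apply: f0; first exact: clA.
    apply: neq; have /andP[h _] := cl s; exact: lt_le_trans h.
  apply: haslog_eq hl => t; rewrite /H subr0 clampr// scale1r.
  by rewrite addrC subrK.
have step2 : haslog (fun t => circ t - q0).
  apply: (haslog_near step).
  - by move=> t; apply: cvgB; [exact: circ_continuous|exact: cvg_cst].
  - by move=> t; rewrite circ_perio.
  move=> t; have := fpos (q0 + s0 *: (circ t - q0)) _ (near_q0 t) (neq _ _ s0gt0).
  rewrite addrAC subrr add0r => /(_ _)/wrap[].
    apply: closed_disk_segment => //; last exact: circ_closed_disk.
    by rewrite s0le1 ltW.
  move: (f _) => v; rewrite /dot2/=.
  have -> : v.1 * (s0 *: (cos t - q0.1)) + v.2 * (s0 *: (sin t - q0.2)) =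
     s0 * (v.1 * (cos t - q0.1) + v.2 * (sin t - q0.2)).
    by rewrite /GRing.scale/=; ring.
  by rewrite pmulr_rgt0.
apply: (@circ_nolog R); apply: (haslog_near step2 circ_continuous circ_perio) => t.
rewrite /dot2/=; move: Dq0; rewrite /open_disk/=; have := cos2Dsin2 t.
move: (cos t) (sin t) (q0.1) (q0.2) => a b u v e1 e2.
have -> : (a - u) * a + (b - v) * b = (a ^+ 2 + b ^+ 2) - (u * a + v * b) by ring.
rewrite e1.
have := sqr_ge0 (a - u); have := sqr_ge0 (b - v).
have -> : (a - u) ^+ 2 = a ^+ 2 + u ^+ 2 - 2 * (u * a) by ring.
have -> : (b - v) ^+ 2 = b ^+ 2 + v ^+ 2 - 2 * (v * b) by ring.
lra.
Qed.

(** Planar form of the degree argument: g has the same boundary loop as f, up to the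
    reparametrization kap, and f winds once around 0, so g cannot avoid 0. *)
Lemma disk_hit f g (kap : R -> R * R) (q0 : R * R) r :
  {within closed_disk R, continuous f} -> open_disk R q0 ->
  (forall z, closed_disk R z -> z <> q0 -> f z != 0) ->
  0 < r -> (forall z, closed_disk R z -> `|z - q0| < r -> z <> q0 ->
     0 < dot2 (f z) (z - q0)) ->
  {within closed_disk R, continuous g} ->
  continuous kap -> perio kap -> (forall t, closed_disk R (kap t)) ->
  (forall t, g (kap t) = f (circ t)) ->
  exists2 z, closed_disk R z & g z = 0.
Proof.
move=> cf Dq0 f0 r0 fpos cg ck pk Dk gk; apply: contrapT => nex.
apply: (nolog_isolated cf Dq0 f0 r0 fpos).
apply: (@haslog_eq (fun t => g (kap t))) => //.
apply: (@haslog_fill (closed_disk R) 0) => //.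
- by move=> z Dz; apply/eqP => gz0; apply: nex; exists z.
- move=> t s s01; apply: closed_disk_segment => //.
  by rewrite /closed_disk/= expr0n addr0 ler01.
Qed.

Definition cbox (c : R * R) (rho : R) : set (R * R) :=
  [set z | `|z.1 - c.1| <= rho /\ `|z.2 - c.2| <= rho].

(** The loop of g on the boundary of the box makes an acute angle with the loop z - y, which winds once
    around 0, so that g cannot avoid 0. *)
Lemma box_hit (c : R * R) (rho : R) g (y : R * R) : 0 < rho ->
  {within cbox c rho, continuous g} ->
  `|y.1 - c.1| < rho -> `|y.2 - c.2| < rho ->
  (forall z, cbox c rho z -> `|z.1 - c.1| = rho \/ `|z.2 - c.2| = rho ->
     0 < dot2 (g z) (z - y)) ->
  exists2 z, cbox c rho z & g z = 0.
Proof.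
move=> rho0 cg y1 y2 gpos; apply: contrapT => nex.
pose m (t : R) := Num.max `|cos t| `|sin t|.
have m0 t : 0 < m t.
  rewrite /m lt_max !normr_gt0 -negb_and; apply/negP => /andP[/eqP h1 /eqP h2].
  by have := cos2Dsin2 t; rewrite h1 h2 expr0n addr0 => /esym/eqP; rewrite oner_eq0.
have cm : continuous m.
  move=> t; apply: (@cont_comp _ _ _ (fun s => (`|cos s|, `|sin s|)) (fun z => Num.max z.1 z.2)).
    apply: cont_pair.
      by apply: (@cont_comp _ _ _ cos Num.norm); [exact: continuous_cos|exact: norm_continuous].
    by apply: (@cont_comp _ _ _ sin Num.norm); [exact: continuous_sin|exact: norm_continuous].
  exact: max_continuous.
pose k t := c + (rho / m t) *: circ t.
have kE1 t : (k t).1 - c.1 = rho / m t * cos t by rewrite /k/= addrAC subrr add0r.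
have kE2 t : (k t).2 - c.2 = rho / m t * sin t by rewrite /k/= addrAC subrr add0r.
have rm0 t : 0 < rho / m t by rewrite divr_gt0.
have ck : continuous k.
  move=> t; apply: (cvgD (cvg_cst _)); apply: cvgZ; last exact: circ_continuous.
  apply: cvgM; first exact: cvg_cst.
  by apply: cvgV; [rewrite gt_eqF|exact: cm].
have pk : perio k by move=> t; rewrite /k circ_perio /m cosD2pi sinD2pi.
have kb1 t : `|(k t).1 - c.1| <= rho.
  by rewrite kE1 normrM gtr0_norm// mulrAC ler_pdivrMr// ler_wpM2l ?(ltW rho0)// le_max lexx.
have kb2 t : `|(k t).2 - c.2| <= rho.
  by rewrite kE2 normrM gtr0_norm// mulrAC ler_pdivrMr// ler_wpM2l ?(ltW rho0)// le_max lexx orbT.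
have kbd t : `|(k t).1 - c.1| = rho \/ `|(k t).2 - c.2| = rho.
  have [h|/ltW h] := leP `|cos t| `|sin t|.
    right; rewrite kE2 normrM gtr0_norm// mulrAC.
    by have := m0 t; rewrite /m (max_r h) => h0; rewrite mulfK// gt_eqF.
  left; rewrite kE1 normrM gtr0_norm// mulrAC.
  by have := m0 t; rewrite /m (max_l h) => h0; rewrite mulfK// gt_eqF.
have l1 : haslog (fun t => g (k t)).
  apply: (haslog_fill (c0 := c) cg) => //.
    by move=> z Dz; apply/eqP => gz0; apply: nex; exists z.
  move=> t s /andP[s0 s1]; split => /=; rewrite addrAC subrr add0r normrM ger0_norm//.
    by rewrite (le_trans _ (kb1 t))// ler_piMl.
  by rewrite (le_trans _ (kb2 t))// ler_piMl.
have l2 : haslog (fun t => k t - y).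
  apply: (haslog_near l1).
  - by move=> t; apply: cvgB; [exact: ck|exact: cvg_cst].
  - by move=> t; rewrite pk.
  - by move=> t; apply: gpos.
have l3 : haslog (fun t => k t - c).
  pose H s t := k t - (y + clamp 0 1 s *: (c - y)).
  apply: (@haslog_eq (H 1)).
    by move=> t; rewrite /H clampr// scale1r (addrC y) subrK.
  apply: haslog_homotopy.
  - move=> z; apply: cvgB.
      by apply: (@cont_comp _ _ _ snd k); [exact: cvg_snd|exact: ck].
    have h : continuous (fun t : R => c) by move=> ?; exact: cvg_cst.
    by apply: (@segment_map_continuous (clamp 0 1) y (fun _ => c)) => //; exact: clamp_continuous.
  - by move=> s t; rewrite /H pk.
  - move=> s t; rewrite /H subr_eq0; apply/eqP => E.
    have /andP[s0 s1] : 0 <= clamp 0 1 s <= 1 by exact: clamp_itv.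
    have h1 : (k t).1 - c.1 = (1 - clamp 0 1 s) * (y.1 - c.1).
      by rewrite E/=; rewrite /GRing.scale/=; ring.
    have h2 : (k t).2 - c.2 = (1 - clamp 0 1 s) * (y.2 - c.2).
      by rewrite E/=; rewrite /GRing.scale/=; ring.
    have hs : 0 <= 1 - clamp 0 1 s <= 1 by apply/andP; split; lra.
    have strict (u : R) : `|u| < rho -> `|(1 - clamp 0 1 s) * u| < rho.
      move=> ur; rewrite normrM ger0_norm; last by case/andP : hs.
      by rewrite (le_lt_trans _ ur)// ler_piMl//; case/andP : hs.
    by case: (kbd t); rewrite ?h1 ?h2 => h; [have := strict _ y1|have := strict _ y2]; rewrite h ltxx.
  by apply: haslog_eq l2 => t; rewrite /H clampl// scale0r addr0.
apply: (@circ_nolog R); apply: (haslog_near l3 circ_continuous circ_perio) => t.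
rewrite /dot2/= kE1 kE2 -!mulrA -mulrDr -!expr2 mulr_gt0//.
by rewrite -mulrDr cos2Dsin2 mulr1 invr_gt0.
Qed.

End hitting.

(** * Lebesgue measure on the plane *)

Section plane_measure.
Context {R : realType}.
Local Notation mu1 := (@lebesgue_measure R).
Local Notation mu := (@lebesgue_measure R \x @lebesgue_measure R)%E.
Implicit Types (A E : set (R * R)).

Lemma open_measurable2 A : open A -> measurable A.
Proof.
move=> oA.
pose F (p q r : rat) : set (R * R) :=
  if asbool ([set z | `|z.1 - ratr p| < ratr r /\ `|z.2 - ratr q| < ratr r] `<=` A) then
  `](ratr p - ratr r), (ratr p + ratr r)[ `*` `](ratr q - ratr r), (ratr q + ratr r)[
  else set0.
have -> : A = \bigcup_p \bigcup_q \bigcup_r F p q r.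
  apply/seteqP; split => [z Az|z [p _ [q _ [r _]]]]; last first.
    rewrite /F; case: asboolP => // FA /= []; rewrite !in_itv/= => h1 h2.
    by apply: FA; rewrite /= !ltr_distl.
  have /nbhs_ballP[e /= e0 eA] : nbhs z A by exact: (open_nbhs_nbhs (conj oA Az)).
  have e2 : 0 < e / 2 by rewrite divr_gt0.
  have [r] := @rat_in_itvoo R _ _ e2; rewrite in_itv/= => /andP[r0 re].
  have /rat_in_itvoo[p] : z.1 - ratr r < z.1 + ratr r by rewrite ltrD2l gtrN.
  rewrite in_itv/= => /andP[p1 p2].
  have /rat_in_itvoo[q] : z.2 - ratr r < z.2 + ratr r by rewrite ltrD2l gtrN.
  rewrite in_itv/= => /andP[q1 q2].
  exists p => //; exists q => //; exists r => //; rewrite /F.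
  case: asboolP => [_|]; first by split; rewrite /= in_itv/=; apply/andP; split; lra.
  case=> -[x y] /=; rewrite !ltr_distl => -[/andP[h1 h2] /andP[h3 h4]].
  apply: eA; split => /=; rewrite /ball/= ltr_distl; apply/andP; split; lra.
apply: bigcupT_measurable_rat => p; apply: bigcupT_measurable_rat => q.
apply: bigcupT_measurable_rat => r; rewrite /F; case: ifP => _ //.
exact: measurableX.
Qed.

Lemma closed_measurable2 A : closed A -> measurable A.
Proof.
move=> cA; rewrite -[A]setCK; apply: measurableC; apply: open_measurable2.
exact: closed_openC.
Qed.

Lemma compact_measurable2 A : compact A -> measurable A.
Proof.
move=> cA; apply: closed_measurable2; apply: compact_closed => //.
Qed.

Lemma lebesgue_shift (c : R) (A : set R) : measurable A ->
  mu1 [set y | A (y + c)] = mu1 A.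
Proof.
move=> mA; apply/esym.
have ms : measurable_fun [set: measurableTypeR R] (fun y : measurableTypeR R => y + c : measurableTypeR R).
  by apply: measurable_funD => //; exact: measurable_cst.
unshelve eapply (@lebesgue_measure_unique R
  (pushforward mu1 (fun y : measurableTypeR R => y + c : measurableTypeR R)) _ A mA) => //.
move=> X [[a b] _ <-] /=; rewrite /pushforward.
have -> : (fun y : R => y + c) @^-1` `]a, b]%classic = `](a - c), (b - c)]%classic.
  by apply/seteqP; split => y /=; rewrite !in_itv/= ltrBlDr lerBrDr.
by rewrite !lebesgue_measure_itv/= !lte_fin ltrD2r; case: ifP => // _; rewrite -!EFinB; congr EFin; ring.
Qed.

Definition shear2 (phi : R -> R) (z : R * R) : R * R := (z.1, z.2 + phi z.1).
Definition shear1 (phi : R -> R) (z : R * R) : R * R := (z.1 + phi z.2, z.2).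

Lemma measurable_shear2 phi : measurable_fun setT phi -> measurable_fun setT (shear2 phi).
Proof.
move=> mphi; apply/measurable_fun_pairP; split => /=; first exact: measurable_fst.
apply: measurable_funD; first exact: measurable_snd.
by apply: (measurableT_comp mphi); exact: measurable_fst.
Qed.

Lemma measurable_shear1 phi : measurable_fun setT phi -> measurable_fun setT (shear1 phi).
Proof.
move=> mphi; apply/measurable_fun_pairP; split => /=; last exact: measurable_snd.
apply: measurable_funD; first exact: measurable_fst.
by apply: (measurableT_comp mphi); exact: measurable_snd.
Qed.

(** A shear translates each vertical section, so that Fubini reduces this to translation invariance on
    the line. *)
Lemma measure_shear2 phi E : measurable_fun setT phi -> measurable E ->
  measurable (shear2 phi @^-1` E) /\ mu (shear2 phi @^-1` E) = mu E.
Proof.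
move=> mphi mE; split.
  by rewrite -[X in measurable X]setTI; exact: (measurable_shear2 mphi).
rewrite /product_measure1; apply: eq_integral => x _ /=.
rewrite -(@lebesgue_shift (phi x) (xsection E x)); last exact: measurable_xsection.
by congr mu1; rewrite !xsectionE.
Qed.

Lemma product_measure12 E : measurable E -> mu E = (mu1 \x^ mu1)%E E.
Proof.
by move=> mE; apply: product_measure_unique => // A B mA mB /=; rewrite product_measure2E.
Qed.

Lemma measure_shear1 phi E : measurable_fun setT phi -> measurable E ->
  measurable (shear1 phi @^-1` E) /\ mu (shear1 phi @^-1` E) = mu E.
Proof.
move=> mphi mE.
have mS : measurable (shear1 phi @^-1` E).
  by rewrite -[X in measurable X]setTI; exact: (measurable_shear1 mphi).
split => //; rewrite !product_measure12// /product_measure2; apply: eq_integral => x _ /=.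
rewrite -(@lebesgue_shift (phi x) (ysection E x)); last exact: measurable_ysection.
by congr mu1; rewrite !ysectionE.
Qed.

Lemma measure_scaled_itv (a p s : R) : a != 0 -> 0 <= s ->
  measurable [set u | p <= u / a <= p + s] /\
  mu1 [set u | p <= u / a <= p + s] = (`|a| * s)%:E.
Proof.
move=> a0 s0.
have [an|ap] : (a < 0) \/ (0 < a) by apply/orP; rewrite -neq_lt.
- have -> : [set u | p <= u / a <= p + s] = `[(p + s) * a, p * a]%classic.
    apply/seteqP; split => u /=; rewrite in_itv/= ler_ndivlMr// ler_ndivrMr// andbC.
    by [].
    by [].
  split; first exact: measurable_itv.
  rewrite lebesgue_measure_itv/= lte_fin ltr0_norm//.
  case: ltP => h; first by rewrite -EFinB; congr EFin; ring.
  have : s * a >= 0 by lra.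
  rewrite nmulr_lge0// => s0'; have -> : s = 0 by apply: le_anti; rewrite s0 s0'.
  by rewrite mulr0.
have -> : [set u | p <= u / a <= p + s] = `[p * a, (p + s) * a]%classic.
  by apply/seteqP; split => u /=; rewrite in_itv/= ler_pdivlMr// ler_pdivrMr//.
split; first exact: measurable_itv.
rewrite lebesgue_measure_itv/= lte_fin gtr0_norm//.
case: ltP => h; first by rewrite -EFinB; congr EFin; ring.
have : s * a <= 0 by lra.
rewrite pmulr_lle0// => s0'; have -> : s = 0 by apply: le_anti; rewrite s0 s0'.
  by rewrite mulr0.
Qed.

(** A parallelogram is the image of a coordinate box under two shears, which preserve area. *)
Lemma measure_parallelogram (a b c d p q s t : R) : a * d - b * c != 0 ->
  0 <= s -> 0 <= t ->
  let D := a * d - b * c in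
  let M := [set Z : R * R | p <= (d * Z.1 - b * Z.2) / D <= p + s /\
                            q <= (a * Z.2 - c * Z.1) / D <= q + t] in
  measurable M /\ mu M = (`|D| * s * t)%:E.
Proof.
move=> D0 s0 t0 D M.
have mlin (r : R) : measurable_fun setT (fun x : R => r * x).
  by apply: measurable_funM => //; exact: measurable_cst.
have [a0|a0] := eqVneq a 0.
  have b0 : b != 0 by apply: contraNneq D0 => ->; rewrite a0 !mul0r subr0.
  have c0 : c != 0 by apply: contraNneq D0 => ->; rewrite a0 mulr0 mul0r subr0.
  have DE : D = - (b * c) by rewrite /D a0 mul0r sub0r.
  have [mU eU] := measure_scaled_itv q b0 t0.
  have [mV eV] := measure_scaled_itv p c0 s0.
  have [mS eS] := measure_shear2 (mlin (- (d / b))) (measurableX mU mV).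
  have ME : M = shear2 (fun x => - (d / b) * x) @^-1`
      ([set u | q <= u / b <= q + t] `*` [set u | p <= u / c <= p + s]).
    have e1 x y : (d * x - b * y) / D = (y + - (d / b) * x) / c.
      by rewrite DE; field; rewrite ?b0 ?c0.
    have e2 x y : (a * y - c * x) / D = x / b by rewrite DE a0; field; rewrite ?b0 ?c0.
    apply/seteqP; split => -[x y]; rewrite /M /shear2 /= => -[h1 h2].
      by split; [rewrite -(e2 x y)|rewrite -(e1 x y)].
    by split; [rewrite (e1 x y)|rewrite (e2 x y)].
  rewrite ME; split => //; rewrite eS product_measure1E// [X in (X * _)%E]eU [X in (_ * X)%E]eV.
  by rewrite DE normrN normrM -EFinM; congr EFin; ring.
have [mU eU] := measure_scaled_itv p a0 s0.
have Da : D / a != 0 by rewrite mulf_neq0// invr_neq0.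
have [mV eV] := measure_scaled_itv q Da t0.
have [mS1 eS1] := measure_shear1 (mlin (- (b * a / D))) (measurableX mU mV).
have [mS eS] := measure_shear2 (mlin (- (c / a))) mS1.
have ME : M = shear2 (fun x => - (c / a) * x) @^-1`
   (shear1 (fun x => - (b * a / D) * x) @^-1`
      ([set u | p <= u / a <= p + s] `*` [set u | q <= u / (D / a) <= q + t])).
  have e1 x y : (d * x - b * y) / D = (x + - (b * a / D) * (y + - (c / a) * x)) / a.
    by rewrite /D; field; rewrite ?a0 ?D0.
  have e2 x y : (a * y - c * x) / D = (y + - (c / a) * x) / (D / a).
    by rewrite /D; field; rewrite ?a0 ?D0.
  apply/seteqP; split => -[x y]; rewrite /M /shear1 /shear2 /= => -[h1 h2].
    by split; [rewrite -(e1 x y)|rewrite -(e2 x y)].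
  by split; [rewrite (e1 x y)|rewrite (e2 x y)].
rewrite ME; split => //; rewrite eS eS1 product_measure1E// [X in (X * _)%E]eU [X in (_ * X)%E]eV.
rewrite normrM normfV -EFinM; congr EFin; field.
by rewrite normr_eq0.
Qed.

End plane_measure.

(** * Bisection of squares *)

Section bisection.
Context {R : realType}.

Definition subadd4 (m : R -> R -> R -> \bar R) := forall a b l : R, 0 < l ->
  (m a b (l *+ 2)%R <= m a b l + m (a + l)%R b l +
     (m a (b + l)%R l + m (a + l)%R (b + l)%R l))%E.

Definition superadd4 (m : R -> R -> R -> \bar R) := forall a b l : R, 0 < l ->
  (m a b l + m (a + l)%R b l + (m a (b + l)%R l + m (a + l)%R (b + l)%R l)
     <= m a b (l *+ 2)%R)%E.

(** Repeated halving: a square violating the inequality contains a quarter violating it, and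
    the nested squares so obtained shrink to a point where the local hypothesis fails. *)
Lemma bisection_le (m1 m2 : R -> R -> R -> \bar R) : subadd4 m1 -> superadd4 m2 ->
  (forall (z : R * R) (e : R), 0 < e -> exists2 d : R, 0 < d & forall a b l : R, 0 < l < d ->
     a <= z.1 <= a + l -> b <= z.2 <= b + l ->
     (m1 a b l <= m2 a b l + (e * l ^+ 2)%:E)%E) ->
  forall e a b l : R, 0 < e -> 0 < l -> (m1 a b l <= m2 a b l + (e * l ^+ 2)%:E)%E.
Proof.
move=> sbm spm loc e a b l e0 l0; apply: contrapT => nle.
pose bad (s : R * R * R) := 0 < s.2 /\
   ~ (m1 s.1.1 s.1.2 s.2 <= m2 s.1.1 s.1.2 s.2 + (e * s.2 ^+ 2)%:E)%E.
pose nxt (s s' : R * R * R) := bad s -> [/\ bad s', s'.2 = s.2 / 2,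
    s.1.1 <= s'.1.1 <= s.1.1 + s.2 / 2 & s.1.2 <= s'.1.2 <= s.1.2 + s.2 / 2].
have nxtE s : exists s', nxt s s'.
  have [bs|] := pselect (bad s); last by move=> nb; exists s.
  move: s bs => [[x y] r] [/= r0 nb].
  have r2 : 0 < r / 2 by rewrite divr_gt0.
  have r2E : r / 2 *+ 2 = r by rewrite -mulr_natr divfK.
  have h1 : x <= x <= x + r / 2 by rewrite lexx lerDl ltW.
  have h2 : x <= x + r / 2 <= x + r / 2 by rewrite lexx lerDl ltW.
  have h3 : y <= y <= y + r / 2 by rewrite lexx lerDl ltW.
  have h4 : y <= y + r / 2 <= y + r / 2 by rewrite lexx lerDl ltW.
  apply: contrapT => nex; apply: nb.
  have main x' y' : x <= x' <= x + r / 2 -> y <= y' <= y + r / 2 ->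
     (m1 x' y' (r / 2)%R <= m2 x' y' (r / 2)%R + (e * (r / 2) ^+ 2)%:E)%E.
    move=> hx hy; apply: contrapT => nb'; apply: nex.
    by exists ((x', y'), r / 2) => _; split.
  have := sbm x y _ r2; rewrite r2E => /le_trans; apply.
  have := spm x y _ r2; rewrite r2E => hsup.
  apply: le_trans (leeD2r _ hsup).
  apply: (le_trans (leeD (leeD (main _ _ h1 h3) (main _ _ h2 h3))
                         (leeD (main _ _ h1 h4) (main _ _ h2 h4)))).
  have -> : ((e * r ^+ 2)%:E = ((e * (r / 2) ^+ 2)%:E + (e * (r / 2) ^+ 2)%:E) +
     ((e * (r / 2) ^+ 2)%:E + (e * (r / 2) ^+ 2)%:E) :> \bar R)%E.
    by rewrite -!EFinD; congr EFin; field.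
  set q := (e * (r / 2) ^+ 2)%:E.
  rewrite (addeACA _ q) (addeACA _ q) (addeACA _ (q + q)%E).
  exact: lexx.
have [f fP] := choice nxtE.
pose s n := iter n f ((a, b), l).
have sbad n : bad (s n).
  by elim: n => [|n ih]; [split|have [] := fP _ ih].
have sl n : (s n).2 = l / 2 ^+ n.
  elim: n => [|n ih]; first by rewrite expr0 divr1.
  have [_ -> _ _] := fP _ (sbad n); rewrite ih exprSr invfM mulrA.
  by rewrite mulrAC.
have mono (p : R * R -> R) : (forall n, p (s n).1 <= p (s n.+1).1 <= p (s n).1 + (s n).2 / 2) ->
    exists z, forall n, p (s n).1 <= z <= p (s n).1 + (s n).2.
  move=> pS.
  have up n k : p (s n).1 <= p (s (n + k)%N).1 /\
      p (s (n + k)%N).1 + (s (n + k)%N).2 <= p (s n).1 + (s n).2.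
    elim: k => [|k [ih1 ih2]]; first by rewrite addn0.
    have /andP[h1 h2] := pS (n + k)%N.
    rewrite addnS; split; first exact: le_trans h1.
    apply: le_trans ih2; have [_ E _ _] := fP _ (sbad (n + k)%N).
    have : (s (n + k)%N.+1).2 = (s (n + k)%N).2 / 2 by [].
    move=> ->; lra.
  exists (sup (range (fun n => p (s n).1))) => n.
  have ubn k : p (s k).1 <= p (s n).1 + (s n).2.
    have [kn|/ltnW nk] := leqP k n.
      rewrite -(subnKC kn); have [h _] := up k (n - k)%N; apply: le_trans h _.
      by rewrite lerDl; have [/ltW] := sbad (k + (n - k))%N.
    rewrite -(subnKC nk); have [_] := up n (k - n)%N; apply: le_trans.
    by rewrite lerDl; have [/ltW] := sbad (n + (k - n))%N.
  apply/andP; split.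
    apply: ub_le_sup; last by exists n.
    by exists (p (s n).1 + (s n).2) => _ [k _ <-].
  by apply: sup_le_ub; [exists (p (s 0%N).1), 0%N|move=> _ [k _ <-]].
have [z1 z1P] : exists z, forall n, (s n).1.1 <= z <= (s n).1.1 + (s n).2.
  by apply: (mono fst) => n; have [_ _ + _] := fP _ (sbad n).
have [z2 z2P] : exists z, forall n, (s n).1.2 <= z <= (s n).1.2 + (s n).2.
  by apply: (mono snd) => n; have [_ _ _ +] := fP _ (sbad n).
have [d d0 dP] := loc (z1, z2) e e0.
have [n nP] : exists n, l / 2 ^+ n < d.
  exists (Num.truncn (l / d)).+1; rewrite ltr_pdivrMr ?exprn_gt0// mulrC -ltr_pdivrMr//.
  apply: (lt_le_trans (truncnS_gt _)).
  rewrite -natrX ler_nat; apply: ltnW; exact: ltn_expl.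
have [_ nb] := sbad n; apply: nb; apply: dP => //=; rewrite sl nP andbT.
by rewrite divr_gt0// exprn_gt0.
Qed.

End bisection.

(** * Images of small squares *)

Section local_area.
Context {R : realType}.
Local Notation mu := (@lebesgue_measure R \x @lebesgue_measure R)%E.

Definition csq (a b l : R) : set (R * R) :=
  [set z | a <= z.1 <= a + l /\ b <= z.2 <= b + l].
Definition hsq (a b l : R) : set (R * R) :=
  [set z | a <= z.1 < a + l /\ b <= z.2 < b + l].

(** Frechet differentiability at z0 of a real function of two variables, with gradient (a, b). *)
Definition sdiff (f : R * R -> R) (z0 : R * R) (a b : R) :=
  forall eta : R, 0 < eta -> exists2 d : R, 0 < d & forall z : R * R,
    `|z.1 - z0.1| < d -> `|z.2 - z0.2| < d ->
    `|f z - f z0 - (a * (z.1 - z0.1) + b * (z.2 - z0.2))|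
       <= eta * (`|z.1 - z0.1| + `|z.2 - z0.2|).

(** Differentiability at z0 controls f on all small squares that contain z0, wherever z0 lies in them. *)
Lemma sdiff_sq f z0 a b (eta : R) : sdiff f z0 a b -> 0 < eta ->
  exists2 d : R, 0 < d & forall al be l : R, 0 < l < d ->
    al <= z0.1 <= al + l -> be <= z0.2 <= be + l ->
    forall z, csq al be l z ->
      `|f z - f z0 - (a * (z.1 - z0.1) + b * (z.2 - z0.2))| <= eta * l.
Proof.
move=> fd e0; have e2 : 0 < eta / 2 by rewrite divr_gt0.
have [d d0 dP] := fd _ e2; exists d => // al be l /andP[l0 ld] h1 h2 z [h3 h4].
have k1 : `|z.1 - z0.1| <= l by rewrite ler_norml; apply/andP; split; lra.
have k2 : `|z.2 - z0.2| <= l by rewrite ler_norml; apply/andP; split; lra.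
apply: le_trans (dP z (le_lt_trans k1 ld) (le_lt_trans k2 ld)) _.
have -> : eta * l = eta / 2 * (l + l) by field.
by apply: ler_wpM2l; [exact: ltW|exact: lerD].
Qed.

Lemma lin_bound (u v e1 e2 D h : R) : D != 0 -> `|e1| <= h -> `|e2| <= h ->
  `|(u * e1 - v * e2) / D| <= (`|u| + `|v|) / `|D| * h.
Proof.
move=> D0 h1 h2; rewrite normrM normfV mulrAC ler_wpM2r// ?invr_ge0//.
rewrite (le_trans (ler_normB _ _))// !normrM mulrDl.
by apply: lerD; apply: ler_wpM2l.
Qed.

Lemma abs_itv (x y h : R) : `|x - y| <= h -> y - h <= x <= y + h.
Proof. by rewrite ler_distl. Qed.

(** The image of a small square is within o(l) of a parallelogram of area |det| l^2, or of a segment. *)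
Lemma upper_cover f g z0 a b c d (e : R) : sdiff f z0 a b -> sdiff g z0 c d -> 0 < e ->
  exists2 dl : R, 0 < dl & forall al be l : R, 0 < l < dl ->
    al <= z0.1 <= al + l -> be <= z0.2 <= be + l ->
    exists M : set (R * R), [/\ measurable M, (forall z, csq al be l z -> M (f z, g z)) &
       (mu M <= ((`|a * d - b * c| + e) * l ^+ 2)%:E)%E].
Proof.
move=> fd gd e0.
(* reduce to a uniform choice of eta *)
suff [eta eta0 etaP] : exists2 eta : R, 0 < eta & forall al be l : R, 0 < l ->
    al <= z0.1 <= al + l -> be <= z0.2 <= be + l ->
    (forall z, csq al be l z ->
      `|f z - f z0 - (a * (z.1 - z0.1) + b * (z.2 - z0.2))| <= eta * l /\
      `|g z - g z0 - (c * (z.1 - z0.1) + d * (z.2 - z0.2))| <= eta * l) ->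
    exists M : set (R * R), [/\ measurable M, (forall z, csq al be l z -> M (f z, g z)) &
       (mu M <= ((`|a * d - b * c| + e) * l ^+ 2)%:E)%E].
  have [d1 d10 d1P] := sdiff_sq fd eta0.
  have [d2 d20 d2P] := sdiff_sq gd eta0.
  exists (Num.min d1 d2); first by rewrite lt_min d10.
  move=> al be l /andP[l0]; rewrite lt_min => /andP[l1 l2] h1 h2.
  apply: etaP => // z Hz; split; [apply: d1P|apply: d2P]; rewrite ?l0//; eassumption.
have [D0|D0] := eqVneq (a * d - b * c) 0; last first.
  set D := a * d - b * c in D0 *.
  pose kap := (`|a| + `|b| + `|c| + `|d|) / `|D|.
  have nD : 0 < `|D| by rewrite normr_gt0.
  have kap0 : 0 <= kap by rewrite divr_ge0// !addr_ge0.
  pose tau := Num.min 1 (e / (8 * `|D|)).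
  have tau0 : 0 < tau by rewrite lt_min ltr01 divr_gt0// mulr_gt0.
  have kp : 0 < kap + 1 by rewrite ltr_wpDl.
  exists (tau / (kap + 1)); first by rewrite divr_gt0.
  move=> al be l l0 h1 h2 H.
  pose s := l * (1 + 2 * tau).
  have s0 : 0 <= s by rewrite mulr_ge0 ?(ltW l0)// addr_ge0// mulr_ge0// ltW.
  pose p := al - z0.1 - tau * l + (d * f z0 - b * g z0) / D.
  pose q := be - z0.2 - tau * l + (a * g z0 - c * f z0) / D.
  have [mM eM] := measure_parallelogram p q D0 s0 s0.
  eexists; split; [exact: mM| |].
    move=> z Hz; have [H1 H2] := H z Hz.
    set e1 := (X in `|X|) in H1; set e2 := (X in `|X|) in H2.
    have kh : kap * (tau / (kap + 1) * l) <= tau * l.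
      rewrite mulrA ler_wpM2r ?(ltW l0)// mulrCA ler_piMr ?(ltW tau0)//.
      by rewrite ler_pdivrMr// mul1r lerDl.
    have le_kap (u v : R) : `|u| + `|v| <= `|a| + `|b| + `|c| + `|d| ->
      (`|u| + `|v|) / `|D| * (tau / (kap + 1) * l) <= tau * l.
      move=> uv; apply: le_trans kh; apply: ler_wpM2r.
        by rewrite mulr_ge0 ?(ltW l0)// divr_ge0 ?(ltW tau0)// ltW.
      by rewrite ler_wpM2r// invr_ge0 ltW.
    have b1 := le_trans (lin_bound d b D0 H1 H2) (le_kap d b _).
    have b2 := le_trans (lin_bound a c D0 H2 H1) (le_kap a c _).
    have k1 : `|d| + `|b| <= `|a| + `|b| + `|c| + `|d|.
      by clear -a b c d; have := normr_ge0 a; have := normr_ge0 c; lra.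
    have k2 : `|a| + `|c| <= `|a| + `|b| + `|c| + `|d|.
      by clear -a b c d; have := normr_ge0 b; have := normr_ge0 d; lra.
    have {b1 k1} /abs_itv/andP[b1 b1'] : `|(d * e1 - b * e2) / D - 0| <= tau * l by rewrite subr0 b1.
    have {b2 k2} /abs_itv/andP[b2 b2'] : `|(a * e2 - c * e1) / D - 0| <= tau * l by rewrite subr0 b2.
    have E1 : (d * f z - b * g z) / D =
       (d * e1 - b * e2) / D + (z.1 - z0.1) + (d * f z0 - b * g z0) / D.
      by rewrite /e1 /e2 /D; field.
    have E2 : (a * g z - c * f z) / D =
       (a * e2 - c * e1) / D + (z.2 - z0.2) + (a * g z0 - c * f z0) / D.
      by rewrite /e1 /e2 /D; field.
    case: Hz => /andP[z1 z1'] /andP[z2 z2']; split => /=.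
      by rewrite E1 /p /s; clear -b1 b1' z1 z1'; apply/andP; split; lra.
    by rewrite E2 /q /s; clear -b2 b2' z2 z2'; apply/andP; split; lra.
  rewrite eM lee_fin /s.
  have -> : `|D| * (l * (1 + 2 * tau)) * (l * (1 + 2 * tau)) =
     (`|D| + `|D| * (4 * tau + 4 * tau * tau)) * l ^+ 2 by ring.
  apply: ler_wpM2r; first exact: sqr_ge0.
  rewrite lerD2l.
  have t1 : tau <= 1 by rewrite ge_min lexx.
  have t2 : tau * (8 * `|D|) <= e by rewrite -ler_pdivlMr ?mulr_gt0// ge_min lexx orbT.
  apply: le_trans t2.
  rewrite mulrCA (mulrC `|D|) mulrA ler_wpM2r//.
  have : tau * tau <= tau * 1 by apply: ler_wpM2l => //; exact: ltW.
  lra.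
(* degenerate differential: the image lies in a thin strip *)
rewrite D0 normr0.
have [[m [cE dE]]|nm] := pselect (exists m, c = m * a /\ d = m * b).
  pose A := `|a| + `|b| + 1.
  pose B := 1 + `|m|.
  have A0 : 0 < A by rewrite ltr_wpDl// addr_ge0.
  have B0 : 0 < B by rewrite ltr_pwDl.
  pose eta := Num.min 1 (e / (4 * A * B)).
  have eta0 : 0 < eta by rewrite lt_min ltr01 divr_gt0// !mulr_gt0.
  have eta1 : eta <= 1 by rewrite ge_min lexx.
  have eta2 : eta * (4 * A * B) <= e by rewrite -ler_pdivlMr ?mulr_gt0// ge_min lexx orbT.
  exists eta => // al be l l0 h1 h2 H.
  have s0 : 0 <= 2 * (A * l) by rewrite !mulr_ge0// ltW.
  have t0 : 0 <= 2 * (B * (eta * l)) by rewrite !mulr_ge0// ltW.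
  have D1 : 1 * 1 - 0 * m != 0 :> R by rewrite mul0r subr0 mul1r oner_neq0.
  have [mM eM] := measure_parallelogram (f z0 - A * l) (g z0 - m * f z0 - B * (eta * l)) D1 s0 t0.
  eexists; split; [exact: mM| |].
    move=> z Hz; have [H1 H2] := H z Hz.
    rewrite /= !mul1r mul0r !subr0 mul0r subr0 !divr1.
    case: Hz => z1 z2.
    have k1 : `|z.1 - z0.1| <= l by clear -z1 z2 h1 h2; rewrite ler_norml; apply/andP; split; lra.
    have k2 : `|z.2 - z0.2| <= l by clear -z1 z2 h1 h2; rewrite ler_norml; apply/andP; split; lra.
    have X1 : `|f z - f z0| <= A * l.
      rewrite -[f z - _](subrK (a * (z.1 - z0.1) + b * (z.2 - z0.2))).
      rewrite (le_trans (ler_normD _ _))// /A !mulrDl mul1r addrC.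
      apply: lerD; last by rewrite (le_trans H1)// ler_piMl// ltW.
      rewrite (le_trans (ler_normD _ _))// !normrM.
      by apply: lerD; apply: ler_wpM2l.
    have X2 : `|(g z - m * f z) - (g z0 - m * f z0)| <= B * (eta * l).
      set e1 := (X in `|X|) in H1; set e2 := (X in `|X|) in H2.
      have -> : (g z - m * f z) - (g z0 - m * f z0) = e2 - m * e1.
        by rewrite /e1 /e2 cE dE; ring.
      rewrite (le_trans (ler_normB _ _))// normrM /B mulrDl mul1r.
      by apply: lerD => //; apply: ler_wpM2l.
    by move: X1 X2 => /abs_itv/andP[u1 u2] /abs_itv/andP[v1 v2]; clear -u1 u2 v1 v2; split; apply/andP; split; lra.
  rewrite eM lee_fin !mul0r mulr1 subr0 normr1 mul1r add0r.
  have -> : 2 * (A * l) * (2 * (B * (eta * l))) = eta * (4 * A * B) * l ^+ 2 by ring.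
  by apply: ler_wpM2r => //; exact: sqr_ge0.
have [a0 b0] : a = 0 /\ b = 0.
  move/eqP: D0; rewrite subr_eq0 => /eqP D0.
  split; apply: contrapT => /eqP n0; apply: nm.
    by exists (c / a); rewrite divfK//; split => //; apply: (mulfI n0); rewrite D0; field.
  by exists (d / b); rewrite divfK//; split => //; apply: (mulfI n0); rewrite -D0; field.
pose A := `|c| + `|d| + 1.
have A0 : 0 < A by rewrite ltr_wpDl// addr_ge0.
pose eta := Num.min 1 (e / (4 * A)).
have eta0 : 0 < eta by rewrite lt_min ltr01 divr_gt0// !mulr_gt0.
have eta1 : eta <= 1 by rewrite ge_min lexx.
have eta2 : eta * (4 * A) <= e by rewrite -ler_pdivlMr ?mulr_gt0// ge_min lexx orbT.
exists eta => // al be l l0 h1 h2 H.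
have s0 : 0 <= 2 * (eta * l) by rewrite !mulr_ge0// ltW.
have t0 : 0 <= 2 * (A * l) by rewrite !mulr_ge0// ltW.
have D1 : 1 * 1 - 0 * 0 != 0 :> R by rewrite mul0r subr0 mul1r oner_neq0.
have [mM eM] := measure_parallelogram (f z0 - eta * l) (g z0 - A * l) D1 s0 t0.
eexists; split; [exact: mM| |].
  move=> z Hz; have [H1 H2] := H z Hz.
  rewrite /= !mul1r !mul0r !subr0 !divr1.
  case: Hz => z1 z2.
  have k1 : `|z.1 - z0.1| <= l by clear -z1 z2 h1 h2; rewrite ler_norml; apply/andP; split; lra.
  have k2 : `|z.2 - z0.2| <= l by clear -z1 z2 h1 h2; rewrite ler_norml; apply/andP; split; lra.
  move: H1; rewrite a0 b0 !mul0r addr0 subr0 => /abs_itv/andP[? ?].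
  have : `|g z - g z0| <= A * l.
    rewrite -[g z - _](subrK (c * (z.1 - z0.1) + d * (z.2 - z0.2))).
    rewrite (le_trans (ler_normD _ _))// /A !mulrDl mul1r addrC.
    apply: lerD; last by rewrite (le_trans H2)// ler_piMl// ltW.
    rewrite (le_trans (ler_normD _ _))// !normrM.
    by apply: lerD; apply: ler_wpM2l.
  by move=> /abs_itv/andP[u1 u2]; split; apply/andP; split; lra.
rewrite eM lee_fin !mul0r mulr1 subr0 normr1 mul1r add0r.
have -> : 2 * (eta * l) * (2 * (A * l)) = eta * (4 * A) * l ^+ 2 by ring.
by apply: ler_wpM2r => //; exact: sqr_ge0.
Qed.

End local_area.

Section lower_area.
Context {R : realType}.
Local Notation mu := (@lebesgue_measure R \x @lebesgue_measure R)%E.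

Lemma max_sep (x y : R) (t eps : R) : 0 < t -> t <= `|x| \/ t <= `|y| -> 2 * eps < t ->
  0 <= eps -> 0 < x ^+ 2 + y ^+ 2 - eps * (`|x| + `|y|).
Proof.
move=> t0 + et e0; rewrite -(real_normK (num_real x)) -(real_normK (num_real y)).
move: `|x| `|y| (normr_ge0 x) (normr_ge0 y) => {x y} x y x0 y0.
wlog xy : x y x0 y0 / y <= x => [W|].
  have [|/ltW] := leP y x => xy h; first exact: W.
  by rewrite (addrC (x ^+ 2)) (addrC x); apply: W => //; case: h; [right|left].
move=> h; have tx : t <= x by case: h => // /le_trans; apply.
have h1 : x * (2 * eps) < x * x by rewrite ltr_pM2l; lra.
have h2 : eps * y <= eps * x by apply: ler_wpM2l.
have := sqr_ge0 y; lra.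
Qed.

(** A planar map close to an invertible linear one covers a slightly smaller parallelogram, by the
    degree argument on a box. *)
Lemma lower_cover (f g : R * R -> R) z0 a b c d (e : R) :
  sdiff f z0 a b -> sdiff g z0 c d -> a * d - b * c != 0 -> 0 < e ->
  exists2 dl : R, 0 < dl & forall al be l : R, 0 < l < dl ->
    al <= z0.1 <= al + l -> be <= z0.2 <= be + l ->
    (forall z, csq al be l z -> {for z, continuous f} /\ {for z, continuous g}) ->
    exists M : set (R * R), [/\ measurable M,
       (forall Z, M Z -> exists2 z, hsq al be l z & Z = (f z, g z)) &
       (((`|a * d - b * c| - e) * l ^+ 2)%:E <= mu M)%E].
Proof.
move=> fd gd D0 e0; set D := a * d - b * c in D0 *.
pose kap := (`|a| + `|b| + `|c| + `|d|) / `|D|.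
have nD : 0 < `|D| by rewrite normr_gt0.
have kap0 : 0 <= kap by rewrite divr_ge0// !addr_ge0.
pose tau := Num.min (1 / 4) (e / (4 * `|D|)).
have tau0 : 0 < tau by rewrite lt_min !divr_gt0// mulr_gt0.
have tau1 : tau <= 1 / 4 by rewrite ge_min lexx.
have tau2 : tau * (4 * `|D|) <= e by rewrite -ler_pdivlMr ?mulr_gt0// ge_min lexx orbT.
have kp : 0 < 8 * kap + 1 by rewrite ltr_wpDl// mulr_ge0.
pose eta := tau / (8 * kap + 1).
have eta0 : 0 < eta by rewrite divr_gt0.
have keta : kap * eta * 8 < tau.
  have -> : kap * eta * 8 = tau * (8 * kap / (8 * kap + 1)).
    by rewrite /eta; field; rewrite gt_eqF.
  by rewrite gtr_pMr// ltr_pdivrMr// mul1r ltrDl.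
have [d1 d10 d1P] := sdiff_sq fd eta0.
have [d2 d20 d2P] := sdiff_sq gd eta0.
exists (Num.min d1 d2); first by rewrite lt_min d10.
move=> al be l /andP[l0]; rewrite lt_min => /andP[l1 l2] h1 h2 cfg.
have ll1 : 0 < l < d1 by rewrite l0.
have ll2 : 0 < l < d2 by rewrite l0.
have H1 := d1P _ _ _ ll1 h1 h2; have H2 := d2P _ _ _ ll2 h1 h2.
pose s := l * (1 - 2 * tau).
have s0 : 0 <= s by rewrite mulr_ge0 ?(ltW l0)//; lra.
pose p := al - z0.1 + tau * l + (d * f z0 - b * g z0) / D.
pose q := be - z0.2 + tau * l + (a * g z0 - c * f z0) / D.
have [mM eM] := measure_parallelogram p q D0 s0 s0.
eexists; split; [exact: mM| |]; last first.
  rewrite eM lee_fin /s.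
  have -> : `|D| * (l * (1 - 2 * tau)) * (l * (1 - 2 * tau)) =
     (`|D| - (tau * (4 * `|D|)) + 4 * (tau ^+ 2 * `|D|)) * l ^+ 2 by ring.
  apply: ler_wpM2r; first exact: sqr_ge0.
  have : 0 <= tau ^+ 2 * `|D| by rewrite mulr_ge0// sqr_ge0.
  by move: (tau ^+ 2 * _) (tau * _) tau2 => u v ? ?; lra.
move=> [X Y] /= [/andP[m1 m1'] /andP[m2 m2']].
pose cc : R * R := (al + l / 2, be + l / 2).
pose rho := l / 2 * (1 - tau).
have rho0 : 0 < rho by rewrite mulr_gt0 ?divr_gt0//; lra.
pose y : R * R := (z0.1 + ((d * X - b * Y) / D - (d * f z0 - b * g z0) / D),
                   z0.2 + ((a * Y - c * X) / D - (a * g z0 - c * f z0) / D)).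
pose G (z : R * R) : R * R := ((d * f z - b * g z) / D - (d * X - b * Y) / D,
                       (a * g z - c * f z) / D - (a * Y - c * X) / D).
have tl : tau * l <= l / 4.
  have := ler_wpM2r (ltW l0) tau1; lra.
have tl0 : 0 < tau * l by rewrite mulr_gt0.
have rhoE : rho = l / 2 - tau * l / 2 by rewrite /rho; ring.
have sub z : cbox cc rho z -> hsq al be l z.
  rewrite /cbox rhoE /= => -[/abs_itv/andP[u1 u2] /abs_itv/andP[v1 v2]].
  move: (tau * l) tl0 u1 u2 v1 v2 => w w0 u1 u2 v1 v2.
  by clear -w0 u1 u2 v1 v2; split; apply/andP; split; lra.
have subc z : cbox cc rho z -> csq al be l z.
  by move=> /sub [/andP[? ?] /andP[? ?]]; split; apply/andP; split => //; exact: ltW.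
have y1 : `|y.1 - cc.1| <= l / 2 - tau * l.
  rewrite /y/= ler_distl; move: m1 m1'; rewrite /p /s mulrBr mulr1.
  move: ((d * X - b * Y) / D) ((d * f z0 - b * g z0) / D) => u v.
  rewrite (mulrC l (2 * tau)) -mulrA.
  move: (tau * l) => w; move: (z0.1) => z01 m1 m1'; clear -m1 m1'; apply/andP; split; lra.
have y2 : `|y.2 - cc.2| <= l / 2 - tau * l.
  rewrite /y/= ler_distl; move: m2 m2'; rewrite /q /s mulrBr mulr1.
  move: ((a * Y - c * X) / D) ((a * g z0 - c * f z0) / D) => u v.
  rewrite (mulrC l (2 * tau)) -mulrA.
  move: (tau * l) => w; move: (z0.2) => z02 m2 m2'; clear -m2 m2'; apply/andP; split; lra.
have [] := @box_hit R cc rho G y rho0.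
- apply: continuous_in_subspaceT => z; rewrite inE => /subc/cfg[cf cg].
  apply: (@cont_pair _ R R (fun z => (d * f z - b * g z) / D - (d * X - b * Y) / D)
     (fun z => (a * g z - c * f z) / D - (a * Y - c * X) / D) z).
    apply: cvgB; last exact: cvg_cst.
    apply: cvgM; last exact: cvg_cst.
    by apply: cvgB; apply: cvgM; (exact: cvg_cst || exact: cf || exact: cg).
  apply: cvgB; last exact: cvg_cst.
  apply: cvgM; last exact: cvg_cst.
  by apply: cvgB; apply: cvgM; (exact: cvg_cst || exact: cf || exact: cg).
- by apply: le_lt_trans y1 _; rewrite rhoE; lra.
- by apply: le_lt_trans y2 _; rewrite rhoE; lra.
- move=> z Bz bd.
  have K1 := H1 _ (subc _ Bz); have K2 := H2 _ (subc _ Bz).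
  set e1 := (X in `|X|) in K1; set e2 := (X in `|X|) in K2.
  have E1 : (G z).1 = z.1 - y.1 + (d * e1 - b * e2) / D.
    by rewrite /G /y /e1 /e2 /D /=; field.
  have E2 : (G z).2 = z.2 - y.2 + (a * e2 - c * e1) / D.
    by rewrite /G /y /e1 /e2 /D /=; field.
  have b1 : `|(d * e1 - b * e2) / D| <= kap * (eta * l).
    apply: le_trans (lin_bound d b D0 K1 K2) _.
    apply: ler_wpM2r; first by rewrite mulr_ge0// ltW.
    rewrite ler_wpM2r// ?invr_ge0//.
    by clear -a b c d; move: (normr_ge0 a) (normr_ge0 c) => ? ?; lra.
  have b2 : `|(a * e2 - c * e1) / D| <= kap * (eta * l).
    apply: le_trans (lin_bound a c D0 K2 K1) _.
    apply: ler_wpM2r; first by rewrite mulr_ge0// ltW.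
    rewrite ler_wpM2r// ?invr_ge0//.
    by clear -a b c d; move: (normr_ge0 b) (normr_ge0 d) => ? ?; lra.
  rewrite /dot2 E1 E2 /=.
  move: ((d * e1 - b * e2) / D) ((a * e2 - c * e1) / D) b1 b2 => r1 r2 b1 b2.
  set x1 := z.1 - y.1; set x2 := z.2 - y.2.
  have : 0 < x1 ^+ 2 + x2 ^+ 2 - kap * (eta * l) * (`|x1| + `|x2|).
    apply: (@max_sep _ _ (tau * l / 2)).
    - by rewrite divr_gt0.
    - case: bd => bd; [left|right].
        have : `|z.1 - cc.1| <= `|x1| + `|y.1 - cc.1|.
          by rewrite -(subrKA y.1 z.1); exact: ler_normD.
        by rewrite bd rhoE => K; clear -K y1; lra.
      have : `|z.2 - cc.2| <= `|x2| + `|y.2 - cc.2|.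
        by rewrite -(subrKA y.2 z.2); exact: ler_normD.
      by rewrite bd rhoE => K; clear -K y2; lra.
    - have -> : 2 * (kap * (eta * l)) = kap * eta * 8 * (l / 4) by field.
      have -> : tau * l / 2 = tau * (l / 2) by ring.
      apply: (@lt_trans _ _ (tau * (l / 4))); first by rewrite ltr_pM2r ?divr_gt0.
      by rewrite ltr_pM2l//; clear -l0; lra.
    - by apply: mulr_ge0 => //; apply: mulr_ge0; exact: ltW.
  have b1' : - (kap * (eta * l) * `|x1|) <= r1 * x1.
    rewrite lerNl (le_trans (ler_norm _))// normrN normrM.
    by apply: ler_wpM2r.
  have b2' : - (kap * (eta * l) * `|x2|) <= r2 * x2.
    rewrite lerNl (le_trans (ler_norm _))// normrN normrM.
    by apply: ler_wpM2r.
  move: (kap * (eta * l)) b1' b2' => h b1' b2' K.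
  have -> : (z.1 - y.1 + r1) * x1 + (z.2 - y.2 + r2) * x2 =
     x1 ^+ 2 + x2 ^+ 2 + r1 * x1 + r2 * x2 by rewrite /x1 /x2; ring.
  by rewrite mulrDr in K; clear -K b1' b2'; lra.
move=> z Bz [/eqP + /eqP]; rewrite !subr_eq0 => /eqP e1 /eqP e2.
exists z; first exact: sub.
have e1' : d * f z - b * g z = d * X - b * Y by rewrite -[LHS](divfK D0) e1 divfK.
have e2' : a * g z - c * f z = a * Y - c * X by rewrite -[LHS](divfK D0) e2 divfK.
congr pair; apply: (mulfI D0).
  transitivity (a * (d * X - b * Y) + b * (a * Y - c * X)); first by rewrite /D; ring.
  by rewrite -e1' -e2' /D; ring.
transitivity (c * (d * X - b * Y) + d * (a * Y - c * X)); first by rewrite /D; ring.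
by rewrite -e1' -e2' /D; ring.
Qed.

End lower_area.

(** * Comparison of areas and Lebesgue measure *)

Section global_area.
Context {R : realType}.
Local Notation mu1 := (@lebesgue_measure R).
Local Notation mu := (@lebesgue_measure R \x @lebesgue_measure R)%E.

Lemma csqE (a b l : R) : csq a b l = `[a, a + l]%classic `*` `[b, b + l]%classic.
Proof. by apply/seteqP; split => z; rewrite /csq/= !in_itv/=. Qed.

Lemma hsqE (a b l : R) : hsq a b l = `[a, a + l[%classic `*` `[b, b + l[%classic.
Proof. by apply/seteqP; split => z; rewrite /hsq/= !in_itv/=. Qed.

Lemma csq_compact (a b l : R) : compact (csq a b l).
Proof. by rewrite csqE; apply: compact_setX; exact: segment_compact. Qed.

Lemma hsq_measurable (a b l : R) : measurable (hsq a b l).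
Proof. by rewrite hsqE; apply: measurableX; exact: measurable_itv. Qed.

Lemma hsq_measure (a b l : R) : 0 < l -> mu (hsq a b l) = (l ^+ 2)%:E.
Proof.
move=> l0; rewrite hsqE product_measure1E; [|exact: measurable_itv..].
rewrite [X in (X * _)%E]lebesgue_measure_itv [X in (_ * X)%E]lebesgue_measure_itv/=.
rewrite !lte_fin !ltrDl l0 -!EFinD -EFinM; congr EFin; ring.
Qed.

Lemma hsq_csq (a b l : R) : hsq a b l `<=` csq a b l.
Proof. by move=> z [/andP[? ?] /andP[? ?]]; split; apply/andP; split => //; exact: ltW. Qed.

Lemma cont_measurable (O : set (R * R)) (f : R * R -> R) : open O ->
  (forall z, O z -> {for z, continuous f}) -> measurable_fun O f.
Proof.
move=> oO cf; apply: (measurability _ (RGenOpens.measurableE R)).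
move=> _ [_ [a [b ->] <-]]; apply: open_measurable2.
rewrite openE => z [Oz fz]; apply: filterI; first exact: open_nbhs_nbhs.
by apply: (cf z Oz); apply: open_nbhs_nbhs; split => //; exact: interval_open.
Qed.

Lemma sq_near (P : set (R * R)) (z : R * R) : nbhs z P -> exists2 dl : R, 0 < dl &
  forall a b l, 0 < l < dl -> a <= z.1 <= a + l -> b <= z.2 <= b + l ->
    csq a b l `<=` P.
Proof.
move=> /nbhs_ballP[e /= e0 eP]; exists e => // a b l /andP[l0 le] /andP[h1 h2] /andP[h3 h4].
move=> w [/andP[? ?] /andP[? ?]]; apply: eP; split; rewrite /ball/= ltr_distl; apply/andP; split; lra.
Qed.

Section nonneg_integral.
Variables (O : set (R * R)) (dens : R * R -> R).
Hypotheses (oO : open O) (cdens : forall z, O z -> {for z, continuous dens})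
  (dens0 : forall z, O z -> 0 <= dens z).

Lemma dens_measurable A : measurable A -> A `<=` O -> measurable_fun A (EFin \o dens).
Proof.
move=> mA AO; apply: (measurable_funS (open_measurable2 oO) AO).
by apply/measurable_EFinP; exact: cont_measurable.
Qed.

Lemma integral_superadd (A B C : set (R * R)) : measurable A -> measurable B -> measurable C ->
  A `<=` C -> B `<=` C -> C `<=` O -> A `&` B = set0 ->
  (\int[mu]_(z in A) (dens z)%:E + \int[mu]_(z in B) (dens z)%:E
     <= \int[mu]_(z in C) (dens z)%:E)%E.
Proof.
move=> mA mB mC AC BC CO AB.
have UC : A `|` B `<=` C by move=> z [/AC|/BC].
have mU : measurable (A `|` B) by exact: measurableU.
rewrite -ge0_integral_setU//.
- apply: ge0_subset_integral => //; first exact: dens_measurable.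
  by move=> z /CO Oz; rewrite lee_fin dens0.
- by apply: dens_measurable => //; exact: subset_trans CO.
- by move=> z /UC/CO Oz; rewrite lee_fin dens0.
- by apply/disj_setPS; rewrite AB.
Qed.

Lemma integral_subadd (A B C : set (R * R)) : measurable A -> measurable B -> measurable C ->
  A `<=` O -> B `<=` O -> C `<=` A `|` B ->
  (\int[mu]_(z in C) (dens z)%:E
     <= \int[mu]_(z in A) (dens z)%:E + \int[mu]_(z in B) (dens z)%:E)%E.
Proof.
move=> mA mB mC AO BO CU.
have mBA : measurable (B `\` A) by exact: measurableD.
have UE : A `|` (B `\` A) = A `|` B.
  apply/seteqP; split => z [Az|Bz]; [by left|by right; case: Bz|by left|].
  by have [Az|nAz] := pselect (A z); [left|right].
have UO : A `|` B `<=` O by move=> z [/AO|/BO].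
have mU : measurable (A `|` B) by exact: measurableU.
have nn z : O z -> (0 <= (dens z)%:E)%E by move=> Oz; rewrite lee_fin dens0.
apply: (@le_trans _ _ (\int[mu]_(z in A `|` B) (dens z)%:E)%E).
  apply: ge0_subset_integral => //; first exact: dens_measurable.
  by move=> z /UO; exact: nn.
rewrite -[in X in (X <= _)%E]UE ge0_integral_setU//.
- apply: leeD2l; apply: ge0_subset_integral => //.
  + exact: dens_measurable.
  + by move=> z /BO; exact: nn.
- by rewrite UE; exact: dens_measurable.
- by move=> z; rewrite UE => /UO; exact: nn.
- by apply/disj_setPS => z [? []].
Qed.

(** By continuity, the integral of dens over a small square around z0 is dens z0 times its area, up to e. *)
Lemma integral_hsq_bounds (z0 : R * R) (e : R) : O z0 -> 0 < e ->
  exists2 dl : R, 0 < dl & forall a b l : R, 0 < l < dl ->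
    a <= z0.1 <= a + l -> b <= z0.2 <= b + l ->
    [/\ csq a b l `<=` O,
     (((dens z0 - e) * l ^+ 2)%:E <= \int[mu]_(z in hsq a b l) (dens z)%:E)%E &
     (\int[mu]_(z in hsq a b l) (dens z)%:E <= ((dens z0 + e) * l ^+ 2)%:E)%E].
Proof.
move=> Oz0 e0.
have [d1 d10 d1P] := sq_near (open_nbhs_nbhs (conj oO Oz0)).
have : nbhs z0 [set z | `|dens z0 - dens z| < e].
  by move/cvgrPdist_lt : (cdens Oz0) => /(_ _ e0).
move=> /sq_near[d2 d20 d2P].
exists (Num.min d1 d2); first by rewrite lt_min d10.
move=> a b l /andP[l0]; rewrite lt_min => /andP[l1 l2] h1 h2.
have cO : csq a b l `<=` O by apply: d1P; rewrite ?l0.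
have cb : csq a b l `<=` [set z | `|dens z0 - dens z| < e] by apply: d2P; rewrite ?l0.
have mh := hsq_measurable a b l.
have hO : hsq a b l `<=` O := subset_trans (@hsq_csq a b l) cO.
split=> //.
- have [neg|pos] := leP (dens z0 - e) 0.
    apply: (@le_trans _ _ 0%E).
      by rewrite lee_fin mulr_le0_ge0// sqr_ge0.
    by apply: integral_ge0 => z /hO Oz; rewrite lee_fin dens0.
  rewrite EFinM -(hsq_measure a b l0) -(integral_cst mu mh).
  apply: ge0_le_integral => //.
  + by move=> z _; rewrite lee_fin ltW.
  + exact: dens_measurable.
  + by move=> z /hsq_csq/cb/=; rewrite ltr_distl lee_fin => /andP[_]; lra.
- rewrite EFinM -(hsq_measure a b l0) -(integral_cst mu mh).
  apply: ge0_le_integral => //.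
  + by move=> z /hO Oz; rewrite lee_fin dens0.
  + exact: dens_measurable.
  + by move=> z /hsq_csq/cb/=; rewrite ltr_distl lee_fin => /andP[+ _]; lra.
Qed.

End nonneg_integral.

(** The inequality half of the area formula.  Measure of the image is subadditive and the integral is
    additive on half-open squares, so that the local hypothesis propagates by bisection. *)
Lemma area_image_le (K O : set (R * R)) (F : R * R -> R * R) (dens : R * R -> R) :
  open O -> K `<=` O -> compact K -> {within K, continuous F} ->
  (forall z, O z -> {for z, continuous dens}) -> (forall z, O z -> 0 <= dens z) ->
  (forall z0 (e : R), K z0 -> 0 < e -> exists2 dl : R, 0 < dl &
    forall a b l : R, 0 < l < dl -> a <= z0.1 <= a + l -> b <= z0.2 <= b + l ->
    exists M : set (R * R), [/\ measurable M, (forall z, csq a b l z -> M (F z)) &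
       (mu M <= ((dens z0 + e) * l ^+ 2)%:E)%E]) ->
  (mu (F @` K) <= \int[mu]_(z in O) (dens z)%:E)%E.
Proof.
move=> oO KO cK cF cdens dens0 loc.
have mO : measurable O by exact: open_measurable2.
pose Kc a b l := K `&` csq a b l.
have cKc a b l : compact (Kc a b l).
  by apply: compact_closedI => //; apply: compact_closed => //; exact: csq_compact.
have mFK a b l : measurable (F @` Kc a b l).
  apply: compact_measurable2; apply: continuous_compact => //.
  by apply: continuous_subspaceW cF; exact: subIsetl.
have mOh (a b l : R) : measurable (O `&` hsq a b l).
  by apply: measurableI => //; exact: hsq_measurable.
pose m1 a b l := mu (F @` Kc a b l).
pose m2 a b l := (\int[mu]_(z in O `&` hsq a b l) (dens z)%:E)%E.
have sub1 : subadd4 m1.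
  move=> a b l l0; rewrite /m1.
  have sb : F @` Kc a b (l *+ 2) `<=` (F @` Kc a b l `|` F @` Kc (a + l) b l) `|`
       (F @` Kc a (b + l) l `|` F @` Kc (a + l) (b + l) l).
    move=> _ [z [Kz [/andP[z1 z1'] /andP[z2 z2']]] <-].
    rewrite mulr2n in z1' z2'.
    have [h1|/ltW h1] := leP z.1 (a + l); have [h2|/ltW h2] := leP z.2 (b + l).
    - by left; left; exists z => //; do 2?split => //; apply/andP.
    - by right; left; exists z => //; do 2?split => //; apply/andP; split => //; rewrite -addrA.
    - by left; right; exists z => //; do 2?split => //; apply/andP; split => //; rewrite -addrA.
    - by right; right; exists z => //; do 2?split => //; apply/andP; split => //; rewrite -addrA.
  have mU := measurableU _ _ (mFK a b l) (mFK (a + l) b l).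
  have mV := measurableU _ _ (mFK a (b + l) l) (mFK (a + l) (b + l) l).
  apply: (le_trans (le_measure mu _ _ sb)); rewrite ?inE//; [exact: mFK|exact: measurableU|].
  apply: (le_trans (measureU2 mu mU mV)).
  by apply: leeD; apply: measureU2; exact: mFK.
have sup2 : superadd4 m2.
  move=> a b l l0; rewrite /m2.
  have e1 : O `&` hsq a b l `&` (O `&` hsq (a + l) b l) = set0.
    by apply/seteqP; split => // z [[_ [/andP[? ?] _]] [_ [/andP[? ?] _]]]; lra.
  have e2 : O `&` hsq a (b + l) l `&` (O `&` hsq (a + l) (b + l) l) = set0.
    by apply/seteqP; split => // z [[_ [/andP[? ?] _]] [_ [/andP[? ?] _]]]; lra.
  have e3 : ((O `&` hsq a b l) `|` (O `&` hsq (a + l) b l)) `&`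
    ((O `&` hsq a (b + l) l) `|` (O `&` hsq (a + l) (b + l) l)) = set0.
    apply/seteqP; split => // z [h h'].
    have k1 : z.2 < b + l by case: h => -[_ [_ /andP[]]].
    have k2 : b + l <= z.2 by case: h' => -[_ [_ /andP[]]].
    by rewrite ltNge k2 in k1.
  have inO (A B : set (R * R)) : (O `&` A) `|` (O `&` B) `<=` O by move=> z [[]|[]].
  have := integral_superadd oO cdens dens0 (mOh a b l) (mOh (a + l) b l)
    (measurableU _ _ (mOh a b l) (mOh (a + l) b l)) (@subsetUl _ _ _) (@subsetUr _ _ _)
    (@inO _ _) e1.
  have := integral_superadd oO cdens dens0 (mOh a (b + l) l) (mOh (a + l) (b + l) l)
    (measurableU _ _ (mOh a (b + l) l) (mOh (a + l) (b + l) l)) (@subsetUl _ _ _) (@subsetUr _ _ _)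
    (@inO _ _) e2.
  move=> i2 i1; apply: (le_trans (leeD i1 i2)).
  have in2 (x y : R) : a <= x -> b <= y -> x + l <= a + l *+ 2 -> y + l <= b + l *+ 2 ->
    O `&` hsq x y l `<=` O `&` hsq a b (l *+ 2).
    by move=> ? ? ? ? z [Oz [/andP[? ?] /andP[? ?]]]; do 2?split => //; apply/andP; split; lra.
  have l2 : l *+ 2 = l + l by rewrite mulr2n.
  apply: (integral_superadd oO cdens dens0) => //; try exact: measurableU.
  - by move=> z [|]; apply: in2; rewrite ?l2; clear -l0; lra.
  - by move=> z [|]; apply: in2; rewrite ?l2; clear -l0; lra.
have main (e a b l : R) : 0 < e -> 0 < l -> (m1 a b l <= m2 a b l + (e * l ^+ 2)%:E)%E.
  apply: bisection_le => // z0 {}e e0.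
  have [Kz|nKz] := pselect (K z0); last first.
    have : nbhs z0 (~` K).
      apply: open_nbhs_nbhs; split => //; apply: closed_openC.
      exact: compact_closed.
    move=> /sq_near[dl dl0 dlP]; exists dl => // {}a {}b {}l h h1 h2.
    rewrite /m1 (_ : Kc a b l = set0); last first.
      by apply/seteqP; split => // z [Kz /(dlP _ _ _ h h1 h2)].
    rewrite image_set0 measure0 adde_ge0//; last by rewrite lee_fin mulr_ge0 ?sqr_ge0// ltW.
    by apply: integral_ge0 => z [Oz _]; rewrite lee_fin dens0.
  have e2 : 0 < e / 2 by rewrite divr_gt0.
  have [d1 d10 d1P] := loc z0 _ Kz e2.
  have [d2 d20 d2P] := integral_hsq_bounds oO cdens dens0 (KO _ Kz) e2.
  exists (Num.min d1 d2); first by rewrite lt_min d10.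
  move=> {}a {}b {}l /andP[l0]; rewrite lt_min => /andP[l1 l2] h1 h2.
  have ll1 : 0 < l < d1 by rewrite l0.
  have ll2 : 0 < l < d2 by rewrite l0.
  have [M [mM MF muM]] := d1P _ _ _ ll1 h1 h2.
  have [cO i1 i2] := d2P _ _ _ ll2 h1 h2.
  have -> : m2 a b l = (\int[mu]_(z in hsq a b l) (dens z)%:E)%E.
    by rewrite /m2 setIidr//; exact: subset_trans (@hsq_csq a b l) cO.
  apply: (@le_trans _ _ (mu M)).
    apply: le_measure; rewrite ?inE//; first exact: mFK.
    by move=> _ [z [_ cz] <-]; exact: MF.
  apply: (le_trans muM); apply: (@le_trans _ _ (((dens z0 - e / 2) * l ^+ 2)%:E + (e * l ^+ 2)%:E)%E).
    by rewrite -EFinD lee_fin -mulrDl; apply: ler_wpM2r; [exact: sqr_ge0|lra].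
  exact: leeD2r.
have [r [r0 Kr]] : exists r : R, 0 < r /\ forall z, K z -> `|z| <= r.
  have [r [_ rP]] := compact_bounded cK.
  exists (Num.max r 0 + 1); split; first by rewrite ltr_wpDl// le_max lexx orbT.
  by move=> z Kz; apply: rP => //; rewrite ltr_pwDr// le_max lexx.
have KE : F @` K = F @` Kc (- r) (- r) (r + r).
  congr image; apply/seteqP; split => z; last by case.
  move=> Kz; split => //; have := Kr _ Kz; rewrite prod_normE ge_max => /andP[].
  by rewrite !ler_norml => /andP[? ?] /andP[? ?]; split; apply/andP; split; lra.
rewrite KE; apply/lee_addgt0Pr => e e0.
have rr : 0 < r + r by rewrite addr_gt0.
have e1 : 0 < e / (r + r) ^+ 2 by rewrite divr_gt0// exprn_gt0.
have := main _ (- r) (- r) _ e1 rr; rewrite divfK; last by rewrite gt_eqF// exprn_gt0.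
move=> /le_trans; apply; apply: leeD2r.
apply: ge0_subset_integral => //; first exact: mOh.
by apply: (dens_measurable oO cdens).
Qed.

End global_area.

Section open_area.
Context {R : realType}.
Local Notation mu := (@lebesgue_measure R \x @lebesgue_measure R)%E.

(** The points of D in a bounded square and at distance at least 1/(n+1) from the complement of D. *)
Definition exhaust (D : set (R * R)) (n : nat) : set (R * R) :=
  csq (- n%:R) (- n%:R) (n%:R + n%:R) `&`
  \bigcap_(w in ~` D) [set z | n.+1%:R^-1 <= `|z - w|].

Lemma exhaust_compact D n : compact (exhaust D n).
Proof.
apply: (subclosed_compact _ (@csq_compact R _ _ _)); last exact: subIsetl.
apply: closedI; first by apply: compact_closed => //; exact: csq_compact.
apply: closed_bigI => w _.
apply: (@closed_comp _ _ (fun z : R * R => `|z - w|) [set x | n.+1%:R^-1 <= x]); last exact: closed_ge.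
move=> z _; apply: (@cont_comp _ _ _ (fun z : R * R => z - w) (fun z => `|z|)).
  by apply: cvgB; [exact: cvg_id|exact: cvg_cst].
exact: norm_continuous.
Qed.

Lemma exhaust_sub D n : exhaust D n `<=` D.
Proof.
move=> z [_ h]; apply: contrapT => nDz; have := h z nDz.
by rewrite /= subrr normr0 leNgt invr_gt0 ltr0n.
Qed.

Lemma exhaust_nd D : nondecreasing_seq (exhaust D).
Proof.
move=> m n mn; apply/subsetPset => z [[/andP[z1 z1'] /andP[z2 z2']] h].
have mnR : m%:R <= n%:R :> R by rewrite ler_nat.
split; first by split; apply/andP; split; lra.
move=> w /h /=; apply: le_trans; rewrite lef_pV2 ?posrE ?ltr0n// ler_nat ltnS//.
Qed.

Lemma exhaust_bigcup D : open D -> \bigcup_n exhaust D n = D.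
Proof.
move=> oD; apply/seteqP; split => [z [n _ /exhaust_sub]//|z Dz].
have /nbhs_ballP[e /= e0 eD] : nbhs z D by exact: open_nbhs_nbhs.
pose n := (Num.truncn `|z| + Num.truncn e^-1).+1.
have zn : `|z| <= n%:R.
  apply: ltW; apply: (lt_le_trans (truncnS_gt _)).
  by rewrite ler_nat ltnS leq_addr.
have en : n.+1%:R^-1 <= e.
  rewrite invf_ple ?posrE ?ltr0n//; apply: ltW; apply: (lt_le_trans (truncnS_gt _)).
  by rewrite ler_nat ltnS (leq_trans (leq_addl _ _) (leqnSn _)).
exists n => //; split.
  move: zn; rewrite prod_normE ge_max !ler_norml => /andP[/andP[? ?] /andP[? ?]].
  by split; apply/andP; split; lra.
move=> w nDw /=; apply: (le_trans en); rewrite leNgt; apply/negP => zw.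
by apply: nDw; apply: eD; rewrite -ball_normE.
Qed.

Lemma hsq_bigcup (a b l : R) : 0 < l ->
  hsq a b l = \bigcup_n csq a b (l - l / n.+1%:R).
Proof.
move=> l0; apply/seteqP; split => [z [/andP[z1 z1'] /andP[z2 z2']]|z [n _ [/andP[z1 z1'] /andP[z2 z2']]]]; last first.
  have : 0 < l / n.+1%:R by rewrite divr_gt0.
  by move: (l / n.+1%:R) z1' z2' => w z1' z2' w0; split; apply/andP; split; lra.
pose m := Num.min (a + l - z.1) (b + l - z.2).
have m0 : 0 < m by rewrite lt_min; apply/andP; split; lra.
exists (Num.truncn (l / m)) => //.
have : l / (Num.truncn (l / m)).+1%:R <= m.
  rewrite ler_pdivrMr ?ltr0n// mulrC -ler_pdivrMr//; apply: ltW; exact: truncnS_gt.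
rewrite le_min; move: (l / _) => w /andP[? ?]; split; apply/andP; split; lra.
Qed.

Lemma image_open_measurable (D : set (R * R)) (F : R * R -> R * R) (a b l : R) : open D ->
  (forall z, D z -> {for z, continuous F}) -> 0 < l ->
  measurable (F @` D) /\ measurable (F @` (D `&` hsq a b l)).
Proof.
move=> oD cF l0.
have mK (A : set (R * R)) : A `<=` D -> compact A -> measurable (F @` A).
  move=> AD cA; apply: compact_measurable2; apply: continuous_compact => //.
  by apply: continuous_in_subspaceT => z; rewrite inE => /AD /cF.
split.
  rewrite -(exhaust_bigcup oD) image_bigcup; apply: bigcupT_measurable => n.
  by apply: mK; [exact: exhaust_sub|exact: exhaust_compact].
have -> : D `&` hsq a b l = \bigcup_n \bigcup_m (exhaust D n `&` csq a b (l - l / m.+1%:R)).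
  rewrite -{1}(exhaust_bigcup oD) hsq_bigcup//; apply/seteqP; split => z.
    by move=> [[n _ Dz] [m _ Cz]]; exists n => //; exists m.
  by move=> [n _ [m _ [Dz Cz]]]; split; [exists n|exists m].
rewrite image_bigcup; apply: bigcupT_measurable => n.
rewrite image_bigcup; apply: bigcupT_measurable => m.
apply: mK; first by move=> z [/exhaust_sub].
apply: compact_closedI; first exact: exhaust_compact.
by apply: compact_closed => //; exact: csq_compact.
Qed.

Lemma sdiff_continuous (f : R * R -> R) z a b : sdiff f z a b -> {for z, continuous f}.
Proof.
move=> fd; apply/cvgrPdist_lt => e e0.
have [d d0 dP] := fd 1 ltr01.
pose M := `|a| + `|b| + 2.
have M0 : 0 < M by rewrite ltr_wpDl// addr_ge0.
have r0 : 0 < Num.min d (e / M) by rewrite lt_min d0 divr_gt0.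
suff : nbhs z [set w | `|f z - f w| < e] by [].
apply/nbhs_ballP; exists (Num.min d (e / M)) => //= w [/=].
rewrite /ball/= distrC lt_min => /andP[w1 w1'] ; rewrite distrC lt_min => /andP[w2 w2'].
have := dP w w1 w2; rewrite mul1r => h.
rewrite distrC -[f w - f z](subrK (a * (w.1 - z.1) + b * (w.2 - z.2))).
apply: (le_lt_trans (ler_normD _ _)).
have h2 : `|a * (w.1 - z.1) + b * (w.2 - z.2)| <= `|a| * `|w.1 - z.1| + `|b| * `|w.2 - z.2|.
  by rewrite (le_trans (ler_normD _ _))// !normrM.
have k1 : `|a| * `|w.1 - z.1| <= `|a| * (e / M) by apply: ler_wpM2l => //; exact: ltW.
have k2 : `|b| * `|w.2 - z.2| <= `|b| * (e / M) by apply: ler_wpM2l => //; exact: ltW.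
have : e = (`|a| + `|b| + 2) * (e / M) by rewrite -/M mulrC divfK// gt_eqF.
rewrite !mulrDl => {1}->; lra.
Qed.

(** The compact case, applied to an exhaustion of O. *)
Lemma area_open_le (O : set (R * R)) (F : R * R -> R * R) (dens : R * R -> R) :
  open O -> (forall z, O z -> {for z, continuous F}) ->
  (forall z, O z -> {for z, continuous dens}) -> (forall z, O z -> 0 <= dens z) ->
  (forall z0 (e : R), O z0 -> 0 < e -> exists2 dl : R, 0 < dl &
    forall a b l : R, 0 < l < dl -> a <= z0.1 <= a + l -> b <= z0.2 <= b + l ->
    exists M : set (R * R), [/\ measurable M, (forall z, csq a b l z -> M (F z)) &
       (mu M <= ((dens z0 + e) * l ^+ 2)%:E)%E]) ->
  (mu (F @` O) <= \int[mu]_(z in O) (dens z)%:E)%E.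
Proof.
move=> oO cF cdens dens0 loc.
have cFE n : {within exhaust O n, continuous F}.
  by apply: continuous_in_subspaceT => z; rewrite inE => /exhaust_sub /cF.
have mFE n : measurable (F @` exhaust O n).
  by apply: compact_measurable2; apply: continuous_compact => //; exact: exhaust_compact.
have le n : (mu (F @` exhaust O n) <= \int[mu]_(z in O) (dens z)%:E)%E.
  apply: area_image_le => //; [exact: exhaust_sub|exact: exhaust_compact|].
  by move=> z0 e /exhaust_sub; exact: loc.
have cv : mu (F @` exhaust O n) @[n --> \oo] --> mu (\bigcup_n F @` exhaust O n).
  apply: nondecreasing_cvg_mu => //; first exact: bigcupT_measurable.
  move=> m n mn; apply/subsetPset; apply: image_subset.
  by apply/subsetPset; exact: exhaust_nd.
rewrite -image_bigcup exhaust_bigcup// in cv.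
by apply: (cvge_to_le cv); apply: nearW => k.
Qed.

(** Injectivity makes the measure of the images of disjoint squares additive; the local lower bound at
    points where the Jacobian vanishes is trivial, so that the bisection applies on compact subsets. *)
Lemma area_open_ge (D : set (R * R)) (f g : R * R -> R) (dens : R * R -> R) :
  open D -> (forall z w, D z -> D w -> f z = f w -> g z = g w -> z = w) ->
  (forall z, D z -> {for z, continuous dens}) -> (forall z, D z -> 0 <= dens z) ->
  (forall z, D z -> exists a b c d, [/\ sdiff f z a b, sdiff g z c d &
     dens z = `|a * d - b * c|]) ->
  (\int[mu]_(z in D) (dens z)%:E <= mu ((fun z => (f z, g z)) @` D))%E.
Proof.
move=> oD inj cdens dens0 dfg; set F := fun z => (f z, g z).
have cf z : D z -> {for z, continuous f}.
  by move=> /dfg[a [b [c [d [h _ _]]]]]; exact: sdiff_continuous h.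
have cg z : D z -> {for z, continuous g}.
  by move=> /dfg[a [b [c [d [_ h _]]]]]; exact: sdiff_continuous h.
have cF z : D z -> {for z, continuous F}.
  by move=> Dz; apply: cont_pair; [exact: cf|exact: cg].
have mD : measurable D by exact: open_measurable2.
suff le n : (\int[mu]_(z in exhaust D n) (dens z)%:E <= mu (F @` D))%E.
  have mE n : measurable (exhaust D n) by apply: compact_measurable2; exact: exhaust_compact.
  have cv : (\int[mu]_(z in exhaust D n) (dens z)%:E)%E @[n --> \oo] -->
      (\int[mu]_(z in \bigcup_n exhaust D n) (dens z)%:E)%E.
    apply: ge0_nondecreasing_set_cvg_integral => //.
    - exact: exhaust_nd.
    - by move=> n; apply: (dens_measurable oD cdens) => //; exact: exhaust_sub.
    - by move=> n z /exhaust_sub Dz; rewrite lee_fin dens0.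
  rewrite exhaust_bigcup// in cv.
  by apply: (cvge_to_le cv); apply: nearW => k.
set K := exhaust D n.
have cK : compact K by exact: exhaust_compact.
have KD : K `<=` D by exact: exhaust_sub.
have mK : measurable K by exact: compact_measurable2.
have mKh (a b l : R) : measurable (K `&` hsq a b l).
  by apply: measurableI => //; exact: hsq_measurable.
have KhD a b l : K `&` hsq a b l `<=` D by move=> z [/KD].
pose m1 a b l := (\int[mu]_(z in K `&` hsq a b l) (dens z)%:E)%E.
pose m2 a b l := mu (F @` (D `&` hsq a b l)).
have mI (a b l : R) : 0 < l -> measurable (F @` (D `&` hsq a b l)).
  by move=> l0; have [] := image_open_measurable a b oD cF l0.
have sub1 : subadd4 m1.
  move=> a b l l0; rewrite /m1.
  have UD (A B : set (R * R)) : A `<=` D -> B `<=` D -> A `|` B `<=` D by move=> AD BD z [/AD|/BD].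
  have mU (x y x' y' : R) : measurable ((K `&` hsq x y l) `|` (K `&` hsq x' y' l)).
    by apply: measurableU; exact: mKh.
  apply: (le_trans (integral_subadd oD cdens dens0 (mU a b (a + l) b)
     (mU a (b + l) (a + l) (b + l)) (mKh a b (l *+ 2)) _ _ _)).
  - by apply: UD; exact: KhD.
  - by apply: UD; exact: KhD.
  - move=> z [Kz [/andP[z1 z1'] /andP[z2 z2']]].
    rewrite mulr2n in z1' z2'.
    have [h1|h1] := ltP z.1 (a + l); have [h2|h2] := ltP z.2 (b + l).
    - by left; left; do 2?split => //; apply/andP.
    - by right; left; do 2?split => //; apply/andP; split => //; rewrite -addrA.
    - by left; right; do 2?split => //; apply/andP; split => //; rewrite -addrA.
    - by right; right; do 2?split => //; apply/andP; split => //; rewrite -addrA.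
  by apply: leeD; apply: (integral_subadd oD cdens dens0) => //; exact: KhD.
have sup2 : superadd4 m2.
  move=> a b l l0; rewrite /m2.
  have Finj : {in D &, injective F}.
    by move=> z w; rewrite !inE => Dz Dw [e1 e2]; exact: inj.
  have dis (A B : set (R * R)) : A `<=` D -> B `<=` D -> A `&` B = set0 -> F @` A `&` F @` B = set0.
    move=> AD BD AB; apply/seteqP; split => // _ [[z Az <-] [w Bw Fwz]].
    have E : w = z by apply: Finj; rewrite ?inE; [exact: BD|exact: AD|].
    have : (A `&` B) z by split => //; rewrite -E.
    by rewrite AB.
  have sD (x y : R) : D `&` hsq x y l `<=` D by exact: subIsetl.
  have e1 : F @` (D `&` hsq a b l) `&` F @` (D `&` hsq (a + l) b l) = set0.
    apply: dis => //.
    by apply/seteqP; split => // z [[_ [/andP[? ?] _]] [_ [/andP[? ?] _]]]; lra.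
  have e2 : F @` (D `&` hsq a (b + l) l) `&` F @` (D `&` hsq (a + l) (b + l) l) = set0.
    apply: dis => //.
    by apply/seteqP; split => // z [[_ [/andP[? ?] _]] [_ [/andP[? ?] _]]]; lra.
  have e3 : (F @` (D `&` hsq a b l) `|` F @` (D `&` hsq (a + l) b l)) `&`
     (F @` (D `&` hsq a (b + l) l) `|` F @` (D `&` hsq (a + l) (b + l) l)) = set0.
    rewrite -!image_setU; apply: dis.
    - by move=> z [[]|[]].
    - by move=> z [[]|[]].
    apply/seteqP; split => // z [h h'].
    have k1 : z.2 < b + l by case: h => -[_ [_ /andP[]]].
    have k2 : b + l <= z.2 by case: h' => -[_ [_ /andP[]]].
    by rewrite ltNge k2 in k1.
  have l2 : 0 < l *+ 2 by rewrite mulrn_wgt0.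
  rewrite -!measureU//; try (by apply: measurableU; exact: mI); try exact: mI.
  apply: le_measure; rewrite ?inE.
  - by apply: measurableU; apply: measurableU; exact: mI.
  - exact: mI.
  rewrite -!image_setU; apply: image_subset => z.
  move=> [[]|[]] [Dz [/andP[? ?] /andP[? ?]]]; split => //; split; rewrite mulr2n; apply/andP; split; lra.
have main (e a b l : R) : 0 < e -> 0 < l -> (m1 a b l <= m2 a b l + (e * l ^+ 2)%:E)%E.
  apply: bisection_le => // z0 {}e e0.
  have [Kz|nKz] := pselect (K z0); last first.
    have : nbhs z0 (~` K).
      apply: open_nbhs_nbhs; split => //; apply: closed_openC.
      exact: compact_closed.
    move=> /sq_near[dl dl0 dlP]; exists dl => // {}a {}b {}l h h1 h2.
    rewrite /m1 (_ : K `&` hsq a b l = set0); last first.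
      by apply/seteqP; split => // z [Kz /hsq_csq /(dlP _ _ _ h h1 h2)].
    rewrite integral_set0 adde_ge0//.
    by rewrite lee_fin mulr_ge0 ?sqr_ge0// ltW.
  have e2 : 0 < e / 2 by rewrite divr_gt0.
  have Dz0 := KD _ Kz.
  have [a0 [b0 [c0 [d0 [fd gd dE]]]]] := dfg _ Dz0.
  have [d2 d20 d2P] := integral_hsq_bounds oD cdens dens0 Dz0 e2.
  have m1le (a' b' l' : R) : csq a' b' l' `<=` D ->
     (m1 a' b' l' <= \int[mu]_(z in hsq a' b' l') (dens z)%:E)%E.
    move=> cD; have hD := subset_trans (@hsq_csq R a' b' l') cD.
    apply: ge0_subset_integral => //.
    - exact: mKh.
    - exact: hsq_measurable.
    - by apply: (dens_measurable oD cdens) => //; exact: hsq_measurable.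
    - by move=> z /hD Dz; rewrite lee_fin dens0.
  have [D0|D0] := eqVneq (a0 * d0 - b0 * c0) 0.
    exists d2 => // {}a {}b {}l h h1 h2; have [cD _ i2] := d2P _ _ _ h h1 h2.
    apply: (le_trans (m1le _ _ _ cD)); apply: (le_trans i2).
    rewrite dE D0 normr0 add0r -[X in (X <= _)%E]add0e; apply: leeD => //.
    by rewrite lee_fin; apply: ler_wpM2r; [exact: sqr_ge0|lra].
  have [d1 d10 d1P] := lower_cover fd gd D0 e2.
  exists (Num.min d1 d2); first by rewrite lt_min d10.
  move=> {}a {}b {}l /andP[l0]; rewrite lt_min => /andP[l1 l2] h1 h2.
  have ll1 : 0 < l < d1 by rewrite l0.
  have ll2 : 0 < l < d2 by rewrite l0.
  have [cD _ i2] := d2P _ _ _ ll2 h1 h2.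
  have [M [mM MF muM]] := d1P _ _ _ ll1 h1 h2 (fun z cz => conj (cf _ (cD _ cz)) (cg _ (cD _ cz))).
  apply: (le_trans (m1le _ _ _ cD)); apply: (le_trans i2).
  apply: (@le_trans _ _ (mu M + (e * l ^+ 2)%:E)%E).
    apply: (@le_trans _ _ (((`|a0 * d0 - b0 * c0| - e / 2) * l ^+ 2)%:E + (e * l ^+ 2)%:E)%E).
      by rewrite -EFinD lee_fin -mulrDl dE; apply: ler_wpM2r; [exact: sqr_ge0|lra].
    exact: leeD2r.
  apply: leeD2r; apply: le_measure; rewrite ?inE//; first exact: mI.
  move=> Z /MF[z hz ->]; exists z => //; split => //; apply: cD; exact: hsq_csq.
have [r [r0 Kr]] : exists r : R, 0 < r /\ forall z, K z -> `|z| < r.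
  have [r [_ rP]] := compact_bounded cK.
  exists (Num.max r 0 + 2); split; first by rewrite ltr_wpDl// le_max lexx orbT.
  move=> z Kz; apply: (@le_lt_trans _ _ (Num.max r 0 + 1)); last by rewrite ltrD2l ltr1n.
  by apply: rP => //; rewrite ltr_pwDr// le_max lexx.
have KE : K = K `&` hsq (- r) (- r) (r + r).
  apply/seteqP; split => z; last by case.
  move=> Kz; split => //; have := Kr _ Kz; rewrite prod_normE gt_max => /andP[].
  by rewrite !ltr_norml => /andP[? ?] /andP[? ?]; split; apply/andP; split; lra.
rewrite KE; apply/lee_addgt0Pr => e e0.
have rr : 0 < r + r by rewrite addr_gt0.
have e1 : 0 < e / (r + r) ^+ 2 by rewrite divr_gt0// exprn_gt0.
have := main _ (- r) (- r) _ e1 rr; rewrite divfK; last by rewrite gt_eqF// exprn_gt0.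
move=> /le_trans; apply; apply: leeD2r.
apply: le_measure; rewrite ?inE.
- exact: mI.
- by have [] := image_open_measurable 0 0 oD cF ltr01.
- by apply: image_subset; exact: subIsetl.
Qed.

End open_area.

(** * Differentials of functions of two variables *)

Section sdiff_calculus.
Context {R : realType}.
Implicit Types (f g : R * R -> R) (z : R * R).

Lemma sdiff_ext f g z a b : (\forall w \near z, f w = g w) -> f z = g z ->
  sdiff f z a b -> sdiff g z a b.
Proof.
move=> fg fgz fd eta e0; have [d d0 dP] := fd _ e0.
have [e /= e1 eP] := (iffLR (nbhs_ballP _ _)) fg.
exists (Num.min d e); first by rewrite lt_min d0.
move=> w; rewrite !lt_min => /andP[w1 w1'] /andP[w2 w2'].
have fgw : f w = g w by apply: eP; split; rewrite /ball/= distrC.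
by rewrite -fgw -fgz; exact: dP.
Qed.

Lemma sdiff_eqfun f g z a b : f =1 g -> sdiff f z a b -> sdiff g z a b.
Proof. by move=> /funext ->. Qed.

Lemma sdiff_fst z : sdiff fst z 1 0.
Proof.
move=> eta e0; exists 1 => // w _ _.
by rewrite mul1r mul0r addr0 subrr normr0 mulr_ge0 ?(ltW e0)// addr_ge0.
Qed.

Lemma sdiff_snd z : sdiff snd z 0 1.
Proof.
move=> eta e0; exists 1 => // w _ _.
by rewrite mul1r mul0r add0r subrr normr0 mulr_ge0 ?(ltW e0)// addr_ge0.
Qed.

Lemma sdiff_cst (c : R) z : sdiff (fun _ => c) z 0 0.
Proof.
move=> eta e0; exists 1 => // w _ _.
by rewrite !mul0r addr0 subrr subr0 normr0 mulr_ge0 ?(ltW e0)// addr_ge0.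
Qed.

Lemma sdiffD f g z a b a' b' : sdiff f z a b -> sdiff g z a' b' ->
  sdiff (fun w => f w + g w) z (a + a') (b + b').
Proof.
move=> fd gd eta e0; have e2 : 0 < eta / 2 by rewrite divr_gt0.
have [d d0 dP] := fd _ e2; have [d' d0' dP'] := gd _ e2.
exists (Num.min d d'); first by rewrite lt_min d0.
move=> w; rewrite !lt_min => /andP[w1 w1'] /andP[w2 w2'].
have -> : f w + g w - (f z + g z) - ((a + a') * (w.1 - z.1) + (b + b') * (w.2 - z.2)) =
   (f w - f z - (a * (w.1 - z.1) + b * (w.2 - z.2))) +
   (g w - g z - (a' * (w.1 - z.1) + b' * (w.2 - z.2))) by ring.
rewrite (le_trans (ler_normD _ _))// [in leRHS](splitr eta) mulrDl.
by apply: lerD; [exact: dP|exact: dP'].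
Qed.

Lemma sdiff_comp (phi : R -> R) (l : R) f z a b : is_derive (f z) (1 : R) phi l ->
  sdiff f z a b -> sdiff (fun w => phi (f w)) z (l * a) (l * b).
Proof.
move=> dphi fd eta e0.
have cf := sdiff_continuous fd.
pose M := `|a| + `|b| + 1.
have M0 : 0 < M by rewrite ltr_wpDl// addr_ge0.
have l0 : 0 < `|l| + 1 by rewrite ltr_wpDl.
have h0 : 0 < eta / (2 * M) by rewrite divr_gt0// mulr_gt0.
have k0 : 0 < Num.min 1 (eta / (2 * (`|l| + 1))) by rewrite lt_min ltr01 divr_gt0// mulr_gt0.
have [d d0 dP] := fd _ k0.
(* difference quotient form of is_derive *)
have [r r0 rP] : exists2 r : R, 0 < r & forall y, `|y - f z| < r ->
    `|phi y - phi (f z) - l * (y - f z)| <= eta / (2 * M) * `|y - f z|.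
  have /is_derive1_caratheodory[G [GE cG GfE]] := dphi.
  have : nbhs (f z) [set y | `|G (f z) - G y| < eta / (2 * M)].
    by move/cvgrPdist_lt : cG => /(_ _ h0).
  move=> /nbhs_ballP[r /= r0 rP]; exists r => // y yr.
  rewrite GE -GfE -mulrBl normrM ler_wpM2r// distrC; apply: ltW; apply: rP.
  by rewrite /ball/= distrC.
have : nbhs z [set w | `|f z - f w| < r] by move/cvgrPdist_lt : cf => /(_ _ r0).
move=> /nbhs_ballP[s /= s0 sP].
exists (Num.min d s); first by rewrite lt_min d0.
move=> w; rewrite !lt_min => /andP[w1 w1'] /andP[w2 w2'].
have fw : `|f w - f z| < r by rewrite distrC; apply: sP; split; rewrite /ball/= distrC.
have H1 := dP w w1 w2; have H2 := rP _ fw.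
set x := w.1 - z.1 in H1 *; set y := w.2 - z.2 in H1 *.
have fwz : `|f w - f z| <= M * (`|x| + `|y|).
  rewrite -[f w - f z](subrK (a * x + b * y)) (le_trans (ler_normD _ _))//.
  have e1 : `|a * x + b * y| <= `|a| * `|x| + `|b| * `|y|.
    by rewrite (le_trans (ler_normD _ _))// !normrM.
  have e2 : `|f w - f z - (a * x + b * y)| <= `|x| + `|y|.
    apply: (le_trans H1); rewrite ler_piMl ?addr_ge0// ge_min lexx//.
  have e3 : 0 <= `|a| * `|y| + `|b| * `|x| by rewrite addr_ge0// mulr_ge0.
  by rewrite /M; move: `|a| `|b| `|x| `|y| e1 e2 e3 => A B X Y e1 e2 e3; lra.
have -> : phi (f w) - phi (f z) - (l * a * x + l * b * y) =
   (phi (f w) - phi (f z) - l * (f w - f z)) + l * (f w - f z - (a * x + b * y)) by ring.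
rewrite (le_trans (ler_normD _ _))// [in leRHS](splitr eta) mulrDl; apply: lerD.
  apply: (le_trans H2).
  have -> : eta / 2 * (`|x| + `|y|) = eta / (2 * M) * (M * (`|x| + `|y|)).
    by field; rewrite gt_eqF.
  by apply: ler_wpM2l => //; exact: ltW.
rewrite normrM.
apply: (@le_trans _ _ ((`|l| + 1) * (eta / (2 * (`|l| + 1)) * (`|x| + `|y|)))); last first.
  by rewrite le_eqVlt; apply/orP; left; apply/eqP; field; rewrite gt_eqF.
apply: ler_pM => //; first by rewrite lerDl.
by apply: (le_trans H1); apply: ler_wpM2r; rewrite ?addr_ge0// ge_min lexx orbT.
Qed.

Lemma sdiffZ (c : R) f z a b : sdiff f z a b -> sdiff (fun w => c * f w) z (c * a) (c * b).
Proof.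
apply: (@sdiff_comp (fun x => c * x)).
by apply: is_derive_eq; rewrite /GRing.scale/= ?mulr0 ?addr0 ?add0r mulr1.
Qed.

Lemma sdiffN f z a b : sdiff f z a b -> sdiff (fun w => - f w) z (- a) (- b).
Proof.
move=> /(sdiffZ (-1)); rewrite !mulN1r; apply: sdiff_eqfun => w; exact: mulN1r.
Qed.

Lemma sdiffB f g z a b a' b' : sdiff f z a b -> sdiff g z a' b' ->
  sdiff (fun w => f w - g w) z (a - a') (b - b').
Proof. by move=> fd gd; apply: sdiffD => //; exact: sdiffN. Qed.

Lemma sdiff_sqr f z a b : sdiff f z a b ->
  sdiff (fun w => f w ^+ 2) z (2 * f z * a) (2 * f z * b).
Proof.
apply: (@sdiff_comp (fun x => x ^+ 2)).
by apply: is_derive_eq; rewrite /GRing.scale/=; ring.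
Qed.

Lemma sdiff_eq f z a b a' b' : sdiff f z a b -> a = a' -> b = b' -> sdiff f z a' b'.
Proof. by move=> + <- <-. Qed.

Lemma sdiffM f g z a b a' b' : sdiff f z a b -> sdiff g z a' b' ->
  sdiff (fun w => f w * g w) z (a * g z + f z * a') (b * g z + f z * b').
Proof.
move=> fd gd.
have := sdiffZ (1 / 4) (sdiffB (sdiff_sqr (sdiffD fd gd)) (sdiff_sqr (sdiffB fd gd))).
move=> /sdiff_eq h; have {}h := h (a * g z + f z * a') (b * g z + f z * b').
by apply: sdiff_eqfun (h _ _) => [w||]; field.
Qed.

Lemma sdiffV f z a b : f z != 0 -> sdiff f z a b ->
  sdiff (fun w => (f w)^-1) z (- a / f z ^+ 2) (- b / f z ^+ 2).
Proof.
move=> f0 fd.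
have dV : is_derive (f z) (1 : R) (fun x => x^-1) (- (f z) ^- 2).
  by apply: is_derive_eq (is_deriveV f0 (is_derive_id (f z) (1 : R))) _; rewrite /GRing.scale/= mulr1.
by apply: sdiff_eq (sdiff_comp dV fd) _ _; field.
Qed.

Lemma sdiff_div f g z a b a' b' : g z != 0 -> sdiff f z a b -> sdiff g z a' b' ->
  sdiff (fun w => f w / g w) z ((a * g z - f z * a') / g z ^+ 2) ((b * g z - f z * b') / g z ^+ 2).
Proof. by move=> g0 fd gd; apply: sdiff_eq (sdiffM fd (sdiffV g0 gd)) _ _; field. Qed.

Lemma sdiff_unique f z a b a' b' : sdiff f z a b -> sdiff f z a' b' -> a = a' /\ b = b'.
Proof.
move=> h1 h2; have := sdiffB h1 h2.
move: (a - a') (b - b') (subr_eq0 a a') (subr_eq0 b b') => u v u0 v0 h.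
have {}h : sdiff (fun=> 0) z u v by apply: sdiff_eqfun h => w; rewrite subrr.
have small (e : R) : 0 < e -> `|u| <= e /\ `|v| <= e.
  move=> e0; have [d d0 dP] := h _ e0.
  have d2 : 0 < d / 2 by rewrite divr_gt0.
  have dd : d / 2 < d by lra.
  have e1 (x : R) : x + d / 2 - x = d / 2 by ring.
  split.
    have := dP (z.1 + d / 2, z.2); rewrite /= e1 !subrr normr0 (gtr0_norm d2) mulr0 !addr0 sub0r.
    by rewrite normrN normrM (gtr0_norm d2) ler_pM2r//; apply.
  have := dP (z.1, z.2 + d / 2); rewrite /= e1 !subrr normr0 (gtr0_norm d2) mulr0 !add0r.
  by rewrite normrN normrM (gtr0_norm d2) ler_pM2r//; apply.
have z0 (x : R) : (forall e, 0 < e -> `|x| <= e) -> x = 0.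
  move=> hx; apply/eqP; rewrite -normr_le0; apply/ler_addgt0Pr => e e0.
  by rewrite add0r; exact: hx.
split; apply/eqP; [rewrite -u0|rewrite -v0]; apply/eqP; apply: z0 => e /small[]//.
Qed.

Lemma mean_value (phi dphi : R -> R) (x y : R) :
  (forall t, `|t - x| <= `|y - x| -> is_derive t (1 : R) phi (dphi t)) ->
  exists2 c, `|c - x| <= `|y - x| & phi y - phi x = dphi c * (y - x).
Proof.
move=> der.
have cont (I : interval R) : (forall t, t \in I -> `|t - x| <= `|y - x|) -> {within [set` I], continuous phi}.
  move=> hI; apply: derivable_within_continuous => t /hI/der h; exact: ex_derive.
have [xy|yx] := leP x y.
  have hI t : t \in `[x, y] -> `|t - x| <= `|y - x|.
    by rewrite in_itv/= => /andP[? ?]; rewrite !ger0_norm; lra.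
  have [|c /hI cx ->] := @MVT_segment R phi dphi x y xy _ (cont _ hI); last by exists c.
  by move=> t ht; apply: der; apply: hI; exact: subset_itv_oo_cc.
have hI t : t \in `[y, x] -> `|t - x| <= `|y - x|.
  by rewrite in_itv/= => /andP[? ?]; rewrite !ler0_norm; lra.
have [|c /hI cx E] := @MVT_segment R phi dphi y x (ltW yx) _ (cont _ hI); last first.
  by exists c => //; rewrite -[LHS]opprB E; ring.
by move=> t ht; apply: der; apply: hI; exact: subset_itv_oo_cc.
Qed.

Lemma is_derive_line1 f (x y : R) : derivable f (x, y) (1, 0) ->
  is_derive x (1 : R) (fun t => f (t, y)) ('D_(1, 0) f (x, y)).
Proof.
have E : (fun h : R => h^-1 *: (f (h *: (1, 0) + (x, y)) - f (x, y))) =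
    (fun h : R => h^-1 *: (((fun t => f (t, y)) \o shift x) (h *: (1 : R)) - f (x, y))).
  apply/funext => h; congr (_ *: (f _ - _)).
  by congr pair; rewrite /=/GRing.scale/= ?mulr0 ?add0r.
by move=> df; split; [move: df; rewrite /derivable E|rewrite /derive /= E].
Qed.

Lemma is_derive_line2 f (x y : R) : derivable f (x, y) (0, 1) ->
  is_derive y (1 : R) (fun t => f (x, t)) ('D_(0, 1) f (x, y)).
Proof.
have E : (fun h : R => h^-1 *: (f (h *: (0, 1) + (x, y)) - f (x, y))) =
    (fun h : R => h^-1 *: (((fun t => f (x, t)) \o shift y) (h *: (1 : R)) - f (x, y))).
  apply/funext => h; congr (_ *: (f _ - _)).
  by congr pair; rewrite /=/GRing.scale/= ?mulr0 ?add0r.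
by move=> df; split; [move: df; rewrite /derivable E|rewrite /derive /= E].
Qed.

(** The mean value theorem along the two sides of a coordinate rectangle. *)
Lemma C1_sdiff f (O : set (R * R)) z : open O -> O z ->
  (forall w, O w -> derivable f w (1, 0) /\ derivable f w (0, 1)) ->
  {for z, continuous ('D_(1, 0) f)} -> {for z, continuous ('D_(0, 1) f)} ->
  sdiff f z ('D_(1, 0) f z) ('D_(0, 1) f z).
Proof.
move=> oO Oz df c1 c2 eta e0.
have /nbhs_ballP[r /= r0 rO] : nbhs z O by exact: open_nbhs_nbhs.
have : nbhs z [set w | `|'D_(1, 0) f z - 'D_(1, 0) f w| < eta].
  by move/cvgrPdist_lt : c1 => /(_ _ e0).
move=> /nbhs_ballP[s /= s0 sP].
have : nbhs z [set w | `|'D_(0, 1) f z - 'D_(0, 1) f w| < eta].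
  by move/cvgrPdist_lt : c2 => /(_ _ e0).
move=> /nbhs_ballP[t /= t0 tP].
exists (Num.min r (Num.min s t)); first by rewrite !lt_min r0 s0.
move=> [x y]; rewrite !lt_min /= => /and3P[x1 x2 x3] /and3P[y1 y2 y3].
move: z Oz rO sP tP x1 x2 x3 y1 y2 y3 {c1 c2} => [x0 y0] /= Oz rO sP tP x1 x2 x3 y1 y2 y3.
have [u ux uE] : exists2 c, `|c - x0| <= `|x - x0| &
    f (x, y) - f (x0, y) = 'D_(1, 0) f (c, y) * (x - x0).
  apply: (@mean_value (fun t => f (t, y)) (fun t => 'D_(1, 0) f (t, y))) => c cx.
  have Oc : O (c, y) by apply: rO; split; rewrite /ball/= distrC//; exact: le_lt_trans x1.
  by have [h1 _] := df _ Oc; exact: (is_derive_line1 h1).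
have [v vy vE] : exists2 c, `|c - y0| <= `|y - y0| &
    f (x0, y) - f (x0, y0) = 'D_(0, 1) f (x0, c) * (y - y0).
  apply: (@mean_value (fun t => f (x0, t)) (fun t => 'D_(0, 1) f (x0, t))) => c cy.
  have Oc : O (x0, c).
    apply: rO; split; rewrite /ball/=; first by rewrite subrr normr0.
    by rewrite distrC; exact: le_lt_trans y1.
  by have [_ h2] := df _ Oc; exact: (is_derive_line2 h2).
have -> : f (x, y) - f (x0, y0) -
    ('D_(1, 0) f (x0, y0) * (x - x0) + 'D_(0, 1) f (x0, y0) * (y - y0)) =
   ('D_(1, 0) f (u, y) - 'D_(1, 0) f (x0, y0)) * (x - x0) +
   ('D_(0, 1) f (x0, v) - 'D_(0, 1) f (x0, y0)) * (y - y0).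
  by rewrite !mulrBl -uE -vE; ring.
rewrite (le_trans (ler_normD _ _))// !normrM mulrDr; apply: lerD; apply: ler_wpM2r => //.
  rewrite distrC; apply: ltW; apply: sP; split; rewrite /ball/= distrC//.
  exact: le_lt_trans x2.
rewrite distrC; apply: ltW; apply: tP; split; rewrite /ball/=; first by rewrite subrr normr0.
by rewrite distrC; exact: le_lt_trans y3.
Qed.

End sdiff_calculus.

(** * Primitives *)

Section primitives.
Context {R : realType}.
Implicit Types (k K : R -> R).

Lemma eq_derive_eq (f g df : R -> R) (a b : R) :
  (forall t, `|t - a| <= `|b - a| -> is_derive t (1 : R) f (df t)) ->
  (forall t, `|t - a| <= `|b - a| -> is_derive t (1 : R) g (df t)) ->
  f b - f a = g b - g a.
Proof.
move=> hf hg.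
have [|c _] := @mean_value R (fun t => f t - g t) (fun=> 0) a b.
  move=> t ht; apply: is_derive_eq (is_deriveB (hf t ht) (hg t ht)) _.
  by rewrite subrr.
rewrite mul0r => /eqP; rewrite subr_eq0 => /eqP E; lra.
Qed.

Lemma derive_cont k (dk : R -> R) x : is_derive x (1 : R) k (dk x) -> {for x, continuous k}.
Proof.
move=> dkx; apply: differentiable_continuous.
by apply/derivable1_diffP; exact: (@ex_derive _ _ _ _ _ _ _ dkx).
Qed.

(** Primitives on half lines starting below b, normalised at b, agree where both are defined. *)
Lemma primitive_exists k (b : R) : continuous k ->
  exists2 K, K b = 0 & forall x, is_derive x (1 : R) K (k x).
Proof.
move=> ck.
pose G (n : nat) x : R := (\int[lebesgue_measure]_(t in `[(b - n.+1%:R)%R, x]) k t)%R.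
have dG n x : b - n.+1%:R < x -> is_derive x (1 : R) (G n) (k x).
  move=> nx; have xx1 : x < x + 1 by rewrite ltrDl.
  have int : (@lebesgue_measure R).-integrable `[b - n.+1%:R, x + 1] (EFin \o k).
    by apply: continuous_compact_integrable; [exact: segment_compact|exact: continuous_subspaceT].
  have [dd de] := continuous_FTC1_closed xx1 int nx (ck x).
  by split; [exact: dd|rewrite -derive1E; exact: de].
pose H n x := G n x - G n b.
have dH n x : b - n.+1%:R < x -> is_derive x (1 : R) (H n) (k x).
  move=> nx; rewrite -[k x]subr0; apply: is_deriveB; exact: dG.
pose N (x : R) := Num.truncn `|x - b|.
have NP x y : `|y - b| <= `|x - b| -> b - (N x).+1%:R < y.
  move=> yx; have := le_lt_trans yx (truncnS_gt _); rewrite ltr_norml => /andP[+ _].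
  by rewrite /N; lra.
have H0 n : H n b = 0 by rewrite /H subrr.
have HE n m x : b - n.+1%:R < x -> b - m.+1%:R < x -> H n x = H m x.
  move=> nx mx; have [xb|bx] := leP x b.
    have hx t : `|t - b| <= `|x - b| -> x <= t.
      by rewrite (ler0_norm (_ : x - b <= 0)) ?subr_le0// ler_norml => /andP[]; lra.
    have := @eq_derive_eq (H n) (H m) k b x; rewrite !H0 !subr0; apply.
      by move=> t /hx xt; apply: dH; exact: lt_le_trans xt.
    by move=> t /hx xt; apply: dH; exact: lt_le_trans xt.
  have [|c _] := @mean_value R (fun t => H n t - H m t) (fun=> 0) x b.
    move=> t ht; have bt : b <= t.
      by move: ht; rewrite (ltr0_norm (_ : b - x < 0)) ?subr_lt0// ler_norml => /andP[]; lra.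
    have lt (i : nat) : b - i.+1%:R < t by rewrite ltrBlDr (le_lt_trans bt)// ltrDl ltr0n.
    by apply: is_derive_eq (is_deriveB (dH _ _ (lt n)) (dH _ _ (lt m))) _; rewrite subrr.
  by rewrite mul0r !H0; lra.
exists (fun x => H (N x) x); first exact: H0.
move=> x.
apply: (near_eq_is_derive _ (dH (N x).+1 x _)).
- near=> y; apply: HE; last exact: NP.
  have : `|y - x| < 1.
    rewrite distrC; near: y; exact: (nbhsx_ballx x 1 ltr01).
  have := NP x x (lexx _); rewrite -(natr1 (N x).+1) ltr_norml => h /andP[]; lra.
- have := NP x x (lexx _); rewrite -(natr1 (N x).+1); lra.
Unshelve. all: by end_near. Qed.

End primitives.

(** * The profile geodesic *)

Section profile.
Context {R : realType}.

Lemma mvt_itv (phi dphi : R -> R) (a b : R) : a <= b ->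
  (forall t, a <= t <= b -> is_derive t (1 : R) phi (dphi t)) ->
  exists2 c, a <= c <= b & phi b - phi a = dphi c * (b - a).
Proof.
move=> ab der.
have [||c] := @MVT_segment R phi dphi a b ab.
- by move=> t ht; apply: der; have := subset_itv_oo_cc ht; rewrite in_itv.
- apply: derivable_within_continuous => t; rewrite in_itv/= => /der h; exact: ex_derive.
- by rewrite in_itv/= => cab E; exists c.
Qed.

Lemma derive_le (f g df dg : R -> R) (a b : R) : a <= b ->
  (forall t, a <= t <= b -> is_derive t (1 : R) f (df t)) ->
  (forall t, a <= t <= b -> is_derive t (1 : R) g (dg t)) ->
  (forall t, a <= t <= b -> df t <= dg t) ->
  f b - f a <= g b - g a.
Proof.
move=> ab hf hg le.
have [|c cab] := @mvt_itv (fun t => g t - f t) (fun t => dg t - df t) a b ab.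
  by move=> t ht; apply: is_deriveB; [exact: hg|exact: hf].
have : 0 <= (dg c - df c) * (b - a) by rewrite mulr_ge0 ?subr_ge0// le.
by move=> h E; rewrite -E in h; lra.
Qed.

Definition xw (w : R) : R := 12 + w ^+ 2.
(** The rate of the profile angle when the radius is x = 12 + w^2.  Clairaut's relation for the orbit
    metric, with constant S(12) = 156, gives the angle as an integral in x with an inverse square root
    singularity at x = 12, which the variable w resolves. *)
Definition kw (mu w : R) : R := Num.sqrt 156 * Num.sqrt (1 + mu * xw w) /
  (xw w * (1 + xw w) * Num.sqrt (w ^+ 2 + 25)).

Lemma xw_ge12 w : 12 <= xw w.
Proof. by rewrite lerDl sqr_ge0. Qed.

Lemma xw_gt0 w : 0 < xw w.
Proof. by rewrite (lt_le_trans _ (xw_ge12 w)). Qed.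

Lemma sqrt25_ge5 (w : R) : 5 <= Num.sqrt (w ^+ 2 + 25).
Proof.
rewrite -[X in X <= _](@ger0_norm _ 5)// -sqrtr_sqr ler_sqrt; last by rewrite addr_ge0 ?sqr_ge0.
by have := sqr_ge0 w; lra.
Qed.

Lemma sqrt25_gt0 (w : R) : 0 < Num.sqrt (w ^+ 2 + 25).
Proof. by rewrite (lt_le_trans _ (sqrt25_ge5 w)). Qed.

Lemma kw_den_gt0 w : 0 < xw w * (1 + xw w) * Num.sqrt (w ^+ 2 + 25).
Proof.
have h := xw_gt0 w; have h' := sqrt25_gt0 w.
by rewrite mulr_gt0// mulr_gt0// addr_gt0.
Qed.

Lemma xw_continuous : continuous xw.
Proof. by move=> w; apply: cvgD; [exact: cvg_cst|exact: exprn_continuous]. Qed.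

Lemma sqrt_comp_continuous (f : R -> R) : continuous f -> continuous (fun w => Num.sqrt (f w)).
Proof.
by move=> cf w; apply: (@cont_comp R R R f Num.sqrt); [exact: cf|exact: sqrt_continuous].
Qed.

Lemma kw_continuous mu : continuous (kw mu).
Proof.
move=> w; apply: cvgM.
  apply: cvgM; first exact: cvg_cst.
  apply: (@sqrt_comp_continuous (fun w => 1 + mu * xw w)) => {}w.
  by apply: cvgD; [exact: cvg_cst|apply: cvgM; [exact: cvg_cst|exact: xw_continuous]].
apply: cvgV; first by rewrite gt_eqF// kw_den_gt0.
apply: cvgM.
  apply: cvgM; first exact: xw_continuous.
  by apply: cvgD; [exact: cvg_cst|exact: xw_continuous].
apply: (@sqrt_comp_continuous (fun w => w ^+ 2 + 25)) => {}w.
by apply: cvgD; [exact: exprn_continuous|exact: cvg_cst].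
Qed.

Lemma kw_gt0 mu w : 0 <= mu -> 0 < kw mu w.
Proof.
move=> m0; rewrite divr_gt0 ?kw_den_gt0// mulr_gt0 ?sqrtr_gt0//.
by rewrite ltr_pwDl// mulr_ge0// ltW ?xw_gt0.
Qed.

Lemma sqrt156_le : Num.sqrt 156 <= 25 / 2 :> R.
Proof.
rewrite -[leRHS](@ger0_norm R); last by lra.
by rewrite -sqrtr_sqr ler_sqrt; lra.
Qed.

Lemma sqrt156_ge : 12 <= Num.sqrt 156 :> R.
Proof.
by rewrite -[leLHS](@ger0_norm R)// -sqrtr_sqr ler_sqrt; lra.
Qed.

Lemma sqrt_le_sq (a b : R) : 0 <= b -> a <= b ^+ 2 -> Num.sqrt a <= b.
Proof.
move=> b0 ab; rewrite -[leRHS]ger0_norm// -sqrtr_sqr ler_sqrt//; exact: sqr_ge0.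
Qed.

Lemma sqrt_ge_sq (a b : R) : 0 <= a -> b ^+ 2 <= a -> b <= Num.sqrt a.
Proof.
move=> a0 ba; rewrite (le_trans (ler_norm b))// -sqrtr_sqr ler_sqrt.
by [].
by [].
Qed.

Lemma is_derive_atan_scaled (a w : R) : a != 0 ->
  is_derive w (1 : R) (fun w => atan (w / a)) (a / (a ^+ 2 + w ^+ 2)).
Proof.
move=> a0.
have d1 : is_derive w (1 : R) (fun w => w / a) a^-1.
  by apply: is_derive_eq; rewrite /GRing.scale/=; ring.
apply: is_derive_eq (is_derive1_comp (f := atan) _ d1) _.
have : 0 < a ^+ 2 + w ^+ 2.
  by rewrite ltr_pwDl ?sqr_ge0// exprn_even_gt0.
move=> /lt0r_neq0 h.
have -> : 1 + (w / a) ^+ 2 = (a ^+ 2 + w ^+ 2) / a ^+ 2 by field.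
by field; rewrite ?a0 ?h.
Qed.

(** The bound integrates to pi / 3 on the half line, so that the total angle is too small for mu = 2. *)
Lemma kw_le2 w : kw 2 w <= 2 / 3 * (3 / (3 ^+ 2 + w ^+ 2)).
Proof.
have x0 := xw_gt0 w.
have q0 := sqr_ge0 w.
have s25 := sqrt25_gt0 w.
have h1 : Num.sqrt (1 + 2 * xw w) <= 3 / 2 * Num.sqrt (w ^+ 2 + 25).
  apply: sqrt_le_sq; first by rewrite mulr_ge0// ltW.
  rewrite exprMn sqr_sqrtr ?addr_ge0// /xw; lra.
have h2 : Num.sqrt 156 * Num.sqrt (1 + 2 * xw w) <= 25 / 2 * (3 / 2 * Num.sqrt (w ^+ 2 + 25)).
  by apply: ler_pM; rewrite ?sqrtr_ge0// sqrt156_le.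
have w9 : 0 < 3 ^+ 2 + w ^+ 2 by lra.
rewrite /kw ler_pdivrMr ?kw_den_gt0//; apply: (le_trans h2).
have -> : 2 / 3 * (3 / (3 ^+ 2 + w ^+ 2)) * (xw w * (1 + xw w) * Num.sqrt (w ^+ 2 + 25)) =
   2 * xw w * (1 + xw w) / (3 ^+ 2 + w ^+ 2) * Num.sqrt (w ^+ 2 + 25).
  by move: (3 ^+ 2 + w ^+ 2) (lt0r_neq0 w9) => D D0; field.
rewrite !mulrA ler_pM2r// ler_pdivlMr//.
have e1 : 24 * (3 ^+ 2 + w ^+ 2) <= 2 * xw w * (1 + xw w).
  by apply: ler_pM; rewrite ?(ltW w9)//; rewrite /xw; lra.
lra.
Qed.

(* crude bound, uniform enough to make the total angle finite and Lipschitz in mu *)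
Lemma kw_bound mu w : 0 <= mu -> kw mu w <= 5 * (1 + mu) * (1 / (1 ^+ 2 + w ^+ 2)).
Proof.
move=> m0; have x0 := xw_gt0 w; have q0 := sqr_ge0 w; have s25 := sqrt25_ge5 w.
have mx : 0 <= mu * xw w by rewrite mulr_ge0// ltW.
have h1 : Num.sqrt (1 + mu * xw w) <= (1 + mu) * (1 + xw w).
  apply: sqrt_le_sq; first by rewrite mulr_ge0// addr_ge0// ltW.
  have e : 1 + mu * xw w <= (1 + mu) * (1 + xw w) by nra.
  apply: (le_trans e); rewrite expr2 ler_peMl//; first by rewrite mulr_ge0// addr_ge0// ltW.
  nra.
have h2 : Num.sqrt 156 * Num.sqrt (1 + mu * xw w) <= 25 / 2 * ((1 + mu) * (1 + xw w)).
  by apply: ler_pM; rewrite ?sqrtr_ge0// sqrt156_le.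
have w1 : 0 < 1 ^+ 2 + w ^+ 2 by rewrite expr1n; lra.
rewrite /kw ler_pdivrMr ?kw_den_gt0//; apply: (le_trans h2).
have -> : 5 * (1 + mu) * (1 / (1 ^+ 2 + w ^+ 2)) * (xw w * (1 + xw w) * Num.sqrt (w ^+ 2 + 25)) =
   (5 * xw w / (1 ^+ 2 + w ^+ 2) * Num.sqrt (w ^+ 2 + 25)) * ((1 + mu) * (1 + xw w)).
  by move: (1 ^+ 2 + w ^+ 2) (lt0r_neq0 w1) => D D0; field.
apply: ler_wpM2r; first by rewrite mulr_ge0// addr_ge0// ltW.
have e2 : 5 <= 5 * xw w / (1 ^+ 2 + w ^+ 2) by rewrite ler_pdivlMr// expr1n /xw; lra.
have := ler_pM _ _ e2 s25; lra.
Qed.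

(** This makes the total angle a continuous function of mu. *)
Lemma kw_lip mu nu w : 2 <= mu -> mu <= nu ->
  kw nu w <= kw mu w + 3 * (nu - mu) * (1 / (1 ^+ 2 + w ^+ 2)).
Proof.
move=> m2 mn; have x0 := xw_gt0 w; have q0 := sqr_ge0 w; have s25 := sqrt25_ge5 w.
have d0 := kw_den_gt0 w.
have w1 : 0 < 1 ^+ 2 + w ^+ 2 by rewrite expr1n; lra.
have dx : 0 <= (nu - mu) * xw w by rewrite mulr_ge0 ?subr_ge0// ltW.
have mx : 0 <= mu * xw w by rewrite mulr_ge0// ?(ltW x0)//; lra.
have h1 : Num.sqrt (1 + nu * xw w) <= Num.sqrt (1 + mu * xw w) + (nu - mu) * xw w.
  apply: sqrt_le_sq; first by rewrite addr_ge0// sqrtr_ge0.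
  rewrite sqrrD sqr_sqrtr; last by lra.
  have s1 : 1 <= Num.sqrt (1 + mu * xw w) by apply: sqrt_ge_sq; lra.
  have := ler_wpM2r dx s1; have := sqr_ge0 ((nu - mu) * xw w).
  rewrite -mulr_natr; move: (Num.sqrt _) => s; lra.
rewrite /kw -lerBlDl -mulrBl -mulrBr ler_pdivrMr//.
apply: (@le_trans _ _ (25 / 2 * ((nu - mu) * xw w))).
  apply: ler_pM; rewrite ?sqrtr_ge0 ?sqrt156_le//; last by lra.
  by rewrite subr_ge0 ler_sqrt; nra.
have -> : 3 * (nu - mu) * (1 / (1 ^+ 2 + w ^+ 2)) * (xw w * (1 + xw w) * Num.sqrt (w ^+ 2 + 25)) =
   (3 * (1 + xw w) / (1 ^+ 2 + w ^+ 2) * Num.sqrt (w ^+ 2 + 25)) * ((nu - mu) * xw w).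
  by move: (1 ^+ 2 + w ^+ 2) (lt0r_neq0 w1) => D D0; field.
apply: ler_wpM2r => //.
have e2 : 3 <= 3 * (1 + xw w) / (1 ^+ 2 + w ^+ 2) by rewrite ler_pdivlMr// expr1n /xw; lra.
have := ler_pM _ _ e2 s25; lra.
Qed.

(** The angle swept over w in [0, 1] alone exceeds a quarter turn for this M. *)
Lemma kw_large : exists2 M : R, 2 <= M & forall w, 0 <= w <= 1 -> 2 <= kw M w.
Proof.
exists 10000; first by lra.
move=> w /andP[w0 w1]; have x0 := xw_gt0 w.
have ww : w ^+ 2 <= 1 by rewrite expr_le1.
have x13 : xw w <= 13 by rewrite /xw; lra.
have x12 := xw_ge12 w.
have s6 : Num.sqrt (w ^+ 2 + 25) <= 6 by apply: sqrt_le_sq => //; lra.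
have s300 : 300 <= Num.sqrt (1 + 10000 * xw w) by apply: sqrt_ge_sq; lra.
rewrite /kw ler_pdivlMr ?kw_den_gt0//.
apply: (@le_trans _ _ (12 * 300)); last by apply: ler_pM; rewrite ?ler0n// sqrt156_ge.
have h1 : xw w * (1 + xw w) <= 13 * 14.
  by clear s300 s6 ww; apply: ler_pM; [exact: ltW|rewrite addr_ge0// ltW|by []|lra].
have h2 : xw w * (1 + xw w) * Num.sqrt (w ^+ 2 + 25) <= 13 * 14 * 6.
  apply: ler_pM; [|exact: sqrtr_ge0|exact: h1|exact: s6].
  by apply: mulr_ge0; [exact: ltW|rewrite addr_ge0// ltW].
by clear -h2; lra.
Qed.

(** The pitch is chosen so that the geodesic of the orbit space with turning point x = 12 joins
    antipodal ideal points: its total angle is continuous in mu, too small for mu = 2 and too large for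
    the M of kw_large. *)
Lemma profile_exists : exists (mu : R) (vth : R -> R),
  [/\ 2 <= mu, vth 0 = 0, (forall w, is_derive w (1 : R) vth (kw mu w)),
      (forall w, vth w < pi / 2) &
      (forall e : R, 0 < e -> exists w, pi / 2 - e < vth w)].
Proof.
have /choice[V VP] : forall mu, exists K : R -> R, K 0 = 0 /\
    forall w, is_derive w (1 : R) K (kw mu w).
  move=> mu; have [K K0 dK] := @primitive_exists R _ 0 (@kw_continuous mu).
  by exists K.
have p2 : 0 < (pi : R) / 2 by rewrite divr_gt0// pi_gt0.
have atan_le (w : R) : atan w <= pi / 2 by apply: ltW; exact: atan_ltpi2.
have atan0w (a : R) : atan (0 / a) = 0 :> R by rewrite mul0r atan0.
have V_neg (mu w : R) : 0 <= mu -> w <= 0 -> V mu w <= 0.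
  move=> m0 w0; have [V0 dV] := VP mu.
  have := @derive_le (fun=> 0) (V mu) (fun=> 0) (kw mu) w 0 w0; rewrite V0 subrr sub0r oppr_ge0; apply.
  by move=> t _; apply: ltW; exact: kw_gt0.
have V_incr (mu w w' : R) : 0 <= mu -> w < w' -> V mu w < V mu w'.
  move=> m0 ww; have [V0 dV] := VP mu.
  have [c _ E] := @mvt_itv (V mu) (kw mu) w w' (ltW ww) (fun t _ => dV t).
  by rewrite -subr_gt0 E mulr_gt0 ?subr_gt0// kw_gt0.
have compare (mu B a w : R) : 0 <= w -> 0 < a -> 0 <= B ->
    (forall t, kw mu t <= B * (a / (a ^+ 2 + t ^+ 2))) -> V mu w <= B * (pi / 2).
  move=> w0 a0 B0 le; have [V0 dV] := VP mu.
  have := @derive_le (V mu) (fun t => B * atan (t / a)) (kw mu)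
     (fun t => B * (a / (a ^+ 2 + t ^+ 2))) 0 w w0.
  rewrite V0 atan0w mulr0 !subr0 => /(_ _ _ _)/le_trans; apply.
  - move=> t _; have h := is_derive_atan_scaled t (lt0r_neq0 a0).
    by apply: is_derive_eq; rewrite /GRing.scale/= ?mulr0 ?addr0 ?add0r.
  - by move=> t _; exact: le.
  - by apply: ler_wpM2l.
have V_ub mu w : 0 <= mu -> V mu w <= 5 * (1 + mu) * (pi / 2).
  move=> m0; have [w0|/ltW w0] := leP 0 w.
    by apply: (@compare _ _ 1) => //; [rewrite mulr_ge0// addr_ge0|move=> t; exact: kw_bound].
  apply: (le_trans (V_neg _ _ m0 w0)); rewrite mulr_ge0 ?(ltW p2)// mulr_ge0// addr_ge0//.
pose T (mu : R) : R := sup (range (V mu)).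
have hs mu : 0 <= mu -> has_sup (range (V mu)).
  move=> m0; split; first by exists (V mu 0), 0.
  by exists (5 * (1 + mu) * (pi / 2)) => _ [w _ <-]; exact: V_ub.
have V_le_T mu w : 0 <= mu -> V mu w <= T mu.
  by move=> m0; apply: sup_ubound; [case: (hs _ m0)|exists w].
have T_le mu B : 0 <= B -> (forall w, 0 <= w -> V mu w <= B) -> 0 <= mu -> T mu <= B.
  move=> B0 le m0; apply: sup_le_ub; first by exists (V mu 0), 0.
  move=> _ [w _ <-]; have [w0|/ltW w0] := leP 0 w; first exact: le.
  exact: le_trans (V_neg _ _ m0 w0) B0.
have T2 : T 2 <= pi / 2.
  apply: (@le_trans _ _ (2 / 3 * (pi / 2))); last by lra.
  apply: T_le => //; first by rewrite mulr_ge0// ltW.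
  by move=> w w0; apply: (@compare _ _ 3) => // t; exact: kw_le2.
have [M M2 kM] := kw_large.
have M0 : 0 <= M by lra.
have T4 : pi / 2 <= T M.
  apply: (@le_trans _ _ (V M 1)); last exact: V_le_T.
  apply: (@le_trans _ _ 2); first exact: ltW (pihalf_lt2 R).
  have [V0 dV] := VP M.
  have := @derive_le (fun t => 2 * t) (V M) (fun=> 2) (kw M) 0 1 ler01.
  rewrite V0 mulr1 mulr0 !subr0; apply.
  - by move=> t _; apply: is_derive_eq; rewrite /GRing.scale/=; ring.
  - by move=> t; exact: kM.
have T_mono mu nu : 2 <= mu -> mu <= nu -> T mu <= T nu.
  move=> m2 mn; have m0 : 0 <= mu by lra.
  apply: T_le => //; first by have [<- _] := VP nu; apply: V_le_T; lra.
  move=> w w0; apply: (@le_trans _ _ (V nu w)); last by apply: V_le_T; lra.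
  have [V0 dV] := VP mu; have [V0' dV'] := VP nu.
  have := @derive_le (V mu) (V nu) (kw mu) (kw nu) 0 w w0; rewrite V0 V0' !subr0; apply => // t _.
  rewrite /kw ler_pM2r ?invr_gt0 ?kw_den_gt0// ler_pM2l; last by have := sqrt156_ge; lra.
  by have x0 := xw_gt0 t; rewrite ler_sqrt; nra.
have T_lip mu nu : 2 <= mu -> mu <= nu -> T nu <= T mu + 3 * (nu - mu) * (pi / 2).
  move=> m2 mn; have m0 : 0 <= mu by lra.
  have B0 : 0 <= 3 * (nu - mu) by rewrite mulr_ge0// subr_ge0.
  apply: T_le; [| |by lra].
    by apply: addr_ge0; [have [<- _] := VP mu; exact: V_le_T|apply: mulr_ge0 => //; exact: ltW].
  move=> w w0; apply: (@le_trans _ _ (V mu w + 3 * (nu - mu) * atan (w / 1))); last first.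
    by apply: lerD; [exact: V_le_T|apply: ler_wpM2l].
  have [V0 dV] := VP mu; have [V0' dV'] := VP nu.
  have := @derive_le (V nu) (fun t => V mu t + 3 * (nu - mu) * atan (t / 1)) (kw nu)
    (fun t => kw mu t + 3 * (nu - mu) * (1 / (1 ^+ 2 + t ^+ 2))) 0 w w0.
  rewrite V0 V0' atan0w mulr0 addr0 !subr0; apply.
  - move=> t _; have h := is_derive_atan_scaled t (oner_neq0 R).
    by have h' := dV t; apply: is_derive_eq; rewrite /GRing.scale/= ?mulr0 ?addr0 ?add0r.
  - by move=> t _; exact: kw_lip.
have cT : continuous (fun s : R => T (Num.max 2 s)).
  move=> s; apply/cvgrPdist_le => /= e e0.
  have lip (a b : R) : a <= b -> `|T (Num.max 2 a) - T (Num.max 2 b)| <= 6 * `|b - a|.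
    move=> ab; have ma : 2 <= Num.max 2 a by rewrite le_max lexx.
    have mab : Num.max 2 a <= Num.max 2 b by rewrite ge_max !le_max lexx/= ab orbT.
    rewrite distrC ger0_norm ?subr_ge0 ?T_mono// (ger0_norm (_ : 0 <= b - a)) ?subr_ge0//.
    rewrite lerBlDl (le_trans (T_lip _ _ ma mab))// lerD2l.
    have dab : Num.max 2 b - Num.max 2 a <= b - a.
      have ha : a <= Num.max 2 a by rewrite le_max lexx orbT.
      by rewrite lerBlDr ge_max; apply/andP; split; lra.
    have dab0 : 0 <= Num.max 2 b - Num.max 2 a by rewrite subr_ge0.
    apply: (@le_trans _ _ (3 * (Num.max 2 b - Num.max 2 a) * 2)); last by lra.
    by apply: ler_wpM2l; [rewrite mulr_ge0|exact: ltW (pihalf_lt2 R)].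
  have e6 : 0 < e / 6 by rewrite divr_gt0.
  near=> t.
  have st : `|s - t| < e / 6 by near: t; exact: (nbhsx_ballx s (e / 6) e6).
  have [h|/ltW h] := leP s t.
    by apply: (le_trans (lip _ _ h)); rewrite distrC; lra.
  by rewrite distrC; apply: (le_trans (lip _ _ h)); lra.
have max2 (s : R) : 2 <= s -> Num.max 2 s = s by move=> ?; rewrite max_r.
have [mu mu_itv Tmu'] : exists2 mu, mu \in `[2, M] & T (Num.max 2 mu) = pi / 2.
  apply: (@IVT _ (fun s : R => T (Num.max 2 s))) => //.
    by apply: continuous_subspaceT => ?; exact: cT.
  rewrite !max2//.
  by rewrite ge_min le_max T2 T4 orbT.
have Tmu : T mu = pi / 2.
  by rewrite -Tmu' max2//; move: mu_itv; rewrite in_itv/= => /andP[].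
move: mu_itv; rewrite in_itv/= => /andP[m2 _].
have m0 : 0 <= mu by lra.
have [V0 dV] := VP mu.
exists mu, (V mu); split => //.
- move=> w; rewrite -Tmu; apply: (@lt_le_trans _ _ (V mu (w + 1))); last exact: V_le_T.
  by apply: V_incr => //; rewrite ltrDl.
- move=> e e0; rewrite -Tmu.
  have [_ [w _ <-] h] := sup_adherent e0 (hs _ m0).
  by exists w.
Unshelve. all: by end_near. Qed.

End profile.

(** * The concavity inequality *)

Section key_inequality.
Context {R : realType}.
Implicit Types (mu y ys : R).

(** In the orbit space of the screw motion, with y = 1 + 2x and S = x(1 + x), the squared slope of
    the calibration is k = y^2/(1 + mu x) = 2 y^2/dk, which is concave in S where y >= 3;
    kslope and kbase give its tangent line, kbase + kslope * (y^2 - 1). *)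
Definition dk mu y := mu * y - (mu - 2).
Definition kfun mu y := 2 * y ^+ 2 / dk mu y.
Definition kslope mu y := (mu * y - 2 * (mu - 2)) / dk mu y ^+ 2.
Definition kbase mu y := (mu * y ^+ 3 + mu * y - 2 * (mu - 2)) / dk mu y ^+ 2.

Lemma dk_gt0 mu y : 2 <= mu -> 1 <= y -> 0 < dk mu y.
Proof. by rewrite /dk => m2 y1; nra. Qed.

Lemma kslope_ge0 mu y : 2 <= mu -> 2 <= y -> 0 <= kslope mu y.
Proof. by move=> m2 y3; rewrite divr_ge0 ?sqr_ge0//; nra. Qed.

(** The graph of k as a function of y^2 - 1 = 4 S lies below its tangents: concavity for y >= 3. *)
Lemma kfun_tangent mu y ys : 2 <= mu -> 3 <= y -> 3 <= ys ->
  kfun mu y <= kbase mu ys + kslope mu ys * (y ^+ 2 - 1).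
Proof.
move=> m2 y3 ys3.
have d0 : 0 < dk mu y by apply: dk_gt0; lra.
have ds0 : 0 < dk mu ys by apply: dk_gt0; lra.
rewrite -subr_ge0.
have -> : kbase mu ys + kslope mu ys * (y ^+ 2 - 1) - kfun mu y =
   (y - ys) ^+ 2 * mu * ((mu * ys - 2 * (mu - 2)) * y - (mu - 2) * ys) / (dk mu y * dk mu ys ^+ 2).
  rewrite /kbase /kslope /kfun; move: (lt0r_neq0 d0) (lt0r_neq0 ds0); rewrite /dk => h h'.
  by field; rewrite h h'.
apply: divr_ge0; last by rewrite mulr_ge0 ?sqr_ge0// ltW.
apply: mulr_ge0; first by rewrite mulr_ge0 ?sqr_ge0//; lra.
have h1 : 2 * y + ys <= y * ys by nra.
have : (mu - 2) * (2 * y + ys) <= mu * (y * ys).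
  by apply: ler_pM => //; lra.
lra.
Qed.

Lemma kbase_ge mu ys : 2 <= mu -> 25 <= ys -> 25 / mu <= kbase mu ys.
Proof.
move=> m2 ys25; have m0 : 0 < mu by lra.
have d0 : 0 < dk mu ys by apply: dk_gt0; lra.
rewrite /kbase ler_pdivlMr ?exprn_gt0// mulrAC ler_pdivrMr//.
have d1 : dk mu ys ^+ 2 <= (mu * ys) ^+ 2.
  rewrite ler_sqr ?nnegrE ?(ltW d0)//; last by nra.
  by rewrite /dk; lra.
have h2 : 25 * (mu * ys) ^+ 2 <= mu ^+ 2 * ys ^+ 3.
  have -> : mu ^+ 2 * ys ^+ 3 = ys * (mu * ys) ^+ 2 by ring.
  by apply: ler_wpM2r => //; exact: sqr_ge0.
have h3 : 0 <= mu * (mu * ys - 2 * (mu - 2)) by apply: mulr_ge0; nra.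
lra.
Qed.

(** Concavity of k: the two squared slopes, in the angle and in the radius, combine to at most the
    squared slope at the mean level ys. *)
Lemma key_inequality mu (N2 n2 kap Q2 ys : R) : 2 <= mu -> 0 <= N2 <= 1 -> 25 <= ys ->
  ys ^+ 2 = 1 + 4 * (156 + N2 * Q2) -> 0 <= Q2 ->
  (n2 = 0 \/ exists yt, [/\ 3 <= yt, 624 = (1 - N2) * (yt ^+ 2 - 1) & n2 = (1 - N2) * kfun mu yt]) ->
  (kap <= 25 / mu \/ exists y, [/\ 3 <= y, 4 * Q2 = y ^+ 2 - 1 & kap = kfun mu y]) ->
  N2 * kap + n2 <= kfun mu ys.
Proof.
move=> m2 /andP[N0 N1] y25 ysE Q0 hn hk.
have ds0 : 0 < dk mu ys by apply: dk_gt0; lra.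
have sl0 : 0 <= kslope mu ys by apply: kslope_ge0; lra.
have kb := kbase_ge m2 y25.
have kb0 : 0 <= kbase mu ys by apply: le_trans kb; rewrite divr_ge0//; lra.
have -> : kfun mu ys = kbase mu ys + kslope mu ys * (ys ^+ 2 - 1).
  rewrite /kbase /kslope /kfun; move: (lt0r_neq0 ds0); rewrite /dk => h.
  by field.
have e1 : n2 <= (1 - N2) * kbase mu ys + kslope mu ys * 624.
  case: hn => [->|[yt [yt3 E ->]]].
    by apply: addr_ge0; apply: mulr_ge0; [lra|exact: kb0|exact: sl0|lra].
  have := ler_wpM2l (_ : 0 <= 1 - N2) (@kfun_tangent mu yt ys m2 yt3 _) => /(_ _ _)/le_trans; apply.
  - by lra.
  - by lra.
  - by rewrite E; move: (kbase _ _) (kslope _ _) => A B; lra.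
have e2 : kap <= kbase mu ys + kslope mu ys * (4 * Q2).
  case: hk => [h|[y [y3 -> ->]]].
    by apply: (le_trans h); apply: (le_trans kb); rewrite lerDl mulr_ge0// mulr_ge0.
  by apply: kfun_tangent => //; lra.
have := ler_wpM2l N0 e2; rewrite ysE; move: e1; move: (kbase _ _) (kslope _ _) => A B.
lra.
Qed.

End key_inequality.

(** * The profile angle and its inverse *)

Section one_variable.
Context {R : realType}.
Implicit Types (f g : R -> R).

Lemma is_derive_epsP f (x l : R) : is_derive x (1 : R) f l <->
  forall e : R, 0 < e -> exists2 d : R, 0 < d & forall y, `|y - x| < d ->
    `|f y - f x - l * (y - x)| <= e * `|y - x|.
Proof.
split => [/is_derive1_caratheodory[G [GE cG GfE]] e e0|h].
  have : nbhs x [set y | `|G x - G y| < e] by move/cvgrPdist_lt : cG => /(_ _ e0).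
  move=> /nbhs_ballP[r /= r0 rP]; exists r => // y yr.
  rewrite GE -GfE -mulrBl normrM ler_wpM2r// distrC; apply: ltW; apply: rP.
  by rewrite /ball/= distrC.
apply/is_derive1_caratheodory.
exists (fun y => if y == x then l else (f y - f x) / (y - x)); split.
- move=> y; case: eqP => [->|/eqP yx]; first by rewrite !subrr mulr0.
  by rewrite divfK// subr_eq0.
- apply/cvgrPdist_le => /= e e0; have [d d0 dP] := h _ e0.
  suff : nbhs x [set y | `|(if x == x then l else (f x - f x) / (x - x)) -
      (if y == x then l else (f y - f x) / (y - x))| <= e] by [].
  apply/nbhs_ballP; exists d => // y /=; rewrite /ball/= distrC => xy.
  rewrite eqxx; case: eqP => [_|/eqP yx]; first by rewrite subrr normr0 ltW.
  have yx0 : y - x != 0 by rewrite subr_eq0.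
  have -> : l - (f y - f x) / (y - x) = - ((f y - f x - l * (y - x)) / (y - x)) by field.
  by rewrite normrN normf_div ler_pdivrMr ?normr_gt0// dP.
- by rewrite eqxx.
Qed.

Lemma is_derive_glue f f1 f2 (x l : R) :
  (forall y, x <= y -> f y = f1 y) -> (forall y, y <= x -> f y = f2 y) ->
  is_derive x (1 : R) f1 l -> is_derive x (1 : R) f2 l -> is_derive x (1 : R) f l.
Proof.
move=> h1 h2 /is_derive_epsP d1 /is_derive_epsP d2; apply/is_derive_epsP => e e0.
have [r r0 rP] := d1 _ e0; have [s s0 sP] := d2 _ e0.
exists (Num.min r s); first by rewrite lt_min r0.
move=> y; rewrite lt_min => /andP[yr ys].
have [xy|/ltW yx] := leP x y.
  by rewrite !h1//; exact: rP.
by rewrite !h2//; exact: sP.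
Qed.

Lemma is_derive_near f g (x l e : R) : 0 < e -> (forall y, `|y - x| < e -> f y = g y) ->
  is_derive x (1 : R) g l -> is_derive x (1 : R) f l.
Proof.
move=> e0 fg /is_derive_epsP d; apply/is_derive_epsP => eta h0.
have [r r0 rP] := d _ h0.
exists (Num.min r e); first by rewrite lt_min r0.
move=> y; rewrite lt_min => /andP[yr ye].
by rewrite (fg y)// (fg x) ?subrr ?normr0//; exact: rP.
Qed.

Definition prim (k : R -> R) : R -> R :=
  xget (fun=> 0) [set K : R -> R | K 0 = 0 /\ forall x, is_derive x (1 : R) K (k x)].

Lemma primP k : continuous k -> prim k 0 = 0 /\ forall x, is_derive x (1 : R) (prim k) (k x).
Proof.
move=> ck; have [K K0 dK] := primitive_exists 0 ck.
by apply: (@xgetPex _ (fun=> 0) [set K : R -> R | K 0 = 0 /\ forall x, is_derive x (1 : R) K (k x)]); exists K.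
Qed.

End one_variable.

(** The angle swept by the profile geodesic, with pitch normalised so that it sweeps exactly half a
    turn. *)
Record is_profile (R : realType) (mu : R) (vth : R -> R) : Prop := IsProfile {
  profile_mu : 2 <= mu;
  profile0 : vth 0 = 0;
  profile_derive : forall w, is_derive w (1 : R) vth (kw mu w);
  profile_lt : forall w, vth w < pi / 2;
  profile_sup : forall e : R, 0 < e -> exists w, pi / 2 - e < vth w }.

Section profile_inverse.
Context {R : realType}.
Variables (mu : R) (vth : R -> R).
Hypothesis hP : is_profile mu vth.

Let m2 : 2 <= mu := profile_mu hP.
Let m0 : 0 <= mu. Proof. by rewrite (le_trans _ m2). Qed.
Let dv := profile_derive hP.

Lemma profile_odd w : vth (- w) = - vth w.
Proof.
have : vth w - vth 0 = - vth (- w) - - vth (- 0).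
  apply: (@eq_derive_eq R vth (fun t => - vth (- t)) (kw mu)) => t _; first exact: dv.
  have d1 : is_derive t (1 : R) (fun t : R => - t) (- 1) by apply: is_derive_eq.
  have d2 := dv (- t).
  apply: is_derive_eq (is_deriveN (is_derive1_comp (f := vth) d2 d1)) _.
  by rewrite mulrN1 opprK /kw /xw sqrrN.
by rewrite oppr0 (profile0 hP); lra.
Qed.

Lemma profile_incr w w' : w < w' -> vth w < vth w'.
Proof.
move=> ww; have [c _ E] := @mvt_itv R vth (kw mu) w w' (ltW ww) (fun t _ => dv t).
by rewrite -subr_gt0 E mulr_gt0 ?subr_gt0// kw_gt0.
Qed.

Lemma profile_mono : {mono vth : w w' / w <= w'}.
Proof. by apply: le_mono => w w'; exact: profile_incr. Qed.

Lemma profile_bounds w : - (pi / 2) < vth w < pi / 2.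
Proof. by rewrite (profile_lt hP) andbT ltrNl -profile_odd (profile_lt hP). Qed.

Lemma profile_continuous : continuous vth.
Proof. by move=> w; exact: derive_cont (dv w). Qed.

Lemma profile_onto t : - (pi / 2) < t < pi / 2 -> exists w, vth w = t.
Proof.
move=> /andP[t1 t2].
have [w1] : exists w, pi / 2 - (pi / 2 - t) < vth w by apply: (profile_sup hP); rewrite subr_gt0.
have [w2] : exists w, pi / 2 - (pi / 2 + t) < vth w by apply: (profile_sup hP); lra.
move=> h2 h1.
have h3 : vth (- w2) < t by rewrite profile_odd; lra.
have h4 : t < vth w1 by lra.
have ww : - w2 <= w1 by rewrite -profile_mono; lra.
have [w _ <-] : exists2 w, w \in `[- w2, w1] & vth w = t.
  apply: IVT => //; first by apply: continuous_subspaceT => ?; exact: profile_continuous.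
  by rewrite ge_min le_max (ltW h3) (ltW h4) orbT.
by exists w.
Qed.

Definition win t : R := xget 0 [set w | vth w = t].

Lemma winK t : - (pi / 2) < t < pi / 2 -> vth (win t) = t.
Proof. by move=> /profile_onto h; exact: (xgetPex _ h). Qed.

Lemma profileK w : win (vth w) = w.
Proof. by apply: (inc_inj profile_mono); rewrite winK// profile_bounds. Qed.

Lemma is_derive_win t : - (pi / 2) < t < pi / 2 -> is_derive t (1 : R) win (kw mu (win t))^-1.
Proof.
move=> h; rewrite -{1}(winK h); apply: is_derive_inverse.
- by exists 1 => //= w _; exact: profileK.
- by exists 1 => //= w _; exact: profile_continuous.
- exact: dv.
- by rewrite gt_eqF// kw_gt0.
Qed.

Lemma win0 : win 0 = 0.
Proof. by rewrite -[in LHS](profile0 hP) profileK. Qed.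

Lemma win_ge0 t : 0 <= t < pi / 2 -> 0 <= win t.
Proof.
move=> /andP[t0 t1]; rewrite -profile_mono (profile0 hP) winK// t1 andbT (lt_le_trans _ t0)//.
by rewrite oppr_lt0 divr_gt0// pi_gt0.
Qed.

(** Decay rate of the remaining angle. *)
Lemma profile_tail w : 4 <= w -> 12 / (25 * w ^+ 3) <= pi / 2 - vth w.
Proof.
move=> w4; apply: (@le_trans _ _ (vth (2 * w) - vth w)); last first.
  by rewrite lerD2r ltW// (profile_lt hP).
have w2 : w <= 2 * w by lra.
have [c /andP[wc c2] ->] := @mvt_itv R vth (kw mu) w (2 * w) w2 (fun t _ => dv t).
have w0 : 0 < w by lra.
have -> : 2 * w - w = w by ring.
have -> : 12 / (25 * w ^+ 3) = 12 / (25 * w ^+ 4) * w by field; rewrite gt_eqF.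
apply: ler_wpM2r; first exact: ltW.
have x0 := xw_gt0 c.
have p0 : 0 < xw c * (1 + xw c) by rewrite mulr_gt0// addr_gt0.
apply: (@le_trans _ _ (12 / (xw c * (1 + xw c)))).
  have c22 : c ^+ 2 <= (2 * w) ^+ 2 by rewrite ler_sqr ?nnegrE; lra.
  have e : xw c * (1 + xw c) <= (5 * w ^+ 2) * (5 * w ^+ 2).
    have ww : 16 <= w ^+ 2 by nra.
    have E4 : (2 * w) ^+ 2 = 4 * w ^+ 2 by ring.
    rewrite E4 in c22.
    have h1 : xw c <= 5 * w ^+ 2 by rewrite /xw; move: c22 ww; lra.
    have h2 : 1 + xw c <= 5 * w ^+ 2 by rewrite /xw; move: c22 ww; lra.
    apply: ler_pM => //; first exact: ltW.
    by rewrite addr_ge0// ltW.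
  apply: ler_wpM2l => //; rewrite lef_pV2 ?posrE ?p0//; last by rewrite mulr_gt0// exprn_gt0.
  by apply: (le_trans e); rewrite le_eqVlt; apply/orP; left; apply/eqP; ring.
have s0 := sqrt25_gt0 c.
have -> : kw mu c = Num.sqrt 156 * (Num.sqrt (1 + mu * xw c) / Num.sqrt (c ^+ 2 + 25)) /
    (xw c * (1 + xw c)).
  rewrite /kw; move: (lt0r_neq0 p0) (lt0r_neq0 s0).
  by move: (xw c * (1 + xw c)) (Num.sqrt (c ^+ 2 + 25)) => X s X0 s1; field; rewrite X0 s1.
apply: ler_wpM2r; first by rewrite invr_ge0 ltW.
rewrite -[leLHS]mulr1; apply: ler_pM => //; first exact: sqrt156_ge.
rewrite ler_pdivlMr// mul1r ler_sqrt; last by rewrite ltW// ltr_pwDl// mulr_ge0// ltW.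
have : 2 * xw c <= mu * xw c by rewrite ler_pM2r.
by have := sqr_ge0 c; rewrite /xw; lra.
Qed.

End profile_inverse.

(** * The angular factor of the calibration *)

Section angular_factor.
Context {R : realType}.
Variables (mu : R) (vth : R -> R).
Hypothesis hP : is_profile mu vth.

Let m2 : 2 <= mu := profile_mu hP.
Let m0 : 0 <= mu. Proof. by rewrite (le_trans _ m2). Qed.

Lemma is_derive_comp (f g : R -> R) (x l k : R) : is_derive (g x) (1 : R) f k ->
  is_derive x (1 : R) g l -> is_derive x (1 : R) (fun t => f (g t)) (k * l).
Proof. by move=> df dg; exact: (is_derive1_comp (f := f) (g := g)). Qed.

Lemma is_derive_sqrt (g : R -> R) (x l : R) : 0 < g x -> is_derive x (1 : R) g l ->
  is_derive x (1 : R) (fun t => Num.sqrt (g t)) (l / (2 * Num.sqrt (g x))).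
Proof.
move=> g0 dg; rewrite mulrC.
by apply: (is_derive_comp (f := Num.sqrt) (is_derive1_sqrt g0) dg).
Qed.

Lemma is_derive_mul (f g : R -> R) (x l k : R) : is_derive x (1 : R) f l ->
  is_derive x (1 : R) g k -> is_derive x (1 : R) (fun t => f t * g t) (l * g x + f x * k).
Proof.
move=> df dg; apply: is_derive_eq (is_deriveM df dg) _.
by rewrite /GRing.scale/= addrC (mulrC (g x)).
Qed.

Lemma is_derive_inv (f : R -> R) (x l : R) : f x != 0 -> is_derive x (1 : R) f l ->
  is_derive x (1 : R) (fun t => (f t)^-1) (- l / f x ^+ 2).
Proof.
move=> f0 df; apply: is_derive_eq (is_deriveV f0 df) _.
by rewrite /GRing.scale/= mulNr mulrC mulNr.
Qed.

Definition Sw (w : R) : R := xw w * (1 + xw w).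
(** The square is 1 - 156 / S.  By Clairaut's relation, this is the radial component of the unit tangent
    vector of the profile. *)
Definition nu (w : R) : R := w * Num.sqrt (w ^+ 2 + 25) / Num.sqrt (Sw w).

Lemma Sw_gt0 (w : R) : 0 < Sw w.
Proof. by rewrite mulr_gt0 ?xw_gt0// addr_gt0// xw_gt0. Qed.

Lemma sq25_gt0 (w : R) : 0 < w ^+ 2 + 25.
Proof. by have := sqr_ge0 w; lra. Qed.

Lemma nu_sqr (w : R) : nu w ^+ 2 = 1 - 156 / Sw w.
Proof.
have S0 := Sw_gt0 w; have s0 := sq25_gt0 w.
rewrite /nu !exprMn exprVn !sqr_sqrtr ?(ltW S0) ?(ltW s0)//.
have q := sqr_ge0 w.
have h1 : 12 + w ^+ 2 != 0 by rewrite gt_eqF//; lra.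
have h2 : 1 + (12 + w ^+ 2) != 0 by rewrite gt_eqF//; lra.
by rewrite /Sw /xw; field; rewrite h1 h2.
Qed.

Lemma nu_ge0 (w : R) : 0 <= w -> 0 <= nu w.
Proof. by move=> w0; rewrite /nu divr_ge0 ?sqrtr_ge0// mulr_ge0 ?sqrtr_ge0. Qed.

Lemma nu_gt0 (w : R) : 0 < w -> 0 < nu w.
Proof. by move=> w0; rewrite divr_gt0 ?sqrtr_gt0 ?Sw_gt0// mulr_gt0// sqrtr_gt0 sq25_gt0. Qed.

Lemma nu_le1 (w : R) : nu w <= 1.
Proof.
have [w0|w0] := leP 0 w; last first.
  apply: (@le_trans _ _ 0) => //; rewrite /nu -mulrA.
  by apply: mulr_le0_ge0; [exact: ltW|rewrite mulr_ge0 ?invr_ge0 ?sqrtr_ge0].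
rewrite -(@ler_pXn2r _ 2) ?nnegrE ?nu_ge0// nu_sqr expr1n lerBlDr lerDl.
by rewrite divr_ge0 ?(ltW (Sw_gt0 w))//; lra.
Qed.

Lemma is_derive_nu (w : R) : is_derive w (1 : R) nu
  (156 * (1 + 2 * xw w) / (Num.sqrt (w ^+ 2 + 25) * Num.sqrt (Sw w) ^+ 3)).
Proof.
have S0 := Sw_gt0 w; have s0 := sq25_gt0 w.
have d1 : is_derive w (1 : R) (fun w => w ^+ 2 + 25) (2 * w).
  by apply: is_derive_eq; rewrite /GRing.scale/=; ring.
have d2 : is_derive w (1 : R) (fun w => Num.sqrt (w ^+ 2 + 25)) (w / Num.sqrt (w ^+ 2 + 25)).
  apply: is_derive_eq (is_derive_sqrt (g := fun w => w ^+ 2 + 25) s0 d1) _.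
  have : Num.sqrt (w ^+ 2 + 25) != 0 by rewrite gt_eqF// sqrtr_gt0.
  by move: (Num.sqrt _) => s s1; field.
have d3 : is_derive w (1 : R) Sw (2 * w * (1 + 2 * xw w)).
  rewrite /Sw /xw; apply: is_derive_eq; rewrite /GRing.scale/=; ring.
have d4 : is_derive w (1 : R) (fun w => Num.sqrt (Sw w)) (w * (1 + 2 * xw w) / Num.sqrt (Sw w)).
  apply: is_derive_eq (is_derive_sqrt (g := Sw) S0 d3) _.
  have : Num.sqrt (Sw w) != 0 by rewrite gt_eqF// sqrtr_gt0.
  by move: (Num.sqrt _) => s s1; field.
have sS : Num.sqrt (Sw w) != 0 by rewrite gt_eqF// sqrtr_gt0.
have ss : Num.sqrt (w ^+ 2 + 25) != 0 by rewrite gt_eqF// sqrtr_gt0.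
have d5 := is_derive_mul (is_derive_mul (is_derive_id w (1 : R)) d2)
  (is_derive_inv (f := fun w => Num.sqrt (Sw w)) sS d4).
apply: is_derive_eq d5 _; rewrite /=.
have E1 : Num.sqrt (w ^+ 2 + 25) ^+ 2 = w ^+ 2 + 25 by rewrite sqr_sqrtr// ltW.
have E2 : Num.sqrt (Sw w) ^+ 2 = (12 + w ^+ 2) * (13 + w ^+ 2).
  by rewrite sqr_sqrtr ?(ltW S0)// /Sw /xw; ring.
move: (Num.sqrt (Sw w)) sS E2 (Num.sqrt (w ^+ 2 + 25)) ss E1 => b b0 E2 a a0 E1.
rewrite /xw.
have -> : (1 * a + w * (w / a)) * b^-1 + w * a * (- (w * (1 + 2 * (12 + w ^+ 2)) / b) / b ^+ 2) =
   ((w ^+ 2 + a ^+ 2) * b ^+ 2 - w ^+ 2 * (1 + 2 * (12 + w ^+ 2)) * a ^+ 2) / (a * b ^+ 3).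
  by field; rewrite a0 b0.
by rewrite E1 E2; field; rewrite a0 b0.
Qed.

(** The radial component of the calibration is proportional to this function of the angle tau,
    measured from the plane of symmetry of the profile. *)
Definition mf (t : R) : R :=
  if t == 0 then 1 else nu (win vth (Num.max 0 (pi / 2 - `|t|))).

Let p2 : 0 < (pi : R) / 2. Proof. by rewrite divr_gt0// pi_gt0. Qed.

Lemma mf_itv (t : R) : t != 0 -> 0 <= Num.max 0 (pi / 2 - `|t|) < pi / 2.
Proof.
move=> t0; rewrite le_max lexx/= gt_max p2/= ltrBlDr ltrDl.
by rewrite normr_gt0.
Qed.

Lemma mf_ge0 t : 0 <= mf t.
Proof.
rewrite /mf; case: ifPn => // t0; apply: nu_ge0; apply: (win_ge0 hP); exact: mf_itv.
Qed.

Lemma mf_le1 t : mf t <= 1.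
Proof. by rewrite /mf; case: ifPn => // t0; exact: nu_le1. Qed.

Lemma mf_even t : mf (- t) = mf t.
Proof. by rewrite /mf oppr_eq0 normrN. Qed.

Lemma mf_gt0 t : `|t| < pi / 2 -> 0 < mf t.
Proof.
move=> tp; rewrite /mf; case: ifPn => // t0.
have h := mf_itv t0.
have e : 0 < Num.max 0 (pi / 2 - `|t|) by rewrite lt_max subr_gt0 tp orbT.
apply: nu_gt0; rewrite -(leW_mono (profile_mono hP)) (profile0 hP) (winK hP)//.
by case/andP: h => _ ->; rewrite (lt_trans _ e)// oppr_lt0.
Qed.

Lemma mf_profile w : 0 <= w -> mf (pi / 2 - vth w) = nu w.
Proof.
move=> w0; have vw : 0 < pi / 2 - vth w by rewrite subr_gt0 (profile_lt hP).
rewrite /mf gt_eqF// gtr0_norm// subKr max_r ?(profileK hP)//.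
by rewrite -(profile0 hP) (profile_mono hP).
Qed.

(** The squared slope b^2 in terms of the value a of mf.  The second alternative holds along the profile,
    where S = 156 / (1 - a^2) and yt = 1 + 2 x. *)
Definition mf_slope (a b : R) := (b ^+ 2 = 0 \/
  exists yt, [/\ 3 <= yt, 624 = (1 - a ^+ 2) * (yt ^+ 2 - 1) & b ^+ 2 = (1 - a ^+ 2) * kfun mu yt]).

Lemma is_derive_nuwin s : - (pi / 2) < s < pi / 2 -> exists2 b,
  is_derive s (1 : R) (nu \o win vth) b & mf_slope (nu (win vth s)) b.
Proof.
move=> hs; have dw := is_derive_win hP hs; set w := win vth s in dw *.
have dn := is_derive_nu w.
exists (156 * (1 + 2 * xw w) / (Num.sqrt (w ^+ 2 + 25) * Num.sqrt (Sw w) ^+ 3) * (kw mu w)^-1).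
  exact: (is_derive_comp (f := nu) (g := win vth) dn dw).
right; exists (1 + 2 * xw w).
have S0 := Sw_gt0 w; have s0 := sq25_gt0 w; have x0 := xw_gt0 w.
have W0 : 0 < 1 + mu * xw w by rewrite ltr_pwDl// mulr_ge0// ltW.
rewrite nu_sqr; split; first by have := xw_ge12 w; lra.
  have x1 : 1 + xw w != 0 by rewrite gt_eqF// addr_gt0.
  by rewrite /Sw; field; rewrite (lt0r_neq0 x0) x1.
have E1 : Num.sqrt (w ^+ 2 + 25) ^+ 2 = w ^+ 2 + 25 by rewrite sqr_sqrtr// ltW.
have E2 : Num.sqrt (Sw w) ^+ 2 = Sw w by rewrite sqr_sqrtr// ltW.
have E3 : Num.sqrt (1 + mu * xw w) ^+ 2 = 1 + mu * xw w by rewrite sqr_sqrtr// ltW.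
have E4 : Num.sqrt 156 ^+ 2 = 156 :> R by rewrite sqr_sqrtr//; lra.
have h156 : Num.sqrt 156 != 0 :> R by have h := @sqrt156_ge R; rewrite gt_eqF//; lra.
have -> : kfun mu (1 + 2 * xw w) = (1 + 2 * xw w) ^+ 2 / (1 + mu * xw w).
  rewrite /kfun /dk; have -> : mu * (1 + 2 * xw w) - (mu - 2) = 2 * (1 + mu * xw w) by ring.
  by move: (1 + mu * xw w) (lt0r_neq0 W0) => D D0; field.
have a0 : Num.sqrt (w ^+ 2 + 25) != 0 by rewrite gt_eqF// sqrtr_gt0.
have b0 : Num.sqrt (Sw w) != 0 by rewrite gt_eqF// sqrtr_gt0.
have c0 : Num.sqrt (1 + mu * xw w) != 0 by rewrite gt_eqF// sqrtr_gt0.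
rewrite /kw -/(Sw w).
have -> : 156 * (1 + 2 * xw w) / (Num.sqrt (w ^+ 2 + 25) * Num.sqrt (Sw w) ^+ 3) *
    (Num.sqrt 156 * Num.sqrt (1 + mu * xw w) / (Sw w * Num.sqrt (w ^+ 2 + 25)))^-1 =
    156 * (1 + 2 * xw w) / (Num.sqrt (Sw w) * Num.sqrt 156 * Num.sqrt (1 + mu * xw w)).
  rewrite -[in X in (_ / X)^-1]E2; move: a0 b0 c0 h156.
  move: (Num.sqrt (w ^+ 2 + 25)) (Num.sqrt (Sw w)) (Num.sqrt (1 + mu * xw w)) (Num.sqrt 156).
  move=> a b c d a0 b0 c0 d0; field.
  by rewrite a0 b0 c0 d0.
rewrite exprMn exprVn !exprMn E2 E3 E4.
move: (lt0r_neq0 S0) (lt0r_neq0 W0); move: (Sw w) (1 + mu * xw w) => S W S1 W1.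
by field; rewrite S1 W1.
Qed.

(** The remaining profile angle is at least of order w^-3 while 1 - nu is of order w^-4, so that the
    difference quotient tends to 0. *)
Lemma is_derive_mf0 : is_derive 0 (1 : R) mf 0.
Proof.
apply/is_derive_epsP => e e0.
pose w0 := Num.max 4 (325 / e).
exists (pi / 2 - vth w0); first by rewrite subr_gt0 (profile_lt hP).
move=> y; rewrite subr0 mul0r subr0 => yw.
rewrite [mf 0]/mf eqxx; have [->|y0] := eqVneq y 0.
  by rewrite /mf eqxx subrr normr0 mulr0.
have ylt : `|y| < pi / 2.
  apply: (lt_le_trans yw); rewrite lerBlDr lerDl -(profile0 hP) (profile_mono hP).
  by rewrite /w0 le_max ler0n.
have [h1 h2] := andP (mf_itv y0).
rewrite distrC ger0_norm ?subr_ge0 ?mf_le1// /mf (negPf y0).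
have y1 : 0 <= pi / 2 - `|y| by rewrite subr_ge0 ltW.
rewrite (max_r y1) in h2 *.
set w := win vth _.
have vw : vth w = pi / 2 - `|y|.
  by apply: (winK hP); rewrite h2 andbT (lt_le_trans _ y1)// oppr_lt0.
have ww : w0 < w by rewrite -(leW_mono (profile_mono hP)) vw; lra.
have w4 : 4 <= w by rewrite (le_trans _ (ltW ww))// le_max lexx.
have we : 325 / e <= w by rewrite (le_trans _ (ltW ww))// le_max lexx orbT.
have wpos : 0 < w by lra.
have tail := profile_tail hP w4; rewrite vw subKr in tail.
apply: (@le_trans _ _ (e * (12 / (25 * w ^+ 3)))); last by apply: ler_wpM2l => //; exact: ltW.
have n0 := nu_ge0 (ltW wpos); have n1 := nu_le1 w.
apply: (@le_trans _ _ (1 - nu w ^+ 2)); first by nra.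
rewrite nu_sqr subKr.
have w3 : 0 < w ^+ 3 by rewrite exprn_gt0.
have S4 : w * w ^+ 3 <= Sw w.
  by rewrite /Sw /xw -exprS; have := sqr_ge0 w; have := sqr_ge0 (w ^+ 2); rewrite -exprM; lra.
have S1 := Sw_gt0 w.
have we' : 325 <= e * w by move: we; rewrite ler_pdivrMr// mulrC.
rewrite ler_pdivrMr//.
apply: (@le_trans _ _ (e * (12 / (25 * w ^+ 3)) * (w * w ^+ 3))); last first.
  by apply: ler_wpM2l => //; rewrite mulr_ge0 ?(ltW e0)// divr_ge0// mulr_ge0// ltW.
have -> : e * (12 / (25 * w ^+ 3)) * (w * w ^+ 3) = 12 / 25 * (e * w).
  by move: (w ^+ 3) (lt0r_neq0 w3) => D D0; field.
lra.
Qed.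

Lemma mf_derive t : `|t| < pi / 2 -> exists2 b, is_derive t (1 : R) mf b & mf_slope (mf t) b.
Proof.
have pos s : 0 < s -> s < pi / 2 -> exists2 b, is_derive s (1 : R) mf b & mf_slope (mf s) b.
  move=> s0 s1.
  have [|b db hb] := @is_derive_nuwin (pi / 2 - s); first by apply/andP; split; lra.
  have d1 : is_derive s (1 : R) (fun s : R => pi / 2 - s) (- 1).
    by apply: is_derive_eq (is_deriveB (is_derive_cst (pi / 2 : R) s 1) (is_derive_id s (1 : R))) _; rewrite sub0r.
  have E y : 0 < y -> y <= pi / 2 -> mf y = nu (win vth (pi / 2 - y)).
    by move=> y0 y1; rewrite /mf gt_eqF// gtr0_norm// max_r// subr_ge0.
  exists (- b).
    have m : 0 < Num.min s (pi / 2 - s) by rewrite lt_min s0 subr_gt0.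
    apply: (@is_derive_near _ mf (fun s => (nu \o win vth) (pi / 2 - s)) _ _ _ m).
      move=> y; rewrite lt_min ltr_norml => /andP[/andP[ys _] ]; rewrite ltr_norml => /andP[_ ys'].
      by rewrite E//; lra.
    by apply: is_derive_eq (is_derive_comp (f := nu \o win vth) (g := fun s : R => pi / 2 - s) db d1) _; rewrite mulrN1.
  by rewrite /mf_slope sqrrN E// ltW.
move=> tp; have [t0|t0|->] := ltgtP t 0; last first.
- by exists 0; [exact: is_derive_mf0|left; rewrite expr0n].
- by apply: pos => //; rewrite -(gtr0_norm t0).
have [||b db hb] := pos (- t); [by lra|by rewrite -(ltr0_norm t0)|].
exists (- b); last by rewrite /mf_slope sqrrN -mf_even.
have d1 : is_derive t (1 : R) (fun s : R => - s) (- 1) by apply: is_derive_eq.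
apply: (@is_derive_near _ mf (fun s => mf (- s)) _ _ 1) => //.
  by move=> y _; rewrite mf_even.
by apply: is_derive_eq (is_derive_comp (f := mf) (g := fun s : R => - s) db d1) _; rewrite mulrN1.
Qed.

Lemma mf_continuous : continuous mf.
Proof.
move=> t; have [tp|tp] := ltP `|t| (pi / 2).
  have [b db _] := mf_derive tp.
  by apply: (@derive_cont _ _ (fun=> b)).
have t0 : t != 0 by rewrite -normr_gt0 (lt_le_trans p2).
have c1 : {for t, continuous (fun s : R => Num.max 0 (pi / 2 - `|s|))}.
  apply: continuous_max; first exact: cvg_cst.
  by apply: cvgB; [exact: cvg_cst|exact: (cvg_norm (f := id))].
have [|b db _] := @is_derive_nuwin (Num.max 0 (pi / 2 - `|t|)).
  by have /andP[h1 ->] := mf_itv t0; rewrite (lt_le_trans _ h1)// oppr_lt0.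
have c2 := @derive_cont _ _ (fun=> b) _ db.
have c3 := @cont_comp _ _ _ (fun s : R => Num.max 0 (pi / 2 - `|s|)) (nu \o win vth) t c1 c2.
have nt : 0 < `|t| by rewrite normr_gt0.
rewrite /continuous_at {2}/mf (negPf t0).
apply: cvg_trans c3; apply: near_eq_cvg.
near=> s; rewrite /mf/=; have -> // : (s == 0) = false.
apply/negbTE; apply: contraTneq isT => s0.
have : `|t - s| < `|t| by near: s; exact: (nbhsx_ballx t `|t| nt).
by rewrite s0 subr0 ltxx.
Unshelve. all: by end_near. Qed.

End angular_factor.

(** * The radial factor of the calibration *)

Section radial_factor.
Context {R : realType}.
Implicit Types (x y e xi w : R).
Variable mu : R.
Hypothesis m2 : 2 <= mu.
Local Notation s2 := (Num.sqrt (2 : R)).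

Let mu0 : 0 < mu. Proof. by rewrite (lt_le_trans _ m2). Qed.
Let s2E : s2 ^+ 2 = 2. Proof. by rewrite sqr_sqrtr. Qed.
Let s2_gt0 : 0 < s2. Proof. by rewrite sqrtr_gt0. Qed.
Let s2_bounds : 7 / 5 <= s2 <= 3 / 2.
Proof. by apply/andP; split; [apply: sqrt_ge_sq; lra|apply: sqrt_le_sq; lra]. Qed.

(** The radial factor of the calibration.  Off a neighbourhood of the axis it is sqrt S with
    S = x (1 + x); near the axis, where the squared slope is no longer concave in S, it is continued
    by a homographic function with the same value and slope at x = 1. *)
Definition rQ (x : R) : R := if x < 1 then 4 * s2 * x / (x + 3) else Num.sqrt (x * (1 + x)).

Lemma rQ_gt0 x : 0 < x -> 0 < rQ x.
Proof.
move=> x0; rewrite /rQ; case: ifPn => _; last by rewrite sqrtr_gt0 mulr_gt0// addr_gt0.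
by rewrite divr_gt0 ?addr_gt0 ?mulr_gt0.
Qed.

Lemma rQ0 : rQ 0 = 0.
Proof. by rewrite /rQ ltr01 mulr0 mul0r. Qed.

Lemma rQ_large x : 1 <= x -> rQ x = Num.sqrt (x * (1 + x)).
Proof. by rewrite /rQ ltNge => ->. Qed.

Lemma rQ_sqr_le x : 0 < x -> rQ x ^+ 2 <= x * (1 + x).
Proof.
move=> x0; rewrite /rQ; case: ifPn => [x1|_]; last by rewrite sqr_sqrtr// mulr_ge0 ?addr_ge0// ltW.
rewrite expr_div_n !exprMn s2E ler_pdivrMr ?exprn_gt0 ?addr_gt0// -subr_ge0.
have -> : x * (1 + x) * (x + 3) ^+ 2 - 4 ^+ 2 * 2 * x ^+ 2 = x * ((x - 1) ^+ 2 * (x + 9)) by ring.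
by rewrite mulr_ge0 ?(ltW x0)// mulr_ge0 ?sqr_ge0// addr_ge0// ltW.
Qed.

Lemma is_derive_rQ_small x : 0 <= x ->
  is_derive x (1 : R) (fun x => 4 * s2 * x / (x + 3)) (12 * s2 / (x + 3) ^+ 2).
Proof.
move=> x0; have x3 : x + 3 != 0 by rewrite gt_eqF// ltr_wpDl.
have d1 : is_derive x (1 : R) (fun x => 4 * s2 * x) (4 * s2).
  by apply: is_derive_eq; rewrite /GRing.scale/=; ring.
have d2 : is_derive x (1 : R) (fun x => x + 3) 1.
  by apply: is_derive_eq; rewrite addr0.
apply: is_derive_eq (is_derive_mul d1 (is_derive_inv (f := fun x => x + 3) x3 d2)) _.
by field.
Qed.

Lemma is_derive_rQ_large x : 0 < x ->
  is_derive x (1 : R) (fun x => Num.sqrt (x * (1 + x))) ((1 + 2 * x) / (2 * Num.sqrt (x * (1 + x)))).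
Proof.
move=> x0; have S0 : 0 < x * (1 + x) by rewrite mulr_gt0// addr_gt0.
apply: (is_derive_sqrt (g := fun x => x * (1 + x)) S0).
by apply: is_derive_eq; rewrite /GRing.scale/=; ring.
Qed.

Lemma is_derive_rQ x : 0 <= x -> is_derive x (1 : R) rQ
  (if x < 1 then 12 * s2 / (x + 3) ^+ 2 else (1 + 2 * x) / (2 * Num.sqrt (x * (1 + x)))).
Proof.
move=> x0; have [x1|x1|->] := ltgtP x 1.
- have e : 0 < 1 - x by rewrite subr_gt0.
  apply: (is_derive_near e _ (is_derive_rQ_small x0)) => y.
  by rewrite ltr_norml /rQ => /andP[_ h]; have -> : y < 1 by lra.
- have e : 0 < x - 1 by rewrite subr_gt0.
  apply: (is_derive_near e _ (is_derive_rQ_large _)); last by lra.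
  move=> y; rewrite ltr_norml => /andP[h _]; rewrite rQ_large//; lra.
- have -> : (1 + 2 * 1) / (2 * Num.sqrt (1 * (1 + 1))) = 12 * s2 / (1 + 3) ^+ 2 :> R.
    have -> : 1 * (1 + 1) = 2 :> R by ring.
    have -> : 12 * s2 / (1 + 3) ^+ 2 = 3 * s2 ^+ 2 / (4 * s2) by field; rewrite gt_eqF.
    by rewrite s2E; field; rewrite gt_eqF.
  apply: (@is_derive_glue _ rQ (fun x => Num.sqrt (x * (1 + x))) (fun x => 4 * s2 * x / (x + 3))).
  + by move=> y; exact: rQ_large.
  + move=> y; rewrite le_eqVlt => /orP[/eqP ->|y1]; last by rewrite /rQ y1.
    rewrite rQ_large//; have -> : 1 * (1 + 1) = 2 :> R by ring.
    by field.
  + apply: is_derive_eq (is_derive_rQ_large ltr01) _.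
    have -> : 1 * (1 + 1) = 2 :> R by ring.
    have -> : 12 * s2 / (1 + 3) ^+ 2 = 3 * s2 ^+ 2 / (4 * s2) by field; rewrite gt_eqF.
    by rewrite s2E; field; rewrite gt_eqF.
  + exact: is_derive_rQ_small.
Qed.

Lemma rQ_continuous x : 0 <= x -> {for x, continuous rQ}.
Proof. by move=> /is_derive_rQ h; exact: (@derive_cont _ _ (fun=> _) _ h). Qed.

(** The normalised radial slope satisfies the alternative required by the concavity argument. *)
Lemma rQ_slope x : 0 < x -> exists2 q, is_derive x (1 : R) rQ q &
  let kap := 4 * (x * (1 + x)) * q ^+ 2 / (1 + mu * x) in
  kap <= 25 / mu \/ exists y, [/\ 3 <= y, 4 * rQ x ^+ 2 = y ^+ 2 - 1 & kap = kfun mu y].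
Proof.
move=> x0; have := is_derive_rQ (ltW x0); set q := (if _ then _ else _) => dq.
exists q => //=; rewrite /q {q dq}.
have m0 : 0 < mu by rewrite (lt_le_trans _ m2).
have W0 : 0 < 1 + mu * x by rewrite ltr_pwDl// mulr_ge0// ltW.
case: ifPn => [x1|]; [left|rewrite -leNgt => x1; right; exists (1 + 2 * x)].
  rewrite expr_div_n exprMn s2E.
  have x3 : 0 < x + 3 by rewrite addr_gt0.
  have p4 : 0 < (x + 3) ^+ 2 ^+ 2 by rewrite !exprn_gt0.
  rewrite ler_pdivrMr//.
  set P := (x + 3) ^+ 2 ^+ 2 in p4 *.
  have -> : 4 * (x * (1 + x)) * (12 ^+ 2 * 2 / P) = 4 * (x * (1 + x)) * (12 ^+ 2 * 2) / P by rewrite !mulrA.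
  rewrite ler_pdivrMr// /P.
  apply: (@le_trans _ _ (25 * x * (x + 3) ^+ 2 ^+ 2)); last first.
    rewrite ler_pM2r//.
    have -> : 25 / mu * (1 + mu * x) = 25 / mu + 25 * x by field; rewrite gt_eqF.
    by rewrite lerDr divr_ge0// ltW.
  have -> : 4 * (x * (1 + x)) * (12 ^+ 2 * 2) = x * (1152 * (1 + x)) by ring.
  rewrite [25 * x]mulrC -[in leRHS]mulrA; apply: ler_wpM2l; first exact: ltW.
  have h2 : 9 + 6 * x <= (x + 3) ^+ 2 by have := sqr_ge0 x; lra.
  have h3 : (9 + 6 * x) * (9 + 6 * x) <= (x + 3) ^+ 2 ^+ 2.
    by rewrite [_ ^+ 2 ^+ 2]expr2; apply: ler_pM => //; lra.
  move: h3; move: ((x + 3) ^+ 2 ^+ 2) => Z h3; nra.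
have S0 : 0 < x * (1 + x) by rewrite mulr_gt0// addr_gt0.
have E : Num.sqrt (x * (1 + x)) ^+ 2 = x * (1 + x) by rewrite sqr_sqrtr// ltW.
rewrite rQ_large// E; split; [lra|ring|].
rewrite expr_div_n exprMn E /kfun /dk.
have -> : mu * (1 + 2 * x) - (mu - 2) = 2 * (1 + mu * x) by ring.
move: (x * (1 + x)) (1 + mu * x) (lt0r_neq0 S0) (lt0r_neq0 W0) => S W S1 W1.
by field; rewrite S1 W1.
Qed.

(** The function that maps (rQ x)^-1 to x^-1, one branch for each branch of rQ, extended by a constant
    to negative arguments. *)
Definition gG (e : R) : R := let c := s2 / 2 in let n := Num.max 0 (Num.min e c) in
  (n ^+ 2 + n * Num.sqrt (n ^+ 2 + 4)) / 2 + 4 * s2 / 3 * (Num.max e c - c).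

Lemma gG_rQ x : 0 < x -> gG (rQ x)^-1 = x^-1.
Proof.
move=> x0; rewrite /gG /=.
have s0 := lt0r_neq0 s2_gt0.
have [x1|x1] := ltP x 1; last first.
  have S0 : 0 < x * (1 + x) by rewrite mulr_gt0// addr_gt0.
  rewrite rQ_large//; set t := Num.sqrt _.
  have tE : t ^+ 2 = x * (1 + x) by rewrite sqr_sqrtr// ltW.
  have t0 : 0 < t by rewrite sqrtr_gt0.
  have tc : t^-1 <= s2 / 2.
    have -> : s2 / 2 = s2^-1 by rewrite -{2}s2E; field.
    by rewrite lef_pV2 ?posrE// ler_sqrt; nra.
  have ti : 0 <= t^-1 by rewrite invr_ge0 ltW.
  rewrite (min_l tc) (max_r tc) (max_r ti) subrr mulr0 addr0.
  have -> : t^-1 ^+ 2 + 4 = ((1 + 2 * x) / t) ^+ 2.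
    rewrite expr_div_n exprVn tE; field.
    by rewrite (lt0r_neq0 x0) gt_eqF// addr_gt0.
  rewrite sqrtr_sqr ger0_norm; last by rewrite divr_ge0 ?(ltW t0)//; lra.
  rewrite mulrA [_^-1 * _]mulrC -mulrA -expr2 exprVn tE; field.
  by rewrite (lt0r_neq0 x0) gt_eqF// addr_gt0.
have E : (rQ x)^-1 = (x + 3) / (4 * s2 * x) by rewrite /rQ x1 invf_div.
have ec : s2 / 2 <= (rQ x)^-1.
  rewrite E ler_pdivlMr ?mulr_gt0//.
  have -> : s2 / 2 * (4 * s2 * x) = 2 * s2 ^+ 2 * x by field.
  by rewrite s2E; lra.
rewrite (min_r ec) (max_l ec) max_r; last by rewrite divr_ge0// ltW.
have -> : (s2 / 2) ^+ 2 + 4 = (3 / s2) ^+ 2 by rewrite !expr_div_n s2E; field.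
rewrite sqrtr_sqr ger0_norm; last by rewrite divr_ge0// ltW.
rewrite E expr_div_n s2E.
have -> : 4 * s2 / 3 * ((x + 3) / (4 * s2 * x) - s2 / 2) = (x + 3) / (3 * x) - 2 / 3 * s2 ^+ 2.
  by field; rewrite s0 lt0r_neq0.
by rewrite s2E; field; rewrite s0 lt0r_neq0.
Qed.

Lemma gG_ge e : 0 <= e -> e <= gG e.
Proof.
move=> e0; rewrite /gG /=; set c := s2 / 2; rewrite (@max_r _ _ 0); last by rewrite le_min e0 divr_ge0// ltW.
set n := Num.min e c.
have c0 : 0 <= c by rewrite divr_ge0// ltW.
have n0 : 0 <= n by rewrite le_min e0.
have s4 : 2 <= Num.sqrt (n ^+ 2 + 4) by apply: sqrt_ge_sq; have := sqr_ge0 n; lra.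
have M0 : 0 <= Num.max e c - c by rewrite subr_ge0 le_max lexx orbT.
have nM : n + Num.max e c = e + c by rewrite /n addr_min_max.
have h1 : n <= (n ^+ 2 + n * Num.sqrt (n ^+ 2 + 4)) / 2.
  have := ler_wpM2l n0 s4; have := sqr_ge0 n; lra.
have h2 : Num.max e c - c <= 4 * s2 / 3 * (Num.max e c - c).
  by apply: ler_peMl => //; case/andP: s2_bounds; lra.
lra.
Qed.

(** This regularity of the inverse of rQ makes the height correction continuous in xi. *)
Lemma gG_lip e e' : `|gG e - gG e'| <= 6 * `|e - e'|.
Proof.
rewrite /gG /=; set c := s2 / 2.
have [s2l s2u] := andP s2_bounds.
have c0 : 0 <= c by rewrite /c; lra.
have c1 : c <= 1 by rewrite /c; lra.
have dmin0 : `|Num.min e c - Num.min e' c| <= `|e - e'|.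
  have h1 := ler_norm (e - e'); have h2 := ler_norm (e' - e); rewrite distrC in h2.
  by rewrite ler_norml; case: (leP e c) => h; case: (leP e' c) => h'; apply/andP; split; lra.
have dmin : `|Num.max 0 (Num.min e c) - Num.max 0 (Num.min e' c)| <= `|e - e'|.
  move: (Num.min e c) (Num.min e' c) dmin0 => a b ab; apply: (le_trans _ ab).
  have h1 := ler_norm (a - b); have h2 := ler_norm (b - a); rewrite distrC in h2.
  by rewrite ler_norml; case: (leP 0 a) => h; case: (leP 0 b) => h'; apply/andP; split; lra.
have dmax : `|Num.max e c - Num.max e' c| <= `|e - e'|.
  have h1 := ler_norm (e - e'); have h2 := ler_norm (e' - e); rewrite distrC in h2.
  by rewrite ler_norml; case: (leP e c) => h; case: (leP e' c) => h'; apply/andP; split; lra.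
have n0 : 0 <= Num.max 0 (Num.min e c) by rewrite le_max lexx.
have n0' : 0 <= Num.max 0 (Num.min e' c) by rewrite le_max lexx.
have n1 : Num.max 0 (Num.min e c) <= 1 by rewrite ge_max ler01 ge_min c1 orbT.
have n1' : Num.max 0 (Num.min e' c) <= 1 by rewrite ge_max ler01 ge_min c1 orbT.
clear dmin0.
have E4 : 4 * s2 / 3 * (Num.max e c - c) - 4 * s2 / 3 * (Num.max e' c - c) =
   4 * s2 / 3 * (Num.max e c - Num.max e' c) by ring.
move: n0 n0' n1 n1' dmin dmax E4.
move: (Num.max 0 (Num.min e c)) (Num.max 0 (Num.min e' c)) (Num.max e c) (Num.max e' c) => a b M M' a0 b0 a1 b1 dmin dmax E4.
have sub (x y : R) : 0 <= x -> Num.sqrt (y ^+ 2 + 4) <= Num.sqrt (x ^+ 2 + 4) + `|x - y|.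
  move=> x0; apply: sqrt_le_sq; first by rewrite addr_ge0// sqrtr_ge0.
  have p : 0 <= x ^+ 2 + 4 by have := sqr_ge0 x; lra.
  rewrite sqrrD sqr_sqrtr// real_normK ?num_real//.
  have h : x <= Num.sqrt (x ^+ 2 + 4) by apply: sqrt_ge_sq => //; lra.
  have h' := ler_wpM2r (normr_ge0 (x - y)) h.
  have h2 : x * (y - x) <= x * `|x - y| by apply: ler_wpM2l => //; rewrite distrC ler_norm.
  move: (`|x - y|) (Num.sqrt (x ^+ 2 + 4)) h' h2 => z s h' h2; lra.
have sd : `|Num.sqrt (a ^+ 2 + 4) - Num.sqrt (b ^+ 2 + 4)| <= `|a - b|.
  have h1 := sub a b a0; have h2 := sub b a b0; rewrite distrC in h2.
  by rewrite ler_norml; apply/andP; split; lra.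
have s3 : Num.sqrt (a ^+ 2 + 4) <= 3 by apply: sqrt_le_sq => //; nra.
have s0 := sqrtr_ge0 (a ^+ 2 + 4).
move: (Num.sqrt (a ^+ 2 + 4)) (Num.sqrt (b ^+ 2 + 4)) sd s3 s0 => s t sd s3 s0.
have -> : (a ^+ 2 + a * s) / 2 + 4 * s2 / 3 * (M - c) - ((b ^+ 2 + b * t) / 2 + 4 * s2 / 3 * (M' - c)) =
  ((a + b) / 2) * (a - b) + s / 2 * (a - b) + b / 2 * (s - t) + 4 * s2 / 3 * (M - M').
  by rewrite -E4; field.
have t1 : `|(a + b) / 2 * (a - b)| <= 1 * `|e - e'|.
  by rewrite normrM; apply: ler_pM => //; rewrite ger0_norm; lra.
have t2 : `|s / 2 * (a - b)| <= 3 / 2 * `|e - e'|.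
  by rewrite normrM; apply: ler_pM => //; rewrite ger0_norm; lra.
have t3 : `|b / 2 * (s - t)| <= 1 / 2 * `|e - e'|.
  by rewrite normrM; apply: ler_pM => //; [rewrite ger0_norm; lra|exact: le_trans sd dmin].
have t4 : `|4 * s2 / 3 * (M - M')| <= 2 * `|e - e'|.
  by rewrite normrM; apply: ler_pM => //; rewrite ger0_norm; lra.
have h0 := normr_ge0 (e - e').
apply: (@le_trans _ _ (1 * `|e - e'| + 3 / 2 * `|e - e'| + 1 / 2 * `|e - e'| + 2 * `|e - e'|)); last by lra.
rewrite (le_trans (ler_normD _ _))// lerD//.
by rewrite (le_trans (ler_normD _ _))// lerD// (le_trans (ler_normD _ _))// lerD.
Qed.

Definition yst (xi : R) : R := Num.sqrt (625 + 4 * xi ^+ 2).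
(** The parameter w of the point of the profile with first coordinate xi. *)
Definition om (xi : R) : R := Num.sqrt ((yst xi - 25) / 2).
Definition ups (xi : R) : R := Num.sqrt (1 + mu * ((yst xi - 1) / 2)) / yst xi.
Definition Ups : R -> R := prim ups.

Lemma yst_sqr xi : yst xi ^+ 2 = 1 + 4 * (156 + xi ^+ 2).
Proof.
by rewrite sqr_sqrtr; have := sqr_ge0 xi; move: (xi ^+ 2) => q ?; [ring|lra].
Qed.

Lemma yst_ge xi : 25 <= yst xi.
Proof. by apply: sqrt_ge_sq; have := sqr_ge0 xi; move: (xi ^+ 2) => q ?; lra. Qed.

Lemma yst_continuous : continuous yst.
Proof.
apply: sqrt_comp_continuous => xi; apply: cvgD; first exact: cvg_cst.
by apply: cvgM; [exact: cvg_cst|exact: exprn_continuous].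
Qed.

Lemma om_continuous : continuous om.
Proof.
apply: sqrt_comp_continuous => xi; apply: cvgM; last exact: cvg_cst.
by apply: cvgB; [exact: yst_continuous|exact: cvg_cst].
Qed.

Lemma yst_sub25 (w : R) : yst (w * Num.sqrt (w ^+ 2 + 25)) = 25 + 2 * w ^+ 2.
Proof.
have q := sqr_ge0 w.
rewrite /yst exprMn sqr_sqrtr; last by lra.
have -> : 625 + 4 * (w ^+ 2 * (w ^+ 2 + 25)) = (25 + 2 * w ^+ 2) ^+ 2 by ring.
by rewrite sqrtr_sqr ger0_norm; lra.
Qed.

Lemma omK (w : R) : 0 <= w -> om (w * Num.sqrt (w ^+ 2 + 25)) = w.
Proof.
move=> w0; rewrite /om yst_sub25.
have -> : (25 + 2 * w ^+ 2 - 25) / 2 = w ^+ 2 by field.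
by rewrite sqrtr_sqr ger0_norm.
Qed.

Lemma ups_continuous : continuous ups.
Proof.
move=> xi; apply: cvgM.
  apply: (@sqrt_comp_continuous _ (fun xi => 1 + mu * ((yst xi - 1) / 2))) => {}xi.
  apply: cvgD; first exact: cvg_cst.
  apply: cvgM; first exact: cvg_cst.
  apply: cvgM; last exact: cvg_cst.
  by apply: cvgB; [exact: yst_continuous|exact: cvg_cst].
apply: cvgV; last exact: yst_continuous.
by have y25 := yst_ge xi; rewrite gt_eqF//; lra.
Qed.

Lemma Ups0 : Ups 0 = 0.
Proof. exact: (primP ups_continuous).1. Qed.

Lemma is_derive_Ups xi : is_derive xi (1 : R) Ups (ups xi).
Proof. exact: (primP ups_continuous).2. Qed.

Lemma ups_gt0 xi : 0 < ups xi.
Proof.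
have y25 := yst_ge xi; have y0 : 0 < yst xi by lra.
have h : 0 <= mu * ((yst xi - 1) / 2) by apply: mulr_ge0; [exact: ltW|lra].
by apply: divr_gt0 => //; rewrite sqrtr_gt0; lra.
Qed.

Lemma ups_sqr xi : ups xi ^+ 2 * kfun mu (yst xi) = 1.
Proof.
have y25 := yst_ge xi.
have h : 0 <= mu * ((yst xi - 1) / 2) by apply: mulr_ge0; [exact: ltW|lra].
rewrite /ups /kfun /dk expr_div_n sqr_sqrtr; last by lra.
have d0 : 0 < mu * yst xi - (mu - 2) by lra.
have y0 : yst xi != 0 by rewrite gt_eqF//; lra.
by field; rewrite y0 gt_eqF.
Qed.

End radial_factor.

(** * The height correction *)

Section calibration.
Context {R : realType}.
Implicit Types (x y t xi p v z s e : R).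
Variables (mu : R) (vth : R -> R).
Hypothesis hP : is_profile mu vth.

Let p2 : 0 < (pi : R) / 2. Proof. by rewrite divr_gt0// pi_gt0. Qed.

(** The pitch: the screw motion turns by lam per unit of translation. *)
Definition lam : R := Num.sqrt (mu - 1).
Local Notation mf := (mf vth).

Lemma lam_gt0 : 0 < lam.
Proof. by have h := profile_mu hP; rewrite sqrtr_gt0; lra. Qed.

Lemma lam_le : lam <= mu.
Proof. by have h := profile_mu hP; apply: sqrt_le_sq; nra. Qed.

(** Along a level set of the first coordinate xi, Kc is the rate at which orthogonality to the
    orbits makes the height vary with the angle. *)
Definition Kc (xi t : R) : R := lam / (mu + gG (mf t / xi)).
Definition Jc (xi : R) : R -> R := prim (Kc xi).

Lemma Kc_den xi t : 0 < xi -> mu <= mu + gG (mf t / xi).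
Proof.
move=> xi0; rewrite lerDl.
have h : 0 <= mf t / xi by rewrite divr_ge0 ?(mf_ge0 hP)// ltW.
exact: le_trans h (gG_ge h).
Qed.

Lemma Kc_itv xi t : 0 < xi -> 0 <= Kc xi t <= 1.
Proof.
have m2' := profile_mu hP.
move=> xi0; have d := Kc_den t xi0; have l0 := lam_gt0; have l1 := lam_le.
have D0 : 0 < mu + gG (mf t / xi) by lra.
apply/andP; split; first by rewrite divr_ge0// ltW.
by rewrite ler_pdivrMr// mul1r; lra.
Qed.

(** Since gG e >= e, the rate is small when xi is, which makes the calibration continuous across v = 0. *)
Lemma Kc_decay xi t : 0 < xi -> 0 < mf t -> Kc xi t <= lam * xi / mf t.
Proof.
have m2' := profile_mu hP.
move=> xi0 mt; have d := Kc_den t xi0; have l0 := lam_gt0.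
have D0 : 0 < mu + gG (mf t / xi) by lra.
rewrite ler_pdivrMr//; have h : 0 <= mf t / xi by rewrite divr_ge0 ?(mf_ge0 hP)// ltW.
have h1 : mf t / xi <= mu + gG (mf t / xi) by have := gG_ge h; lra.
apply: (@le_trans _ _ (lam * xi / mf t * (mf t / xi))).
  have -> : lam * xi / mf t * (mf t / xi) = lam by field; rewrite (lt0r_neq0 xi0) lt0r_neq0.
  by [].
by apply: ler_wpM2l => //; rewrite divr_ge0 ?mulr_ge0// ltW.
Qed.

(** Kc depends on xi and on the angle through gG only, which is Lipschitz. *)
Lemma Kc_lip xi xi' t t' : 0 < xi -> 0 < xi' ->
  `|Kc xi t - Kc xi' t'| <= 6 * `|mf t / xi - mf t' / xi'|.
Proof.
have m2' := profile_mu hP.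
move=> x0 x0'; have d := Kc_den t x0; have d' := Kc_den t' x0'.
have l0 := lam_gt0; have l1 := lam_le.
have := gG_lip (mf t / xi) (mf t' / xi'); rewrite /Kc.
move: (gG (mf t / xi)) (gG (mf t' / xi')) d d' => g g' d d' lip; apply: le_trans lip.
have D0 : 0 < mu + g by lra.
have D0' : 0 < mu + g' by lra.
have -> : lam / (mu + g) - lam / (mu + g') = lam / ((mu + g) * (mu + g')) * (g' - g).
  by field; rewrite (lt0r_neq0 D0) lt0r_neq0.
rewrite normrM distrC; apply: ler_piMl => //.
have DD : 0 < (mu + g) * (mu + g') by rewrite mulr_gt0.
rewrite ger0_norm; last by rewrite divr_ge0// ltW.
rewrite ler_pdivrMr// mul1r; apply: (le_trans l1).
by apply: (le_trans d); rewrite ler_peMr// ?(ltW D0)//; lra.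
Qed.

Lemma Kc_continuous xi : 0 < xi -> continuous (Kc xi).
Proof.
move=> x0 t; apply/cvgrPdist_le => /= e e0.
have e6 : 0 < e / 6 by rewrite divr_gt0.
have c : {for t, continuous (fun s => mf s / xi)}.
  by apply: cvgM; [exact: (mf_continuous hP)|exact: cvg_cst].
have {}c : \forall s \near t, `|mf t / xi - mf s / xi| <= e / 6.
  by move/cvgrPdist_le : c => /(_ _ e6).
near=> s; apply: (le_trans (Kc_lip t s x0 x0)).
have : `|mf t / xi - mf s / xi| <= e / 6 by near: s.
lra.
Unshelve. all: by end_near. Qed.

Lemma Jc0 xi : 0 < xi -> Jc xi 0 = 0.
Proof. by move=> /Kc_continuous/primP[]. Qed.

Lemma is_derive_Jc xi t : 0 < xi -> is_derive t (1 : R) (Jc xi) (Kc xi t).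
Proof. by move=> /Kc_continuous/primP[_]; exact. Qed.

Lemma Jc_mvt xi t t' : 0 < xi -> exists2 c, `|c - t| <= `|t' - t| &
  Jc xi t' - Jc xi t = Kc xi c * (t' - t).
Proof. by move=> xi0; apply: mean_value => s _; exact: is_derive_Jc. Qed.

Lemma Jc_lip xi t t' : 0 < xi -> `|Jc xi t' - Jc xi t| <= `|t' - t|.
Proof.
move=> xi0; have [c _ ->] := Jc_mvt t t' xi0.
have /andP[k0 k1] := Kc_itv c xi0.
by rewrite normrM ger0_norm// ler_piMl.
Qed.

Lemma Jc_lip1 xi xi' t : 0 < xi -> 0 < xi' ->
  `|Jc xi' t - Jc xi t| <= 6 * `|xi'^-1 - xi^-1| * `|t|.
Proof.
move=> x0 x0'.
have [s _|c _] := @mean_value R (fun s => Jc xi' s - Jc xi s) (fun s => Kc xi' s - Kc xi s) 0 t.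
  by apply: is_deriveB; exact: is_derive_Jc.
rewrite !Jc0// subrr !subr0 => ->; rewrite normrM; apply: ler_wpM2r => //.
apply: (le_trans (Kc_lip _ _ x0' x0)); rewrite -mulrBr normrM.
apply: ler_wpM2l => //; apply: ler_piMl => //.
by rewrite ger0_norm ?(mf_ge0 hP)//; exact: mf_le1.
Qed.

Lemma Jc_jointly_continuous (T : topologicalType) (X S : T -> R) (w0 : T) : 0 < X w0 ->
  {for w0, continuous X} -> {for w0, continuous S} ->
  {for w0, continuous (fun w => Jc (X w) (S w))}.
Proof.
move=> x0 cX cS; apply/cvgrPdist_le => /= e e0.
have cV : {for w0, continuous (fun w => (X w)^-1)} by apply: cvgV => //; rewrite gt_eqF.
have e2 : 0 < e / 2 by rewrite divr_gt0.
have B0 : 0 < 12 * (`|S w0| + 1) by rewrite mulr_gt0// ltr_wpDl.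
have e3 : 0 < e / (12 * (`|S w0| + 1)) by rewrite divr_gt0.
have h1 : \forall w \near w0, `|S w0 - S w| <= e / 2 by move/cvgrPdist_le : cS => /(_ _ e2).
have h2 : \forall w \near w0, `|(X w0)^-1 - (X w)^-1| <= e / (12 * (`|S w0| + 1)).
  by move/cvgrPdist_le : cV => /(_ _ e3).
have h3 : \forall w \near w0, 0 < X w.
  by move/cvgrPdist_lt : cX => /(_ _ x0); apply: filterS => w; rewrite ltr_norml; lra.
near=> w.
have k1 : `|S w0 - S w| <= e / 2 by near: w.
have k2 : `|(X w0)^-1 - (X w)^-1| <= e / (12 * (`|S w0| + 1)) by near: w.
have k3 : 0 < X w by near: w.
have -> : Jc (X w0) (S w0) - Jc (X w) (S w) =
  (Jc (X w0) (S w0) - Jc (X w) (S w0)) + (Jc (X w) (S w0) - Jc (X w) (S w)) by ring.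
apply: (le_trans (ler_normD _ _)).
have l2 := Jc_lip (S w) (S w0) k3.
have l1 := Jc_lip1 (S w0) k3 x0.
have l3 : 6 * `|(X w0)^-1 - (X w)^-1| * `|S w0| <= e / 2.
  apply: (@le_trans _ _ (6 * (e / (12 * (`|S w0| + 1))) * (`|S w0| + 1))).
    by apply: ler_pM => //; rewrite ?ler_pM2l// ?lerDl.
  have : `|S w0| + 1 != 0 by rewrite gt_eqF// ltr_wpDl.
  move: (`|S w0| + 1) => D D0; rewrite le_eqVlt; apply/orP; left; apply/eqP.
  by field.
lra.
Unshelve. all: by end_near. Qed.

Lemma Kc_jointly_continuous xi t : 0 < xi -> forall e, 0 < e -> exists2 d : R, 0 < d &
  forall xi' t', `|xi' - xi| < d -> `|t' - t| < d -> `|Kc xi' t' - Kc xi t| <= e.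
Proof.
move=> x0 e e0; have e6 : 0 < e / 6 by rewrite divr_gt0.
have cq : {for (xi, t), continuous (fun w : R * R => mf w.2 / w.1)}.
  apply: cvgM; last by apply: cvgV; [rewrite gt_eqF|exact: cvg_fst].
  by apply: (@cont_comp _ _ _ snd mf); [exact: cvg_snd|exact: (mf_continuous hP)].
have : nbhs (xi, t) [set w : R * R | `|mf t / xi - mf w.2 / w.1| <= e / 6].
  by move/cvgrPdist_le : cq => /(_ _ e6).
move=> /nbhs_ballP[r /= r0 rP].
exists (Num.min r xi); first by rewrite lt_min r0.
move=> xi' t'; rewrite !lt_min => /andP[h1 h2] /andP[h3 h4].
have x0' : 0 < xi' by move: h2; rewrite ltr_norml; lra.
rewrite distrC; apply: (le_trans (Kc_lip _ _ x0 x0')).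
have /= : [set w : R * R | `|mf t / xi - mf w.2 / w.1| <= e / 6] (xi', t').
  by apply: rP; split; rewrite /ball/= distrC.
lra.
Qed.

(** Near the surface v = 0 the correction to the height disappears. *)
Lemma Jc_small e : 0 < e -> exists2 d : R, 0 < d &
  forall xi t, 0 < xi < d -> `|t| <= pi / 2 -> `|Jc xi t| <= e.
Proof.
move=> e0; pose eta : R := Num.min (e / 2) (pi / 4).
have pp := pi_gt0 R; have p22 := pihalf_lt2 R.
have eta0 : 0 < eta by rewrite lt_min !divr_gt0.
have eta4 : eta <= pi / 4 by rewrite ge_min lexx orbT.
have etae : eta <= e / 2 by rewrite ge_min lexx.
pose b := pi / 2 - eta; have b0 : 0 < b by rewrite /b; lra.
have nb : - b <= b by lra.
have cm : {within `[- b, b], continuous mf}.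
  by apply: continuous_subspaceT => s; exact: (mf_continuous hP).
have [c cb cmin] := EVT_min nb cm.
have mc : 0 < mf c.
  apply: (mf_gt0 hP); move: cb; rewrite in_itv/= => /andP[c1 c2].
  by rewrite ltr_norml; apply/andP; split; rewrite /b in c1 c2; lra.
have l0 := lam_gt0.
have d0 : 0 < e * mf c / (4 * lam) by rewrite divr_gt0 ?mulr_gt0.
exists (e * mf c / (4 * lam)) => // xi t /andP[xi0 xid] tp.
have main s : `|s| <= b -> `|Jc xi s| <= e / 2.
  move=> sb; have [r rs] := Jc_mvt 0 s xi0; rewrite Jc0// !subr0 => ->.
  rewrite !subr0 in rs.
  have rb : r \in `[- b, b] by rewrite in_itv/= -ler_norml (le_trans rs).
  have mr := cmin _ rb; have mr0 : 0 < mf r := lt_le_trans mc mr.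
  have /andP[k0 _] := Kc_itv r xi0.
  rewrite normrM (ger0_norm k0).
  have s2 : `|s| <= 2 by rewrite (le_trans sb)// /b; lra.
  apply: (@le_trans _ _ (e / 4 * 2)); last by lra.
  apply: ler_pM => //; apply: (le_trans (Kc_decay xi0 mr0)).
  rewrite ler_pdivrMr//; apply: (@le_trans _ _ (e / 4 * mf c)); last first.
    by apply: ler_wpM2l => //; rewrite divr_ge0// ltW.
  have : lam * xi <= lam * (e * mf c / (4 * lam)) by rewrite ler_pM2l// ltW.
  have -> // : lam * (e * mf c / (4 * lam)) = e / 4 * mf c by field; rewrite gt_eqF.
have [sb|bs] := leP `|t| b; first by apply: (le_trans (main _ sb)); lra.
pose t' := Num.sg t * b.
have t'b : `|t'| <= b.
  rewrite /t' normrM (ger0_norm (ltW b0)); apply: ler_piMl; first exact: ltW.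
  by rewrite normr_sg; case: (t != 0).
have tt' : `|t - t'| <= eta.
  rewrite {1}[t]numEsg /t' -mulrBr normrM normr_sg.
  apply: (@le_trans _ _ `| `|t| - b |); first by apply: ler_piMl => //; case: (t != 0).
  rewrite ger0_norm; last by rewrite subr_ge0 ltW.
  by rewrite /b; lra.
rewrite -[Jc xi t](subrK (Jc xi t')); apply: (le_trans (ler_normD _ _)).
have := main _ t'b; have := Jc_lip t' t xi0; lra.
Qed.

End calibration.

(** * The calibration map *)

Section calibration_map.
Context {R : realType}.
Implicit Types (x y t xi p v z s e : R).
Variables (mu : R) (vth : R -> R).
Hypothesis hP : is_profile mu vth.

Let p2 : 0 < (pi : R) / 2. Proof. by rewrite divr_gt0// pi_gt0. Qed.

Definition tauc p v : R := atan (p / v).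
Definition xic p v : R := mf vth (tauc p v) * rQ (p ^+ 2 + v ^+ 2).
Definition shc xi : R := Jc mu vth xi (pi / 2 - vth (om xi)).

(** The calibration in corotating cylindrical coordinates: p and v are Cartesian coordinates of the
    orbit space, v = 0 being its axis of symmetry, and z is the height. *)
Definition calp p v z : R * R :=
  (Ups mu (xic p v), z - Jc mu vth (xic p v) (tauc p v) + shc (xic p v)).
(** The values for v < 0 come from the half turn around the line v = z = 0, which exchanges the two
    sides of the surface v = 0; xi tends to 0 on that surface. *)
Definition cal (q : R * R * R) : R * R :=
  let: (p, v, z) := q in
  if 0 < v then calp p v z else if v < 0 then - calp p (- v) (- z) else (0, z).

Lemma tauc_lt p v : `|tauc p v| < pi / 2.
Proof. by rewrite ltr_norml atan_gtNpi2 atan_ltpi2. Qed.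

Lemma xic_gt0 p v : 0 < v -> 0 < xic p v.
Proof.
move=> v0; rewrite mulr_gt0 ?(mf_gt0 hP) ?tauc_lt// rQ_gt0// ltr_wpDl ?sqr_ge0//.
by rewrite exprn_gt0.
Qed.

Lemma calN p v z : cal (p, - v, - z) = - cal (p, v, z).
Proof.
rewrite /cal; rewrite oppr_gt0 oppr_lt0; have [v0|v0|v0] := ltgtP v 0.
- by rewrite opprK.
- by rewrite !opprK.
- by congr pair; rewrite ?oppr0.
Qed.

Lemma cal0 p z : cal (p, 0, z) = (0, z).
Proof. by rewrite /cal ltxx. Qed.

(** On the profile the calibration is the parametrisation by arc length of the orbit space and by
    height. *)
Lemma cal_profile w z (q := Num.sqrt (xw w)) :
  cal (q * cos (vth w), q * sin (vth w), z) = (Ups mu (w * Num.sqrt (w ^+ 2 + 25)), z).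
Proof.
have pos w' z' (q' := Num.sqrt (xw w')) : 0 < w' ->
    cal (q' * cos (vth w'), q' * sin (vth w'), z') = (Ups mu (w' * Num.sqrt (w' ^+ 2 + 25)), z').
  move=> w0; have q0 : 0 < q' by rewrite sqrtr_gt0 xw_gt0.
  have v0 : 0 < vth w' by rewrite -(profile0 hP) (leW_mono (profile_mono hP)).
  have v1 := profile_lt hP w'.
  have s0 : 0 < sin (vth w') by rewrite sin_gt0_pihalf// v0.
  have -> : cal (q' * cos (vth w'), q' * sin (vth w'), z') =
      calp (q' * cos (vth w')) (q' * sin (vth w')) z' by rewrite /cal mulr_gt0.
  have tE : tauc (q' * cos (vth w')) (q' * sin (vth w')) = pi / 2 - vth w'.
    rewrite /tauc; have -> : q' * cos (vth w') / (q' * sin (vth w')) = tan (pi / 2 - vth w').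
      rewrite /tan sinB cosB cos_pihalf sin_pihalf !mul1r !mul0r subr0 add0r.
      by field; rewrite (lt0r_neq0 s0) lt0r_neq0.
    by rewrite tanK// in_itv/=; apply/andP; split; lra.
  have xE : (q' * cos (vth w')) ^+ 2 + (q' * sin (vth w')) ^+ 2 = xw w'.
    by rewrite !exprMn -mulrDr cos2Dsin2 mulr1 sqr_sqrtr// ltW// xw_gt0.
  have xiE : xic (q' * cos (vth w')) (q' * sin (vth w')) = w' * Num.sqrt (w' ^+ 2 + 25).
    rewrite /xic tE xE (mf_profile hP) ?(ltW w0)// rQ_large; last by have := xw_ge12 w'; lra.
    by rewrite /nu -/(Sw w') divfK// gt_eqF// sqrtr_gt0 Sw_gt0.
  by rewrite /calp xiE tE /shc omK ?(ltW w0)// subrK.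
have [w0|w0|w0] := ltgtP w 0.
- rewrite -[vth w]opprK -(profile_odd hP) cosN sinN mulrN -[z]opprK calN.
  have E : q = Num.sqrt (xw (- w)) by rewrite /q /xw sqrrN.
  rewrite E pos ?oppr_gt0// sqrrN mulNr.
  have UN : Ups mu (- (w * Num.sqrt (w ^+ 2 + 25))) = - Ups mu (w * Num.sqrt (w ^+ 2 + 25)).
    set X := w * _.
    suff : Ups mu X - Ups mu 0 = - Ups mu (- X) - - Ups mu (- 0) by rewrite oppr0 Ups0; lra.
    apply: (@eq_derive_eq R (Ups mu) (fun t => - Ups mu (- t)) (ups mu)) => t _.
      exact: is_derive_Ups.
    have d1 : is_derive t (1 : R) (fun t : R => - t) (- 1) by apply: is_derive_eq.
    have d2 := is_deriveN (is_derive_comp (is_derive_Ups mu (- t)) d1).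
    by apply: is_derive_eq d2 _; rewrite mulrN1 opprK /ups /yst sqrrN.
  by rewrite UN; congr pair; rewrite /= ?opprK.
- exact: pos.
- by rewrite w0 (profile0 hP) sin0 mulr0 cal0 mul0r Ups0.
Qed.

Lemma tauc_continuous p v : 0 < v -> {for (p, v), continuous (fun q : R * R => tauc q.1 q.2)}.
Proof.
move=> v0; apply: (@cont_comp _ _ _ (fun q : R * R => q.1 / q.2) atan).
  by apply: cvgM; [exact: cvg_fst|apply: cvgV; [rewrite gt_eqF|exact: cvg_snd]].
exact: continuous_atan.
Qed.

Lemma rQ2_continuous p v : {for (p, v), continuous (fun q : R * R => rQ (q.1 ^+ 2 + q.2 ^+ 2))}.
Proof.
apply: (@cont_comp _ _ _ (fun q : R * R => q.1 ^+ 2 + q.2 ^+ 2) rQ).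
  apply: cvgD.
    by apply: (@cont_comp _ _ _ fst (fun x : R => x ^+ 2)); [exact: cvg_fst|exact: exprn_continuous].
  by apply: (@cont_comp _ _ _ snd (fun x : R => x ^+ 2)); [exact: cvg_snd|exact: exprn_continuous].
by apply: rQ_continuous; rewrite addr_ge0 ?sqr_ge0.
Qed.

Lemma xic_continuous p v : 0 < v -> {for (p, v), continuous (fun q : R * R => xic q.1 q.2)}.
Proof.
move=> v0; apply: cvgM; last exact: rQ2_continuous.
apply: (@cont_comp _ _ _ (fun q : R * R => tauc q.1 q.2) (mf vth)).
  exact: tauc_continuous.
exact: (mf_continuous hP).
Qed.

Lemma shc_continuous xi : 0 < xi -> {for xi, continuous shc}.
Proof.
move=> xi0; apply: (@Jc_jointly_continuous _ _ _ hP _ (fun xi => xi) (fun xi => pi / 2 - vth (om xi))) => //.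
apply: cvgB; first exact: cvg_cst.
by apply: (@cont_comp _ _ _ om vth); [exact: om_continuous|exact: (profile_continuous hP)].
Qed.

Lemma calp_continuous p v z : 0 < v ->
  {for (p, v, z), continuous (fun q : R * R * R => calp q.1.1 q.1.2 q.2)}.
Proof.
move=> v0.
have cxi : {for (p, v, z), continuous (fun q : R * R * R => xic q.1.1 q.1.2)}.
  apply: (@cont_comp _ _ _ fst (fun q : R * R => xic q.1 q.2)); first exact: cvg_fst.
  exact: xic_continuous.
have ct : {for (p, v, z), continuous (fun q : R * R * R => tauc q.1.1 q.1.2)}.
  apply: (@cont_comp _ _ _ fst (fun q : R * R => tauc q.1 q.2)); first exact: cvg_fst.
  exact: tauc_continuous.
have xi0 := xic_gt0 p v0.
apply: cont_pair.
  apply: (@cont_comp _ _ _ (fun q : R * R * R => xic q.1.1 q.1.2) (Ups mu)) => //.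
  by have := is_derive_Ups mu (xic p v); exact: derive_cont.
apply: cvgD.
  apply: cvgB; first exact: cvg_snd.
  by apply: (@Jc_jointly_continuous _ _ _ hP _ (fun q : R * R * R => xic q.1.1 q.1.2)
    (fun q : R * R * R => tauc q.1.1 q.1.2)).
apply: (@cont_comp _ _ _ (fun q : R * R * R => xic q.1.1 q.1.2) shc) => //.
exact: shc_continuous.
Qed.

Lemma mf_atan_small e : 0 < e -> exists2 M : R, 0 < M & forall s, M <= `|s| -> mf vth (atan s) <= e.
Proof.
move=> e0.
have mp : mf vth (pi / 2) = 0.
  by rewrite /mf gt_eqF// gtr0_norm// subrr maxxx (win0 hP) /nu mul0r mul0r.
have : nbhs (pi / 2 : R) [set t | `|mf vth (pi / 2) - mf vth t| <= e].
  by move/cvgrPdist_le : (@mf_continuous _ _ _ hP (pi / 2)) => /(_ _ e0).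
move=> /nbhs_ballP[d /= d0 dP].
pose r := Num.min (d / 2) (pi / 4).
have pp := pi_gt0 R.
have r0 : 0 < r by rewrite lt_min !divr_gt0.
have rd : r < d by have : r <= d / 2 by [rewrite ge_min lexx]; lra.
have r4 : r <= pi / 4 by rewrite ge_min lexx orbT.
have itv : pi / 2 - r \in `](- (pi / 2)), (pi / 2)[ by rewrite in_itv/=; apply/andP; split; lra.
exists (Num.max 1 (tan (pi / 2 - r))); first by rewrite lt_max ltr01.
have pos s : 0 <= s -> Num.max 1 (tan (pi / 2 - r)) <= s -> mf vth (atan s) <= e.
  move=> s0; rewrite ge_max => /andP[_ ts].
  have a1 : pi / 2 - r <= atan s.
    rewrite leNgt; apply/negP => h.
    have : tan (atan s) < tan (pi / 2 - r).
      by rewrite ltr_tan// in_itv/= atan_gtNpi2 atan_ltpi2.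
    by rewrite atanK ltNge ts.
  have a2 := atan_ltpi2 s.
  have : `|0 - mf vth (atan s)| <= e.
    by rewrite -mp; apply: dP; rewrite /ball/= ger0_norm; lra.
  by rewrite sub0r normrN ger0_norm// (mf_ge0 hP).
move=> s; have [s0|s0] := leP 0 s; first by rewrite ger0_norm//; exact: pos.
by rewrite ltr0_norm// -[s in X in _ -> X]opprK atanN mf_even; apply: pos; rewrite oppr_ge0 ltW.
Qed.

(** Either the radius is small, and then rQ is, or the angle from the profile axis is close to a quarter
    turn, and then mf is. *)
Lemma xic_small p0 e : 0 < e -> exists2 d : R, 0 < d &
  forall p v, `|p - p0| < d -> 0 < v < d -> xic p v <= e.
Proof.
move=> e0.
have [B B0 [d1 d10 d1P]] : exists2 B : R, 0 < B & exists2 d : R, 0 < d & forall p v,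
    `|p - p0| < d -> 0 < v < d -> rQ (p ^+ 2 + v ^+ 2) <= B /\ (p0 = 0 -> rQ (p ^+ 2 + v ^+ 2) <= e).
  have c := @rQ2_continuous p0 0.
  pose B := `|rQ (p0 ^+ 2 + 0 ^+ 2)| + 1.
  exists B; first by rewrite ltr_wpDl.
  have m0 : 0 < Num.min 1 e by rewrite lt_min ltr01.
  have : nbhs (p0, 0) [set q : R * R | `|rQ (p0 ^+ 2 + 0 ^+ 2) - rQ (q.1 ^+ 2 + q.2 ^+ 2)| < Num.min 1 e].
    by move/cvgrPdist_lt : c => /(_ _ m0).
  move=> /nbhs_ballP[d /= d0 dP]; exists d => // p v pd /andP[v0 vd].
  have /= : `|rQ (p0 ^+ 2 + 0 ^+ 2) - rQ ((p, v).1 ^+ 2 + (p, v).2 ^+ 2)| < Num.min 1 e.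
    by apply: dP; split; rewrite /ball/=; [rewrite distrC|rewrite sub0r normrN gtr0_norm].
  rewrite lt_min => /andP[h1 h2]; split.
    rewrite /B; have := ler_norm (rQ (p0 ^+ 2 + 0 ^+ 2)); move: h1; rewrite ltr_norml; lra.
  by move=> E; move: h2; rewrite E expr0n addr0 rQ0 sub0r normrN => /ltW; apply: le_trans; exact: ler_norm.
have [p00|p00] := eqVneq p0 0.
  exists d1 => // p v h1 h2; have [_ /(_ p00) h] := d1P _ _ h1 h2.
  apply: le_trans h; rewrite ler_piMl ?mf_le1//.
  by apply: ltW; apply: rQ_gt0; rewrite ltr_wpDl ?sqr_ge0// exprn_gt0//; case/andP: h2.
have eB : 0 < e / B by rewrite divr_gt0.
have [M M0 hM] := mf_atan_small eB.
have np : 0 < `|p0| by rewrite normr_gt0.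
exists (Num.min d1 (Num.min (`|p0| / 2) (`|p0| / (2 * M)))).
  by rewrite !lt_min d10 !divr_gt0// mulr_gt0.
move=> p v; rewrite !lt_min => /andP[h1 /andP[h2 _]] /andP[v0 /andP[h3 /andP[_ h4]]].
have [hB _] := d1P p v h1 (introT andP (conj v0 h3)).
have q0 : 0 <= rQ (p ^+ 2 + v ^+ 2).
  by apply: ltW; apply: rQ_gt0; rewrite ltr_wpDl ?sqr_ge0// exprn_gt0.
have pp : `|p0| / 2 <= `|p|.
  by have := ler_normB p (p - p0); rewrite subKr; lra.
have Mv : M <= `|p / v|.
  rewrite normf_div (gtr0_norm v0) ler_pdivlMr//.
  have : M * v <= M * (`|p0| / (2 * M)) by rewrite ler_pM2l// ltW.
  have -> : M * (`|p0| / (2 * M)) = `|p0| / 2 by field; rewrite gt_eqF.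
  by move=> h; exact: le_trans h pp.
have -> : e = e / B * B by rewrite divfK// gt_eqF.
by apply: ler_pM => //; [exact: (mf_ge0 hP)|exact: hM].
Qed.

Lemma pi2_vth t : 0 <= t -> `|pi / 2 - vth t| <= pi / 2.
Proof.
move=> t0; have v0 : 0 <= vth t by rewrite -(profile0 hP) (profile_mono hP).
by have h := profile_lt hP t; rewrite ger0_norm; lra.
Qed.

(** The only difficulty is at v = 0, where xi and the height correction tend to 0. *)
Lemma cal_continuous : continuous cal.
Proof.
have pos p v z : 0 < v -> {for (p, v, z), continuous cal}.
  move=> v0; have c := @calp_continuous p v z v0.
  have E : cal (p, v, z) = calp p v z by rewrite /cal v0.
  suff : cal @ (p, v, z) --> cal (p, v, z) by [].
  rewrite E; apply: cvg_trans c; apply: near_eq_cvg.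
  have : \forall q \near (p, v, z), `|v - q.1.2| < v.
    have cv : {for (p, v, z), continuous (fun q : R * R * R => q.1.2)}.
      by apply: (@cont_comp _ _ _ fst snd); [exact: cvg_fst|exact: cvg_snd].
    by move/cvgrPdist_lt : cv => /(_ _ v0).
  apply: filterS => -[[p' v'] z'] /=; rewrite ltr_norml => /andP[_ h].
  by rewrite /cal; have -> : 0 < v' by lra.
move=> [[p v] z]; have [v0|v0|->] := ltgtP v 0; last first.
- apply/cvgrPdist_le => /= e e0.
  have e4 : 0 < e / 4 by rewrite divr_gt0.
  have [dJ dJ0 hJ] := Jc_small hP e4.
  have cU : {for 0, continuous (Ups mu)} by have := is_derive_Ups mu 0; exact: derive_cont.
  have : nbhs (0 : R) [set xi | `|Ups mu 0 - Ups mu xi| <= e].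
    by move/cvgrPdist_le : cU => /(_ _ e0).
  move=> /nbhs_ballP[dU /= dU0 hU].
  have m0 : 0 < Num.min dJ dU / 2 by rewrite divr_gt0// lt_min dJ0.
  have [d d0 hd] := xic_small p m0.
  (* a common bound for both half spaces *)
  have main p' v' z' z0 : `|p' - p| < d -> 0 < v' < d -> `|z0 - z'| <= e / 4 ->
      `|(0, z0) - calp p' v' z'| <= e.
    move=> h1 h2 h3; have x1 := hd p' v' h1 h2.
    have [v'0 _] := andP h2; have x0 := xic_gt0 p' v'0.
    have [xJ xU] : xic p' v' < dJ /\ xic p' v' < dU.
      apply/andP; rewrite -lt_min; apply: (le_lt_trans x1).
      by rewrite ltr_pdivrMr// ltr_pMr ?ltr1n// lt_min dJ0.
    have b1 : `|Jc mu vth (xic p' v') (tauc p' v')| <= e / 4.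
      by apply: hJ; [rewrite x0|exact: ltW (tauc_lt _ _)].
    have b2 : `|shc (xic p' v')| <= e / 4.
      by apply: hJ; [rewrite x0|apply: pi2_vth; exact: sqrtr_ge0].
    rewrite prod_normE ge_max/=; apply/andP; split.
      have := hU (xic p' v'); rewrite /ball/= Ups0; apply.
      by rewrite sub0r normrN gtr0_norm.
    have -> : z0 - (z' - Jc mu vth (xic p' v') (tauc p' v') + shc (xic p' v')) =
       (z0 - z') + (Jc mu vth (xic p' v') (tauc p' v') - shc (xic p' v')) by ring.
    apply: (le_trans (ler_normD _ _)).
    have := ler_normB (Jc mu vth (xic p' v') (tauc p' v')) (shc (xic p' v')).
    move: b1 b2 h3; move: (`|_ - shc _|) => A b1 b2 h3 h4; lra.
  have r0 : 0 < Num.min d (e / 4) by rewrite lt_min d0.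
  suff : nbhs (p, 0, z) [set q | `|cal (p, 0, z) - cal q| <= e] by [].
  apply/nbhs_ballP; exists (Num.min d (e / 4)) => // -[[p' v'] z'] [[/= hp hv] hz].
  move: hp hv hz; rewrite /ball/= !lt_min sub0r normrN => /andP[hp _] /andP[hv _] /andP[_ hz].
  rewrite distrC in hp.
  suff : `|cal (p, 0, z) - cal (p', v', z')| <= e by [].
  rewrite cal0 /cal.
  have [v'0|v'0|v'0] := ltgtP v' 0.
  + rewrite opprK.
    have -> : (0, z) + calp p' (- v') (- z') = - ((0, - z) - calp p' (- v') (- z')).
      by rewrite opprB addrC; congr (_ + _); congr pair; rewrite /= ?oppr0 ?opprK.
    rewrite normrN; apply: main => //.
      by rewrite oppr_gt0 v'0/= -(ltr0_norm v'0).
    by rewrite -opprD normrN ltW.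
  + by apply: main => //; [rewrite v'0 -(gtr0_norm v'0)|exact: ltW].
  + by rewrite prod_normE ge_max/= subrr normr0 (ltW e0)/= (le_trans (ltW hz))//; lra.
- exact: pos.
- have E : cal = (fun q => - cal (q.1.1, - q.1.2, - q.2)).
    by apply/funext => -[[p' v'] z'] /=; rewrite -calN !opprK.
  rewrite E; apply: cvgN.
  apply: (@cont_comp _ _ _ (fun q : R * R * R => (q.1.1, - q.1.2, - q.2)) cal); last first.
    by apply: pos; rewrite oppr_gt0.
  apply: cont_pair; last by apply: cvgN; exact: cvg_snd.
  apply: cont_pair; first by apply: (@cont_comp _ _ _ fst fst); [exact: cvg_fst|exact: cvg_fst].
  by apply: cvgN; apply: (@cont_comp _ _ _ fst snd); [exact: cvg_fst|exact: cvg_snd].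
Qed.

End calibration_map.

(** * The metric in corotating coordinates *)

Lemma mu_lam (R : realType) (mu : R) : 2 <= mu -> mu = lam mu ^+ 2 + 1.
Proof. by move=> m2; rewrite sqr_sqrtr; [ring|lra]. Qed.

Section orbit_space_metric.
Context {R : realType}.
Implicit Types (x p v z : R).
Variable mu : R.
Local Notation lam := (lam mu).

(** The hyperbolic metric in the coordinates (p, v, z): p and v are Cartesian coordinates,
    corotating with the screw motion, of the orthogonal projection to a totally geodesic plane. *)
Definition gpv p v (p1 v1 z1 p2 v2 z2 : R) : R :=
  (p1 - lam * z1 * v) * (p2 - lam * z2 * v) + (v1 + lam * z1 * p) * (v2 + lam * z2 * p) +
  (1 + (p ^+ 2 + v ^+ 2)) * (z1 * z2) -
  (p * p1 + v * v1) * (p * p2 + v * v2) / (1 + (p ^+ 2 + v ^+ 2)).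

(** Completing the square in the height displays an orthonormal coframe: radial, along the orbits, and
    across them. *)
Lemma gpv_polar p v (p1 v1 z1 p2 v2 z2 : R) (x := p ^+ 2 + v ^+ 2) (mu' := lam ^+ 2 + 1)
  (x1 := 2 * (p * p1 + v * v1)) (x2 := 2 * (p * p2 + v * v2))
  (t1 := (p1 * v - p * v1) / x) (t2 := (p2 * v - p * v2) / x)
  (k := lam * x / (1 + mu' * x)) :
  x != 0 -> 1 + x != 0 -> 1 + mu' * x != 0 ->
  gpv p v p1 v1 z1 p2 v2 z2 = x1 * x2 / (4 * (x * (1 + x))) +
    (1 + mu' * x) * ((z1 - k * t1) * (z2 - k * t2)) + x * (1 + x) / (1 + mu' * x) * (t1 * t2).
Proof.
rewrite /gpv /k /t1 /t2 /x1 /x2 /mu' /x => h1 h2 h3.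
have e : (p1 * v - p * v1) * (p2 * v - p * v2) + (p * p1 + v * v1) * (p * p2 + v * v2) =
   (p ^+ 2 + v ^+ 2) * (p1 * p2 + v1 * v2) by ring.
have -> : (p1 - lam * z1 * v) * (p2 - lam * z2 * v) + (v1 + lam * z1 * p) * (v2 + lam * z2 * p) =
   ((p1 * v - p * v1) * (p2 * v - p * v2) + (p * p1 + v * v1) * (p * p2 + v * v2)) / (p ^+ 2 + v ^+ 2)
   - lam * (z1 * (p2 * v - p * v2) + z2 * (p1 * v - p * v1)) + lam ^+ 2 * (p ^+ 2 + v ^+ 2) * (z1 * z2).
  by rewrite e; field.
move: (p1 * v - p * v1) (p2 * v - p * v2) (p * p1 + v * v1) (p * p2 + v * v2) (p ^+ 2 + v ^+ 2) h1 h2 h3.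
move=> a1 a2 b1 b2 x' h1 h2 h3; move: lam h3 => l h3.
by field; rewrite h1 h2 h3.
Qed.

(** Cauchy-Schwarz in the orthonormal coframe: the Jacobian of a map whose gradient lies in the
    plane orthogonal to the orbits is at most the area density. *)
Lemma jacobian_le (S W al be x1 x2 t1 t2 V1 V2 : R) : 0 < S -> 0 < W ->
  al ^+ 2 / S + be ^+ 2 * (4 * S / W) <= 1 ->
  let g a1 b1 c1 a2 b2 c2 := a1 * a2 / (4 * S) + W * (b1 * b2) + S / W * (c1 * c2) in
  ((al * t1 + be * x1) * V2 - (al * t2 + be * x2) * V1) ^+ 2 <=
  g x1 V1 t1 x1 V1 t1 * g x2 V2 t2 x2 V2 t2 - g x1 V1 t1 x2 V2 t2 ^+ 2.
Proof.
move=> S0 W0 h /=; set X := t1 * V2 - t2 * V1; set Y := x1 * V2 - x2 * V1.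
have s0 := lt0r_neq0 S0; have w0 := lt0r_neq0 W0.
have -> : (al * t1 + be * x1) * V2 - (al * t2 + be * x2) * V1 = al * X + be * Y.
  by rewrite /X /Y; ring.
set G := (X in _ <= X).
have -> : G = S * X ^+ 2 + W / (4 * S) * Y ^+ 2 + (x1 * t2 - x2 * t1) ^+ 2 / (4 * W).
  by rewrite /G /X /Y; field; rewrite s0 w0.
apply: (@le_trans _ _ (S * X ^+ 2 + W / (4 * S) * Y ^+ 2)); last first.
  by rewrite lerDl divr_ge0 ?sqr_ge0// mulr_ge0// ltW.
set D := S * X ^+ 2 + _.
have D0 : 0 <= D.
  apply: addr_ge0; apply: mulr_ge0; rewrite ?sqr_ge0 ?(ltW S0)//.
  by apply: divr_ge0; [exact: ltW|rewrite mulr_ge0// ltW].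
apply: (@le_trans _ _ ((al ^+ 2 / S + be ^+ 2 * (4 * S / W)) * D)); last by rewrite ler_piMl.
rewrite -subr_ge0.
have -> : (al ^+ 2 / S + be ^+ 2 * (4 * S / W)) * D - (al * X + be * Y) ^+ 2 =
   (W * (al * Y) - 4 * S ^+ 2 * (be * X)) ^+ 2 / (4 * S ^+ 2 * W).
  by rewrite /D; field; rewrite s0 w0.
by rewrite divr_ge0 ?sqr_ge0// mulr_ge0 ?(ltW W0)// mulr_ge0 ?sqr_ge0.
Qed.

End orbit_space_metric.

Section ball_coordinates.
Context {R : realType}.
Implicit Types (X : R * R * R).
Variables (mu eps : R).
Hypothesis m2 : 2 <= mu.
Hypothesis eps1 : eps ^+ 2 = 1.
Local Notation lam := (lam mu).

Definition del X : R := 1 - (X.1.1 ^+ 2 + X.1.2 ^+ 2 + X.2 ^+ 2).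
Definition Pz X : R := X.1.1 ^+ 2 + X.1.2 ^+ 2 + (1 + X.2) ^+ 2.
Definition Mz X : R := X.1.1 ^+ 2 + X.1.2 ^+ 2 + (1 - X.2) ^+ 2.
Definition zc X : R := (ln (Pz X) - ln (Mz X)) / 2.
Definition ac X : R := 2 * eps * X.1.1 / del X.
Definition bc X : R := 2 * eps * X.1.2 / del X.
Definition pc X : R := ac X * cos (lam * zc X) + bc X * sin (lam * zc X).
Definition vc X : R := bc X * cos (lam * zc X) - ac X * sin (lam * zc X).

Lemma del_P X : Pz X = 1 + (X.1.1 ^+ 2 + X.1.2 ^+ 2 + X.2 ^+ 2) + 2 * X.2.
Proof. by rewrite /Pz; ring. Qed.

Lemma ball_lt1 X : 0 < del X -> -1 < X.2 < 1.
Proof.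
rewrite /del => h; have := sqr_ge0 X.1.1; have := sqr_ge0 X.1.2 => h1 h2.
by apply/andP; split; nra.
Qed.

Lemma Pz_gt0 X : 0 < del X -> 0 < Pz X.
Proof.
move=> /ball_lt1/andP[h _]; rewrite ltr_wpDl ?addr_ge0 ?sqr_ge0// exprn_gt0//; lra.
Qed.

Lemma Mz_gt0 X : 0 < del X -> 0 < Mz X.
Proof.
move=> /ball_lt1/andP[_ h]; rewrite ltr_wpDl ?addr_ge0 ?sqr_ge0// exprn_gt0//; lra.
Qed.

Lemma gpv_rotate (a b c s : R) (p v x : R) (a1 b1 z1 p1 v1 a2 b2 z2 p2 v2 : R) :
  c ^+ 2 + s ^+ 2 = 1 -> p = a * c + b * s -> v = b * c - a * s -> x = a ^+ 2 + b ^+ 2 ->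
  p1 = a1 * c + b1 * s + lam * z1 * v -> v1 = b1 * c - a1 * s - lam * z1 * p ->
  p2 = a2 * c + b2 * s + lam * z2 * v -> v2 = b2 * c - a2 * s - lam * z2 * p ->
  gpv mu p v p1 v1 z1 p2 v2 z2 = a1 * a2 + b1 * b2 + (1 + x) * (z1 * z2) -
    (a * a1 + b * b1) * (a * a2 + b * b2) / (1 + x).
Proof.
move=> cs pE vE xE p1E v1E p2E v2E.
have xE' : p ^+ 2 + v ^+ 2 = x.
  rewrite pE vE xE -[RHS]mulr1 -cs; ring.
have e1 : p * p1 + v * v1 = a * a1 + b * b1.
  rewrite p1E v1E -[RHS]mulr1 -cs pE vE; ring.
have e2 : p * p2 + v * v2 = a * a2 + b * b2.
  rewrite p2E v2E -[RHS]mulr1 -cs pE vE; ring.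
rewrite /gpv xE' e1 e2; congr (_ + _ - _).
rewrite -[RHS]mulr1 -cs p1E v1E p2E v2E; ring.
Qed.

(** The metric of the ball in hyperboloid coordinates a, b, c and T, with c and T replaced by the
    height z through T + c = sqrt (1 + x) exp z. *)
Lemma ball_metric (X0 X1 X2 A0 A1 A2 B0 B1 B2 d d1 d2 P P1 P2 M M1 M2 : R) :
  d = 1 - (X0 ^+ 2 + X1 ^+ 2 + X2 ^+ 2) ->
  P = X0 ^+ 2 + X1 ^+ 2 + (1 + X2) ^+ 2 -> M = X0 ^+ 2 + X1 ^+ 2 + (1 - X2) ^+ 2 ->
  d1 = - (2 * (X0 * A0 + X1 * A1 + X2 * A2)) -> d2 = - (2 * (X0 * B0 + X1 * B1 + X2 * B2)) ->
  P1 = 2 * (X0 * A0 + X1 * A1 + (1 + X2) * A2) -> P2 = 2 * (X0 * B0 + X1 * B1 + (1 + X2) * B2) ->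
  M1 = 2 * (X0 * A0 + X1 * A1 - (1 - X2) * A2) -> M2 = 2 * (X0 * B0 + X1 * B1 - (1 - X2) * B2) ->
  d != 0 -> P != 0 -> M != 0 ->
  let a := 2 * eps * X0 / d in let b := 2 * eps * X1 / d in
  let a1 := 2 * eps * (A0 * d - X0 * d1) / d ^+ 2 in
  let b1 := 2 * eps * (A1 * d - X1 * d1) / d ^+ 2 in
  let a2 := 2 * eps * (B0 * d - X0 * d2) / d ^+ 2 in
  let b2 := 2 * eps * (B1 * d - X1 * d2) / d ^+ 2 in
  let z1 := (P1 / P - M1 / M) / 2 in let z2 := (P2 / P - M2 / M) / 2 in
  let x := a ^+ 2 + b ^+ 2 in
  4 * (A0 * B0 + A1 * B1 + A2 * B2) / d ^+ 2 =
    a1 * a2 + b1 * b2 + (1 + x) * (z1 * z2) - (a * a1 + b * b1) * (a * a2 + b * b2) / (1 + x).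
Proof.
move=> dE PE ME d1E d2E P1E P2E M1E M2E d0 P0 M0 a b a1 b1 a2 b2 z1 z2 x.
pose c := 2 * X2 / d; pose T := (2 - d) / d.
pose c1 := 2 * (A2 * d - X2 * d1) / d ^+ 2; pose T1 := - 2 * d1 / d ^+ 2.
pose c2 := 2 * (B2 * d - X2 * d2) / d ^+ 2; pose T2 := - 2 * d2 / d ^+ 2.
have Tc : d * (T + c) = P by rewrite /T /c PE {2}dE; field.
have Tc' : d * (T - c) = M by rewrite /T /c ME {2}dE; field.
have Tn : T + c != 0 by apply: contraNneq P0; rewrite -Tc => ->; rewrite mulr0.
have Tn' : T - c != 0 by apply: contraNneq M0; rewrite -Tc' => ->; rewrite mulr0.
have P1' : P1 = d1 * (T + c) + d * (T1 + c1).
  rewrite /T /c /T1 /c1 P1E; have -> : 2 * (X0 * A0 + X1 * A1 + (1 + X2) * A2) = 2 * A2 - d1 by rewrite d1E; ring.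
  by field.
have P2' : P2 = d2 * (T + c) + d * (T2 + c2).
  rewrite /T /c /T2 /c2 P2E; have -> : 2 * (X0 * B0 + X1 * B1 + (1 + X2) * B2) = 2 * B2 - d2 by rewrite d2E; ring.
  by field.
have M1' : M1 = d1 * (T - c) + d * (T1 - c1).
  rewrite /T /c /T1 /c1 M1E; have -> : 2 * (X0 * A0 + X1 * A1 - (1 - X2) * A2) = - 2 * A2 - d1 by rewrite d1E; ring.
  by field.
have M2' : M2 = d2 * (T - c) + d * (T2 - c2).
  rewrite /T /c /T2 /c2 M2E; have -> : 2 * (X0 * B0 + X1 * B1 - (1 - X2) * B2) = - 2 * B2 - d2 by rewrite d2E; ring.
  by field.
have z1E : z1 = (c1 * T - T1 * c) / ((T + c) * (T - c)).
  by rewrite /z1 P1' M1' -Tc -Tc'; field; rewrite d0 Tn Tn'.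
have z2E : z2 = (c2 * T - T2 * c) / ((T + c) * (T - c)).
  by rewrite /z2 P2' M2' -Tc -Tc'; field; rewrite d0 Tn Tn'.
have nn : X0 ^+ 2 + X1 ^+ 2 + X2 ^+ 2 = 1 - d by rewrite dE; ring.
have n1 : X0 * A0 + X1 * A1 + X2 * A2 = - (d1 / 2) by rewrite d1E; field.
have n2 : X0 * B0 + X1 * B1 + X2 * B2 = - (d2 / 2) by rewrite d2E; field.
have xE : 1 + x = (T + c) * (T - c).
  rewrite /x /a /b /T /c !exprMn exprVn eps1.
  have -> : 1 + (2 ^+ 2 * 1 * X0 ^+ 2 / d ^+ 2 + 2 ^+ 2 * 1 * X1 ^+ 2 / d ^+ 2) =
    (d ^+ 2 + 4 * (X0 ^+ 2 + X1 ^+ 2 + X2 ^+ 2) - 4 * X2 ^+ 2) / d ^+ 2 by field.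
  by rewrite nn; field.
have dotab (U0 U1 V0 V1 : R) : (2 * eps * U0) * (2 * eps * V0) + (2 * eps * U1) * (2 * eps * V1) =
    4 * (U0 * V0 + U1 * V1).
  have -> : (2 * eps * U0) * (2 * eps * V0) + (2 * eps * U1) * (2 * eps * V1) =
    4 * eps ^+ 2 * (U0 * V0 + U1 * V1) by ring.
  by rewrite eps1 mulr1.
have e1 : a * a1 + b * b1 = T * T1 - c * c1.
  have -> : a * a1 + b * b1 = ((2 * eps * X0) * (2 * eps * (A0 * d - X0 * d1)) +
     (2 * eps * X1) * (2 * eps * (A1 * d - X1 * d1))) / d ^+ 3.
    by rewrite /a /a1 /b /b1; field.
  rewrite dotab.
  have -> : 4 * (X0 * (A0 * d - X0 * d1) + X1 * (A1 * d - X1 * d1)) =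
    4 * ((X0 * A0 + X1 * A1 + X2 * A2) * d - (X0 ^+ 2 + X1 ^+ 2 + X2 ^+ 2) * d1) -
    4 * X2 * (A2 * d - X2 * d1) by ring.
  by rewrite n1 nn /T /c /T1 /c1; field.
have e2 : a * a2 + b * b2 = T * T2 - c * c2.
  have -> : a * a2 + b * b2 = ((2 * eps * X0) * (2 * eps * (B0 * d - X0 * d2)) +
     (2 * eps * X1) * (2 * eps * (B1 * d - X1 * d2))) / d ^+ 3.
    by rewrite /a /a2 /b /b2; field.
  rewrite dotab.
  have -> : 4 * (X0 * (B0 * d - X0 * d2) + X1 * (B1 * d - X1 * d2)) =
    4 * ((X0 * B0 + X1 * B1 + X2 * B2) * d - (X0 ^+ 2 + X1 ^+ 2 + X2 ^+ 2) * d2) -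
    4 * X2 * (B2 * d - X2 * d2) by ring.
  by rewrite n2 nn /T /c /T2 /c2; field.
have e3 : a1 * a2 + b1 * b2 = 4 * (A0 * B0 + A1 * B1 + A2 * B2) / d ^+ 2 - (c1 * c2 - T1 * T2).
  have -> : a1 * a2 + b1 * b2 = ((2 * eps * (A0 * d - X0 * d1)) * (2 * eps * (B0 * d - X0 * d2)) +
     (2 * eps * (A1 * d - X1 * d1)) * (2 * eps * (B1 * d - X1 * d2))) / d ^+ 4.
    by rewrite /a1 /a2 /b1 /b2; field.
  rewrite dotab.
  have -> : 4 * ((A0 * d - X0 * d1) * (B0 * d - X0 * d2) + (A1 * d - X1 * d1) * (B1 * d - X1 * d2)) =
    4 * ((A0 * B0 + A1 * B1 + A2 * B2) * d ^+ 2 - d * d2 * (X0 * A0 + X1 * A1 + X2 * A2)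
      - d * d1 * (X0 * B0 + X1 * B1 + X2 * B2) + (X0 ^+ 2 + X1 ^+ 2 + X2 ^+ 2) * d1 * d2) -
    4 * (A2 * d - X2 * d1) * (B2 * d - X2 * d2) by ring.
  by rewrite n1 n2 nn /c1 /c2 /T1 /T2; field.
rewrite e1 e2 e3 xE z1E z2E; move: Tn Tn'; move: c T c1 T1 c2 T2 {P1' P2' M1' M2' z1E z2E Tc Tc' xE e1 e2 e3} => c T c1 T1 c2 T2 Tn Tn'.
by field; rewrite Tn Tn' d0.
Qed.

(** Differentials of the coordinates along a map with components f0, f1, f2. *)
Lemma ball_coordinates_sdiff (f0 f1 f2 : R * R -> R) (w : R * R) (X := (f0 w, f1 w, f2 w))
    (a0 b0 a1 b1 a2 b2 : R) :
  0 < del X -> sdiff f0 w a0 b0 -> sdiff f1 w a1 b1 -> sdiff f2 w a2 b2 ->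
  exists p1 p2 v1 v2 z1 z2, let g := gpv mu (pc X) (vc X) in
  [/\ sdiff (fun s => pc (f0 s, f1 s, f2 s)) w p1 p2,
      sdiff (fun s => vc (f0 s, f1 s, f2 s)) w v1 v2,
      sdiff (fun s => zc (f0 s, f1 s, f2 s)) w z1 z2 &
   [/\ 4 * (a0 * a0 + a1 * a1 + a2 * a2) / del X ^+ 2 = g p1 v1 z1 p1 v1 z1,
       4 * (a0 * b0 + a1 * b1 + a2 * b2) / del X ^+ 2 = g p1 v1 z1 p2 v2 z2 &
       4 * (b0 * b0 + b1 * b1 + b2 * b2) / del X ^+ 2 = g p2 v2 z2 p2 v2 z2]].
Proof.
move=> d0 h0 h1 h2.
have dn := lt0r_neq0 d0.
have P0 := Pz_gt0 d0; have M0 := Mz_gt0 d0.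
have q0 := sdiff_sqr h0; have q1 := sdiff_sqr h1; have q2 := sdiff_sqr h2.
pose Y s : R * R * R := (f0 s, f1 s, f2 s).
pose d1 := - (2 * (f0 w * a0 + f1 w * a1 + f2 w * a2)).
pose d2 := - (2 * (f0 w * b0 + f1 w * b1 + f2 w * b2)).
pose P1 := 2 * (f0 w * a0 + f1 w * a1 + (1 + f2 w) * a2).
pose P2 := 2 * (f0 w * b0 + f1 w * b1 + (1 + f2 w) * b2).
pose M1 := 2 * (f0 w * a0 + f1 w * a1 - (1 - f2 w) * a2).
pose M2 := 2 * (f0 w * b0 + f1 w * b1 - (1 - f2 w) * b2).
have hd : sdiff (fun s => del (Y s)) w d1 d2.
  by apply: sdiff_eq (sdiffB (sdiff_cst 1 w) (sdiffD (sdiffD q0 q1) q2)) _ _; rewrite /d1 /d2; ring.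
have hP : sdiff (fun s => Pz (Y s)) w P1 P2.
  apply: sdiff_eq (sdiffD (sdiffD q0 q1) (sdiff_sqr (sdiffD (sdiff_cst 1 w) h2))) _ _;
  by rewrite /P1 /P2; ring.
have hM : sdiff (fun s => Mz (Y s)) w M1 M2.
  apply: sdiff_eq (sdiffD (sdiffD q0 q1) (sdiff_sqr (sdiffB (sdiff_cst 1 w) h2))) _ _;
  by rewrite /M1 /M2; ring.
pose z1 := (P1 / Pz X - M1 / Mz X) / 2; pose z2 := (P2 / Pz X - M2 / Mz X) / 2.
have hz : sdiff (fun s => zc (Y s)) w z1 z2.
  have hlP := sdiff_comp (is_derive1_ln P0) hP.
  have hlM := sdiff_comp (is_derive1_ln M0) hM.
  apply: (@sdiff_eqfun _ (fun s => 2^-1 * (ln (Pz (Y s)) - ln (Mz (Y s))))).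
    by move=> s; rewrite /zc mulrC.
  by apply: sdiff_eq (sdiffZ 2^-1 (sdiffB hlP hlM)) _ _; rewrite /z1 /z2 mulrC (mulrC _^-1) (mulrC _^-1).
pose A1 := 2 * eps * (a0 * del X - f0 w * d1) / del X ^+ 2.
pose A2 := 2 * eps * (b0 * del X - f0 w * d2) / del X ^+ 2.
pose B1 := 2 * eps * (a1 * del X - f1 w * d1) / del X ^+ 2.
pose B2 := 2 * eps * (b1 * del X - f1 w * d2) / del X ^+ 2.
have ha : sdiff (fun s => ac (Y s)) w A1 A2.
  apply: sdiff_eq (sdiff_div (f := fun s => 2 * eps * f0 s) (g := fun s => del (Y s)) dn (sdiffZ (2 * eps) h0) hd) _ _;
  by rewrite /A1 /A2 -/X; congr (_ / _); ring.
have hb : sdiff (fun s => bc (Y s)) w B1 B2.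
  apply: sdiff_eq (sdiff_div (f := fun s => 2 * eps * f1 s) (g := fun s => del (Y s)) dn (sdiffZ (2 * eps) h1) hd) _ _;
  by rewrite /B1 /B2 -/X; congr (_ / _); ring.
have hphi := sdiffZ lam hz.
have hc := sdiff_comp (f := fun s => lam * zc (Y s)) (is_derive_cos _) hphi.
have hs := sdiff_comp (f := fun s => lam * zc (Y s)) (is_derive_sin _) hphi.
have hp := sdiffD (sdiffM ha hc) (sdiffM hb hs).
have hv := sdiffB (sdiffM hb hc) (sdiffM ha hs).
have BM (D0 D1 D2 D0' D1' D2' : R) := @ball_metric X.1.1 X.1.2 X.2 D0 D1 D2 D0' D1' D2' (del X)
  _ _ (Pz X) _ _ (Mz X) _ _ erefl erefl erefl erefl erefl erefl erefl erefl erefl dn (lt0r_neq0 P0) (lt0r_neq0 M0).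
have cs := cos2Dsin2 (lam * zc X).
exists (A1 * cos (lam * zc X) + B1 * sin (lam * zc X) + lam * z1 * vc X).
exists (A2 * cos (lam * zc X) + B2 * sin (lam * zc X) + lam * z2 * vc X).
exists (B1 * cos (lam * zc X) - A1 * sin (lam * zc X) - lam * z1 * pc X).
exists (B2 * cos (lam * zc X) - A2 * sin (lam * zc X) - lam * z2 * pc X).
exists z1, z2 => g; split.
- by apply: sdiff_eq hp _ _; rewrite -/X /vc; ring.
- by apply: sdiff_eq hv _ _; rewrite -/X /pc; ring.
- exact: hz.
- by rewrite /g; split; rewrite (gpv_rotate cs erefl erefl erefl erefl erefl erefl erefl) BM.
Qed.

End ball_coordinates.

(** * Local area decrease of the calibration *)

Section local_cover.
Context {R : realType}.
Implicit Types (x y t xi p v z s e : R) (w : R * R).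
Local Notation leb := (@lebesgue_measure R \x @lebesgue_measure R)%E.
Variables (mu : R) (vth : R -> R).
Hypothesis hP : is_profile mu vth.
Local Notation lam := (lam mu).

(** On the level set of xi through the point, gG recovers 1 / x. *)
Lemma Kc_xic p v : 0 < v -> let x := p ^+ 2 + v ^+ 2 in
  Kc mu vth (xic vth p v) (tauc p v) = lam * x / (1 + mu * x).
Proof.
move=> v0 x; have m2 := profile_mu hP.
have x0 : 0 < x by rewrite ltr_wpDl ?sqr_ge0// exprn_gt0.
have n0 : 0 < mf vth (tauc p v) by rewrite (mf_gt0 hP)// tauc_lt.
have q0 := rQ_gt0 x0; rewrite /Kc /xic -/x.
have -> : mf vth (tauc p v) / (mf vth (tauc p v) * rQ x) = (rQ x)^-1.
  by field; rewrite (lt0r_neq0 n0) lt0r_neq0.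
have mx : 0 < 1 + mu * x by rewrite ltr_pwDl// mulr_ge0// ?(ltW x0)//; lra.
rewrite gG_rQ//; have h : mu + x^-1 = (1 + mu * x) / x by field; rewrite lt0r_neq0.
by rewrite h; field; rewrite (lt0r_neq0 x0) lt0r_neq0.
Qed.

(** Moving the angle at fixed xi: only the continuity of the rate Kc in xi is needed. *)
Lemma Jc_sdiff (X T : R * R -> R) w (a b : R) : 0 < X w -> {for w, continuous X} -> sdiff T w a b ->
  let k := Kc mu vth (X w) (T w) in
  sdiff (fun w' => Jc mu vth (X w') (T w') - Jc mu vth (X w') (T w)) w (k * a) (k * b).
Proof.
move=> x0 cX dT k eta e0.
pose C := `|a| + `|b| + 1.
have C0 : 0 < C by rewrite ltr_wpDl// addr_ge0.
have e2 : 0 < eta / (2 * C) by rewrite divr_gt0// mulr_gt0.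
have [d1 d10 hK] := Kc_jointly_continuous hP (T w) x0 e2.
have cT := sdiff_continuous dT.
have m1 : 0 < Num.min 1 (eta / 2) by rewrite lt_min ltr01 divr_gt0.
have [d2 d20 hT] := dT _ m1.
have mx : 0 < Num.min d1 (X w) by rewrite lt_min d10.
have : nbhs w [set w' | `|X w - X w'| < Num.min d1 (X w)].
  by move/cvgrPdist_lt : cX => /(_ _ mx).
move=> /nbhs_ballP[d3 /= d30 hX].
have : nbhs w [set w' | `|T w - T w'| < d1] by move/cvgrPdist_lt : cT => /(_ _ d10).
move=> /nbhs_ballP[d4 /= d40 hT'].
exists (Num.min d2 (Num.min d3 d4)); first by rewrite !lt_min d20 d30.
move=> w'; rewrite !lt_min => /and3P[u2 u3 u4] /and3P[v2 v3 v4].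
have /= := hX w'; rewrite lt_min => hXw.
have {hXw}/andP[hX1 hX2] : (`|X w - X w'| < d1) && (`|X w - X w'| < X w).
  by apply: hXw; split; rewrite /ball/= distrC.
have hT1 : `|T w - T w'| < d1 by apply: hT'; split; rewrite /ball/= distrC.
have x0' : 0 < X w' by move: hX2; rewrite ltr_norml; lra.
pose A := a * (w'.1 - w.1) + b * (w'.2 - w.2).
have hTw : `|T w' - T w - A| <= Num.min 1 (eta / 2) * (`|w'.1 - w.1| + `|w'.2 - w.2|) := hT w' u2 v2.
set D := `|w'.1 - w.1| + _ in hTw *.
have D0 : 0 <= D by rewrite addr_ge0.
have hT2 : `|T w' - T w - A| <= eta / 2 * D.
  by apply: (le_trans hTw); apply: ler_wpM2r => //; rewrite ge_min lexx orbT.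
have hT3 : `|T w' - T w| <= C * D.
  rewrite -[T w' - T w](subrK A); apply: (le_trans (ler_normD _ _)).
  have h1 : `|T w' - T w - A| <= 1 * D.
    by apply: (le_trans hTw); apply: ler_wpM2r => //; rewrite ge_min lexx.
  have h2 : `|A| <= (`|a| + `|b|) * D.
    rewrite /A (le_trans (ler_normD _ _))// !normrM /D.
    have := mulr_ge0 (normr_ge0 a) (normr_ge0 (w'.2 - w.2)).
    have := mulr_ge0 (normr_ge0 b) (normr_ge0 (w'.1 - w.1)).
    lra.
  rewrite /C mulrDl; lra.
have [c hc ->] := Jc_mvt hP (T w) (T w') x0'.
have -> : Jc mu vth (X w) (T w) - Jc mu vth (X w) (T w) = 0 by rewrite subrr.
have kc : `|Kc mu vth (X w') c - k| <= eta / (2 * C).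
  by apply: hK; [rewrite distrC|apply: (le_lt_trans hc); rewrite distrC].
have /andP[k0 k1] := Kc_itv hP (T w) x0.
have -> : Kc mu vth (X w') c * (T w' - T w) - 0 - (k * a * (w'.1 - w.1) + k * b * (w'.2 - w.2)) =
   (Kc mu vth (X w') c - k) * (T w' - T w) + k * (T w' - T w - A) by rewrite /A; ring.
apply: (le_trans (ler_normD _ _)).
rewrite (normrM (Kc mu vth (X w') c - k)) (normrM k (T w' - T w - A)).
have s1 : `|Kc mu vth (X w') c - k| * `|T w' - T w| <= eta / (2 * C) * (C * D) by apply: ler_pM.
have s2 : `|k| * `|T w' - T w - A| <= eta / 2 * D.
  by rewrite -[leRHS]mul1r; apply: ler_pM => //; rewrite ger0_norm.
have -> : eta * D = eta / (2 * C) * (C * D) + eta / 2 * D by field; rewrite gt_eqF.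
exact: lerD.
Qed.

(** Absorbing the part of the height that depends on xi alone into a shear. *)
Lemma Ups_shear xi0 t0 (sg : R) : 0 < xi0 -> sg ^+ 2 = 1 -> exists2 phi : R -> R,
  measurable_fun setT phi & forall xi, xi0 / 2 <= xi <= 2 * xi0 ->
    phi (sg * Ups mu xi) = sg * (Jc mu vth xi t0 - shc mu vth xi).
Proof.
move=> x0 sg1; have m2 := profile_mu hP.
set a := xi0 / 2; set b := 2 * xi0.
have ab : a <= b by rewrite /a /b; lra.
have a0 : 0 < a by rewrite divr_gt0.
have Uinc y y' : y < y' -> Ups mu y < Ups mu y'.
  move=> yy; have [c _ E] := @mvt_itv R (Ups mu) (ups mu) y y' (ltW yy) (fun t _ => is_derive_Ups mu t).
  by rewrite -subr_gt0 E mulr_gt0 ?subr_gt0// ups_gt0.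
have Umono : {mono Ups mu : y y' / y <= y'} by apply: le_mono => y y'; exact: Uinc.
pose inv u := xget 0 [set y | Ups mu y = u].
have invK y : inv (Ups mu y) = y.
  have h : exists y', [set y' | Ups mu y' = Ups mu y] y' by exists y.
  exact: (inc_inj Umono (xgetPex 0 h)).
have cinv : {within `[Ups mu a, Ups mu b], continuous inv}.
  apply: segment_can_le_continuous => //.
  by apply: continuous_subspaceT => y; have := is_derive_Ups mu y; exact: derive_cont.
pose psi y := Jc mu vth y t0 - shc mu vth y.
have cpsi y : 0 < y -> {for y, continuous psi}.
  move=> y0; apply: cvgB; last exact: (shc_continuous hP).
  apply: (@Jc_jointly_continuous _ _ _ hP _ (fun y => y) (fun=> t0)) => //.
  exact: cvg_cst.
pose cl := clamp (Ups mu a) (Ups mu b).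
have Uab : Ups mu a <= Ups mu b by rewrite Umono.
have c1 : continuous (inv \o cl).
  apply: (within_continuous_comp cinv); first exact: clamp_continuous.
  by move=> u; rewrite /= in_itv/=; exact: clamp_itv.
have inv_pos u : 0 < (inv \o cl) u.
  have [y _ E] : exists2 y, y \in `[a, b] & Ups mu y = cl u.
    apply: IVT => //; last by rewrite min_l// max_r// clamp_itv.
    by apply: continuous_subspaceT => y; have := is_derive_Ups mu y; exact: derive_cont.
  have hcl := clamp_itv u Uab; rewrite -/cl -E !Umono in hcl.
  by rewrite /= -E invK; case/andP: hcl => h _; exact: lt_le_trans a0 h.
exists (fun u => sg * psi ((inv \o cl) (sg * u))).
  apply: continuous_measurable_fun => u.
  apply: cvgM; first exact: cvg_cst.
  apply: (@cont_comp _ _ _ (fun u : R => (inv \o cl) (sg * u)) psi); last exact: cpsi.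
  apply: (@cont_comp _ _ _ (fun u : R => sg * u) (inv \o cl)); last exact: c1.
  by apply: cvgM; [exact: cvg_cst|exact: cvg_id].
move=> xi /andP[xa xb].
have -> : sg * (sg * Ups mu xi) = Ups mu xi by rewrite mulrA -expr2 sg1 mul1r.
have -> // : (inv \o cl) (Ups mu xi) = xi.
have E : cl (Ups mu xi) = Ups mu xi.
  by rewrite /cl /clamp (min_r (_ : Ups mu xi <= _)) ?max_r ?Umono.
by rewrite /= E invK.
Qed.

(** The calibration does not increase area, infinitesimally. *)
Lemma cal_jacobian p v (p1 v1 z1 p2 v2 z2 b : R) (x := p ^+ 2 + v ^+ 2)
    (x1 := 2 * (p * p1 + v * v1)) (x2 := 2 * (p * p2 + v * v2))
    (t1 := (p1 * v - p * v1) / x) (t2 := (p2 * v - p * v2) / x)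
    (k := lam * x / (1 + mu * x)) (g := gpv mu p v) (q : R)
    (u := ups mu (xic vth p v))
    (U1 := u * (b * t1 * rQ x + mf vth (tauc p v) * (q * x1)))
    (U2 := u * (b * t2 * rQ x + mf vth (tauc p v) * (q * x2))) :
  0 < v -> mf_slope mu (mf vth (tauc p v)) b ->
  (let kap := 4 * (x * (1 + x)) * q ^+ 2 / (1 + mu * x) in
  kap <= 25 / mu \/ exists y, [/\ 3 <= y, 4 * rQ x ^+ 2 = y ^+ 2 - 1 & kap = kfun mu y]) ->
  `|U1 * (z2 - k * t2) - U2 * (z1 - k * t1)| <=
    Num.sqrt (g p1 v1 z1 p1 v1 z1 * g p2 v2 z2 p2 v2 z2 - g p1 v1 z1 p2 v2 z2 ^+ 2).
Proof.
move=> v0 hb hq; have m2 := profile_mu hP; have mE := mu_lam m2.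
have x0 : 0 < x by rewrite ltr_wpDl ?sqr_ge0// exprn_gt0.
have S0 : 0 < x * (1 + x) by rewrite mulr_gt0// addr_gt0.
have W0 : 0 < 1 + mu * x by rewrite ltr_pwDl// mulr_ge0// ?(ltW x0)//; lra.
set N := mf vth (tauc p v) in hb.
set S := x * (1 + x) in S0 hq; set W := 1 + mu * x in W0 hq.
have hS : (u * (b * rQ x)) ^+ 2 / S + (u * (N * q)) ^+ 2 * (4 * S / W) <= 1.
  have Q2 : rQ x ^+ 2 / S <= 1 by rewrite ler_pdivrMr// mul1r; exact: rQ_sqr_le.
  have N01 : 0 <= N ^+ 2 <= 1.
    have n0 : 0 <= N := mf_ge0 hP _; have n1 : N <= 1 := mf_le1 _ _.
    by rewrite sqr_ge0 expr_le1.
  have ysE : yst (xic vth p v) ^+ 2 = 1 + 4 * (156 + N ^+ 2 * rQ x ^+ 2).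
    by rewrite yst_sqr -exprMn.
  have key := key_inequality m2 N01 (yst_ge _) ysE (sqr_ge0 _) hb hq.
  rewrite -[leRHS](ups_sqr m2 (xic vth p v)) -/u.
  have -> : (u * (b * rQ x)) ^+ 2 / S + (u * (N * q)) ^+ 2 * (4 * S / W) =
     u ^+ 2 * (N ^+ 2 * (4 * S * q ^+ 2 / W) + b ^+ 2 * (rQ x ^+ 2 / S)).
    by field; rewrite (lt0r_neq0 S0) lt0r_neq0.
  apply: ler_wpM2l; first exact: sqr_ge0.
  apply: le_trans key; rewrite lerD2l; apply: ler_piMr => //; exact: sqr_ge0.
have J := @jacobian_le R S W (u * (b * rQ x)) (u * (N * q)) x1 x2 t1 t2 (z1 - k * t1) (z2 - k * t2) S0 W0 hS.
have E := @gpv_polar R mu p v.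
rewrite -mE -/x in E.
have x1n : 1 + x != 0 by rewrite gt_eqF// addr_gt0.
rewrite -sqrtr_sqr ler_sqrt; last first.
  rewrite /g !E ?(lt0r_neq0 x0) ?(lt0r_neq0 W0)//; exact: le_trans (sqr_ge0 _) J.
rewrite /g !E ?(lt0r_neq0 x0) ?(lt0r_neq0 W0)//.
apply: le_trans J; rewrite le_eqVlt; apply/orP; left; apply/eqP.
by rewrite /U1 /U2 -/N; ring.
Qed.

(** After a shear, which preserves area, the calibration is differentiable at the point, with Jacobian
    at most the area density. *)
Lemma cal_cover (P V Z : R * R -> R) w (p1 p2 v1 v2 z1 z2 sg : R) e (g := gpv mu (P w) (V w)) :
  sdiff P w p1 p2 -> sdiff V w v1 v2 -> sdiff Z w z1 z2 -> 0 < V w -> sg ^+ 2 = 1 -> 0 < e ->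
  exists2 dl : R, 0 < dl &
    forall a b l : R, 0 < l < dl -> a <= w.1 <= a + l -> b <= w.2 <= b + l ->
    exists M : set (R * R), [/\ measurable M,
      (forall w', csq a b l w' -> M (sg *: calp mu vth (P w') (V w') (Z w'))) &
      (leb M <= ((Num.sqrt (g p1 v1 z1 p1 v1 z1 * g p2 v2 z2 p2 v2 z2 - g p1 v1 z1 p2 v2 z2 ^+ 2) + e)
         * l ^+ 2)%:E)%E].
Proof.
move=> dP dV dZ V0 sg1 e0; have m2 := profile_mu hP.
have x0 : 0 < P w ^+ 2 + V w ^+ 2 by rewrite ltr_wpDl ?sqr_ge0// exprn_gt0.
have xn := lt0r_neq0 x0; have Vn := lt0r_neq0 V0.
pose X w := xic vth (P w) (V w); pose T w := tauc (P w) (V w).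
have X0 : 0 < X w by exact: (xic_gt0 hP).
have dx := sdiffD (sdiff_sqr dP) (sdiff_sqr dV).
have dT : sdiff T w ((p1 * V w - P w * v1) / (P w ^+ 2 + V w ^+ 2))
     ((p2 * V w - P w * v2) / (P w ^+ 2 + V w ^+ 2)).
  have pv : 1 + (P w / V w) ^+ 2 = (P w ^+ 2 + V w ^+ 2) / V w ^+ 2 by field.
  apply: sdiff_eq (sdiff_comp (f := fun w => P w / V w) (is_derive1_atan _) (sdiff_div Vn dP dV)) _ _;
  by rewrite pv; field; rewrite xn Vn.
have [b db hb] := mf_derive hP (tauc_lt (P w) (V w)).
have [q dq hq] := rQ_slope m2 x0.
have dN := sdiff_comp (f := T) db dT.
have dQ := sdiff_comp (f := fun w => P w ^+ 2 + V w ^+ 2) dq dx.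
have dX : sdiff X w _ _ := sdiffM dN dQ.
have cX : {for w, continuous X} := sdiff_continuous dX.
have dU := sdiff_comp (f := X) (is_derive_Ups mu (X w)) dX.
have dJ := Jc_sdiff X0 cX dT.
have dG := sdiffZ sg (sdiffB dZ dJ).
have {dU}dU := sdiffZ sg dU.
have [dl dl0 hcov] := upper_cover dU dG e0.
have [phi mphi phiE] := @Ups_shear (X w) (T w) sg X0 sg1.
have x2 : 0 < X w / 2 by rewrite divr_gt0.
have : nbhs w [set w' | `|X w - X w'| < X w / 2] by move/cvgrPdist_lt : cX => /(_ _ x2).
move=> /sq_near[d2 d20 d2P].
exists (Num.min dl d2); first by rewrite lt_min dl0.
move=> a' b' l /andP[l0]; rewrite lt_min => /andP[l1 l2] h1 h2.
have [M [mM hM hle]] := hcov a' b' l (introT andP (conj l0 l1)) h1 h2.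
have [mM' muM'] := measure_shear2 mphi mM.
exists (shear2 phi @^-1` M); split => //.
  move=> w' hw'; have := hM w' hw'.
  have := d2P a' b' l (introT andP (conj l0 l2)) h1 h2 w' hw'.
  rewrite /= ltr_norml => /andP[r1 r2].
  have -> // : shear2 phi (sg *: calp mu vth (P w') (V w') (Z w')) =
     (sg * Ups mu (X w'), sg * (Z w' - (Jc mu vth (X w') (T w') - Jc mu vth (X w') (T w)))).
  rewrite /shear2 /calp -/(X w') -/(T w') /=; congr pair.
  have -> : sg *: Ups mu (X w') = sg * Ups mu (X w') by [].
  rewrite phiE; last by apply/andP; split; lra.
  by rewrite /GRing.scale/=; ring.
rewrite muM'; apply: (le_trans hle); rewrite lee_fin ler_pM2r ?exprn_gt0// lerD2r.
apply: le_trans (@cal_jacobian (P w) (V w) p1 v1 z1 p2 v2 z2 b q V0 hb hq).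
rewrite Kc_xic// -/(X w).
set D := (X in `|X| <= _); set D' := (X in _ <= `|X|).
have -> : D = sg ^+ 2 * D' by rewrite /D /D' -/(T w); ring.
by rewrite sg1 mul1r.
Qed.

End local_cover.

(** * Disks in the ball *)

Section components.
Context {R : realType}.
Implicit Types (u v : 'rV[R]_3) (f h : R * R -> 'rV[R]_3).

Definition i0 : 'I_3 := ord0.
Definition i1 : 'I_3 := lift ord0 ord0.
Definition i2 : 'I_3 := lift ord0 (lift ord0 ord0).
Definition tri u : R * R * R := (u ord0 i0, u ord0 i1, u ord0 i2).

Lemma ord3 (i : 'I_3) : [\/ i = i0, i = i1 | i = i2].
Proof.
by case: i => [[|[|[|//]]] h]; [apply: Or31|apply: Or32|apply: Or33]; exact/val_inj.
Qed.

Lemma dotE u v : dot u v = u ord0 i0 * v ord0 i0 + u ord0 i1 * v ord0 i1 + u ord0 i2 * v ord0 i2.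
Proof. by rewrite /dot !big_ord_recl big_ord0 addr0 addrA. Qed.

Lemma del_dot u : del (tri u) = 1 - dot u u.
Proof. by rewrite dotE /del /= !expr2. Qed.

Lemma cont_inv (T : topologicalType) (f : T -> R) t : f t != 0 -> {for t, continuous f} ->
  {for t, continuous (fun s => (f s)^-1)}.
Proof. by move=> f0 cf; apply: cvgV. Qed.

Lemma hyp3_del u : hyp3 R u <-> 0 < del (tri u).
Proof. by rewrite del_dot subr_gt0. Qed.

Lemma component_continuous (T : topologicalType) (g : T -> 'rV[R]_3) t i :
  {for t, continuous g} -> {for t, continuous (fun t => g t ord0 i)}.
Proof.
move=> cg; apply: (@cont_comp _ _ _ g (fun u : 'rV[R]_3 => u ord0 i)) => //.
exact: coord_continuous.
Qed.

Lemma row_continuous (T : topologicalType) (g : T -> 'rV[R]_3) t :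
  (forall i, {for t, continuous (fun t => g t ord0 i)}) -> {for t, continuous g}.
Proof.
move=> c; apply/cvg_ballP => e e0.
have h i : \forall s \near t, `|g t ord0 i - g s ord0 i| < e.
  by move/cvgrPdist_lt : (c i) => /(_ _ e0).
near=> s; split=> // a b; rewrite ord1 /ball/=.
by case: (ord3 b) => ->; near: s; exact: h.
Unshelve. all: by end_near. Qed.

Lemma dot_continuous (T : topologicalType) (f g : T -> 'rV[R]_3) t :
  {for t, continuous f} -> {for t, continuous g} -> {for t, continuous (fun t => dot (f t) (g t))}.
Proof.
move=> cf cg; have -> : (fun t => dot (f t) (g t)) = (fun t => f t ord0 i0 * g t ord0 i0 +
   f t ord0 i1 * g t ord0 i1 + f t ord0 i2 * g t ord0 i2) by apply/funext => s; exact: dotE.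
by do !apply: cvgD; apply: cvgM; apply: component_continuous.
Qed.

Lemma partial1_component f w i : derivable f w (1, 0) ->
  derivable (fun s => f s ord0 i) w (1, 0) /\ 'D_(1, 0) (fun s => f s ord0 i) w = partial1 f w ord0 i.
Proof.
move=> df; split; first by move/derivable_mxP : df; exact.
by rewrite /partial1 derive_mx// mxE.
Qed.

Lemma partial2_component f w i : derivable f w (0, 1) ->
  derivable (fun s => f s ord0 i) w (0, 1) /\ 'D_(0, 1) (fun s => f s ord0 i) w = partial2 f w ord0 i.
Proof.
move=> df; split; first by move/derivable_mxP : df; exact.
by rewrite /partial2 derive_mx// mxE.
Qed.

Lemma Ck1_sdiff f (O : set (R * R)) w i : open O -> Ck 1 O f -> O w ->
  sdiff (fun s => f s ord0 i) w (partial1 f w ord0 i) (partial2 f w ord0 i).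
Proof.
move=> oO [df c1 c2] Ow.
have [d1 E1] := partial1_component i (df w Ow).1.
have [d2 E2] := partial2_component i (df w Ow).2.
rewrite -E1 -E2; apply: (C1_sdiff oO Ow).
- move=> s Os; split; first exact: (partial1_component i (df s Os).1).1.
  exact: (partial2_component i (df s Os).2).1.
- have h : {for w, continuous (fun s => partial1 f s ord0 i)} by apply: component_continuous; exact: c1.
  suff : 'D_(1, 0) (fun s => f s ord0 i) @ w --> 'D_(1, 0) (fun s => f s ord0 i) w by [].
  rewrite E1; apply: cvg_trans h; apply: near_eq_cvg.
  have : \forall s \near w, O s by exact: open_nbhs_nbhs.
  by apply: filterS => s Os; rewrite (partial1_component i (df s Os).1).2.
- have h : {for w, continuous (fun s => partial2 f s ord0 i)} by apply: component_continuous; exact: c2.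
  suff : 'D_(0, 1) (fun s => f s ord0 i) @ w --> 'D_(0, 1) (fun s => f s ord0 i) w by [].
  rewrite E2; apply: cvg_trans h; apply: near_eq_cvg.
  have : \forall s \near w, O s by exact: open_nbhs_nbhs.
  by apply: filterS => s Os; rewrite (partial2_component i (df s Os).2).2.
Qed.

Lemma Ck1_continuous f (O : set (R * R)) w : open O -> Ck 1 O f -> O w -> {for w, continuous f}.
Proof.
move=> oO hf Ow; apply: row_continuous => i.
exact: sdiff_continuous (Ck1_sdiff i oO hf Ow).
Qed.

Lemma open_disk_open : open (open_disk R).
Proof.
have c : continuous (fun p : R * R => p.1 ^+ 2 + p.2 ^+ 2).
  move=> p; apply: cvgD.
    by apply: (@cont_comp _ _ _ fst (fun x : R => x ^+ 2)); [exact: cvg_fst|exact: exprn_continuous].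
  by apply: (@cont_comp _ _ _ snd (fun x : R => x ^+ 2)); [exact: cvg_snd|exact: exprn_continuous].
by move/continuousP : c => /(_ [set x | x < 1] (@open_lt R 1)).
Qed.

Lemma area_density_continuous f (O : set (R * R)) w : open O -> Ck 1 O f -> O w -> hyp3 R (f w) ->
  {for w, continuous (area_density f)}.
Proof.
move=> oO hf Ow hw; have [_ c1 c2] := hf; have cf := Ck1_continuous oO hf Ow.
have n0 : (1 - dot (f w) (f w)) ^+ 2 != 0 by rewrite gt_eqF// exprn_gt0// subr_gt0.
have cd : {for w, continuous (fun s => ((1 - dot (f s) (f s)) ^+ 2)^-1)}.
  apply: cvgV => //; apply: (@cont_comp _ _ _ (fun s => 1 - dot (f s) (f s)) (fun x : R => x ^+ 2)).
    by apply: cvgB; [exact: cvg_cst|exact: dot_continuous].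
  exact: exprn_continuous.
have cm a b : {for w, continuous a} -> {for w, continuous b} ->
    {for w, continuous (fun s => hyp_metric (f s) (a s) (b s))}.
  move=> ca cb; apply: cvgM => //; apply: cvgM; first exact: cvg_cst.
  exact: dot_continuous.
have d1 := c1 w Ow; have d2 := c2 w Ow.
apply: (@cont_comp _ _ _ (fun s => hyp_metric (f s) (partial1 f s) (partial1 f s) *
   hyp_metric (f s) (partial2 f s) (partial2 f s) - hyp_metric (f s) (partial1 f s) (partial2 f s) ^+ 2)
   Num.sqrt); last exact: sqrt_continuous.
apply: cvgB; first by apply: cvgM; exact: cm.
apply: (@cont_comp _ _ _ (fun s => hyp_metric (f s) (partial1 f s) (partial2 f s)) (fun x : R => x ^+ 2)).
  exact: cm.
exact: exprn_continuous.
Qed.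

Lemma area_density_ge0 f w : 0 <= area_density f w.
Proof. exact: sqrtr_ge0. Qed.

End components.

Section calibration_of_disk.
Context {R : realType}.
Local Notation leb := (@lebesgue_measure R \x @lebesgue_measure R)%E.
Variables (mu : R) (vth : R -> R) (eps : R).
Hypothesis hP : is_profile mu vth.
Hypothesis eps1 : eps ^+ 2 = 1.

Definition pvz (u : 'rV[R]_3) : R * R * R :=
  (pc mu eps (tri u), vc mu eps (tri u), zc (tri u)).
Definition Phi (u : 'rV[R]_3) : R * R := cal mu vth (pvz u).

Lemma cal_posE (q : R * R * R) : 0 < q.1.2 -> cal mu vth q = calp mu vth q.1.1 q.1.2 q.2.
Proof. by case: q => -[p v] z /= ->. Qed.

Lemma cal_negE (q : R * R * R) : q.1.2 < 0 -> cal mu vth q = - calp mu vth q.1.1 (- q.1.2) (- q.2).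
Proof. by case: q => -[p v] z /= v0; rewrite v0 ltNge (ltW v0). Qed.

Lemma cal_zeroE (q : R * R * R) : q.1.2 = 0 -> cal mu vth q = (0, q.2).
Proof. by case: q => -[p v] z /= ->; rewrite ltxx. Qed.

Lemma zc_continuous (u : 'rV[R]_3) : 0 < Pz (tri u) -> 0 < Mz (tri u) ->
  {for u, continuous (fun u : 'rV[R]_3 => zc (tri u))}.
Proof.
move=> P0 M0.
have c i : {for u, continuous (fun u : 'rV[R]_3 => u ord0 i)} by exact: coord_continuous.
have cs i : {for u, continuous (fun u : 'rV[R]_3 => u ord0 i ^+ 2)}.
  by apply: (@cont_comp _ _ _ (fun u : 'rV[R]_3 => u ord0 i) (fun x : R => x ^+ 2)); [exact: c|exact: exprn_continuous].
have c2 (b : R) : {for u, continuous (fun u : 'rV[R]_3 => u ord0 i0 ^+ 2 + u ord0 i1 ^+ 2 + (1 + b * u ord0 i2) ^+ 2)}.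
  have cb : {for u, continuous (fun u : 'rV[R]_3 => (1 + b * u ord0 i2) ^+ 2)}.
    apply: (@cont_comp _ _ _ (fun u : 'rV[R]_3 => 1 + b * u ord0 i2) (fun x : R => x ^+ 2)).
      exact: (cvgD (cvg_cst _) (cvgM (cvg_cst _) (c i2))).
    exact: exprn_continuous.
  exact: (cvgD (cvgD (cs i0) (cs i1)) cb).
have cP : {for u, continuous (fun u => ln (Pz (tri u)))}.
  apply: (@cont_comp _ _ _ (fun u => Pz (tri u)) (@ln R)); last exact: continuous_ln.
  have -> : (fun u => Pz (tri u)) = (fun u : 'rV[R]_3 => u ord0 i0 ^+ 2 + u ord0 i1 ^+ 2 + (1 + 1 * u ord0 i2) ^+ 2).
    by apply/funext => s; rewrite mul1r.
  exact: c2.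
have cM : {for u, continuous (fun u => ln (Mz (tri u)))}.
  apply: (@cont_comp _ _ _ (fun u => Mz (tri u)) (@ln R)); last exact: continuous_ln.
  have -> : (fun u => Mz (tri u)) = (fun u : 'rV[R]_3 => u ord0 i0 ^+ 2 + u ord0 i1 ^+ 2 + (1 + (-1) * u ord0 i2) ^+ 2).
    by apply/funext => s; rewrite mulN1r.
  exact: c2.
exact: (cvgM (cvgB cP cM) (cvg_cst _)).
Qed.

Lemma pvz_continuous u : hyp3 R u -> {for u, continuous pvz}.
Proof.
move=> /hyp3_del d0.
have c i : {for u, continuous (fun u : 'rV[R]_3 => u ord0 i)} by exact: coord_continuous.
have cs i : {for u, continuous (fun u : 'rV[R]_3 => u ord0 i ^+ 2)}.
  by apply: (@cont_comp _ _ _ (fun u : 'rV[R]_3 => u ord0 i) (fun x : R => x ^+ 2)); [exact: c|exact: exprn_continuous].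
have cz : {for u, continuous (fun u : 'rV[R]_3 => zc (tri u))}.
  by apply: zc_continuous; [exact: Pz_gt0|exact: Mz_gt0].
have cdel : {for u, continuous (fun u => del (tri u))}.
  exact: (cvgB (cvg_cst _) (cvgD (cvgD (cs i0) (cs i1)) (cs i2))).
have cd := cont_inv (f := fun u => del (tri u)) (lt0r_neq0 d0) cdel.
have ca : {for u, continuous (fun u => ac eps (tri u))}.
  exact: (cvgM (cvgM (cvg_cst _) (c i0)) cd).
have cb : {for u, continuous (fun u => bc eps (tri u))}.
  exact: (cvgM (cvgM (cvg_cst _) (c i1)) cd).
have cl : {for u, continuous (fun u => lam mu * zc (tri u))} by exact: (cvgM (cvg_cst _) cz).
have ccos : {for u, continuous (fun u => cos (lam mu * zc (tri u)))}.
  by apply: (@cont_comp _ _ _ (fun u => lam mu * zc (tri u)) cos) => //; exact: continuous_cos.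
have csin : {for u, continuous (fun u => sin (lam mu * zc (tri u)))}.
  by apply: (@cont_comp _ _ _ (fun u => lam mu * zc (tri u)) sin) => //; exact: continuous_sin.
apply: cont_pair => //; apply: cont_pair.
  exact: (cvgD (cvgM ca ccos) (cvgM cb csin)).
exact: (cvgB (cvgM cb ccos) (cvgM ca csin)).
Qed.

Lemma Phi_continuous u : hyp3 R u -> {for u, continuous Phi}.
Proof.
move=> hu; apply: (@cont_comp _ _ _ pvz (cal mu vth)); first exact: pvz_continuous.
exact: (cal_continuous hP).
Qed.

(** The pulled-back metric, computed in the coordinates (p, v, z). *)
Lemma disk_coordinates (h : R * R -> 'rV[R]_3) (O : set (R * R)) w :
  open O -> Ck 1 O h -> O w -> hyp3 R (h w) ->
  exists p1 p2 v1 v2 z1 z2, let g := gpv mu (pvz (h w)).1.1 (pvz (h w)).1.2 in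
  [/\ sdiff (fun s => (pvz (h s)).1.1) w p1 p2, sdiff (fun s => (pvz (h s)).1.2) w v1 v2,
      sdiff (fun s => (pvz (h s)).2) w z1 z2 &
      area_density h w =
        Num.sqrt (g p1 v1 z1 p1 v1 z1 * g p2 v2 z2 p2 v2 z2 - g p1 v1 z1 p2 v2 z2 ^+ 2)].
Proof.
move=> oO hf Ow /hyp3_del d0.
have s0 := Ck1_sdiff i0 oO hf Ow; have s1 := Ck1_sdiff i1 oO hf Ow; have s2 := Ck1_sdiff i2 oO hf Ow.
have [p1 [p2 [v1 [v2 [z1 [z2 /= [hp hv hz [E F G]]]]]]]] :=
  ball_coordinates_sdiff mu eps1 d0 s0 s1 s2.
exists p1, p2, v1, v2, z1, z2; split => //.
have gE u u' : hyp_metric (h w) u u' =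
    4 * (u ord0 i0 * u' ord0 i0 + u ord0 i1 * u' ord0 i1 + u ord0 i2 * u' ord0 i2) / del (tri (h w)) ^+ 2.
  by rewrite /hyp_metric -del_dot dotE.
have E' := etrans (gE _ _) E; have F' := etrans (gE _ _) F; have G' := etrans (gE _ _) G.
suff H : forall a b c a' b' c' : R, a = a' -> b = b' -> c = c' ->
    Num.sqrt (a * c - b ^+ 2) = Num.sqrt (a' * c' - b' ^+ 2) by exact: (H _ _ _ _ _ _ E' F' G').
by move=> a b c a' b' c' -> -> ->.
Qed.

(** The surface v = 0 is mapped to the line with first coordinate 0, which is negligible, and each open
    side to an open half plane, on which the local estimates apply. *)
Lemma Phi_area_le (h : R * R -> 'rV[R]_3) : Ck 1 (open_disk R) h ->
  (forall w, open_disk R w -> hyp3 R (h w)) ->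
  (leb ((Phi \o h) @` open_disk R) <= area h)%E.
Proof.
move=> hC hh; set D := open_disk R; have oD : open D := open_disk_open.
pose F := Phi \o h; pose q w := pvz (h w).
have ch w : D w -> {for w, continuous h} by exact: Ck1_continuous.
have cF w : D w -> {for w, continuous F}.
  by move=> Dw; apply: (@cont_comp _ _ _ h Phi); [exact: ch|apply: Phi_continuous; exact: hh].
have cv w : D w -> {for w, continuous (fun w => (q w).1.2)}.
  move=> Dw; apply: (@cont_comp _ _ _ (fun w => (q w).1) snd); last exact: cvg_snd.
  apply: (@cont_comp _ _ _ q fst); last exact: cvg_fst.
  by apply: (@cont_comp _ _ _ h pvz); [exact: ch|apply: pvz_continuous; exact: hh].
pose Op := [set w | D w /\ 0 < (q w).1.2].
pose Om := [set w | D w /\ (q w).1.2 < 0].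
have oOp : open Op.
  rewrite openE => w [Dw vw]; rewrite /interior.
  have h1 : \forall s \near w, D s by exact: open_nbhs_nbhs.
  have h2 : \forall s \near w, `|(q w).1.2 - (q s).1.2| < (q w).1.2.
    by move/cvgrPdist_lt : (cv w Dw) => /(_ _ vw).
  near=> s; split; first by near: s.
  have : `|(q w).1.2 - (q s).1.2| < (q w).1.2 by near: s.
  by rewrite ltr_norml; lra.
have oOm : open Om.
  rewrite openE => w [Dw vw]; rewrite /interior.
  have vw' : 0 < - (q w).1.2 by rewrite oppr_gt0.
  have h1 : \forall s \near w, D s by exact: open_nbhs_nbhs.
  have h2 : \forall s \near w, `|(q w).1.2 - (q s).1.2| < - (q w).1.2.
    by move/cvgrPdist_lt : (cv w Dw) => /(_ _ vw').
  near=> s; split; first by near: s.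
  have : `|(q w).1.2 - (q s).1.2| < - (q w).1.2 by near: s.
  by rewrite ltr_norml; lra.
have cdens w : D w -> {for w, continuous (area_density h)}.
  by move=> Dw; exact: (area_density_continuous oD hC Dw (hh w Dw)).
(* each open half contributes at most its area *)
have half (O : set (R * R)) (sg : R) : O `<=` D -> open O -> sg ^+ 2 = 1 ->
    (forall w, O w -> 0 < sg * (q w).1.2 /\
       F w = sg *: calp mu vth (q w).1.1 (sg * (q w).1.2) (sg * (q w).2)) ->
    (leb (F @` O) <= \int[leb]_(z in O) (area_density h z)%:E)%E.
  move=> OD oO sg1 hO; apply: area_open_le => //.
  - by move=> w /OD; exact: cF.
  - by move=> w /OD; exact: cdens.
  - by move=> w _; exact: area_density_ge0.
  move=> w e Ow e0; have Dw := OD _ Ow; have [v0 _] := hO w Ow.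
  have [p1 [p2 [v1 [v2 [z1 [z2 /= [hp hv hz ->]]]]]]] := disk_coordinates oD hC Dw (hh w Dw).
  have [d d0 dP] := cal_cover hP hp (sdiffZ sg hv) (sdiffZ sg hz) v0 sg1 e0.
  have : nbhs w [set s | O s] by exact: open_nbhs_nbhs.
  move=> /sq_near[d' d'0 d'P].
  exists (Num.min d d'); first by rewrite lt_min d0.
  move=> a b l /andP[l0]; rewrite lt_min => /andP[l1 l2] h1 h2.
  have [M [mM hM le]] := dP a b l (introT andP (conj l0 l1)) h1 h2.
  exists M; split => //.
    move=> s hs; have Os : O s by exact: (d'P a b l (introT andP (conj l0 l2)) h1 h2 s hs).
    by have [_ ->] := hO s Os; exact: hM.
  apply: le_trans le _; rewrite lee_fin ler_pM2r ?exprn_gt0// lerD2r.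
  rewrite le_eqVlt; apply/orP; left; apply/eqP; congr Num.sqrt.
  set p := pc _ _ _; set v := vc _ _ _.
  have sgi a1 b1 c1 a2 b2 c2 : gpv mu p (sg * v) a1 (sg * b1) (sg * c1) a2 (sg * b2) (sg * c2) =
     gpv mu p v a1 b1 c1 a2 b2 c2.
    have /eqP := sg1; rewrite sqrf_eq1 => /orP[]/eqP ->; rewrite /gpv ?mul1r ?mulN1r ?sqrrN//.
    congr (_ - _ / _); last by ring.
    ring.
  by rewrite !sgi.
have hp : (leb (F @` Op) <= \int[leb]_(z in Op) (area_density h z)%:E)%E.
  apply: (half Op 1) => //; [by move=> w []|by rewrite expr1n|].
  move=> w [Dw vw]; rewrite !mul1r scale1r; split => //.
  exact: cal_posE.
have hm : (leb (F @` Om) <= \int[leb]_(z in Om) (area_density h z)%:E)%E.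
  apply: (half Om (-1)) => //; [by move=> w []|by rewrite sqrrN expr1n|].
  move=> w [Dw vw]; rewrite !mulN1r scaleN1r oppr_gt0; split => //.
  exact: cal_negE.
pose N := [set 0 : R] `*` [set: R].
have mN : measurable N by apply: measurableX.
have N0 : leb N = 0%E by rewrite product_measure1E//= lebesgue_measure_set1 mul0e.
have mI (O : set (R * R)) : O `<=` D -> open O -> measurable (F @` O).
  move=> OD oO; have cO w : O w -> {for w, continuous F} by move=> /OD; exact: cF.
  exact: (image_open_measurable 0 0 oO cO (@ltr01 R)).1.
have mp : measurable (F @` Op) by apply: mI => // w [].
have mm : measurable (F @` Om) by apply: mI => // w [].
have mD : measurable (F @` D) by exact: mI.
have sub : F @` D `<=` (F @` Op `|` F @` Om) `|` N.
  move=> _ [w Dw <-]; have [v0|v0|v0] := ltgtP (q w).1.2 0.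
  - by left; right; exists w.
  - by left; left; exists w.
  - by right; rewrite /F /comp /Phi (cal_zeroE v0).
have mU : measurable (F @` Op `|` F @` Om) by exact: measurableU.
apply: (@le_trans _ _ (leb ((F @` Op `|` F @` Om) `|` N))).
  by apply: le_measure; rewrite ?inE//; exact: measurableU.
have u1 : (leb ((F @` Op `|` F @` Om) `|` N) <= leb (F @` Op `|` F @` Om) + leb N)%E.
  by apply: measureU2.
have u2 : (leb (F @` Op `|` F @` Om) <= leb (F @` Op) + leb (F @` Om))%E by apply: measureU2.
apply: (le_trans u1); rewrite N0 adde0; apply: (le_trans u2).
apply: (le_trans (leeD hp hm)).
have mOp : measurable Op by exact: open_measurable2.
have mOm : measurable Om by exact: open_measurable2.
have mdens (O : set (R * R)) : O `<=` D -> measurable O -> measurable_fun O (EFin \o area_density h).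
  by move=> OD mO; apply: (dens_measurable oD cdens mO OD).
have dj : [disjoint Op & Om].
  by apply/disj_setPS => w [[_ h1] [_ h2]]; move: (lt_trans h1 h2); rewrite ltxx.
have nn w : (0 <= (area_density h w)%:E)%E by rewrite lee_fin area_density_ge0.
rewrite -ge0_integral_setU//.
  apply: ge0_subset_integral => //; [exact: measurableU|exact: open_measurable2| |by move=> w [[]|[]]].
  by apply: mdens => //; exact: open_measurable2.
by apply: mdens; [by move=> w [[]|[]]|exact: measurableU].
Unshelve. all: by end_near. Qed.

End calibration_of_disk.

(** * Immersions and smooth maps *)

Section differential.
Context {R : realType}.
Implicit Types (A B : 'rV[R]_3) (f : R * R -> 'rV[R]_3).

Definition lin2 A B (u : R * R) : 'rV[R]_3 := u.1 *: A + u.2 *: B.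

Fact lin2_linear A B : linear (lin2 A B).
Proof.
move=> a u v; rewrite /lin2 /= scalerDr !scalerA !scalerDl -!scalerA.
by rewrite addrACA.
Qed.

HB.instance Definition _ A B := GRing.isLinear.Build R (R * R)%type 'rV[R]_3 *:%R (lin2 A B) (lin2_linear A B).

Lemma row_norm_le A (r : R) : (forall i, `|A ord0 i| <= r) -> `|A| <= r.
Proof.
move=> h; apply/ler_addgt0Pr => d d0.
have r0 : 0 < r + d by rewrite (le_lt_trans (le_trans (normr_ge0 _) (h ord0)))// ltrDl.
have : ball (0 : 'rV[R]_3) (r + d) A.
  split => // a b; rewrite ord1 /ball/= mxE sub0r normrN.
  by rewrite (le_lt_trans (h b))// ltrDl.
by rewrite -ball_normE /= sub0r normrN => /ltW.
Qed.

(** Componentwise differentials assemble into the differential of the map. *)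
Lemma sdiff_diff f w A B :
  (forall i, sdiff (fun s => f s ord0 i) w (A ord0 i) (B ord0 i)) ->
  differentiable f w /\ forall u, 'd f w u = u.1 *: A + u.2 *: B.
Proof.
move=> h.
have cL : continuous (lin2 A B).
  move=> u; apply: cvgD; apply: cvgZ; try exact: cvg_cst; [exact: cvg_fst|exact: cvg_snd].
have fo : f \o shift w = cst (f w) + lin2 A B +o_ (0 : R * R) id.
  apply/eqaddoP => e e0.
  have e2 : 0 < e / 2 by rewrite divr_gt0.
  have hi i : \forall s \near (0 : R * R), `|f (s + w) ord0 i - f w ord0 i -
      (A ord0 i * s.1 + B ord0 i * s.2)| <= e * `|s|.
    have [d d0 dP] := h i _ e2.
    suff : nbhs (0 : R * R) [set s | `|f (s + w) ord0 i - f w ord0 i -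
      (A ord0 i * s.1 + B ord0 i * s.2)| <= e * `|s|] by [].
    apply/nbhs_ballP; exists d => // s [/= b1 b2].
    move: b1 b2; rewrite /ball/= !sub0r !normrN => b1 b2.
    have := dP (s + w); rewrite /= !addrK => /(_ b1 b2)/le_trans; apply.
    have n1 : `|s.1| <= `|s| by rewrite prod_normE le_max lexx.
    have n2 : `|s.2| <= `|s| by rewrite prod_normE le_max lexx orbT.
    apply: (@le_trans _ _ (e / 2 * (`|s| + `|s|))); last by lra.
    by apply: ler_wpM2l; [exact: ltW|exact: lerD].
  near=> s; apply: row_norm_le => i.
  have -> : ((f \o shift w) - (cst (f w) + lin2 A B)) s ord0 i =
     f (s + w) ord0 i - f w ord0 i - (A ord0 i * s.1 + B ord0 i * s.2).
    by rewrite !fctE /= /lin2 !mxE opprD addrA (mulrC s.1) (mulrC s.2).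
  by case: (ord3 i) => ->; near: s; exact: hi.
have E := diff_unique cL fo.
split; last by move=> u; rewrite E.
by apply/diff_locallyP; rewrite E.
Unshelve. all: by end_near. Qed.

Lemma Ck1_diff f (O : set (R * R)) w : open O -> Ck 1 O f -> O w ->
  differentiable f w /\ forall u, 'd f w u = u.1 *: partial1 f w + u.2 *: partial2 f w.
Proof. by move=> oO hf Ow; apply: sdiff_diff => i; exact: Ck1_sdiff oO hf Ow. Qed.

Lemma immersion_partials f (O : set (R * R)) w : open O -> Ck 1 O f -> O w ->
  injective ('d f w) <-> (forall a b : R, a *: partial1 f w + b *: partial2 f w = 0 -> a = 0 /\ b = 0).
Proof.
move=> oO hf Ow; have [df dE] := Ck1_diff oO hf Ow; split => [inj a b h|h u v].
  have : 'd f w (a, b) = 'd f w 0 by rewrite linear0 dE.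
  by move=> /inj[].
move=> uv; have : 'd f w (u - v) = 0 by rewrite linearB /= uv subrr.
rewrite dE => /h[/eqP h1 /eqP h2]; move: h1 h2; rewrite !subr_eq0 => /eqP h1 /eqP h2.
by rewrite [u]surjective_pairing [v]surjective_pairing h1 h2.
Qed.

Lemma dot_ge0 A : 0 <= dot A A.
Proof. by rewrite dotE -!expr2 !addr_ge0 ?sqr_ge0. Qed.

Lemma dot_eq0 A : dot A A = 0 -> A = 0.
Proof.
rewrite dotE -!expr2 => h.
have s0 := sqr_ge0 (A ord0 i0); have s1 := sqr_ge0 (A ord0 i1); have s2 := sqr_ge0 (A ord0 i2).
apply/rowP => i; rewrite mxE.
by case: (ord3 i) => ->; apply/eqP; rewrite -sqrf_eq0 eq_le; apply/andP; split => //; lra.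
Qed.

Lemma dot_combination A B (a b : R) : dot (a *: A + b *: B) (a *: A + b *: B) =
  a ^+ 2 * dot A A + 2 * a * b * dot A B + b ^+ 2 * dot B B.
Proof. by rewrite !dotE !mxE; ring. Qed.

(** Equality case of Cauchy-Schwarz. *)
Lemma area_density_gt0 f w : hyp3 R (f w) ->
  (forall a b : R, a *: partial1 f w + b *: partial2 f w = 0 -> a = 0 /\ b = 0) ->
  0 < area_density f w.
Proof.
move=> hw indep; rewrite /area_density /hyp_metric.
set A := partial1 f w in indep *; set B := partial2 f w in indep *.
have d0 : 0 < (1 - dot (f w) (f w)) ^+ 2 by rewrite exprn_gt0// subr_gt0.
set d := (1 - _) ^+ 2 in d0 *.
have e1 (a b c : R) : 4 * a / d * (4 * c / d) - (4 * b / d) ^+ 2 = 16 / d ^+ 2 * (a * c - b ^+ 2).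
  by field; rewrite gt_eqF.
have e2 (a b c : R) : c ^+ 2 * a + 2 * c * - b * b + (- b) ^+ 2 * c = c * (a * c - b ^+ 2) by ring.
rewrite e1.
rewrite sqrtr_gt0; apply: mulr_gt0.
  by apply: divr_gt0 => //; exact: exprn_gt0.
have BB : 0 < dot B B.
  rewrite lt_neqAle dot_ge0 andbT eq_sym; apply/eqP => /dot_eq0 B0.
  by have := indep 0 1; rewrite B0 scale0r scaler0 addr0 => /(_ erefl)[_ /eqP]; rewrite oner_eq0.
have h := dot_combination A B (dot B B) (- dot A B).
rewrite e2 in h.
have : 0 < dot B B * (dot A A * dot B B - dot A B ^+ 2).
  rewrite -h lt_neqAle dot_ge0 andbT eq_sym.
  by apply/eqP => /dot_eq0/indep[/eqP]; rewrite gt_eqF.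
by rewrite (pmulr_rgt0 _ BB).
Qed.

End differential.

Section smooth_functions.
Context {R : realType}.
Implicit Types (f g : R * R -> R).

Definition partials f (f1 f2 : R * R -> R) :=
  forall p, sdiff f p (f1 p) (f2 p).

Fixpoint Cs (k : nat) f : Prop := match k with
  | 0 => continuous f
  | k'.+1 => exists f1 f2, [/\ partials f f1 f2, Cs k' f1 & Cs k' f2]
  end.

Lemma partials_continuous f f1 f2 : partials f f1 f2 -> continuous f.
Proof. by move=> h p; exact: sdiff_continuous (h p). Qed.

Lemma CsW k f : Cs k.+1 f -> Cs k f.
Proof.
elim: k f => [|k IH] f [f1 [f2 [h h1 h2]]]; first exact: partials_continuous h.
by exists f1, f2; split => //; exact: IH.
Qed.

Lemma Cs_cst (c : R) k : Cs k (fun=> c).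
Proof.
elim: k c => [|k IH] c; first by move=> p; exact: cvg_cst.
by exists (fun=> 0), (fun=> 0); split => // p; exact: sdiff_cst.
Qed.

Lemma Cs_fst k : Cs k fst.
Proof.
case: k => [|k]; first by move=> p; exact: cvg_fst.
by exists (fun=> 1), (fun=> 0); split; [move=> p; exact: sdiff_fst|exact: Cs_cst|exact: Cs_cst].
Qed.

Lemma Cs_snd k : Cs k snd.
Proof.
case: k => [|k]; first by move=> p; exact: cvg_snd.
by exists (fun=> 0), (fun=> 1); split; [move=> p; exact: sdiff_snd|exact: Cs_cst|exact: Cs_cst].
Qed.

Lemma CsD k f g : Cs k f -> Cs k g -> Cs k (fun p => f p + g p).
Proof.
elim: k f g => [|k IH] f g; first by move=> cf cg p; exact: (cvgD (cf p) (cg p)).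
move=> [f1 [f2 [h h1 h2]]] [g1 [g2 [h' h1' h2']]].
exists (fun p => f1 p + g1 p), (fun p => f2 p + g2 p).
by split; [move=> p; exact: sdiffD|exact: IH|exact: IH].
Qed.

Lemma CsM k f g : Cs k f -> Cs k g -> Cs k (fun p => f p * g p).
Proof.
elim: k f g => [|k IH] f g; first by move=> cf cg p; exact: (cvgM (cf p) (cg p)).
move=> hf hg; have hf' := CsW hf; have hg' := CsW hg.
move: hf hg => [f1 [f2 [h h1 h2]]] [g1 [g2 [h' h1' h2']]].
exists (fun p => f1 p * g p + f p * g1 p), (fun p => f2 p * g p + f p * g2 p).
by split; [move=> p; exact: sdiffM|apply: CsD; exact: IH|apply: CsD; exact: IH].
Qed.

Lemma CsN k f : Cs k f -> Cs k (fun p => - f p).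
Proof.
move=> hf; have -> : (fun p => - f p) = (fun p => (-1) * f p) by apply/funext => p; rewrite mulN1r.
by apply: CsM hf; exact: Cs_cst.
Qed.

(** Composition with a function whose derivative is controlled at the previous order. *)
Lemma Cs_comp k (phi dphi : R -> R) f : (forall p, is_derive (f p) (1 : R) phi (dphi (f p))) ->
  Cs k.+1 f -> Cs k (fun p => dphi (f p)) -> Cs k.+1 (fun p => phi (f p)).
Proof.
move=> d hf hd; move: hf => [f1 [f2 [h h1 h2]]].
exists (fun p => dphi (f p) * f1 p), (fun p => dphi (f p) * f2 p).
by split; [move=> p; exact: sdiff_comp|exact: CsM|exact: CsM].
Qed.

Lemma CsV k f : (forall p, f p != 0) -> Cs k f -> Cs k (fun p => (f p)^-1).
Proof.
move=> f0; elim: k => [|k IH] hf; first by move=> p; apply: cvgV; [exact: f0|exact: hf].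
apply: (@Cs_comp k (fun x => x^-1) (fun x => - (x^-1 * x^-1))) => //.
  move=> p; apply: is_derive_eq (is_deriveV (f0 p) (is_derive_id (f p) (1 : R))) _.
  by rewrite /GRing.scale/= mulr1 -invfM.
by apply: CsN; apply: CsM; apply: IH; exact: CsW.
Qed.

Lemma Cs_sqrt k f : (forall p, 0 < f p) -> Cs k f -> Cs k (fun p => Num.sqrt (f p)).
Proof.
move=> f0; elim: k => [|k IH] hf.
  by move=> p; apply: (@cont_comp _ _ _ f Num.sqrt); [exact: hf|exact: sqrt_continuous].
apply: (@Cs_comp k Num.sqrt (fun x => (2 * Num.sqrt x)^-1)) => //.
  by move=> p; exact: is_derive1_sqrt.
apply: (@CsV k (fun p => 2 * Num.sqrt (f p))).
  by move=> p; rewrite gt_eqF// mulr_gt0// sqrtr_gt0.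
by apply: CsM; [exact: Cs_cst|apply: IH; exact: CsW].
Qed.

Lemma Cs_exp k f : Cs k f -> Cs k (fun p => expR (f p)).
Proof.
elim: k => [|k IH] hf.
  by move=> p; apply: (@cont_comp _ _ _ f expR); [exact: hf|exact: continuous_expR].
by apply: (@Cs_comp k expR expR) => //; apply: IH; exact: CsW.
Qed.

Lemma Cs_trig k f : Cs k f -> Cs k (fun p => cos (f p)) /\ Cs k (fun p => sin (f p)).
Proof.
elim: k => [|k IH] hf.
  split=> p; first by apply: (@cont_comp _ _ _ f cos); [exact: hf|exact: continuous_cos].
  by apply: (@cont_comp _ _ _ f sin); [exact: hf|exact: continuous_sin].
have [hc hs] := IH (CsW hf); split.
  by apply: (@Cs_comp k cos (fun x => - sin x)) => //; exact: CsN.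
exact: (@Cs_comp k sin cos).
Qed.

Lemma Cs_smooth (f : R * R -> 'rV[R]_3) :
  (forall k i, Cs k (fun p => f p ord0 i)) -> smooth_on setT f.
Proof.
move=> + k; elim: k f => [|k IH] f hf.
  move=> p _; apply: row_continuous => i; exact: (hf 0 i p).
have /choice[f1 /choice[f2 f12]] : forall i, exists f1, exists f2, partials (fun p => f p ord0 i) f1 f2.
  by move=> i; have [f1 [f2 [h _ _]]] := hf 1 i; exists f1, f2.
have d p : differentiable f p /\ forall u, 'd f p u = u.1 *: (\row_i f1 i p) + u.2 *: (\row_i f2 i p).
  by apply: sdiff_diff => i; rewrite !mxE; exact: f12.
have E1 : partial1 f = (fun p => \row_i f1 i p).
  apply/funext => p; rewrite /partial1 deriveE; last exact: (d p).1.
  by rewrite (d p).2 /= scale1r scale0r addr0.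
have E2 : partial2 f = (fun p => \row_i f2 i p).
  apply/funext => p; rewrite /partial2 deriveE; last exact: (d p).1.
  by rewrite (d p).2 /= scale1r scale0r add0r.
have uniq i (g1 g2 : R * R -> R) : partials (fun p => f p ord0 i) g1 g2 -> g1 = f1 i /\ g2 = f2 i.
  by move=> h; split; apply/funext => p; have [] := sdiff_unique (h p) (f12 i p).
split; first by move=> p _; split; apply: diff_derivable; exact: (d p).1.
  rewrite E1; apply: IH => m i.
  have -> : (fun p => (\row_i f1 i p) ord0 i) = f1 i by apply/funext => p; rewrite mxE.
  by have [g1 [g2 [/uniq[<- _] h _]]] := hf m.+1 i.
rewrite E2; apply: IH => m i.
have -> : (fun p => (\row_i f2 i p) ord0 i) = f2 i by apply/funext => p; rewrite mxE.
by have [g1 [g2 [/uniq[_ <-] _ h]]] := hf m.+1 i.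
Qed.

End smooth_functions.

(** * The screw-motion invariant plane *)

Section screw_plane.
Context {R : realType}.
Implicit Types (w t x : R) (p : R * R).
Variables (mu : R) (vth : R -> R) (eps : R).
Hypothesis hP : is_profile mu vth.
Hypothesis eps1 : eps ^+ 2 = 1.
Local Notation lam := (lam mu).

Definition coshR t : R := (expR t + expR (- t)) / 2.
Definition sinhR t : R := (expR t - expR (- t)) / 2.
Definition rw w : R := Num.sqrt (xw w).
Definition hw w : R := Num.sqrt (1 + xw w).
Definition den p : R := 1 + hw p.1 * coshR p.2.
Definition psi p : R := vth p.1 + lam * p.2.

(** The screw-motion invariant surface over the profile. *)
Definition Fs p : 'rV[R]_3 := \row_i
  (if i == i0 then eps * rw p.1 * cos (psi p) / den p
   else if i == i1 then eps * rw p.1 * sin (psi p) / den p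
   else hw p.1 * sinhR p.2 / den p).

Lemma Fs0 p : Fs p ord0 i0 = eps * rw p.1 * cos (psi p) / den p.
Proof. by rewrite mxE. Qed.
Lemma Fs1 p : Fs p ord0 i1 = eps * rw p.1 * sin (psi p) / den p.
Proof. by rewrite mxE. Qed.
Lemma Fs2 p : Fs p ord0 i2 = hw p.1 * sinhR p.2 / den p.
Proof. by rewrite mxE. Qed.

Lemma coshR_gt0 t : 0 < coshR t.
Proof. by rewrite divr_gt0// addr_gt0 ?expR_gt0. Qed.

Lemma cosh2 t : coshR t ^+ 2 = 1 + sinhR t ^+ 2.
Proof.
have e : expR t * expR (- t) = 1 by rewrite -expRD subrr expR0.
rewrite /coshR /sinhR !expr_div_n.
have -> : (expR t + expR (- t)) ^+ 2 = (expR t - expR (- t)) ^+ 2 + 4 * (expR t * expR (- t)) by ring.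
by rewrite e; field.
Qed.

Lemma hw_gt0 w : 0 < hw w.
Proof. by rewrite sqrtr_gt0 addr_gt0// xw_gt0. Qed.

Lemma rw_gt0 w : 0 < rw w.
Proof. by rewrite sqrtr_gt0 xw_gt0. Qed.

Lemma hw_sqr w : hw w ^+ 2 = 1 + xw w.
Proof. by rewrite sqr_sqrtr// addr_ge0// ltW// xw_gt0. Qed.

Lemma rw_sqr w : rw w ^+ 2 = xw w.
Proof. by rewrite sqr_sqrtr// ltW// xw_gt0. Qed.

Lemma den_gt0 p : 0 < den p.
Proof. by rewrite addr_gt0// mulr_gt0 ?hw_gt0 ?coshR_gt0. Qed.

Lemma Fs_sum p : Fs p ord0 i0 ^+ 2 + Fs p ord0 i1 ^+ 2 + Fs p ord0 i2 ^+ 2 = 1 - 2 / den p.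
Proof.
have d0 := lt0r_neq0 (den_gt0 p).
have hc : (hw p.1 * coshR p.2) ^+ 2 = (1 + xw p.1) * (1 + sinhR p.2 ^+ 2).
  by rewrite exprMn hw_sqr cosh2.
rewrite Fs0 Fs1 Fs2; move: (sinhR p.2) hc => S hc.
rewrite !expr_div_n !exprMn eps1 rw_sqr hw_sqr !mul1r.
rewrite -mulrDl -mulrDr cos2Dsin2 mulr1 -mulrDl.
have -> : xw p.1 + (1 + xw p.1) * S ^+ 2 = (hw p.1 * coshR p.2) ^+ 2 - 1 by rewrite hc; ring.
have -> : hw p.1 * coshR p.2 = den p - 1 by rewrite /den; ring.
by field.
Qed.

Lemma Fs_del p : del (tri (Fs p)) = 2 / den p.
Proof.
have h := Fs_sum p; move: h; rewrite /del /tri /=.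
move: (Fs p ord0 i0) (Fs p ord0 i1) (Fs p ord0 i2) => a b c h; lra.
Qed.

Lemma Fs_hyp3 p : hyp3 R (Fs p).
Proof. by apply/hyp3_del; rewrite Fs_del divr_gt0// den_gt0. Qed.

Lemma Fs_zc p : zc (tri (Fs p)) = p.2.
Proof.
have d0 := den_gt0 p; have dn := lt0r_neq0 d0; have s := Fs_sum p; have h0 := hw_gt0 p.1.
have PE : Pz (tri (Fs p)) = 2 * hw p.1 / den p * expR p.2.
  have -> : expR p.2 = coshR p.2 + sinhR p.2 by rewrite /coshR /sinhR; field.
  have -> : 2 * hw p.1 / den p * (coshR p.2 + sinhR p.2) =
      2 * (hw p.1 * coshR p.2) / den p + 2 * (hw p.1 * sinhR p.2 / den p) by field.
  have -> : hw p.1 * coshR p.2 = den p - 1 by rewrite /den; ring.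
  by rewrite del_P /tri /= s Fs2; field.
have ME : Mz (tri (Fs p)) = 2 * hw p.1 / den p * expR (- p.2).
  have -> : Mz (tri (Fs p)) = Pz (tri (Fs p)) - 4 * Fs p ord0 i2.
    by rewrite /Pz /Mz /tri /=; ring.
  by rewrite PE Fs2 /sinhR; field.
have c0 : 0 < 2 * hw p.1 / den p by rewrite divr_gt0// mulr_gt0.
rewrite /zc PE ME; move: (2 * hw p.1 / den p) c0 => c c0.
by rewrite !lnM ?posrE ?expR_gt0// !expRK; field.
Qed.

Lemma Fs_ac p : ac eps (tri (Fs p)) = rw p.1 * cos (psi p) /\ bc eps (tri (Fs p)) = rw p.1 * sin (psi p).
Proof.
have dn := lt0r_neq0 (den_gt0 p); rewrite /ac /bc Fs_del /tri /= Fs0 Fs1.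
have e (c : R) : 2 * eps * (eps * rw p.1 * c / den p) / (2 / den p) = eps ^+ 2 * (rw p.1 * c) by field.
by split; rewrite e eps1 mul1r.
Qed.

Lemma pvz_Fs p : pvz mu eps (Fs p) = (rw p.1 * cos (vth p.1), rw p.1 * sin (vth p.1), p.2).
Proof.
have [aE bE] := Fs_ac p; have zE := Fs_zc p.
rewrite /pvz /pc /vc aE bE zE.
have E : vth p.1 = psi p - lam * p.2 by rewrite /psi addrK.
by congr (_, _, _); rewrite [in RHS]E ?cosB ?sinB; ring.
Qed.

Lemma Phi_Fs p : Phi mu vth eps (Fs p) = (Ups mu (p.1 * Num.sqrt (p.1 ^+ 2 + 25)), p.2).
Proof. by rewrite /Phi pvz_Fs; exact: (cal_profile hP). Qed.

Definition Finv (u : 'rV[R]_3) : R * R :=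
  (win vth (atan ((pvz mu eps u).1.2 / (pvz mu eps u).1.1)), (pvz mu eps u).2).

Lemma vth_cos_gt0 w : 0 < cos (vth w).
Proof. by apply: cos_gt0_pihalf; exact: (profile_bounds hP). Qed.

(** The profile sweeps each angle of the open half plane once. *)
Lemma FsK : cancel Fs Finv.
Proof.
move=> p; rewrite /Finv pvz_Fs /=.
have c0 := vth_cos_gt0 p.1; have r0 := rw_gt0 p.1.
have -> : rw p.1 * sin (vth p.1) / (rw p.1 * cos (vth p.1)) = tan (vth p.1).
  by rewrite /tan; field; rewrite (lt0r_neq0 c0) lt0r_neq0.
rewrite tanK ?(profileK hP) -?surjective_pairing//.
by rewrite in_itv/=; exact: (profile_bounds hP).
Qed.

Definition Pl : set 'rV[R]_3 := range Fs.

Lemma Pl_hyp3 : Pl `<=` hyp3 R.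
Proof. by move=> _ [p _ <-]; exact: Fs_hyp3. Qed.

(** On the half space p > 0 the profile angle is atan (v / p), from which the parameter is recovered. *)
Lemma Finv_continuous u : hyp3 R u -> 0 < (pvz mu eps u).1.1 -> {for u, continuous Finv}.
Proof.
move=> hu p0; have c := @pvz_continuous R mu eps u hu.
have cp : {for u, continuous (fun u => (pvz mu eps u).1.1)}.
  by apply: cont_fst; exact: (cont_fst c).
have cv : {for u, continuous (fun u => (pvz mu eps u).1.2)}.
  by apply: cont_snd; exact: (cont_fst c).
have cz : {for u, continuous (fun u => (pvz mu eps u).2)} by exact: (cont_snd c).
apply: cont_pair => //.
have cq : {for u, continuous (fun u => (pvz mu eps u).1.2 / (pvz mu eps u).1.1)}.
  exact: (cvgM cv (cont_inv (f := fun u => (pvz mu eps u).1.1) (lt0r_neq0 p0) cp)).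
apply: (@cont_comp _ _ _ (fun u => atan ((pvz mu eps u).1.2 / (pvz mu eps u).1.1)) (win vth)).
  apply: (@cont_comp _ _ _ (fun u => (pvz mu eps u).1.2 / (pvz mu eps u).1.1) atan) => //.
  exact: continuous_atan.
set a := atan _; have ha : - (pi / 2) < a < pi / 2 by rewrite atan_gtNpi2 atan_ltpi2.
exact: (@derive_cont _ _ (fun=> _) _ (is_derive_win hP ha)).
Qed.

Lemma Pl_p_gt0 u : Pl u -> 0 < (pvz mu eps u).1.1.
Proof. by move=> [p _ <-]; rewrite pvz_Fs /= mulr_gt0 ?rw_gt0 ?vth_cos_gt0. Qed.

Lemma xw_Cs k : Cs k (fun p => xw p.1).
Proof.
have -> : (fun p => xw p.1) = (fun p => 12 + p.1 * p.1) by apply/funext => p; rewrite /xw expr2.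
by apply: CsD; [exact: Cs_cst|apply: CsM; exact: Cs_fst].
Qed.

Lemma kw_Cs k : Cs k (fun p => kw mu p.1).
Proof.
have x0 (p : R * R) := xw_gt0 p.1; have m2 := profile_mu hP.
have q0 (p : R * R) : 0 < p.1 * p.1 + 25 by have := sqr_ge0 p.1; rewrite expr2; lra.
have -> : (fun p => kw mu p.1) = (fun p => Num.sqrt 156 * Num.sqrt (1 + mu * xw p.1) *
    (xw p.1 * (1 + xw p.1) * Num.sqrt (p.1 * p.1 + 25))^-1) by [].
apply: CsM.
  apply: CsM; first exact: Cs_cst.
  apply: (@Cs_sqrt _ k (fun p => 1 + mu * xw p.1)).
    by move=> p; rewrite ltr_pwDl// mulr_ge0// ?(ltW (x0 p))//; lra.
  by apply: CsD; [exact: Cs_cst|apply: CsM; [exact: Cs_cst|exact: xw_Cs]].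
apply: (@CsV _ k (fun p => xw p.1 * (1 + xw p.1) * Num.sqrt (p.1 * p.1 + 25))).
  by move=> p; rewrite gt_eqF// mulr_gt0 ?sqrtr_gt0// mulr_gt0// addr_gt0.
apply: CsM.
  by apply: CsM; [exact: xw_Cs|apply: CsD; [exact: Cs_cst|exact: xw_Cs]].
apply: (@Cs_sqrt _ k (fun p => p.1 * p.1 + 25)) => //.
by apply: CsD; [apply: CsM; exact: Cs_fst|exact: Cs_cst].
Qed.

Lemma psi_Cs k : Cs k psi.
Proof.
apply: CsD; last by apply: CsM; [exact: Cs_cst|exact: Cs_snd].
case: k => [|k].
  by move=> p; apply: (@cont_comp _ _ _ fst vth); [exact: cvg_fst|exact: (profile_continuous hP)].
apply: (@Cs_comp _ k vth (kw mu) fst); [|exact: Cs_fst|exact: kw_Cs].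
by move=> p; exact: (profile_derive hP).
Qed.

Lemma hw_Cs k : Cs k (fun p => hw p.1).
Proof.
apply: (@Cs_sqrt _ k (fun p => 1 + xw p.1)); first by move=> p; rewrite addr_gt0// xw_gt0.
by apply: CsD; [exact: Cs_cst|exact: xw_Cs].
Qed.

Lemma exp_Cs k : Cs k (fun p : R * R => expR p.2) /\ Cs k (fun p : R * R => expR (- p.2)).
Proof. by split; apply: Cs_exp; [exact: Cs_snd|apply: CsN; exact: Cs_snd]. Qed.

Lemma Fs_smooth : smooth_on setT Fs.
Proof.
apply: Cs_smooth => k i.
have [e1 e2] := exp_Cs k; have [c s] := Cs_trig (psi_Cs k).
have hr : Cs k (fun p => rw p.1).
  by apply: (@Cs_sqrt _ k (fun p => xw p.1)); [move=> p; exact: xw_gt0|exact: xw_Cs].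
have hd : Cs k (fun p => (den p)^-1).
  apply: CsV; first by move=> p; rewrite gt_eqF// den_gt0.
  apply: CsD; first exact: Cs_cst.
  by apply: CsM; [exact: hw_Cs|apply: CsM; [exact: CsD|exact: Cs_cst]].
case: (ord3 i) => ->.
- rewrite (_ : (fun p => _) = (fun p => eps * rw p.1 * cos (psi p) / den p)); last by apply/funext => p; rewrite Fs0.
  by do !apply: CsM => //; exact: Cs_cst.
- rewrite (_ : (fun p => _) = (fun p => eps * rw p.1 * sin (psi p) / den p)); last by apply/funext => p; rewrite Fs1.
  by do !apply: CsM => //; exact: Cs_cst.
- rewrite (_ : (fun p => _) = (fun p => hw p.1 * sinhR p.2 / den p)); last by apply/funext => p; rewrite Fs2.
  apply: CsM => //; apply: CsM; first exact: hw_Cs.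
  by apply: CsM; [apply: CsD => //; exact: CsN|exact: Cs_cst].
Qed.

(** The metric along a disk in the plane, in terms of the parameters (w, t). *)
Lemma gpv_profile w (w1 t1 w2 t2 : R) (r := rw w) (c := cos (vth w)) (s := sin (vth w))
   (kk := kw mu w) :
  let pd a := (w / r * c - r * kk * s) * a in
  let vd a := (w / r * s + r * kk * c) * a in
  gpv mu (r * c) (r * s) (pd w1) (vd w1) t1 (pd w2) (vd w2) t2 =
    w ^+ 2 * w1 * w2 / (xw w * (1 + xw w)) +
    (1 + mu * xw w) * ((t1 + lam * xw w / (1 + mu * xw w) * kk * w1) * (t2 + lam * xw w / (1 + mu * xw w) * kk * w2)) +
    xw w * (1 + xw w) / (1 + mu * xw w) * (kk ^+ 2 * w1 * w2).
Proof.
move=> pd vd; have m2 := profile_mu hP.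
have cs : c ^+ 2 + s ^+ 2 = 1 := cos2Dsin2 _.
have r0 : r != 0 by rewrite gt_eqF// rw_gt0.
have x0 := xw_gt0 w; have rE : r ^+ 2 = xw w := rw_sqr w.
have W0 : 0 < 1 + mu * xw w by rewrite ltr_pwDl// mulr_ge0// ?(ltW x0)//; lra.
have xE : (r * c) ^+ 2 + (r * s) ^+ 2 = xw w by rewrite !exprMn -mulrDr cs mulr1.
have rad a : r * c * pd a + r * s * vd a = w * a.
  have -> : r * c * pd a + r * s * vd a = (c ^+ 2 + s ^+ 2) * (w * a) by rewrite /pd /vd; field.
  by rewrite cs mul1r.
have ang a : pd a * (r * s) - r * c * vd a = - (xw w * kk * a).
  have -> : pd a * (r * s) - r * c * vd a = - ((c ^+ 2 + s ^+ 2) * (r ^+ 2 * kk * a)).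
    by rewrite /pd /vd; field.
  by rewrite cs mul1r rE.
have muE := mu_lam m2.
have X0 := lt0r_neq0 x0; have W1 := lt0r_neq0 W0.
have X1 : 1 + xw w != 0 by rewrite gt_eqF// addr_gt0.
have := @gpv_polar R mu (r * c) (r * s) (pd w1) (vd w1) t1 (pd w2) (vd w2) t2.
cbv zeta; rewrite -muE xE !rad !ang => /(_ X0 X1 W1) ->.
clear pd vd rad ang; clearbody kk.
move: X0 W1 X1; move: (xw w) lam => x l X0 W1 X1.
by field; rewrite X0 X1 W1.
Qed.

End screw_plane.

(** * Area in the plane *)

Section area_in_the_plane.
Context {R : realType}.
Implicit Types (w t x : R) (p s z : R * R).
Local Notation leb := (@lebesgue_measure R \x @lebesgue_measure R)%E.
Variables (mu : R) (vth : R -> R) (eps : R).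
Hypothesis hP : is_profile mu vth.
Hypothesis eps1 : eps ^+ 2 = 1.
Local Notation lam := (lam mu).
Local Notation Fs := (Fs mu vth eps).
Local Notation Pl := (Pl mu vth eps).
Local Notation Finv := (Finv mu vth eps).

Definition uw w : R := w * Num.sqrt (w ^+ 2 + 25).

Lemma is_derive_uw w : is_derive w (1 : R) uw ((25 + 2 * w ^+ 2) / Num.sqrt (w ^+ 2 + 25)).
Proof.
have s0 := sq25_gt0 w.
have d1 : is_derive w (1 : R) (fun w => w ^+ 2 + 25) (2 * w).
  by apply: is_derive_eq; rewrite /GRing.scale/=; ring.
have d2 := is_derive_sqrt (g := fun w => w ^+ 2 + 25) s0 d1.
apply: is_derive_eq (is_derive_mul (is_derive_id w (1 : R)) d2) _.
have E1 : Num.sqrt (w ^+ 2 + 25) ^+ 2 = w ^+ 2 + 25 by rewrite sqr_sqrtr// ltW.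
have : Num.sqrt (w ^+ 2 + 25) != 0 by rewrite gt_eqF// sqrtr_gt0.
move: (Num.sqrt _) E1 => a E1 a0 /=.
have -> : 1 * a + w * (2 * w / (2 * a)) = (a ^+ 2 + w ^+ 2) / a by field.
by rewrite E1; congr (_ / _); ring.
Qed.

Lemma ups_uw w : ups mu (uw w) = Num.sqrt (1 + mu * xw w) / (25 + 2 * w ^+ 2).
Proof.
rewrite /ups /uw yst_sub25; congr (Num.sqrt (1 + mu * _) / _).
by rewrite /xw; field.
Qed.

(** The calibration preserves area on the plane. *)
Lemma plane_density (f : R * R -> 'rV[R]_3) (O : set (R * R)) (wf tf : R * R -> R) z (w1 w2 t1 t2 : R) :
  open O -> Ck 1 O f -> O z -> (forall s, O s -> f s = Fs (wf s, tf s)) ->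
  sdiff wf z w1 w2 -> sdiff tf z t1 t2 ->
  area_density f z = `|Num.sqrt (1 + mu * xw (wf z)) / Num.sqrt (wf z ^+ 2 + 25) * (w1 * t2 - w2 * t1)|.
Proof.
move=> oO hf Oz fE dw dt; have m2 := profile_mu hP.
have hz : hyp3 R (f z) by rewrite fE//; exact: Fs_hyp3.
have [p1 [p2 [v1 [v2 [z1 [z2 /= [dp dv dz ->]]]]]]] := @disk_coordinates R mu eps eps1 f O z oO hf Oz hz.
have nO : \forall s \near z, O s by exact: open_nbhs_nbhs.
have pE s : O s -> pvz mu eps (f s) = (rw (wf s) * cos (vth (wf s)), rw (wf s) * sin (vth (wf s)), tf s).
  by move=> Os; rewrite fE// pvz_Fs.
set w := wf z in dw *; set r := rw w; set kk := kw mu w.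
have r0 : r != 0 by rewrite gt_eqF// rw_gt0.
have drw : is_derive w (1 : R) (@rw R) (w / r).
  have d1 : is_derive w (1 : R) (@xw R) (2 * w).
    by rewrite /xw; apply: is_derive_eq; rewrite /GRing.scale/=; ring.
  apply: is_derive_eq (is_derive_sqrt (g := @xw R) (xw_gt0 w) d1) _.
  by rewrite -/(rw w) -/r; field.
have dr := sdiff_comp (f := wf) drw dw.
have dvt := sdiff_comp (f := wf) (profile_derive hP w) dw.
have dc := sdiff_comp (f := fun s => vth (wf s)) (is_derive_cos _) dvt.
have ds := sdiff_comp (f := fun s => vth (wf s)) (is_derive_sin _) dvt.
have ep := sdiffM dr dc; have ev := sdiffM dr ds.
have ext (g1 g2 : R * R -> R) (a b : R) : (forall s, O s -> g1 s = g2 s) -> sdiff g1 z a b -> sdiff g2 z a b.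
  by move=> h; apply: sdiff_ext; [exact: filterS nO|exact: h].
have [P1 P2] := sdiff_unique dp (ext _ (fun s => pc mu eps (tri (f s))) _ _ (fun s Os => esym (congr1 (fun q => q.1.1) (pE s Os))) ep).
have [V1 V2] := sdiff_unique dv (ext _ (fun s => vc mu eps (tri (f s))) _ _ (fun s Os => esym (congr1 (fun q => q.1.2) (pE s Os))) ev).
have [Z1 Z2] := sdiff_unique dz (ext _ (fun s => zc (tri (f s))) _ _ (fun s Os => esym (congr1 (fun q => q.2) (pE s Os))) dt).
have e1 : pc mu eps (tri (f z)) = r * cos (vth w) := congr1 (fun q => q.1.1) (pE z Oz).
have e2 : vc mu eps (tri (f z)) = r * sin (vth w) := congr1 (fun q => q.1.2) (pE z Oz).
have prof a b c d := @gpv_profile R mu vth hP w a b c d.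
pose pd a := (w / r * cos (vth w) - r * kk * sin (vth w)) * a.
pose vd a := (w / r * sin (vth w) + r * kk * cos (vth w)) * a.
have P1' : p1 = pd w1 by rewrite P1 /pd -/r -/kk; ring.
have P2' : p2 = pd w2 by rewrite P2 /pd -/r -/kk; ring.
have V1' : v1 = vd w1 by rewrite V1 /vd -/r -/kk; ring.
have V2' : v2 = vd w2 by rewrite V2 /vd -/r -/kk; ring.
have x0 := xw_gt0 w; have S0 : 0 < xw w * (1 + xw w) by rewrite mulr_gt0// addr_gt0.
have W0 : 0 < 1 + mu * xw w by rewrite ltr_pwDl// mulr_ge0// ?(ltW x0)//; lra.
have s25 := sq25_gt0 w.
have kE : kk ^+ 2 = 156 * (1 + mu * xw w) / ((xw w * (1 + xw w)) ^+ 2 * (w ^+ 2 + 25)).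
  rewrite /kk /kw !(exprMn, expr_div_n, exprVn) !sqr_sqrtr ?(ltW W0) ?(ltW s25)//; lra.
set W := 1 + mu * xw w in W0 kE *.
set S := xw w * (1 + xw w) in S0 kE.
have SE : S = w ^+ 2 * (w ^+ 2 + 25) + 156 by rewrite /S /xw; ring.
pose c := lam * xw w / W * kk.
have gE a b a' b' : gpv mu (pc mu eps (tri (f z))) (vc mu eps (tri (f z))) (pd a) (vd a) b (pd a') (vd a') b' =
    (a * a') / (w ^+ 2 + 25) + W * ((b + c * a) * (b' + c * a')).
  rewrite e1 e2; have := prof a b a' b'; cbv zeta; rewrite -/r -/kk -/(pd a) -/(pd a') -/(vd a) -/(vd a') => ->.
  rewrite -/W -/S -/c kE.
  have -> : w ^+ 2 * a * a' / S + W * ((b + c * a) * (b' + c * a')) +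
      S / W * (156 * W / (S ^+ 2 * (w ^+ 2 + 25)) * a * a') =
     (w ^+ 2 * (w ^+ 2 + 25) + 156) / S * (a * a' / (w ^+ 2 + 25)) + W * ((b + c * a) * (b' + c * a')).
    by field; rewrite (lt0r_neq0 S0) (lt0r_neq0 W0) lt0r_neq0.
  by rewrite -SE divff ?mul1r// lt0r_neq0.
have H (A B C a1 a2 b1 b2 : R) : A = a1 * a1 / (w ^+ 2 + 25) + W * (b1 * b1) ->
    B = a2 * a2 / (w ^+ 2 + 25) + W * (b2 * b2) -> C = a1 * a2 / (w ^+ 2 + 25) + W * (b1 * b2) ->
    Num.sqrt (A * B - C ^+ 2) = `|Num.sqrt W / Num.sqrt (w ^+ 2 + 25) * (a1 * b2 - a2 * b1)|.
  move=> -> -> ->; rewrite -sqrtr_sqr exprMn expr_div_n !sqr_sqrtr ?(ltW W0) ?(ltW s25)//.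
  by congr Num.sqrt; field; rewrite lt0r_neq0.
rewrite P1' P2' V1' V2' (H _ _ _ w1 w2 (z1 + c * w1) (z2 + c * w2) (gE _ _ _ _) (gE _ _ _ _) (gE _ _ _ _)).
by rewrite Z1 Z2; congr `|_ * _|; ring.
Qed.

(** A vector of the kernel of the Gram matrix is in the kernel of the pair of partial derivatives. *)
Lemma gram_independent (a b d E F G : R) : 0 = a * E + b * F -> 0 = a * F + b * G ->
  Num.sqrt (4 * E / d * (4 * G / d) - (4 * F / d) ^+ 2) != 0 -> a = 0 /\ b = 0.
Proof.
move=> h1 h2 dn.
have D0 : E * G - F ^+ 2 != 0.
  apply: contraNneq dn => D0.
  have -> : 4 * E / d * (4 * G / d) - (4 * F / d) ^+ 2 = 16 * d^-1 ^+ 2 * (E * G - F ^+ 2) by ring.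
  by rewrite D0 mulr0 sqrtr0.
have e1 : a * (E * G - F ^+ 2) = (a * E + b * F) * G - (a * F + b * G) * F by ring.
have e2 : b * (E * G - F ^+ 2) = (a * F + b * G) * E - (a * E + b * F) * F by ring.
rewrite -h1 -h2 !mul0r subr0 in e1 e2.
split; apply/eqP.
  by move/eqP: e1; rewrite mulf_eq0 (negPf D0) orbF.
by move/eqP: e2; rewrite mulf_eq0 (negPf D0) orbF.
Qed.

Lemma dot_linear (u A B : 'rV[R]_3) (a b : R) : dot u (a *: A + b *: B) = a * dot u A + b * dot u B.
Proof. by rewrite !dotE !mxE; ring. Qed.

Lemma dotC (u v : 'rV[R]_3) : dot u v = dot v u.
Proof. by rewrite !dotE; ring. Qed.

Lemma density_independent (f : R * R -> 'rV[R]_3) z : area_density f z != 0 ->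
  forall a b : R, a *: partial1 f z + b *: partial2 f z = 0 -> a = 0 /\ b = 0.
Proof.
rewrite /area_density /hyp_metric.
move: (partial1 f z) (partial2 f z) ((1 - dot (f z) (f z)) ^+ 2) => A B d dn a b h.
have d0 (u : 'rV[R]_3) : dot u 0 = 0 by rewrite dotE !mxE !mulr0 !addr0.
apply: (gram_independent _ _ dn).
  by apply: etrans (dot_linear A A B a b); rewrite h d0.
rewrite (dotC A B); by apply: etrans (dot_linear B A B a b); rewrite h d0.
Qed.

Lemma Pl_plane : plane Pl.
Proof.
exists Fs, Finv; split; last exact: Pl_hyp3.
split => //.
- exact: Fs_smooth.
- move=> p; have S : smooth_on setT Fs by exact: Fs_smooth.
  have C1 : Ck 1 setT Fs := S 1%N.
  apply/(immersion_partials openT C1 I); apply: density_independent.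
  have E s : setT s -> Fs s = Fs (s.1, s.2) by rewrite -surjective_pairing.
  rewrite (plane_density openT C1 I E (sdiff_fst p) (sdiff_snd p)).
  rewrite normr_eq0 mulr1 mulr0 subr0 mulr1.
  have x0 := xw_gt0 p.1; have m2 := profile_mu hP.
  have W0 : 0 < 1 + mu * xw p.1 by rewrite ltr_pwDl// mulr_ge0// ?(ltW x0)//; lra.
  by rewrite gt_eqF// divr_gt0 ?sqrtr_gt0 ?sq25_gt0.
- exact: FsK.
- apply: continuous_in_subspaceT => u; rewrite inE => Pu.
  by apply: Finv_continuous => //; [exact: (Pl_hyp3 eps1 Pu)|exact: (Pl_p_gt0 hP eps1 Pu)].
Qed.

Lemma Ck_sub k (U V : set (R * R)) (f : R * R -> 'rV[R]_3) : V `<=` U -> Ck k U f -> Ck k V f.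
Proof.
move=> VU; elim: k f => [|k IH] f /=; first by move=> h p /VU; exact: h.
by move=> [h h1 h2]; split; [move=> p /VU; exact: h|exact: IH|exact: IH].
Qed.

End area_in_the_plane.

(** * Subdisks are least area *)

Section least_area.
Context {R : realType}.
Implicit Types (w t x : R) (p s z : R * R).
Local Notation leb := (@lebesgue_measure R \x @lebesgue_measure R)%E.
Variables (mu : R) (vth : R -> R) (eps : R).
Hypothesis hP : is_profile mu vth.
Hypothesis eps1 : eps ^+ 2 = 1.
Local Notation Fs := (Fs mu vth eps).
Local Notation Pl := (Pl mu vth eps).
Local Notation Finv := (Finv mu vth eps).
Local Notation Phi := (Phi mu vth eps).

Lemma within_comp (T U V : topologicalType) (A : set T) (h : T -> U) (g : U -> V) :
  {within A, continuous h} -> (forall a, A a -> {for h a, continuous g}) ->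
  {within A, continuous (g \o h)}.
Proof.
move=> ch cg; rewrite continuous_subspace_in => a; rewrite inE => Aa.
by apply: (cvg_comp _ _ (ch a)); exact: cg.
Qed.

Lemma open_closed_disk : open_disk R `<=` closed_disk R.
Proof. by move=> p /ltW. Qed.

Lemma circle_closed_disk : unit_circle R `<=` closed_disk R.
Proof. by move=> p; rewrite /unit_circle /closed_disk /= => ->. Qed.

Lemma unit_circle_compact : compact (unit_circle R).
Proof.
have c : continuous (fun p : R * R => p.1 ^+ 2 + p.2 ^+ 2).
  move=> p; apply: cvgD.
    by apply: (@cont_comp _ _ _ fst (fun x : R => x ^+ 2)); [exact: cvg_fst|exact: exprn_continuous].
  by apply: (@cont_comp _ _ _ snd (fun x : R => x ^+ 2)); [exact: cvg_snd|exact: exprn_continuous].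
have cl : closed (unit_circle R).
  have /continuous_closedP := c => /(_ [set 1] (@closed_eq R 1)).
  by congr closed.
have cK : compact (`[(-1 : R), 1]%classic `*` `[(-1 : R), 1]%classic).
  by apply: compact_setX; exact: segment_compact.
apply: (subclosed_compact cl cK) => p; rewrite /unit_circle/= => h.
have q1 := sqr_ge0 p.1; have q2 := sqr_ge0 p.2.
by split; rewrite /= in_itv/=; apply/andP; split; nra.
Qed.

(** A continuous injection of the compact circle has a continuous inverse on its image. *)
Lemma loop_reparam (f h : R * R -> 'rV[R]_3) :
  {within unit_circle R, continuous f} -> {within unit_circle R, continuous h} ->
  set_inj (unit_circle R) h -> h @` unit_circle R = f @` unit_circle R ->
  exists kap : R -> R * R, [/\ continuous kap, perio kap, forall t, unit_circle R (kap t) &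
    forall t, h (kap t) = f (circ t)].
Proof.
move=> cf ch ih E.
have ex t : exists z, unit_circle R z /\ h z = f (circ t).
  have : (h @` unit_circle R) (f (circ t)) by rewrite E; exists (circ t) => //; exact: circ_unit.
  by move=> [z Cz hz]; exists z.
pose kap t := xget 0 [set z | unit_circle R z /\ h z = f (circ t)].
have kP t : unit_circle R (kap t) /\ h (kap t) = f (circ t) by exact: (xgetPex 0 (ex t)).
exists kap; split; [ | |by move=> t; have [] := kP t|by move=> t; have [] := kP t].
- apply/continuous_closedP => C cC.
  have cfc : continuous (f \o circ).
    by apply: (within_continuous_comp cf); [exact: circ_continuous|exact: circ_unit].
  have -> : kap @^-1` C = (f \o circ) @^-1` (h @` (unit_circle R `&` C)).
    apply/seteqP; split => t /=.
      by move=> Ct; exists (kap t); [split => //; exact: (kP t).1|exact: (kP t).2].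
    move=> [z [Cz Dz] hz]; have [k1 k2] := kP t.
    have -> // : kap t = z by apply: ih; rewrite ?inE// hz.
  move/continuous_closedP : cfc; apply.
  apply: compact_closed; first exact: norm_hausdorff.
  apply: continuous_compact.
    by apply: continuous_subspaceW ch => z [].
  by apply: compact_closedI => //; exact: unit_circle_compact.
- by move=> t; rewrite /kap circ_perio.
Qed.

Lemma uw_inj : injective (@uw R).
Proof.
move=> w w' E; apply: contrapT => /eqP; rewrite neq_lt => h.
have pos (a b : R) : a < b -> uw a < uw b.
  move=> ab.
  have [c _ E'] := @mvt_itv R (@uw R) (fun w => (25 + 2 * w ^+ 2) / Num.sqrt (w ^+ 2 + 25)) a b (ltW ab) (fun t _ => is_derive_uw t).
  rewrite -subr_gt0 E' mulr_gt0 ?subr_gt0// divr_gt0 ?sqrtr_gt0 ?sq25_gt0//.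
  by have := sqr_ge0 c; lra.
by case/orP: h => /pos; rewrite E ltxx.
Qed.

Lemma Ups_inj : injective (Ups mu).
Proof.
move=> w w' E; apply: contrapT => /eqP; rewrite neq_lt => h; have m2 := profile_mu hP.
have pos (a b : R) : a < b -> Ups mu a < Ups mu b.
  move=> ab; have [c _ E'] := @mvt_itv R (Ups mu) (ups mu) a b (ltW ab) (fun t _ => is_derive_Ups mu t).
  by rewrite -subr_gt0 E' mulr_gt0 ?subr_gt0// ups_gt0.
by case/orP: h => /pos; rewrite E ltxx.
Qed.

(** A planar map whose linear part is invertible is, up to a linear change of coordinates of the
    target, outward pointing near the given point. *)
Lemma linearized_outward (f g : R * R -> R) (q : R * R) (a b c d : R) : a * d - b * c != 0 ->
  sdiff f q a b -> sdiff g q c d ->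
  let D := a * d - b * c in
  exists2 r : R, 0 < r & forall z, `|z - q| < r -> z <> q ->
    0 < dot2 ((d * (f z - f q) - b * (g z - g q)) / D, (a * (g z - g q) - c * (f z - f q)) / D) (z - q).
Proof.
move=> D0 df dg D.
have h1 := sdiffZ D^-1 (sdiffB (sdiffZ d df) (sdiffZ b dg)).
have h2 := sdiffZ D^-1 (sdiffB (sdiffZ a dg) (sdiffZ c df)).
have {}h1 : sdiff (fun z => D^-1 * (d * f z - b * g z)) q 1 0.
  by apply: sdiff_eq h1 _ _; rewrite /D; [field|ring].
have {}h2 : sdiff (fun z => D^-1 * (a * g z - c * f z)) q 0 1.
  by apply: sdiff_eq h2 _ _; rewrite /D; [ring|field].
have e4 : 0 < (1 / 4 : R) by rewrite divr_gt0.
have [r1 r10 P1] := h1 _ e4; have [r2 r20 P2] := h2 _ e4.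
exists (Num.min r1 r2); first by rewrite lt_min r10.
move=> z; rewrite prod_normE gt_max !lt_min => /andP[/andP[u1 u2] /andP[v1 v2]] zq.
have k1 := P1 z u1 v1; have k2 := P2 z u2 v2.
rewrite /dot2/=; move: k1 k2; rewrite /= !mul1r !mul0r addr0 add0r.
have -> : D^-1 * (d * f z - b * g z) - D^-1 * (d * f q - b * g q) =
   (d * (f z - f q) - b * (g z - g q)) / D by ring.
have -> : D^-1 * (a * g z - c * f z) - D^-1 * (a * g q - c * f q) =
   (a * (g z - g q) - c * (f z - f q)) / D by ring.
have n0 : 0 < (z.1 - q.1) ^+ 2 + (z.2 - q.2) ^+ 2.
  rewrite lt_neqAle addr_ge0 ?sqr_ge0// andbT eq_sym; apply: contra_notN zq.
  rewrite paddr_eq0 ?sqr_ge0// !sqrf_eq0 !subr_eq0 => /andP[/eqP e1 /eqP e2].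
  by rewrite [z]surjective_pairing [q]surjective_pairing e1 e2.
move: n0; move: (z.1 - q.1) (z.2 - q.2) ((_ - _) / D) ((_ - _) / D) => x y Y X n0.
move=> k1 k2.
have b1 : - (1 / 4 * (`|x| + `|y|) * `|x|) <= (X - x) * x.
  have := ler_norm (- ((X - x) * x)); have := ler_wpM2r (normr_ge0 x) k1.
  by rewrite normrN normrM; lra.
have b2 : - (1 / 4 * (`|x| + `|y|) * `|y|) <= (Y - y) * y.
  have := ler_norm (- ((Y - y) * y)); have := ler_wpM2r (normr_ge0 y) k2.
  by rewrite normrN normrM; lra.
have xx : `|x| ^+ 2 = x ^+ 2 by rewrite real_normK// num_real.
have yy : `|y| ^+ 2 = y ^+ 2 by rewrite real_normK// num_real.
have := sqr_ge0 (`|x| - `|y|).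
move: b1 b2 xx yy; move: (`|x|) (`|y|) => ax ay b1 b2 xx yy h.
nra.
Qed.

Section comparison.
Variables (f h : R * R -> 'rV[R]_3) (U : set (R * R)).
Hypotheses (oU : open U) (DU : closed_disk R `<=` U) (sf : smooth_on U f).
Hypothesis inj_df : forall p, closed_disk R p -> injective ('d f p).
Hypothesis inj_f : set_inj (closed_disk R) f.
Hypothesis fP : f @` closed_disk R `<=` Pl.
Hypothesis hD : disk h.
Hypothesis hf : h @` unit_circle R = f @` unit_circle R.

Let wf s := (Finv (f s)).1.
Let tf s := (Finv (f s)).2.
Let ft s := (Ups mu (uw (wf s)), tf s).

Let fE s : closed_disk R s -> f s = Fs (wf s, tf s).
Proof.
move=> Ds; have [p _ pE] : Pl (f s) by apply: fP; exists s.
by rewrite /wf /tf -pE (FsK hP eps1) -surjective_pairing.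
Qed.

Let f_hyp3 s : closed_disk R s -> hyp3 R (f s).
Proof. by move=> Ds; rewrite fE//; exact: Fs_hyp3. Qed.

Let PhifE s : closed_disk R s -> Phi (f s) = ft s.
Proof. by move=> Ds; rewrite fE// (Phi_Fs hP eps1). Qed.

Let C1f : Ck 1 (open_disk R) f.
Proof. by apply: (Ck_sub _ (sf 1%N)) => z /open_closed_disk/DU. Qed.

Let coords_sdiff z : open_disk R z -> exists w1 w2 t1 t2, sdiff wf z w1 w2 /\ sdiff tf z t1 t2.
Proof.
move=> Dz; have Dz' := open_closed_disk Dz; have hz := f_hyp3 Dz'.
have [p1 [p2 [v1 [v2 [z1 [z2 /= [dp dv dz _]]]]]]] :=
  @disk_coordinates R mu eps eps1 f _ z open_disk_open C1f Dz hz.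
have p0 : pc mu eps (tri (f z)) != 0.
  have : 0 < (pvz mu eps (f z)).1.1 by apply: (Pl_p_gt0 hP eps1); apply: fP; exists z.
  by move=> /= h0; rewrite gt_eqF.
have dq := sdiff_div p0 dv dp.
have da := sdiff_comp (f := fun s => vc mu eps (tri (f s)) / pc mu eps (tri (f s))) (is_derive1_atan _) dq.
have ha : - (pi / 2) < atan (vc mu eps (tri (f z)) / pc mu eps (tri (f z))) < pi / 2.
  by rewrite atan_gtNpi2 atan_ltpi2.
have dw := sdiff_comp (f := fun s => atan (vc mu eps (tri (f s)) / pc mu eps (tri (f s)))) (is_derive_win hP ha) da.
by do 4 eexists; split; [exact: dw|exact: dz].
Qed.

Let ft_sdiff z : open_disk R z -> exists a b c d, [/\ sdiff (fun s => (ft s).1) z a b,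
  sdiff (fun s => (ft s).2) z c d & area_density f z = `|a * d - b * c|].
Proof.
move=> Dz; have [w1 [w2 [t1 [t2 [dw dt]]]]] := coords_sdiff Dz; have m2 := profile_mu hP.
have du := sdiff_comp (f := wf) (is_derive_uw (wf z)) dw.
have dU := sdiff_comp (f := fun s => uw (wf s)) (is_derive_Ups mu (uw (wf z))) du.
do 4 eexists; split; [exact: dU|exact: dt|].
rewrite (@plane_density R mu vth eps hP eps1 f _ wf tf z w1 w2 t1 t2 open_disk_open C1f Dz) => //; last first.
  by move=> s /open_closed_disk; exact: fE.
rewrite ups_uw; congr `|_|.
have q : 25 + 2 * wf z ^+ 2 != 0 by have q := sqr_ge0 (wf z); rewrite gt_eqF//; lra.
have s0 : Num.sqrt (wf z ^+ 2 + 25) != 0 by rewrite gt_eqF// sqrtr_gt0 sq25_gt0.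
by field; rewrite q s0.
Qed.

Let ft_inj z z' : closed_disk R z -> closed_disk R z' -> ft z = ft z' -> z = z'.
Proof.
move=> Dz Dw [/Ups_inj/uw_inj e1 e2]; apply: inj_f; rewrite ?inE//.
by rewrite (fE Dz) (fE Dw) e1 e2.
Qed.

Let ft_continuous : {within closed_disk R, continuous (Phi \o f)}.
Proof.
apply: within_comp => [|z Dz]; last by apply: (Phi_continuous hP); exact: f_hyp3.
apply: continuous_in_subspaceT => z; rewrite inE => /DU Uz.
exact: Ck1_continuous oU (sf 1%N) Uz.
Qed.

Let f_continuous : {within closed_disk R, continuous f}.
Proof.
apply: continuous_in_subspaceT => z; rewrite inE => /DU Uz.
exact: Ck1_continuous oU (sf 1%N) Uz.
Qed.

Lemma subdisk_disk : disk f.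
Proof.
split; first exact: f_continuous.
- by move=> k; apply: (Ck_sub _ (sf k)) => z /open_closed_disk/DU.
- by move=> _ [z Dz <-]; exact: f_hyp3.
- move=> z w; rewrite !inE => /circle_closed_disk Dz /circle_closed_disk Dw.
  by apply: inj_f; rewrite inE.
Qed.

Let density_gt0 z : open_disk R z -> 0 < area_density f z.
Proof.
move=> Dz; have Dz' := open_closed_disk Dz; apply: area_density_gt0; first exact: f_hyp3.
by apply: (immersion_partials oU (sf 1%N) (DU Dz')).1; exact: inj_df.
Qed.

(** Near a point of the open disk the calibrated f is, up to a linear change of coordinates, outward
    pointing, and it takes each value once, so that its boundary loop winds around that value; the
    boundary loop of the calibrated h is a reparametrisation of it. *)
Lemma calibrated_image : ft @` open_disk R `<=` (Phi \o h) @` open_disk R.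
Proof.
move=> _ [q Dq <-]; have [ch sh hh ih] := hD.
have Dq' := open_closed_disk Dq.
have [a [b [c [d [d1 d2 dE]]]]] := ft_sdiff Dq.
have D0 : a * d - b * c != 0 by rewrite -normr_eq0 -dE gt_eqF// density_gt0.
have [r r0 rP] := linearized_outward D0 d1 d2.
set D := a * d - b * c in D0 rP *.
pose L (y : R * R) : R * R := ((d * y.1 - b * y.2) / D, (a * y.2 - c * y.1) / D).
have L0 y : L y = 0 -> y = 0.
  case: y => y1 y2 [/= e1 e2].
  have e1' : d * y1 - b * y2 = 0 by move/eqP: e1; rewrite mulf_eq0 invr_eq0 (negPf D0) orbF => /eqP.
  have e2' : a * y2 - c * y1 = 0 by move/eqP: e2; rewrite mulf_eq0 invr_eq0 (negPf D0) orbF => /eqP.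
  have f1 : D * y1 = 0.
    have -> : D * y1 = a * (d * y1 - b * y2) + b * (a * y2 - c * y1) by rewrite /D; ring.
    by rewrite e1' e2' !mulr0 addr0.
  have f2 : D * y2 = 0.
    have -> : D * y2 = c * (d * y1 - b * y2) + d * (a * y2 - c * y1) by rewrite /D; ring.
    by rewrite e1' e2' !mulr0 addr0.
  by move/eqP: f1; move/eqP: f2; rewrite !mulf_eq0 (negPf D0) /= => /eqP -> /eqP ->.
have cL : continuous L.
  move=> y.
  have cf : {for y, continuous (fun y : R * R => y.1)} by exact: cvg_fst.
  have cs : {for y, continuous (fun y : R * R => y.2)} by exact: cvg_snd.
  have l1 : {for y, continuous (fun y : R * R => (d * y.1 - b * y.2) / D)}.
    exact: (cvgM (cvgB (cvgM (cvg_cst _) cf) (cvgM (cvg_cst _) cs)) (cvg_cst _)).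
  have l2 : {for y, continuous (fun y : R * R => (a * y.2 - c * y.1) / D)}.
    exact: (cvgM (cvgB (cvgM (cvg_cst _) cs) (cvgM (cvg_cst _) cf)) (cvg_cst _)).
  exact: (cont_pair l1 l2).
have cLq : continuous (fun y : R * R => L (y - ft q)).
  move=> y; apply: (@cont_comp _ _ _ (fun y : R * R => y - ft q) L); last exact: cL.
  by apply: cvgB; [exact: cvg_id|exact: cvg_cst].
have [kap [ck pk Ck kE]] : exists kap : R -> R * R, [/\ continuous kap, perio kap,
    forall t, unit_circle R (kap t) & forall t, h (kap t) = f (circ t)].
  apply: loop_reparam => //.
    by apply: continuous_subspaceW f_continuous; exact: circle_closed_disk.
  by apply: continuous_subspaceW ch; exact: circle_closed_disk.
have h_hyp z : closed_disk R z -> hyp3 R (h z) by move=> Dz; apply: hh; exists z.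
have [z Dz Ez] : exists2 z, closed_disk R z & L ((Phi \o h) z - ft q) = 0.
  apply: (@disk_hit R (fun z => L ((Phi \o f) z - ft q)) (fun z => L ((Phi \o h) z - ft q)) kap q r) => //.
  - have W : {within closed_disk R, continuous ((fun y => L (y - ft q)) \o (Phi \o f))}.
      by apply: within_comp => [|z _]; [exact: ft_continuous|exact: cLq].
    exact: W.
  - move=> z Dz zq; apply/eqP => /L0/eqP; rewrite subr_eq0 => /eqP /= E; apply: zq.
    by apply: ft_inj => //; rewrite -E PhifE.
  - move=> z Dz zr zq; have := rP z zr zq; rewrite /L /= PhifE//.
  - have W1 : {within closed_disk R, continuous (Phi \o h)}.
      by apply: within_comp => // z Dz; apply: (Phi_continuous hP); exact: h_hyp.
    have W : {within closed_disk R, continuous ((fun y => L (y - ft q)) \o (Phi \o h))}.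
      by apply: within_comp => [|z _]; [exact: W1|exact: cLq].
    exact: W.
  - by move=> t; apply: circle_closed_disk; exact: Ck.
  - by move=> t; rewrite /= kE.
have E : (Phi \o h) z = ft q by apply/eqP; rewrite -subr_eq0; apply/eqP; exact: L0.
exists z => //; move: (Dz); rewrite /closed_disk/= le_eqVlt => /orP[/eqP Cz|//].
(* z cannot lie on the boundary, where the two calibrated loops agree *)
have : (f @` unit_circle R) (h z) by rewrite -hf; exists z.
move=> [z' Cz' hz']; have Dz' := circle_closed_disk Cz'.
have : ft z' = ft q by rewrite -E /= -hz' PhifE.
move=> /ft_inj -/(_ Dz' Dq') zq.
by move: Dq; rewrite /open_disk/= -zq Cz' ltxx.
Qed.

(** Both areas are compared with the Lebesgue measure of the calibrated images. *)
Lemma subdisk_area_le : (area f <= area h)%E.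
Proof.
have [ch sh hh ih] := hD.
have h_hyp z : open_disk R z -> hyp3 R (h z).
  by move=> /open_closed_disk Dz; apply: hh; exists z.
have up := Phi_area_le hP eps1 (sh 1%N) h_hyp.
apply: le_trans up.
have low : (area f <= leb (ft @` open_disk R))%E.
  apply: (@area_open_ge R _ (fun s => (ft s).1) (fun s => (ft s).2)).
  - exact: open_disk_open.
  - move=> z w /open_closed_disk Dz /open_closed_disk Dw e1 e2; apply: ft_inj => //.
    by rewrite [ft z]surjective_pairing [ft w]surjective_pairing e1 e2.
  - move=> z Dz; apply: (area_density_continuous open_disk_open C1f Dz).
    by apply: f_hyp3; exact: open_closed_disk.
  - by move=> z _; exact: area_density_ge0.
  - exact: ft_sdiff.
apply: (le_trans low); apply: le_measure; rewrite ?inE.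
- have cF z : open_disk R z -> {for z, continuous ft}.
    by move=> /ft_sdiff[a [b [c [d [h1 h2 _]]]]]; apply: cont_pair; [exact: sdiff_continuous h1|exact: sdiff_continuous h2].
  exact: (image_open_measurable 0 0 open_disk_open cF (@ltr01 R)).1.
- have cF z : open_disk R z -> {for z, continuous (Phi \o h)}.
    move=> Dz; apply: (@cont_comp _ _ _ h Phi); first exact: (Ck1_continuous open_disk_open (sh 1%N) Dz).
    by apply: (Phi_continuous hP); exact: h_hyp.
  exact: (image_open_measurable 0 0 open_disk_open cF (@ltr01 R)).1.
- exact: calibrated_image.
Qed.

End comparison.

Lemma subdisk_least_area f : compact_subdisk Pl f -> least_area_disk f.
Proof.
move=> [[U [oU DU] sf] df fi fP]; split; first exact: (subdisk_disk oU DU sf fi fP).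
by move=> h hD E; exact: (subdisk_area_le oU DU sf df fi fP hD E).
Qed.

End least_area.

(** * Lengths of curves *)

Section curves.
Context {R : realType}.
Implicit Types (t s : R) (c : R -> 'rV[R]_3).

Definition speed c t : R := Num.sqrt (hyp_metric (c t) (derive1 c t) (derive1 c t)).

Lemma component_derive c t i : derivable c t 1 ->
  is_derive t (1 : R) (fun t => c t ord0 i) (derive1 c t ord0 i).
Proof.
move=> dc; split; first by move/derivable_mxP : dc; exact.
by rewrite derive1E derive_mx// mxE.
Qed.

Lemma speed_continuous c t : C1_curve c -> hyp3 R (c t) -> {for t, continuous (speed c)}.
Proof.
move=> [dc cd] ht.
have cc : {for t, continuous c}.
  by apply: row_continuous => i; exact: (@derive_cont _ _ (fun=> _) _ (component_derive i (dc t))).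
have cdt : {for t, continuous (derive1 c)} by exact: cd.
have n0 : (1 - dot (c t) (c t)) ^+ 2 != 0 by rewrite gt_eqF// exprn_gt0// subr_gt0.
have c1 : {for t, continuous (fun t => 1 - dot (c t) (c t))}.
  exact: (cvgB (cvg_cst _) (dot_continuous cc cc)).
have c2 : {for t, continuous (fun t => (1 - dot (c t) (c t)) ^+ 2)}.
  by apply: (@cont_comp _ _ _ (fun t => 1 - dot (c t) (c t)) (fun x : R => x ^+ 2)) => //; exact: exprn_continuous.
have c3 : {for t, continuous (fun t => hyp_metric (c t) (derive1 c t) (derive1 c t))}.
  exact: (cvgM (cvgM (cvg_cst _) (dot_continuous cdt cdt)) (cont_inv (f := fun t => (1 - dot (c t) (c t)) ^+ 2) n0 c2)).
apply: (@cont_comp _ _ _ (fun t => hyp_metric (c t) (derive1 c t) (derive1 c t)) Num.sqrt) => //.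
exact: sqrt_continuous.
Qed.

(** The speed is extended continuously beyond [0, 1] by clamping the parameter, so that it has a
    primitive on the line. *)
Lemma length_primitive c : C1_curve c -> (forall t, 0 <= t <= 1 -> hyp3 R (c t)) ->
  exists2 K : R -> R, (forall t, 0 <= t <= 1 -> is_derive t (1 : R) K (speed c t)) &
    curve_length c = (K 1 - K 0)%:E.
Proof.
move=> hc hh.
have cs t : {for t, continuous (fun t => speed c (clamp 0 1 t))}.
  apply: (@cont_comp _ _ _ (clamp 0 1) (speed c)); first exact: clamp_continuous.
  by apply: speed_continuous => //; apply: hh; exact: clamp_itv.
have [K K0 dK] := primitive_exists 0 cs.
have clE t : 0 <= t <= 1 -> clamp 0 1 t = t.
  by move=> /andP[t0 t1]; rewrite /clamp (min_r t1) max_r.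
have cK t : {for t, continuous K} by exact: (@derive_cont _ _ (fun=> _) _ (dK t)).
exists K; first by move=> t ht; rewrite -{2}(clE t ht).
rewrite EFinB -(@continuous_FTC2 R (speed c) K 0 1 ltr01) //.
- apply: continuous_in_subspaceT => t; rewrite inE/= in_itv/= => ht.
  by apply: speed_continuous => //; exact: hh.
- split; first by move=> t _; exact: (@ex_derive _ _ _ _ _ _ _ (dK t)).
  + by apply: cvg_at_right_filter; exact: cK.
  + by apply: cvg_at_left_filter; exact: cK.
- move=> t; rewrite in_itv/= => /andP[t0 t1].
  rewrite derive1E (@derive_val _ _ _ _ _ _ _ (dK t)) clE//.
  by rewrite (ltW t0) (ltW t1).
Qed.

(** Cauchy-Schwarz in dimension 3, as a sum of squares. *)
Lemma dot_CS (u v : 'rV[R]_3) : dot u v ^+ 2 <= dot u u * dot v v.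
Proof.
rewrite !dotE; move: (u ord0 i0) (u ord0 i1) (u ord0 i2) (v ord0 i0) (v ord0 i1) (v ord0 i2).
move=> a b c x y z; rewrite -subr_ge0.
have -> : (a * a + b * b + c * c) * (x * x + y * y + z * z) - (a * x + b * y + c * z) ^+ 2 =
  (a * y - b * x) ^+ 2 + (a * z - c * x) ^+ 2 + (b * z - c * y) ^+ 2 by ring.
by rewrite !addr_ge0 ?sqr_ge0.
Qed.

Lemma component_sqr_le (u : 'rV[R]_3) i : u ord0 i ^+ 2 <= dot u u.
Proof.
rewrite dotE -!expr2; have s0 := sqr_ge0 (u ord0 i0); have s1 := sqr_ge0 (u ord0 i1).
by have s2 := sqr_ge0 (u ord0 i2); case: (ord3 i) => ->; lra.
Qed.

(** Both the coordinates and the logarithm of the conformal factor are Lipschitz for the hyperbolic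
    metric. *)
Lemma length_bounds c (L : R) : C1_curve c -> (forall t, 0 <= t <= 1 -> hyp3 R (c t)) ->
  (curve_length c < L%:E)%E ->
  (forall i, `|c 1 ord0 i - c 0 ord0 i| <= L) /\
  `|ln (1 - dot (c 1) (c 1)) - ln (1 - dot (c 0) (c 0))| <= L.
Proof.
move=> hc hh; have [K dK ->] := length_primitive hc hh; rewrite lte_fin => KL.
have [dc _] := hc.
have compare (phi dphi : R -> R) : (forall t, 0 <= t <= 1 -> is_derive t (1 : R) phi (dphi t)) ->
    (forall t, 0 <= t <= 1 -> `|dphi t| <= speed c t) -> `|phi 1 - phi 0| <= L.
  move=> dphi' le.
  have h1 := @derive_le R phi K dphi (speed c) 0 1 ler01 dphi' dK (fun t ht => le_trans (ler_norm _) (le t ht)).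
  have h2 := @derive_le R (fun t => - phi t) K (fun t => - dphi t) (speed c) 0 1 ler01.
  have {}h2 : - phi 1 - - phi 0 <= K 1 - K 0.
    apply: h2 => //; first by move=> t ht; apply: is_deriveN; exact: dphi'.
    by move=> t ht; apply: le_trans (le t ht); rewrite -normrN; exact: ler_norm.
  by rewrite ler_norml; apply/andP; split; lra.
have sp t : 0 <= t <= 1 -> forall x : R, x ^+ 2 * (1 - dot (c t) (c t)) ^+ 2 <=
    4 * dot (derive1 c t) (derive1 c t) -> `|x| <= speed c t.
  move=> ht x hx; have ht' : 0 < 1 - dot (c t) (c t) by rewrite subr_gt0; exact: hh.
  rewrite -sqrtr_sqr ler_sqrt; last first.
    by rewrite /hyp_metric divr_ge0 ?sqr_ge0// mulr_ge0// dot_ge0.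
  by rewrite /hyp_metric ler_pdivlMr// exprn_gt0.
split=> [i|].
  apply: (compare (fun t => c t ord0 i) (fun t => derive1 c t ord0 i)).
    by move=> t _; exact: component_derive.
  move=> t ht; apply: sp => //.
  have d1 : 0 < 1 - dot (c t) (c t) by rewrite subr_gt0; exact: hh.
  have d2 : (1 - dot (c t) (c t)) ^+ 2 <= 1.
    by have := dot_ge0 (c t); move: (dot _ _) d1 => d d1 d0; nra.
  have := component_sqr_le (derive1 c t) i; have := dot_ge0 (derive1 c t).
  have := sqr_ge0 (derive1 c t ord0 i).
  move: (dot (derive1 c t) (derive1 c t)) (derive1 c t ord0 i ^+ 2) ((1 - _) ^+ 2) d2 => D x d d2; nra.
apply: (compare (fun t => ln (1 - dot (c t) (c t)))
  (fun t => (1 - dot (c t) (c t))^-1 * (- (2 * dot (c t) (derive1 c t))))).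
  move=> t ht.
  have d1 : 0 < 1 - dot (c t) (c t) by rewrite subr_gt0; exact: hh.
  apply: (is_derive_comp (f := @ln R) (g := fun t => 1 - dot (c t) (c t))); first exact: is_derive1_ln.
  have h i := component_derive i (dc t).
  have m i := is_derive_mul (h i) (h i).
  have -> : (fun t => 1 - dot (c t) (c t)) = (fun t => 1 - (c t ord0 i0 * c t ord0 i0 +
    c t ord0 i1 * c t ord0 i1 + c t ord0 i2 * c t ord0 i2)) by apply/funext => s; rewrite dotE.
  apply: is_derive_eq (is_deriveB (is_derive_cst (1 : R) t (1 : R)) (is_deriveD (is_deriveD (m i0) (m i1)) (m i2))) _.
  by rewrite dotE /=; ring.
move=> t ht; apply: sp => //.
have d1 : 0 < 1 - dot (c t) (c t) by rewrite subr_gt0; exact: hh.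
rewrite exprMn exprVn mulrAC mulVf ?mul1r; last by rewrite gt_eqF// exprn_gt0.
have := dot_CS (c t) (derive1 c t); have := dot_ge0 (derive1 c t); have := dot_ge0 (c t).
move: (dot (c t) (derive1 c t)) (dot (derive1 c t) (derive1 c t)) (dot (c t) (c t)) d1.
move=> x D d d1 d0 D0 h; rewrite sqrrN exprMn; nra.
Qed.

Lemma sdiff_line (f : R * R -> R) (p v : R * R) t (A B : R) : sdiff f (p + t *: v) A B ->
  is_derive t (1 : R) (fun s => f (p + s *: v)) (A * v.1 + B * v.2).
Proof.
move=> df; apply/is_derive_epsP => e e0.
pose C := `|v.1| + `|v.2| + 1.
have C0 : 0 < C by rewrite ltr_wpDl// addr_ge0.
have eC : 0 < e / C by rewrite divr_gt0.
have [d d0 dP] := df _ eC.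
exists (d / C); first by rewrite divr_gt0.
move=> y; rewrite ltr_pdivlMr// => yt.
have E1 : (p + y *: v).1 - (p + t *: v).1 = (y - t) * v.1 by rewrite /= /GRing.scale/=; ring.
have E2 : (p + y *: v).2 - (p + t *: v).2 = (y - t) * v.2 by rewrite /= /GRing.scale/=; ring.
have b1 : `|v.1| <= C by rewrite /C; have := normr_ge0 v.2; lra.
have b2 : `|v.2| <= C by rewrite /C; have := normr_ge0 v.1; lra.
have := dP (p + y *: v); rewrite E1 E2 !normrM => /(_ _ _)/le_trans; rewrite -!mulrA => h.
have -> : (A * v.1 + B * v.2) * (y - t) = A * ((y - t) * v.1) + B * ((y - t) * v.2) by ring.
apply: h.
- by apply: le_lt_trans yt; exact: ler_wpM2l.
- by apply: le_lt_trans yt; exact: ler_wpM2l.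
- move: (`|y - t|) (normr_ge0 (y - t)) => Y Y0.
  have -> : e * (C^-1 * (Y * `|v.1| + Y * `|v.2|)) = e * Y * ((`|v.1| + `|v.2|) / C) by ring.
  rewrite ler_piMr//; first by rewrite mulr_ge0// ltW.
  by rewrite ler_pdivrMr// mul1r /C lerDl.
Qed.

End curves.

Section segments.
Context {R : realType}.
Implicit Types (t : R) (p s q : R * R).
Variable f : R * R -> 'rV[R]_3.
Hypothesis C1F : Ck 1 setT f.
Hypothesis f_hyp3 : forall s, hyp3 R (f s).

Definition seg (p q : R * R) (t : R) : 'rV[R]_3 := f (p + t *: (q - p)).

Lemma seg_derive p q t : derivable (seg p q) t 1 /\
  derive1 (seg p q) t = (q - p).1 *: partial1 f (p + t *: (q - p)) + (q - p).2 *: partial2 f (p + t *: (q - p)).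
Proof.
have h i := sdiff_line (Ck1_sdiff (w := p + t *: (q - p)) i openT C1F I).
have d : derivable (seg p q) t 1.
  by apply/derivable_mxP => a i; rewrite ord1; exact: (@ex_derive _ _ _ _ _ _ _ (h i)).
split; first exact: d.
apply/rowP => i; rewrite derive1E (derive_mx d).
apply: etrans (mxE _ _ _ _) _; apply: etrans (@derive_val _ _ _ _ _ _ _ (h i)) _.
by rewrite [RHS]mxE [X in _ = X + _]mxE [X in _ = _ + X]mxE mulrC [X in _ + X = _]mulrC.
Qed.

Lemma line_continuous p q : continuous (fun t : R => p + t *: (q - p)).
Proof. by move=> t; apply: cvgD; [exact: cvg_cst|apply: cvgZ; [exact: cvg_id|exact: cvg_cst]]. Qed.

Lemma seg_C1 p q : C1_curve (seg p q).
Proof.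
split; first by move=> t; exact: (seg_derive p q t).1.
have -> : derive1 (seg p q) = (fun t => (q - p).1 *: partial1 f (p + t *: (q - p)) +
    (q - p).2 *: partial2 f (p + t *: (q - p))) by apply/funext => t; exact: (seg_derive p q t).2.
have [_ c1 c2] := C1F.
move=> t.
have k1 : {for t, continuous (fun t : R => partial1 f (p + t *: (q - p)))}.
  by apply: (@cont_comp _ _ _ (fun t : R => p + t *: (q - p)) (partial1 f)); [exact: line_continuous|exact: c1].
have k2 : {for t, continuous (fun t : R => partial2 f (p + t *: (q - p)))}.
  by apply: (@cont_comp _ _ _ (fun t : R => p + t *: (q - p)) (partial2 f)); [exact: line_continuous|exact: c2].
exact: (cvgD (cvgZ (cvg_cst _) k1) (cvgZ (cvg_cst _) k2)).
Qed.

(** Short coordinate segments are short curves of the plane. *)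
Lemma seg_short q e : 0 < e -> exists2 r : R, 0 < r & forall p, `|p - q| < r ->
  (curve_length (seg p q) < e%:E)%E.
Proof.
move=> e0.
have bnd (x y a : R) : `|x - y| < 1 -> 0 <= a -> y < `|x| + a + 1.
  by have := ler_norm x; rewrite ltr_norml; lra.
have [_ c1 c2] := C1F.
pose E s := hyp_metric (f s) (partial1 f s) (partial1 f s).
pose G s := hyp_metric (f s) (partial2 f s) (partial2 f s).
have cF s : {for s, continuous f} by exact: Ck1_continuous openT C1F I.
have dF s : 0 < 1 - dot (f s) (f s) by rewrite subr_gt0; exact: f_hyp3.
have cm (u : R * R -> 'rV[R]_3) : {for q, continuous u} ->
    {for q, continuous (fun s => hyp_metric (f s) (u s) (u s))}.
  move=> cu.
  have k1 : {for q, continuous (fun s => 1 - dot (f s) (f s))}.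
    exact: (cvgB (cvg_cst _) (dot_continuous (cF q) (cF q))).
  have k2 : {for q, continuous (fun s => (1 - dot (f s) (f s)) ^+ 2)}.
    by apply: (@cont_comp _ _ _ (fun s => 1 - dot (f s) (f s)) (fun x : R => x ^+ 2)) => //; exact: exprn_continuous.
  have n0 : (1 - dot (f q) (f q)) ^+ 2 != 0 by rewrite gt_eqF// exprn_gt0.
  exact: (cvgM (cvgM (cvg_cst _) (dot_continuous cu cu)) (cont_inv (f := fun s => (1 - dot (f s) (f s)) ^+ 2) n0 k2)).
have cE : {for q, continuous E} by apply: cm; exact: c1.
have cG : {for q, continuous G} by apply: cm; exact: c2.
pose M := `|E q| + `|G q| + 1.
have M0 : 0 < M by rewrite ltr_wpDl// addr_ge0.
have : nbhs q [set s | `|E q - E s| < 1] by move/cvgrPdist_lt : cE => /(_ _ (@ltr01 R)).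
move=> /nbhs_ballP[r1 /= r10 h1].
have : nbhs q [set s | `|G q - G s| < 1] by move/cvgrPdist_lt : cG => /(_ _ (@ltr01 R)).
move=> /nbhs_ballP[r2 /= r20 h2].
have eM : 0 < e / (3 * M) by rewrite divr_gt0// mulr_gt0.
have M1 : 1 <= M by rewrite /M lerDr addr_ge0.
exists (Num.min (Num.min r1 r2) (e / (3 * M))); first by rewrite !lt_min r10 r20.
move=> p; rewrite !lt_min => /andP[/andP[pr1 pr2] pe].
have hseg t : hyp3 R (seg p q t) by exact: f_hyp3.
have [K dK KE] := length_primitive (seg_C1 p q) (fun t _ => hseg t).
pose n := `|p - q|; have n0 : 0 <= n by exact: normr_ge0.
have sp t : 0 <= t <= 1 -> speed (seg p q) t <= 2 * M * n.
  move=> /andP[t0 t1]; set s := p + t *: (q - p).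
  have sq : `|q - s| <= n.
    have -> : q - s = (1 - t) *: (q - p) by rewrite /s scalerBl scale1r opprD addrA.
    rewrite normrZ (distrC q p) -/n; apply: ler_piMl; first exact: normr_ge0.
    by rewrite ger0_norm; lra.
  have Es : E s < M.
    have : `|E q - E s| < 1 by apply: h1; rewrite -ball_normE/=; exact: le_lt_trans sq pr1.
    by move=> /bnd; apply.
  have Gs : G s < M.
    have : `|G q - G s| < 1 by apply: h2; rewrite -ball_normE/=; exact: le_lt_trans sq pr2.
    by move=> /bnd h; rewrite /M (addrC `|E q|); apply: h.
  have n1 : `|(q - p).1| <= n by rewrite /n distrC prod_normE le_max lexx.
  have n2 : `|(q - p).2| <= n by rewrite /n distrC prod_normE le_max lexx orbT.
  apply: sqrt_le_sq; first by rewrite mulr_ge0 ?normr_ge0// mulr_ge0// ltW.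
  rewrite (seg_derive p q t).2 -/s /seg -/s /hyp_metric dot_combination.
  move: Es Gs; rewrite /E /G /hyp_metric; have d0 := dF s.
  have CS := dot_CS (partial1 f s) (partial2 f s).
  have p1 := dot_ge0 (partial1 f s); have p3 := dot_ge0 (partial2 f s).
  have dd : 0 < (1 - dot (f s) (f s)) ^+ 2 by rewrite exprn_gt0.
  have a1 : (q - p).1 ^+ 2 <= n ^+ 2 by rewrite -(real_normK (num_real (q - p).1)) ler_sqr ?nnegrE ?normr_ge0 ?n0.
  have a2 : (q - p).2 ^+ 2 <= n ^+ 2 by rewrite -(real_normK (num_real (q - p).2)) ler_sqr ?nnegrE ?normr_ge0 ?n0.
  move: CS p1 p3 dd a1 a2.
  move: (dot (partial1 f s) (partial1 f s)) (dot (partial1 f s) (partial2 f s))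
    (dot (partial2 f s) (partial2 f s)) ((1 - dot (f s) (f s)) ^+ 2) ((q - p).1) ((q - p).2).
  move=> e' f' g' d' a b CS p1 p3 dd a1 a2.
  rewrite !ltr_pdivrMr// ler_pdivrMr// => Es Gs.
  have cross : 2 * a * b * f' <= a ^+ 2 * e' + b ^+ 2 * g'.
    have h0 : (a * b * f') ^+ 2 <= (a ^+ 2 * e') * (b ^+ 2 * g').
      have -> : (a * b * f') ^+ 2 = (a ^+ 2 * b ^+ 2) * f' ^+ 2 by ring.
      have -> : a ^+ 2 * e' * (b ^+ 2 * g') = (a ^+ 2 * b ^+ 2) * (e' * g') by ring.
      by apply: ler_wpM2l => //; rewrite mulr_ge0 ?sqr_ge0.
    have u0 : 0 <= a ^+ 2 * e' by rewrite mulr_ge0 ?sqr_ge0.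
    have v0 : 0 <= b ^+ 2 * g' by rewrite mulr_ge0 ?sqr_ge0.
    have h3 : (2 * a * b * f') ^+ 2 <= (a ^+ 2 * e' + b ^+ 2 * g') ^+ 2.
      have -> : (2 * a * b * f') ^+ 2 = 4 * (a * b * f') ^+ 2 by ring.
      have := sqr_ge0 (a ^+ 2 * e' - b ^+ 2 * g'); move: (a ^+ 2 * e') (b ^+ 2 * g') h0 => U V h0; nra.
    apply: (le_trans (ler_norm _)).
    by rewrite -(@ler_pXn2r _ 2) ?nnegrE ?addr_ge0// real_normK// num_real.
  have k1 : a ^+ 2 * (4 * e') <= n ^+ 2 * (M * d') by apply: ler_pM; rewrite ?sqr_ge0 ?mulr_ge0// ltW.
  have k2 : b ^+ 2 * (4 * g') <= n ^+ 2 * (M * d') by apply: ler_pM; rewrite ?sqr_ge0 ?mulr_ge0// ltW.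
  have k3 : n ^+ 2 * (M * d') <= n ^+ 2 * (M ^+ 2 * d').
    by apply: ler_wpM2l; [exact: sqr_ge0|rewrite ler_pM2r// expr2 ler_peMr// ltW].
  have -> : (2 * M * n) ^+ 2 * d' = 4 * (n ^+ 2 * (M ^+ 2 * d')) by ring.
  lra.
have h := @derive_le R K (fun t => 2 * M * n * t) (speed (seg p q)) (fun=> 2 * M * n) 0 1 ler01 dK.
have {}h : K 1 - K 0 <= 2 * M * n * 1 - 2 * M * n * 0.
  apply: h => // t _; apply: is_derive_eq (is_derive_mul (is_derive_cst (2 * M * n) t (1 : R)) (is_derive_id t (1 : R))) _.
  by rewrite mul0r add0r mulr1.
rewrite mulr0 mulr1 subr0 in h.
rewrite KE lte_fin; apply: (le_lt_trans h).
have : n * (3 * M) < e by rewrite -ltr_pdivlMr// mulr_gt0.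
have := mulr_ge0 n0 (ltW M0); lra.
Qed.

End segments.

(** * Completeness *)

Section completeness.
Context {R : realType}.
Implicit Types (w t : R) (p s : R * R).
Variables (mu : R) (vth : R -> R) (eps : R).
Hypothesis hP : is_profile mu vth.
Hypothesis eps1 : eps ^+ 2 = 1.
Local Notation Fs := (Fs mu vth eps).
Local Notation Pl := (Pl mu vth eps).
Local Notation Finv := (Finv mu vth eps).

(** Any curve of length less than L from x to y gives these bounds. *)
Lemma intrinsic_dist_bounds (x y : 'rV[R]_3) (L : R) : (intrinsic_dist Pl x y < L%:E)%E ->
  (forall i, `|y ord0 i - x ord0 i| <= L) /\ `|ln (del (tri y)) - ln (del (tri x))| <= L.
Proof.
move=> /ereal_inf_lt[_ [c [c1 cP cx cy] <-] len]; rewrite -cx -cy !del_dot.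
apply: length_bounds => // t t01; apply: (Pl_hyp3 eps1); apply: cP; exists t => //.
Qed.

Lemma hw_ge w : `|w| <= hw w.
Proof.
by apply: sqrt_ge_sq; rewrite ?real_normK ?num_real// /xw; have := sqr_ge0 w; lra.
Qed.

Lemma coshR_ge1 t : 1 <= coshR t.
Proof.
have h : 1 <= coshR t ^+ 2 by rewrite cosh2 lerDl sqr_ge0.
by have := coshR_gt0 t; move: (coshR t) h => c h c0; nra.
Qed.

Lemma rw_ge1 w : 1 <= rw w.
Proof. by apply: sqrt_ge_sq; rewrite ?expr1n /xw; have := sqr_ge0 w; lra. Qed.

(** Along the plane, the conformal factor controls the profile parameter, which keeps p away
    from 0. *)
Lemma p_lower_bound p (B : R) : den p <= B -> cos (vth B) <= (pvz mu eps (Fs p)).1.1.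
Proof.
move=> dB; rewrite pvz_Fs// /=.
have hB : `|p.1| <= B.
  apply: (le_trans (hw_ge p.1)); apply: le_trans dB; rewrite /den.
  by have := ler_wpM2l (ltW (hw_gt0 p.1)) (coshR_ge1 p.2); rewrite mulr1; lra.
have c0 := vth_cos_gt0 hP p.1; have r1 := rw_ge1 p.1.
apply: (@le_trans _ _ (cos (vth p.1))); last by rewrite ler_peMl// ltW.
have vabs : cos (vth p.1) = cos (vth `|p.1|).
  by have [h|h] := leP 0 p.1; [rewrite ger0_norm|rewrite ltr0_norm// (profile_odd hP) cosN].
have v0 w : 0 <= w -> 0 <= vth w by rewrite -{2}(profile0 hP) (profile_mono hP).
have vpi w : vth w <= pi.
  by have := profile_lt hP w; have := pi_gt0 R; lra.
have B0 : 0 <= B by exact: le_trans hB.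
rewrite vabs leNgt; apply/negP => h.
have : vth `|p.1| <= vth B by rewrite (profile_mono hP).
rewrite leNgt => /negP; apply.
rewrite -ltr_cos// in_itv/= ?v0 ?vpi//.
Qed.

Lemma cvg_row (x : nat -> 'rV[R]_3) (l : 'rV[R]_3) :
  (forall i, x n ord0 i @[n --> \oo] --> l ord0 i) -> x @ \oo --> l.
Proof.
move=> c; apply/cvg_ballP => e e0.
have h i : \forall n \near \oo, `|l ord0 i - x n ord0 i| < e.
  by move/cvgrPdist_lt : (c i) => /(_ _ e0).
near=> n; split=> // a b; rewrite ord1 /ball/=.
by case: (ord3 b) => ->; near: n; exact: h.
Unshelve. all: by end_near. Qed.

Lemma cvg_lower_bound (a : nat -> R) (l c : R) (N : nat) : a @ \oo --> l ->
  (forall n, (N <= n)%N -> c <= a n) -> c <= l.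
Proof.
move=> al h; rewrite leNgt; apply/negP => lc.
have e0 : 0 < c - l by rewrite subr_gt0.
have : \forall n \near \oo, `|l - a n| < c - l by move/cvgrPdist_lt : al => /(_ _ e0).
move=> [M _ hM]; have := hM (maxn N M) (leq_maxr _ _); have := h _ (leq_maxl N M).
by rewrite /= ltr_norml; lra.
Qed.

(** A Cauchy sequence converges in the ball, because its coordinates and the logarithm of its conformal
    factor do; the limit has p > 0, where Finv is continuous, so it lies in the plane and its parameter
    is the limit of the parameters, to which short coordinate segments lead. *)
Lemma Pl_complete : complete_surface Pl.
Proof.
move=> x xP xC.
have /choice[u uE] : forall n, exists p, Fs p = x n by move=> n; have [p _ <-] := xP n; exists p.
have comp i : cvgn (fun n => x n ord0 i).
  apply/cauchy_cvgP; apply: cauchy_exP => e e0.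
  have e2 : 0 < e / 2 by rewrite divr_gt0.
  have [N hN] := xC _ e2.
  exists (x N ord0 i); exists N => // n /= Nn.
  have [/(_ i) h _] := intrinsic_dist_bounds (hN N n (leqnn N) Nn).
  by rewrite /ball/= distrC (le_lt_trans h)//; lra.
pose X := \row_i lim (x n ord0 i @[n --> \oo]) : 'rV[R]_3.
have xX : x @ \oo --> X.
  by apply: cvg_row => i; rewrite mxE; exact: comp.
have [N1 hN1] := xC _ (@ltr01 R).
pose c := expR (ln (del (tri (x N1))) - 1).
have c0 : 0 < c by exact: expR_gt0.
have dpos n : 0 < del (tri (x n)) by apply/hyp3_del; exact: (Pl_hyp3 eps1 (xP n)).
have dc n : (N1 <= n)%N -> c <= del (tri (x n)).
  move=> Nn; have [_] := intrinsic_dist_bounds (hN1 N1 n (leqnn N1) Nn).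
  rewrite ler_norml => /andP[h _].
  by rewrite -[del (tri (x n))]lnK ?posrE// /c ler_expR; lra.
have cdel : {for X, continuous (fun u : 'rV[R]_3 => del (tri u))}.
  have -> : (fun u : 'rV[R]_3 => del (tri u)) = (fun u => 1 - dot u u) by apply/funext => v; exact: del_dot.
  have cid : {for X, continuous (fun u : 'rV[R]_3 => u)} by exact: cvg_id.
  exact: (cvgB (cvg_cst _) (dot_continuous cid cid)).
have Xh : hyp3 R X.
  apply/hyp3_del; apply: (lt_le_trans c0).
  exact: (cvg_lower_bound (cvg_comp _ _ xX cdel) dc).
pose B := 2 / c.
have k0 : 0 < cos (vth B) by exact: (vth_cos_gt0 hP).
have pB n : (N1 <= n)%N -> cos (vth B) <= (pvz mu eps (x n)).1.1.
  move=> Nn; rewrite -uE; apply: p_lower_bound.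
  have h := dc n Nn; rewrite -uE (Fs_del _ _ eps1) in h.
  have d0 := den_gt0 (u n).
  move: h; rewrite ler_pdivlMr// => h.
  by rewrite /B ler_pdivlMr// mulrC.
have cpv : {for X, continuous (pvz mu eps)} by exact: pvz_continuous.
have Xp : 0 < (pvz mu eps X).1.1.
  apply: (lt_le_trans k0).
  have cp : {for X, continuous (fun u => (pvz mu eps u).1.1)} by apply: cont_fst; exact: (cont_fst cpv).
  exact: (cvg_lower_bound (cvg_comp _ _ xX cp) pB).
have cF : {for X, continuous Finv} by apply: Finv_continuous.
pose q := Finv X.
have uq : u @ \oo --> q.
  have -> : u = (fun n => Finv (x n)) by apply/funext => n; rewrite -uE (FsK hP eps1).
  exact: (cvg_comp _ _ xX cF).
have S : smooth_on setT Fs by exact: Fs_smooth.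
have cFs : {for q, continuous Fs} by exact: (Ck1_continuous openT (S 1%N) I).
have XE : X = Fs q.
  apply: (cvg_unique _ xX); first exact: norm_hausdorff.
  have -> : x = (fun n => Fs (u n)) by apply/funext => n; rewrite uE.
  exact: (cvg_comp _ _ uq cFs).
exists (Fs q); first by exists q.
move=> e e0.
have [r r0 hr] := seg_short (S 1%N) (Fs_hyp3 mu vth eps1) q e0.
have : \forall n \near \oo, `|q - u n| < r by move/cvgrPdist_lt : uq => /(_ _ r0).
move=> [N _ hN]; exists N => n Nn.
have ur : `|u n - q| < r by rewrite distrC; exact: hN.
apply: le_lt_trans (hr _ ur); apply: ereal_inf_lbound.
exists (seg Fs (u n) q) => //; split.
- exact: seg_C1 (S 1%N) _ _.
- by move=> _ [t _ <-]; exists (u n + t *: (q - u n)).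
- by rewrite /seg scale0r addr0 uE.
- by rewrite /seg scale1r addrC subrK.
Qed.

End completeness.

(** * The ideal boundary *)

Section boundary_curve.
Context {R : realType}.
Implicit Types (w t : R) (p s : R * R).
Variables (mu : R) (vth : R -> R).
Hypothesis hP : is_profile mu vth.
Local Notation lam := (lam mu).

Definition artanh (s : R) : R := (ln (1 + s) - ln (1 - s)) / 2.

(** The common ideal boundary: the orbit of two antipodal ideal points under the screw motion,
    closed up by the two ends of its axis. *)
Definition gam p : 'rV[R]_3 := \row_i
  (if i == i0 then - (p.1 * sin (lam * artanh p.2))
   else if i == i1 then p.1 * cos (lam * artanh p.2) else p.2).
Definition Gam : set 'rV[R]_3 := gam @` unit_circle R.

Lemma gam0 p : gam p ord0 i0 = - (p.1 * sin (lam * artanh p.2)).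
Proof. by rewrite mxE. Qed.
Lemma gam1 p : gam p ord0 i1 = p.1 * cos (lam * artanh p.2).
Proof. by rewrite mxE. Qed.
Lemma gam2 p : gam p ord0 i2 = p.2.
Proof. by rewrite mxE. Qed.

Lemma Gam_sphere : Gam `<=` sphere_infty R.
Proof.
move=> _ [p Cp <-]; rewrite /sphere_infty /= dotE gam0 gam1 gam2.
have := cos2Dsin2 (lam * artanh p.2); move: Cp; rewrite /unit_circle/=.
move: (p.1) (p.2) (cos _) (sin _) => a b c s Cp cs.
have -> : - (a * s) * - (a * s) + a * c * (a * c) + b * b = a ^+ 2 * (c ^+ 2 + s ^+ 2) + b ^+ 2 by ring.
by rewrite cs mulr1.
Qed.

(** The height gives back p.2, and undoing the rotation gives back p.1. *)
Lemma gam_inj : set_inj (unit_circle R) gam.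
Proof.
move=> p q _ _ E.
have e2 : p.2 = q.2 by rewrite -gam2 E gam2.
have rec s : s.1 = gam s ord0 i1 * cos (lam * artanh s.2) - gam s ord0 i0 * sin (lam * artanh s.2).
  rewrite gam0 gam1; have := cos2Dsin2 (lam * artanh s.2).
  move: (cos _) (sin _) => c d cd; rewrite -[LHS]mulr1 -cd; ring.
by rewrite [p]surjective_pairing [q]surjective_pairing (rec p) (rec q) E e2.
Qed.

Lemma trig_le1 (a : R) : `|cos a| <= 1 /\ `|sin a| <= 1.
Proof.
have := cos2Dsin2 a; have c2 := sqr_ge0 (cos a); have s2 := sqr_ge0 (sin a) => h.
by split; rewrite -(@ler_pXn2r _ 2) ?nnegrE// real_normK ?num_real// expr1n; lra.
Qed.

(** At the ends of the axis the argument of the trigonometric functions diverges, but they are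
    multiplied by p.1, which tends to 0. *)
Lemma gam_continuous : {within unit_circle R, continuous gam}.
Proof.
apply: continuous_in_subspaceT => p; rewrite inE /unit_circle/= => Cp.
have c1 : {for p, continuous (fun s : R * R => s.1)} by exact: cvg_fst.
have c2 : {for p, continuous (fun s : R * R => s.2)} by exact: cvg_snd.
have prodc (phi : R -> R) : continuous phi -> (forall a, `|phi a| <= 1) ->
    {for p, continuous (fun s : R * R => s.1 * phi (lam * artanh s.2))}.
  move=> cphi phi1; have [p10|p10] := eqVneq p.1 0.
    have z : p.1 * phi (lam * artanh p.2) = 0 by rewrite p10 mul0r.
    apply/cvgrPdist_le => e e0; rewrite /= z.
    have near1 : \forall s \near p, `|p.1 - s.1| <= e by move/cvgrPdist_le : c1 => /(_ _ e0).
    near=> s; have : `|p.1 - s.1| <= e by near: s.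
    by rewrite p10 !sub0r !normrN normrM; apply: le_trans; rewrite ler_piMr.
  have q1 : 0 < p.1 ^+ 2 by rewrite exprn_even_gt0.
  have h1 : 0 < 1 + p.2 by nra.
  have h2 : 0 < 1 - p.2 by nra.
  have l1 : {for p, continuous (fun s : R * R => ln (1 + s.2))}.
    apply: (@cont_comp _ _ _ (fun s : R * R => 1 + s.2) (@ln R)); last exact: continuous_ln.
    exact: (cvgD (cvg_cst _) c2).
  have l2 : {for p, continuous (fun s : R * R => ln (1 - s.2))}.
    apply: (@cont_comp _ _ _ (fun s : R * R => 1 - s.2) (@ln R)); last exact: continuous_ln.
    exact: (cvgB (cvg_cst _) c2).
  have l3 : {for p, continuous (fun s : R * R => lam * artanh s.2)}.
    exact: (cvgM (cvg_cst _) (cvgM (cvgB l1 l2) (cvg_cst _))).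
  have l4 : {for p, continuous (fun s : R * R => phi (lam * artanh s.2))}.
    by apply: (@cont_comp _ _ _ (fun s : R * R => lam * artanh s.2) phi) => //; exact: cphi.
  exact: (cvgM c1 l4).
apply: row_continuous => i; case: (ord3 i) => ->.
- have -> : (fun s => gam s ord0 i0) = (fun s => - (s.1 * sin (lam * artanh s.2))) by apply/funext => s; exact: gam0.
  have h := prodc _ (@continuous_sin R) (fun a => (trig_le1 a).2).
  exact: (cvgN h).
- have -> : (fun s => gam s ord0 i1) = (fun s => s.1 * cos (lam * artanh s.2)) by apply/funext => s; exact: gam1.
  exact: (prodc _ (@continuous_cos R) (fun a => (trig_le1 a).1)).
- have -> : (fun s => gam s ord0 i2) = (fun s => s.2) by apply/funext => s; exact: gam2.
  exact: c2.
Unshelve. all: by end_near.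
Qed.

Lemma Gam_simple : simple_closed_curve Gam.
Proof. by exists gam; split; [exact: gam_continuous|exact: gam_inj|]. Qed.

Lemma closure_rowP (A : set 'rV[R]_3) (X : 'rV[R]_3) :
  (forall e : R, 0 < e -> exists2 u, A u & forall i, `|u ord0 i - X ord0 i| < e) -> closure A X.
Proof.
move=> h B /nbhs_ballP[e /= e0 eB]; have [u Au uX] := h _ e0.
exists u; split => //; apply: eB; split => // a b; rewrite ord1 /ball/= distrC; exact: uX.
Qed.

Lemma cos_lip (a b : R) : `|cos a - cos b| <= `|a - b|.
Proof.
have [c _ E] := @mean_value R cos (fun t => - sin t) b a.
by rewrite E normrM normrN; apply: ler_piMl => //; have [] := trig_le1 c.
Qed.

Lemma sin_lip (a b : R) : `|sin a - sin b| <= `|a - b|.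
Proof.
have [c _ E] := @mean_value R sin cos b a.
by rewrite E normrM; apply: ler_piMl => //; have [] := trig_le1 c.
Qed.

(** The second equation says that the hyperbolic cosine is the reciprocal of the distance to the axis. *)
Lemma tanh_artanh (b : R) : -1 < b < 1 ->
  sinhR (artanh b) = b * coshR (artanh b) /\ coshR (artanh b) ^+ 2 * (1 - b ^+ 2) = 1.
Proof.
move=> /andP[b1 b2]; have p1 : 0 < 1 + b by lra.
have p2 : 0 < 1 - b by lra.
pose E := expR (artanh b); have E0 : 0 < E by exact: expR_gt0.
have EE : E ^+ 2 * (1 - b) = 1 + b.
  rewrite /E expr2 -expRD /artanh.
  have -> : (ln (1 + b) - ln (1 - b)) / 2 + (ln (1 + b) - ln (1 - b)) / 2 = ln (1 + b) - ln (1 - b) by field.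
  by rewrite -ln_div ?posrE// lnK ?posrE ?divr_gt0// divfK// gt_eqF.
have sE : sinhR (artanh b) = b * coshR (artanh b).
  rewrite /sinhR /coshR expRN -/E.
  have -> : (E - E^-1) / 2 = (E ^+ 2 - 1) / (2 * E) by field; rewrite lt0r_neq0.
  have -> : b * ((E + E^-1) / 2) = b * (E ^+ 2 + 1) / (2 * E) by field; rewrite lt0r_neq0.
  by congr (_ / _); move: EE; move: (E ^+ 2) => X EE; lra.
split=> //; have := cosh2 (artanh b); rewrite sE; move: (coshR (artanh b)) => C h.
have -> : C ^+ 2 * (1 - b ^+ 2) = C ^+ 2 - (b * C) ^+ 2 by ring.
lra.
Qed.

Section one_plane.
Variable eps : R.
Hypothesis eps1 : eps ^+ 2 = 1.
Local Notation Fs := (Fs mu vth eps).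
Local Notation Pl := (Pl mu vth eps).

Definition rho p : R := rw p.1 / den p.

Lemma den_ge_w p : `|p.1| <= den p.
Proof.
apply: (le_trans (hw_ge p.1)); rewrite /den.
by have := ler_wpM2l (ltW (hw_gt0 p.1)) (coshR_ge1 p.2); rewrite mulr1; lra.
Qed.

Lemma hw_rw w : rw w <= hw w <= rw w + 1.
Proof.
have x0 := xw_gt0 w; have r0 := rw_gt0 w; apply/andP; split.
  by rewrite ler_sqrt; lra.
by apply: sqrt_le_sq; [lra|have := rw_sqr w; rewrite sqrrD; move: (rw w ^+ 2) => q ->; lra].
Qed.

(** Far out in the plane, the distance to the axis is that of the ideal point at the same height. *)
Lemma rho_cosh p : `|rho p - (coshR p.2)^-1| <= 2 / den p.
Proof.
have d0 := den_gt0 p; have c1 := coshR_ge1 p.2; have h0 := hw_gt0 p.1; have r0 := rw_gt0 p.1.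
have /andP[hr1 hr2] := hw_rw p.1; have c0 := coshR_gt0 p.2.
have dE : den p = 1 + hw p.1 * coshR p.2 by [].
have -> : rho p - (coshR p.2)^-1 = (rw p.1 * coshR p.2 - den p) / coshR p.2 / den p.
  by rewrite /rho; field; rewrite (lt0r_neq0 d0) lt0r_neq0.
rewrite normrM (ger0_norm (_ : 0 <= (den p)^-1)) ?invr_ge0 ?(ltW d0)//.
apply: ler_wpM2r; first by rewrite invr_ge0 ltW.
rewrite normrM (ger0_norm (_ : 0 <= (coshR p.2)^-1)) ?invr_ge0 ?(ltW c0)// ler_pdivrMr//.
rewrite dE ler_norml; move: (hw p.1) (rw p.1) (coshR p.2) hr1 hr2 c1 => H r C hr1 hr2 c1.
by apply/andP; split; nra.
Qed.

Lemma Fs_rho p : [/\ Fs p ord0 i0 = eps * rho p * cos (psi mu vth p),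
  Fs p ord0 i1 = eps * rho p * sin (psi mu vth p) & Fs p ord0 i2 * coshR p.2 = sinhR p.2 * (1 - (den p)^-1)].
Proof.
have d0 := lt0r_neq0 (den_gt0 p).
rewrite Fs0 Fs1 Fs2 /rho; split; [ring|ring|].
have hc : hw p.1 * coshR p.2 = den p - 1 by rewrite /den; ring.
have -> : hw p.1 * sinhR p.2 / den p * coshR p.2 = (hw p.1 * coshR p.2) * sinhR p.2 / den p by ring.
by rewrite hc; field.
Qed.

Lemma vth_limit (sg e : R) : sg ^+ 2 = 1 -> 0 < e -> exists2 B : R, 0 <= B & forall w, B <= w ->
  `|vth (sg * w) - sg * (pi / 2)| < e.
Proof.
move=> sg1 e0; have [w0 hw0] := profile_sup hP e0.
exists (Num.max 0 w0); first by rewrite le_max lexx.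
move=> w; rewrite ge_max => /andP[_ ww].
have E : vth (sg * w) = sg * vth w.
  by have /eqP := sg1; rewrite sqrf_eq1 => /orP[]/eqP ->; rewrite ?mul1r// !mulN1r (profile_odd hP).
rewrite E -mulrBr normrM.
have -> : `|sg| = 1 by have /eqP := sg1; rewrite sqrf_eq1 => /orP[]/eqP ->; rewrite ?normrN normr1.
have v1 : vth w0 <= vth w by rewrite (profile_mono hP).
have v2 := profile_lt hP w.
by rewrite mul1r ltr_norml; apply/andP; split; lra.
Qed.

Lemma eps_sign (a : R) : exists2 sg : R, sg ^+ 2 = 1 & eps * `|a| * sg = a.
Proof.
have ee : eps * eps = 1 by rewrite -expr2.
have [a0|a0] := leP 0 a.
  by exists eps => //; rewrite ger0_norm// mulrAC ee mul1r.
exists (- eps); rewrite ?sqrrN// ltr0_norm//.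
have -> : eps * - a * - eps = eps * eps * a by ring.
by rewrite ee mul1r.
Qed.

Lemma sign_product_dist (r a c c0 d : R) : `|r - a| <= d -> `|a| <= 1 -> `|c| <= 1 -> `|c - c0| <= d ->
  `|eps * r * c - eps * a * c0| <= 2 * d.
Proof.
move=> ra a1 c1 cc; have -> : eps * r * c - eps * a * c0 = eps * ((r - a) * c + a * (c - c0)) by ring.
have e1 : `|eps| = 1.
  by have /eqP := eps1; rewrite sqrf_eq1 => /orP[]/eqP ->; rewrite ?normrN normr1.
rewrite normrM e1 mul1r; apply: (le_trans (ler_normD _ _)); rewrite !normrM.
have h1 : `|r - a| * `|c| <= d * 1 by apply: ler_pM.
have h2 : `|a| * `|c - c0| <= 1 * d by apply: ler_pM.
lra.
Qed.

Lemma cos_sin_quarter (sg x : R) : sg ^+ 2 = 1 ->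
  cos (sg * (pi / 2) + x) = - (sg * sin x) /\ sin (sg * (pi / 2) + x) = sg * cos x.
Proof.
move=> /eqP; rewrite sqrf_eq1 => /orP[]/eqP ->; rewrite ?mul1r ?mulN1r cosD sinD ?cosN ?sinN cos_pihalf sin_pihalf.
  by split; ring.
by split; ring.
Qed.

(** The two ends of a horizontal curve w -> +-oo tend to the ideal curve because the profile angle
    tends to a quarter turn on either side; the ends t -> +-oo tend to the ends of the axis. *)
Lemma Gam_closure : Gam `<=` closure Pl.
Proof.
move=> _ [[a b] Cp <-]; move: Cp; rewrite /unit_circle/= => Cp.
apply: closure_rowP => e e0.
have [b1|b1] := ltP (b ^+ 2) 1; last first.
  (* the ends of the axis *)
  have a0 : a = 0 by apply/eqP; rewrite -sqrf_eq0; apply/eqP; have := sqr_ge0 a; lra.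
  have bb : b ^+ 2 = 1 by rewrite a0 expr0n/= add0r in Cp.
  pose T := 4 * (rw 0 + 2) / e.
  have r1 := rw_ge1 (0 : R).
  have T0 : 0 < T by rewrite divr_gt0// mulr_gt0// addr_gt0// rw_gt0.
  have cT : T / 2 <= coshR T.
    have h1 := expR_ge1Dx T; have h2 := expR_gt0 (- T); rewrite /coshR; lra.
  pose p : R * R := (0, b * T); exists (Fs p); first by exists p.
  have bpm : b = 1 \/ b = -1 by move/eqP : bb; rewrite sqrf_eq1 => /orP[]/eqP; [left|right].
  have cbT : coshR (b * T) = coshR T.
    by case: bpm => ->; rewrite ?mul1r// mulN1r /coshR opprK addrC.
  have sbT : sinhR (b * T) = b * sinhR T.
    by case: bpm => ->; rewrite ?mul1r// !mulN1r /sinhR opprK; lra.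
  have d0 := den_gt0 p.
  have dE : den p = 1 + hw 0 * coshR T by rewrite /den cbT.
  have /andP[hr1 hr2] := hw_rw 0.
  have dT : coshR T <= den p.
    have h1 : 1 <= hw (0 : R) := le_trans r1 hr1.
    by have h := ler_wpM2r (ltW (coshR_gt0 T)) h1; rewrite mul1r in h; rewrite dE; lra.
  have ed : rw 0 + 2 < e * den p.
    have h : e * (T / 2) = 2 * (rw 0 + 2) by rewrite /T; field; rewrite lt0r_neq0.
    have h' : e * (T / 2) <= e * den p by rewrite ler_pM2l// (le_trans cT).
    lra.
  have small x : `|x| <= rw 0 + 2 -> `|x / den p| < e.
    move=> hx; rewrite normrM (ger0_norm (_ : 0 <= (den p)^-1)) ?invr_ge0 ?(ltW d0)//.
    by rewrite ltr_pdivrMr// (le_lt_trans hx).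
  have e1 : `|eps| = 1.
    by have /eqP := eps1; rewrite sqrf_eq1 => /orP[]/eqP ->; rewrite ?normrN normr1.
  have trig_small c : `|c| <= 1 -> `|eps * rw 0 * c| <= rw 0 + 2.
    move=> c1; rewrite !normrM e1 mul1r (ger0_norm (ltW (rw_gt0 0))).
    by have h := ler_wpM2l (ltW (rw_gt0 0)) c1; rewrite mulr1 in h; lra.
  move=> i; case: (ord3 i) => ->.
  - rewrite gam0 Fs0 /= a0 mul0r oppr0 subr0; apply: small; apply: trig_small.
    exact: (trig_le1 _).1.
  - rewrite gam1 Fs1 /= a0 mul0r subr0; apply: small; apply: trig_small.
    exact: (trig_le1 _).2.
  - rewrite gam2 Fs2 /= sbT.
    have -> : hw 0 * (b * sinhR T) / den p - b = (- b * (hw 0 * expR (- T) + 1)) / den p.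
      have EE : expR (- T) = coshR T - sinhR T by rewrite /coshR /sinhR; lra.
      rewrite EE; move: dE (lt0r_neq0 d0); move: (den p) (coshR T) (sinhR T) (hw 0) => D C S H -> D0.
      by field.
    apply: small.
    have -> : `|- b * (hw 0 * expR (- T) + 1)| = hw 0 * expR (- T) + 1.
      have nb : `|- b| = 1 by rewrite normrN; case: bpm => ->; rewrite ?normrN normr1.
      by rewrite normrM nb mul1r ger0_norm// addr_ge0// mulr_ge0 ?expR_ge0 ?(ltW (hw_gt0 0)).
    have E1 : expR (- T) <= 1 by rewrite -expR0 ler_expR; lra.
    by have h := ler_wpM2l (ltW (hw_gt0 0)) E1; rewrite mulr1 in h; lra.
have b11 : -1 < b < 1 by rewrite -ltr_norml -(@ltr_pXn2r _ 2) ?nnegrE// real_normK ?num_real// expr1n.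
have [sE CE] := tanh_artanh b11; set t := artanh b in sE CE.
have C0 := coshR_gt0 t.
have aC : `|a| = (coshR t)^-1.
  apply: (mulIf (lt0r_neq0 C0)); rewrite mulVf ?lt0r_neq0//.
  apply/eqP; rewrite -(@eqrXn2 _ 2) ?mulr_ge0 ?(ltW C0)//; apply/eqP.
  rewrite expr1n exprMn real_normK ?num_real// -CE.
  have -> : a ^+ 2 = 1 - b ^+ 2 by rewrite -Cp; ring.
  by rewrite mulrC.
have a1 : `| `|a| | <= 1.
  by rewrite normr_id -(@ler_pXn2r _ 2) ?nnegrE// real_normK ?num_real// expr1n; have h := sqr_ge0 b; lra.
have [sg sg1 sgE] := eps_sign a.
have e4 : 0 < e / 4 by rewrite divr_gt0.
have [B B0 hB] := vth_limit sg1 e4.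
pose W := B + 8 / e.
have W8 : 8 / e <= W by rewrite /W; lra.
have e8 : 0 < 8 / e by rewrite divr_gt0.
pose p : R * R := (sg * W, t); exists (Fs p); first by exists p.
have d0 := den_gt0 p.
have dW : W <= den p.
  have h := den_ge_w p; rewrite /= in h; apply: le_trans h; rewrite normrM.
  have -> : `|sg| = 1 by have /eqP := sg1; rewrite sqrf_eq1 => /orP[]/eqP ->; rewrite ?normrN normr1.
  by rewrite mul1r ler_norm.
have de : (den p)^-1 <= e / 8.
  have -> : e / 8 = (8 / e)^-1 by rewrite invf_div.
  by rewrite lef_pV2 ?posrE// (le_trans W8).
have rc := rho_cosh p; rewrite /= -/t -aC in rc.
have rc4 : `|rho p - `|a| | <= e / 4 by apply: (le_trans rc); lra.
have psd : `|psi mu vth p - (sg * (pi / 2) + lam * t)| <= e / 4.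
  apply: ltW; have -> : psi mu vth p - (sg * (pi / 2) + lam * t) = vth (sg * W) - sg * (pi / 2) by rewrite /psi/=; ring.
  by apply: hB; rewrite /W; lra.
have [cq sq] := cos_sin_quarter (lam * t) sg1.
have [F0 F1 F2] := Fs_rho p.
move=> i; case: (ord3 i) => ->.
- rewrite gam0 F0 /= -/t.
  have -> : - (a * sin (lam * t)) = eps * `|a| * cos (sg * (pi / 2) + lam * t).
    by rewrite cq -[in LHS]sgE; ring.
  apply: (@le_lt_trans _ _ (2 * (e / 4))); last by lra.
  apply: sign_product_dist => //; first exact: (trig_le1 _).1.
  exact: (le_trans (cos_lip _ _)).
- rewrite gam1 F1 /= -/t.
  have -> : a * cos (lam * t) = eps * `|a| * sin (sg * (pi / 2) + lam * t).
    by rewrite sq -[in LHS]sgE; ring.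
  apply: (@le_lt_trans _ _ (2 * (e / 4))); last by lra.
  apply: sign_product_dist => //; first exact: (trig_le1 _).2.
  exact: (le_trans (sin_lip _ _)).
- rewrite gam2 /=.
  have -> : Fs p ord0 i2 = b * (1 - (den p)^-1).
    apply: (mulIf (lt0r_neq0 C0)); rewrite [LHS]F2 sE; ring.
  have -> : b * (1 - (den p)^-1) - b = - (b * (den p)^-1) by ring.
  have i0 : 0 <= (den p)^-1 by rewrite invr_ge0 ltW.
  rewrite normrN normrM (ger0_norm i0).
  have b1' : `|b| <= 1 by rewrite ler_norml; case/andP : b11 => ? ?; apply/andP; split; lra.
  have h := ler_wpM2r i0 b1'; rewrite mul1r in h; lra.
Qed.

(** The Euclidean coordinate of the ball, corotating with the screw motion, that vanishes on the two
    half planes spanned by the axis and the spirals of the ideal curve; it tends to zero along the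
    plane. *)
Definition turn (u : 'rV[R]_3) : R :=
  u ord0 i0 * cos (lam * zc (tri u)) + u ord0 i1 * sin (lam * zc (tri u)).

Lemma turn_Fs p : turn (Fs p) = eps * (rho p * cos (vth p.1)).
Proof.
have [h0 h1 _] := Fs_rho p; rewrite /turn h0 h1 Fs_zc//.
have -> : cos (vth p.1) = cos (psi mu vth p - lam * p.2) by rewrite /psi addrK.
rewrite cosB; ring.
Qed.

Lemma rho_le1 p : 0 <= rho p <= 1.
Proof.
have d0 := den_gt0 p; have r0 := rw_gt0 p.1; rewrite divr_ge0 ?(ltW d0) ?(ltW r0)//= ler_pdivrMr// mul1r.
have h := ler_wpM2l (ltW (hw_gt0 p.1)) (coshR_ge1 p.2); rewrite mulr1 in h.
by have /andP[h1 _] := hw_rw p.1; rewrite /den; lra.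
Qed.

(** Either the profile parameter is large, and the profile angle is close to a quarter turn, or it is
    bounded, and then the Euclidean distance to the axis tends to 0 with the conformal factor. *)
Lemma turn_small (e : R) : 0 < e -> exists2 d : R, 0 < d &
  forall p, del (tri (Fs p)) < d -> `|turn (Fs p)| < e.
Proof.
move=> e0; have [B B0 hB] := vth_limit (expr1n R 2) e0.
have n1 : (-1 : R) ^+ 2 = 1 by rewrite sqrrN expr1n.
have [B' B'0 hB'] := vth_limit n1 e0.
pose M := Num.max B B'; have r0 := rw_gt0 M.
exists (2 * e / rw M); first by rewrite divr_gt0// mulr_gt0.
move=> p dp; have e1 : `|eps| = 1.
  by have /eqP := eps1; rewrite sqrf_eq1 => /orP[]/eqP ->; rewrite ?normrN normr1.
rewrite turn_Fs normrM e1 mul1r normrM; have /andP[q0 q1] := rho_le1 p.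
rewrite (ger0_norm q0); have [c1 _] := trig_le1 (vth p.1).
have far (sg w : R) : sg ^+ 2 = 1 -> `|vth w - sg * (pi / 2)| < e -> `|cos (vth w)| < e.
  move=> s1; apply: le_lt_trans; have h := cos_lip (vth w) (sg * (pi / 2)).
  by have [cq _] := cos_sin_quarter 0 s1; rewrite addr0 sin0 mulr0 oppr0 in cq; rewrite cq subr0 in h.
have mul_small : `|cos (vth p.1)| < e -> rho p * `|cos (vth p.1)| < e.
  by move=> h; apply: le_lt_trans h; rewrite ler_piMl.
have [wM|Mw] := leP `|p.1| M; last first.
  apply: mul_small; have MB : B <= M by rewrite le_max lexx.
  have MB' : B' <= M by rewrite le_max lexx orbT.
  have [w0|w0] := leP 0 p.1.
    apply: (far 1); first by rewrite expr1n.
    by rewrite -[p.1]mul1r; apply: hB; rewrite (le_trans MB)// (ltW (lt_le_trans Mw _))// ger0_norm.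
  apply: (far (-1)); first by rewrite sqrrN expr1n.
  have E : p.1 = -1 * - p.1 by ring.
  rewrite E; apply: hB'; rewrite (le_trans MB')// (ltW (lt_le_trans Mw _))//.
  by rewrite ltr0_norm.
have rr : rw p.1 <= rw M.
  have x0 := xw_gt0 M; rewrite ler_sqrt ?(ltW x0)// /xw lerD2l -(real_normK (num_real p.1)).
  by rewrite lerXn2r ?nnegrE// (le_trans _ wM).
apply: (@le_lt_trans _ _ (rho p)); first by rewrite ler_piMr.
rewrite Fs_del// in dp; have d0 := den_gt0 p; rewrite /rho ltr_pdivrMr//.
apply: (le_lt_trans rr); move: dp; rewrite ltr_pdivrMr// mulrAC ltr_pdivlMr//; lra.
Qed.

Lemma turn_closure (X : 'rV[R]_3) : closure Pl X -> del (tri X) = 0 ->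
  0 < Pz (tri X) -> 0 < Mz (tri X) -> turn X = 0.
Proof.
move=> clX dX PX MX; apply/eqP/negP => /negP HX.
have n0 : 0 < `|turn X| / 2 by rewrite divr_gt0// normr_gt0.
have [d d0 dP] := turn_small n0.
have c i : {for X, continuous (fun u : 'rV[R]_3 => u ord0 i)} by exact: coord_continuous.
have cz := zc_continuous PX MX.
have cl : {for X, continuous (fun u => lam * zc (tri u))} by exact: (cvgM (cvg_cst _) cz).
have cc : {for X, continuous (fun u => cos (lam * zc (tri u)))}.
  by apply: (@cont_comp _ _ _ (fun u => lam * zc (tri u)) cos) => //; exact: continuous_cos.
have cs : {for X, continuous (fun u => sin (lam * zc (tri u)))}.
  by apply: (@cont_comp _ _ _ (fun u => lam * zc (tri u)) sin) => //; exact: continuous_sin.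
have cH : {for X, continuous turn} by exact: (cvgD (cvgM (c i0) cc) (cvgM (c i1) cs)).
have cd : {for X, continuous (fun u => del (tri u))}.
  have q i : {for X, continuous (fun u : 'rV[R]_3 => u ord0 i ^+ 2)}.
    by apply: (@cont_comp _ _ _ (fun u : 'rV[R]_3 => u ord0 i) (fun x : R => x ^+ 2)); [exact: c|exact: exprn_continuous].
  exact: (cvgB (cvg_cst _) (cvgD (cvgD (q i0) (q i1)) (q i2))).
have near1 : nbhs X [set u | `|turn X - turn u| < `|turn X| / 2] by move/cvgrPdist_lt : cH => /(_ _ n0).
have near2 : nbhs X [set u | `|del (tri X) - del (tri u)| < d] by move/cvgrPdist_lt : cd => /(_ _ d0).
have [u [[p _ <-] [/= h1 h2]]] := clX _ (filterI near1 near2).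
have h3 : `|turn (Fs p)| < `|turn X| / 2.
  by apply: dP; move: h2; rewrite dX sub0r normrN; apply: le_lt_trans; exact: ler_norm.
have h4 := ler_normD (turn X - turn (Fs p)) (turn (Fs p)); rewrite subrK in h4; lra.
Qed.

(** A limit point on the sphere is either an end of the axis or a point where turn vanishes, which puts it
    on the spirals. *)
Lemma closure_Gam : closure Pl `&` sphere_infty R `<=` Gam.
Proof.
move=> X [clX]; rewrite /sphere_infty/= => X1.
have dX : del (tri X) = 0 by rewrite del_dot X1 subrr.
have sX : X ord0 i0 ^+ 2 + X ord0 i1 ^+ 2 + X ord0 i2 ^+ 2 = 1 by rewrite dotE in X1; rewrite !expr2.
have s0 := sqr_ge0 (X ord0 i0); have s1 := sqr_ge0 (X ord0 i1).
have [b1|b1] := ltP (X ord0 i2 ^+ 2) 1; last first.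
  have x0 : X ord0 i0 = 0 by apply/eqP; rewrite -sqrf_eq0; apply/eqP; lra.
  have x1 : X ord0 i1 = 0 by apply/eqP; rewrite -sqrf_eq0; apply/eqP; lra.
  exists (0, X ord0 i2); first by rewrite /unit_circle/= expr0n/= add0r; lra.
  apply/rowP => i; case: (ord3 i) => ->; first by rewrite gam0 /= mul0r oppr0 x0.
    by rewrite gam1 /= mul0r x1.
  by rewrite gam2.
have /andP[b11 b12] : -1 < X ord0 i2 < 1.
  by rewrite -ltr_norml -(@ltr_pXn2r _ 2) ?nnegrE// real_normK ?num_real// expr1n.
have PE : Pz (tri X) = 2 * (1 + X ord0 i2) by rewrite /Pz/= -[in RHS]sX; move: sX; nra.
have ME : Mz (tri X) = 2 * (1 - X ord0 i2) by rewrite /Mz/=; move: sX; nra.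
have p1 : 0 < 1 + X ord0 i2 by lra.
have m1 : 0 < 1 - X ord0 i2 by lra.
have PX : 0 < Pz (tri X) by rewrite PE mulr_gt0.
have MX : 0 < Mz (tri X) by rewrite ME mulr_gt0.
have zE : zc (tri X) = artanh (X ord0 i2).
  by rewrite /zc PE ME !lnM ?posrE// /artanh; congr (_ / _); ring.
have H0 := turn_closure clX dX PX MX; rewrite /turn zE in H0.
have cs1 := cos2Dsin2 (lam * artanh (X ord0 i2)).
set c := cos _ in H0 cs1; set s := sin _ in H0 cs1.
pose a := X ord0 i1 * c - X ord0 i0 * s.
have E0 : - (a * s) = X ord0 i0.
  rewrite /a; have -> : - ((X ord0 i1 * c - X ord0 i0 * s) * s) = X ord0 i0 * (c ^+ 2 + s ^+ 2) - c * (X ord0 i0 * c + X ord0 i1 * s) by ring.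
  by rewrite H0 cs1 mulr0 subr0 mulr1.
have E1 : a * c = X ord0 i1.
  rewrite /a; have -> : (X ord0 i1 * c - X ord0 i0 * s) * c = X ord0 i1 * (c ^+ 2 + s ^+ 2) - s * (X ord0 i0 * c + X ord0 i1 * s) by ring.
  by rewrite H0 cs1 mulr0 subr0 mulr1.
exists (a, X ord0 i2).
  rewrite /unit_circle/= -[RHS]sX; congr (_ + _); rewrite -E0 -E1.
  have -> : (- (a * s)) ^+ 2 + (a * c) ^+ 2 = a ^+ 2 * (c ^+ 2 + s ^+ 2) by ring.
  by rewrite cs1 mulr1.
apply/rowP => i; case: (ord3 i) => ->; first by rewrite gam0.
  by rewrite gam1.
by rewrite gam2.
Qed.

Lemma boundary_Pl : asymptotic_boundary Pl = Gam.
Proof.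
apply/seteqP; split; first exact: closure_Gam.
by move=> X GX; split; [exact: Gam_closure|exact: Gam_sphere].
Qed.

End one_plane.
End boundary_curve.

(** * Two planes with one ideal boundary *)

(** Two planes over the same profile, on opposite sides of the axis: both ends of the profile turn by
    a quarter turn, so the two planes have the same ideal boundary. *)
Theorem theorem5p3 (R : realType) :
  exists G : set 'rV[R]_3,
    [/\ simple_closed_curve G, G `<=` sphere_infty R
      & exists P1 P2 : set 'rV[R]_3,
          [/\ least_area_plane P1, least_area_plane P2, P1 <> P2,
              asymptotic_boundary P1 = G & asymptotic_boundary P2 = G]].
Proof.
have [mu [vth [m2 v0 dv vlt vsup]]] := @profile_exists R.
have hP : is_profile mu vth by exact: IsProfile.
have e1 : (1 : R) ^+ 2 = 1 by rewrite expr1n.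
have e2 : (-1 : R) ^+ 2 = 1 by rewrite sqrrN expr1n.
have lap (eps : R) : eps ^+ 2 = 1 -> least_area_plane (Pl mu vth eps).
  move=> eps1; split; [exact: (Pl_plane hP eps1)|exact: (Pl_complete hP eps1)|].
  by move=> f; exact: (subdisk_least_area hP eps1).
exists (Gam mu); split; [exact: Gam_simple|exact: Gam_sphere|].
exists (Pl mu vth 1), (Pl mu vth (-1)); split.
- exact: lap.
- exact: lap.
- move=> E; have : Pl mu vth 1 (Fs mu vth 1 (0, 0)) by exists (0, 0).
  rewrite E => -[[w t] _ q].
  have t0 : t = 0 by have := Fs_zc mu vth e2 (w, t); rewrite q (Fs_zc mu vth e1).
  have /(congr1 (fun u : 'rV[R]_3 => u ord0 i0)) := q; rewrite !Fs0 t0 /psi /= !mulr0 !addr0 v0 cos0.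
  have c0 := vth_cos_gt0 hP w.
  have r0 := rw_gt0 w; have r1 := rw_gt0 (0 : R); have d0 := den_gt0 (w, 0); have d1 := den_gt0 ((0, 0) : R * R).
  have l : 0 < rw w * cos (vth w) / den (w, 0) by rewrite divr_gt0// mulr_gt0.
  have r : 0 < rw 0 / den ((0, 0) : R * R) by rewrite divr_gt0.
  rewrite mulr1 mul1r mulN1r !mulNr => h; lra.
- exact: boundary_Pl.
- exact: boundary_Pl.
Qed.
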